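(* Let $n\ge2$ be an integer. Let $V_0,V_1:[0,1)\to\mathbb{R}$ satisfy: $V_0,V_1\in C([0,1))\cap C^n((0,1))$; $x^\alpha V_{0x},\,y^\alpha V_{1y}\in C([0,1))$ for some $\alpha\in[0,1)$; $V_0(0)=V_1(0)=0$. Then there exists a unique $C^n$-solution $V(x,y)$ of the Goursat problem for the Euler--Darboux equation in $D$ with data $\{V_0,V_1\}$. Moreover, this solution is given by $$V(x,y)=-\tfrac12 m(x,y,0),\qquad (x,y)\in D,$$ where $m(x,y,z)$ is the unique solution of the scalar Riemann--Hilbert problem $$\begin{cases}m(x,y,\cdot)\text{ is analytic in }\mathbb{C}\setminus\Gamma,\\ m_+(x,y,z)=m_-(x,y,z)+v(x,y,z)\text{ for all }z\in\Gamma,\\ m(x,y,z)=O(z^{-1})\text{ as }z\to\infty,\end{cases}$$ with jump $$v(x,y,z)=\begin{cases}\Phi_0\big(x,F_{(x,y)}^{-1}(z)\big),&z\in\Gamma_0,\\ \Phi_1\big(y,F_{(x,y)}^{-1}(z)\big),&z\in\Gamma_1,\end{cases}$$ where $$\Phi_0(x,k^\pm)=\int_0^x\lambda(x',0,k^\pm)V_{0x}(x')\,dx',\quad x\in[0,1),\ k\in\mathbb{C}\setminus[0,1],$$ $$\Phi_1(y,k^\pm)=\int_0^y\frac{1}{\lambda(0,y',k^\pm)}V_{1y}(y')\,dy',\quad y\in[0,1),\ k\in\mathbb{C}\setminus[0,1].$$ Furthermore, if $\alpha\in(0,1)$ is such that $x^\alpha V_{0x}$ and $y^\alpha V_{1y}$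 are continuous on $[0,1)$ and $m_1:=\lim_{x\downarrow0}x^\alpha V_{0x}(x)$, $m_2:=\lim_{y\downarrow0}y^\alpha V_{1y}(y)$, then $$\lim_{x\downarrow0}x^\alpha V_x(x,y)=\frac{m_1}{\sqrt{1-y}}\ \text{ for each }y\in[0,1),\qquad \lim_{y\downarrow0}y^\alpha V_y(x,y)=\frac{m_2}{\sqrt{1-x}}\ \text{ for each }x\in[0,1).$$
   Context: $D=\{(x,y)\in\mathbb{R}^2: x\ge0,\ y\ge0,\ x+y<1\}$, with interior $\operatorname{int}D$; $\hat{\mathbb{C}}=\mathbb{C}\cup\{\infty\}$. Subscripts $x,y$ denote (partial) derivatives. Conditions such as ''$x^\alpha f_x\in C(S)$'' mean that the function has a continuous extension to $S$. The Euler--Darboux equation is $V_{xy}-\frac{V_x+V_y}{2(1-x-y)}=0$. $C^n$-solution: $V:D\to\mathbb{R}$ is a $C^n$-solution of the Goursat problem for the Euler--Darboux equation in $D$ with data $\{V_0,V_1\}$ if $V\in C(D)\cap C^n(\operatorname{int}D)$; $V$ satisfies the equation in $\operatorname{int}D$; $x^\alpha V_x,\,y^\alpha V_y,\,x^\alpha y^\alpha V_{xy}\in C(D)$ for some $\alpha\in[0,1)$; $V(x,0)=V_0(x)$ for $x\in[0,1)$; $V(0,y)=V_1(y)$ for $y\in[0,1)$. Riemann surface: for $(x,y)\in D$, $\mathcal{S}_{(x,y)}$ is the compact genus-zero Riemann surface of points $P=(\lambda,k)\in\mathbb{C}^2$ with $\lambda^2=\frac{k-(1-y)}{k-x}$,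 together with $\infty^\pm=(\pm1,\infty)$ and the branch point $x\equiv(\infty,x)$. $\lambda(x,y,P)$ is the value of $\lambda$ at $P$. For $k\in\hat{\mathbb{C}}\setminus[x,1-y]$, $k^+$ and $k^-$ are the points over $k$ on the upper and lower sheet, where $\lambda(x,y,k^+)=\sqrt{\frac{k-(1-y)}{k-x}}=-\lambda(x,y,k^-)$ with $\operatorname{Re}\lambda(x,y,k^+)>0$. For $S\subset\mathbb{C}$, $S^\pm$ denotes the set in the upper/lower sheet projecting onto $S$. Put $\Sigma_0=[0,x]^+\cup[x,0]^-$, $\Sigma_1=[1,1-y]^-\cup[1-y,1]^+$. The map $F_{(x,y)}:\mathcal{S}_{(x,y)}\to\hat{\mathbb{C}}$, $F_{(x,y)}(P)=\frac{1+\lambda(x,y,P)}{1-\lambda(x,y,P)}$, is a biholomorphism, and $F_{(x,y)}(\Sigma_0)=\Big[-\frac{\sqrt{1-y}+\sqrt x}{\sqrt{1-y}-\sqrt x},-\frac{\sqrt{1-y}-\sqrt x}{\sqrt{1-y}+\sqrt x}\Big]$, $F_{(x,y)}(\Sigma_1)=\Big[\frac{\sqrt{1-x}-\sqrt y}{\sqrt{1-x}+\sqrt y},\frac{\sqrt{1-x}+\sqrt y}{\sqrt{1-x}-\sqrt y}\Big]$. Contour: $\Gamma=\Gamma_0\cup\Gamma_1$ (depending on $(x,y)$), where $\Gamma_0,\Gamma_1$ are two clockwise nonintersecting smooth loops in the $z$-plane, lying outside each other, encircling $F_{(x,y)}(\Sigma_0)$ and $F_{(x,y)}(\Sigma_1)$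 respectively and not encircling $0$. $m_+$ and $m_-$ are the nontangential boundary values of $m$ from the left and right sides of $\Gamma$. Identification convention: a function of $k^\pm$, $k\in\hat{\mathbb{C}}\setminus[0,1]$, is regarded as a function on any of the surfaces $\mathcal{S}_{(x,y)}$ with the points over $[0,1]$ removed. Here $\Phi_0(x,\cdot)$ and $\Phi_1(y,\cdot)$, viewed this way on $\mathcal{S}_{(x,y)}$, extend continuously (and analytically) across the branch cut over $(x,1-y)$ to $\mathcal{S}_{(x,y)}\setminus(\Sigma_0\cup\Sigma_1)$; the values in $v$ are those of the extension.
   Formalization: Solutions m of the Riemann–Hilbert problem are also required to extend continuously to Γ from each side; with only pointwise nontangential boundary values m is not unique (add h(e/(z-p))-h(0), h entire and tending to 0 in closed sectors off the positive axis, p on Γ, e tangent at p). *)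

(* Defs.v *)
From Stdlib Require Import Reals Lra Psatz ClassicalEpsilon.
From Coquelicot Require Import Coquelicot.

Local Open Scope R_scope.

Definition I01 (x : R) : Prop := 0 <= x < 1.

Definition inD (x y : R) : Prop := 0 <= x /\ 0 <= y /\ x + y < 1.

Definition intD (x y : R) : Prop := 0 < x /\ 0 < y /\ x + y < 1.

Definition partial_x (V : R -> R -> R) (x y : R) : R := Derive (fun t => V t y) x.

Definition partial_y (V : R -> R -> R) (x y : R) : R := Derive (fun t => V x t) y.

(* [f] is only meaningful on [E]; "f is in C(S)" means that it has a continuous
   extension from [E] to [S]. *)
Definition extends_continuously {T : UniformSpace} (E S : T -> Prop) (f : T -> R) : Prop :=
  exists g : T -> R, continuous_on S g /\ forall p, E p -> g p = f p.

(* [ex_derive_n f n] alone does not give differentiability of the lower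
   derivatives, [Derive] being total; hence the quantification over k. *)
Definition Cn_open01 (n : nat) (f : R -> R) : Prop :=
  forall x, 0 < x < 1 ->
    (forall k, (k <= n)%nat -> ex_derive_n f k x) /\ continuous (Derive_n f n) x.

Definition weighted_derivative_continuous (alpha : R) (f : R -> R) : Prop :=
  extends_continuously (fun x => 0 < x < 1) I01 (fun x => Rpower x alpha * Derive f x).

Definition goursat_data (n : nat) (V0 V1 : R -> R) : Prop :=
  continuous_on I01 V0 /\ continuous_on I01 V1 /\
  Cn_open01 n V0 /\ Cn_open01 n V1 /\
  (exists alpha, 0 <= alpha < 1 /\
     weighted_derivative_continuous alpha V0 /\
     weighted_derivative_continuous alpha V1) /\
  V0 0 = 0 /\ V1 0 = 0.

Definition in_C_of_D (f : R -> R -> R) : Prop :=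
  extends_continuously (fun p : R * R => intD (fst p) (snd p))
    (fun p : R * R => inD (fst p) (snd p)) (fun p : R * R => f (fst p) (snd p)).

Definition Cn_solution (n : nat) (V0 V1 : R -> R) (V : R -> R -> R) : Prop :=
  continuous_on (fun p : R * R => inD (fst p) (snd p)) (fun p : R * R => V (fst p) (snd p)) /\
  (forall x y, intD x y -> ex_diff_n V n x y) /\
  (forall x y, intD x y ->
     partial_y (partial_x V) x y - (partial_x V x y + partial_y V x y) / (2 * (1 - x - y)) = 0) /\
  (exists alpha, 0 <= alpha < 1 /\
     in_C_of_D (fun x y => Rpower x alpha * partial_x V x y) /\
     in_C_of_D (fun x y => Rpower y alpha * partial_y V x y) /\
     in_C_of_D (fun x y => Rpower x alpha * Rpower y alpha * partial_y (partial_x V) x y)) /\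
  (forall x, I01 x -> V x 0 = V0 x) /\
  (forall y, I01 y -> V 0 y = V1 y).

Local Open Scope C_scope.

Inductive Chat : Set := Fin (z : C) | Infty.

(* The pair (lambda, k). *)
Definition point : Set := (Chat * Chat)%type.

Definition surface (x y : R) (P : point) : Prop :=
  match P with
  | (Fin l, Fin k) => k <> RtoC x /\ l * l = (k - RtoC (1 - y)) / (k - RtoC x)
  | (Infty, Fin k) => k = RtoC x
  | (Fin l, Infty) => l = RtoC 1 \/ l = RtoC (-1)
  | (Infty, Infty) => False
  end.

Definition F_map (P : point) : Chat :=
  match fst P with
  | Fin l => if Ceq_dec l (RtoC 1) then Infty
             else Fin ((RtoC 1 + l) / (RtoC 1 - l))
  | Infty => Fin (RtoC (-1))
  end.

(* F_map is a bijection from the surface onto the Riemann sphere, so for each finite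
   z exactly one point satisfies the specification; see [Finv_spec]. *)
Definition Finv (x y : R) (z : C) : point :=
  epsilon (inhabits (Infty, Infty)) (fun P => surface x y P /\ F_map P = Fin z).

(* [0,x] on both sheets; the two lifts of x coincide with the branch point. *)
Definition Sigma0 (x y : R) (P : point) : Prop :=
  surface x y P /\ exists k : R, (0 <= k <= x)%R /\ snd P = Fin (RtoC k).

Definition Sigma1 (x y : R) (P : point) : Prop :=
  surface x y P /\ exists k : R, (1 - y <= k <= 1)%R /\ snd P = Fin (RtoC k).

Inductive sheet : Set := Upper | Lower.

(* Principal branch: on C minus (-oo,0] it is the square root with positive real part. *)
Definition csqrt (z : C) : C :=
  (sqrt ((Cmod z + Re z) / 2),
   (if Rle_dec 0 (Im z) then sqrt ((Cmod z - Re z) / 2)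
    else - sqrt ((Cmod z - Re z) / 2))%R).

(* lambda(x,y,k^+) and lambda(x,y,k^-), for finite k outside [x,1-y]. *)
Definition lambda (x y : R) (s : sheet) (k : C) : C :=
  let l := csqrt ((k - RtoC (1 - y)) / (k - RtoC x)) in
  match s with Upper => l | Lower => - l end.

(* A function of k^+ and k^-, regarded as a function on a surface. *)
Definition on_surface (Phi : sheet -> C -> C) (P : point) : C :=
  match P with
  | (Fin l, Fin k) => Phi (if Rlt_dec 0 (Re l) then Upper else Lower) k
  | _ => RtoC 0
  end.

(* The points over C minus [0,1]; the points over infinity are left out too,
   since Phi_0 and Phi_1 are defined by formulas in a finite k. *)
Definition off_cut (P : point) : Prop :=
  match snd P with
  | Fin k => ~ (Im k = 0%R /\ (0 <= Re k <= 1)%R)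
  | Infty => False
  end.

(* The integral is improper at 0, where the integrand may blow up. For b = 0 the
   improper Riemann integral of an unbounded function is not defined. *)
Definition integral_from_0 (f : R -> C) (b : R) : C :=
  if Req_dec_T b 0 then RtoC 0
  else RInt_gen (V := C_R_CompleteNormedModule) f (at_right 0) (at_point b).

Definition Phi0 (V0 : R -> R) (x : R) (s : sheet) (k : C) : C :=
  integral_from_0 (fun x' => lambda x' 0 s k * RtoC (Derive V0 x')) x.

Definition Phi1 (V1 : R -> R) (y : R) (s : sheet) (k : C) : C :=
  integral_from_0 (fun y' => / lambda 0 y' s k * RtoC (Derive V1 y')) y.

(* v is the value at Finv z of the continuous extension of Phi across the cut:
   the value of Phi itself wherever that is defined, and always the limit. *)
Definition jump_value (Phi : sheet -> C -> C) (x y : R) (z v : C) : Prop :=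
  (off_cut (Finv x y z) -> v = on_surface Phi (Finv x y z)) /\
  filterlim (fun w : C => on_surface Phi (Finv x y w))
    (within (fun w : C => off_cut (Finv x y w)) (locally z)) (locally v).

Definition loop_derivative (g : R -> C) (t : R) : C :=
  (Derive (fun s => Re (g s)) t, Derive (fun s => Im (g s)) t).

(* A simple closed regular smooth curve, parametrized with period 1. *)
Definition smooth_loop (g : R -> C) : Prop :=
  (forall k t, ex_derive_n (fun s => Re (g s)) k t /\ ex_derive_n (fun s => Im (g s)) k t) /\
  (forall t, loop_derivative g t <> RtoC 0) /\
  (forall t, g (t + 1)%R = g t) /\
  (forall s t, (0 <= s < 1)%R -> (0 <= t < 1)%R -> g s = g t -> s = t).

Definition on_loop (g : R -> C) (z : C) : Prop := exists t, g t = z.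

Definition winding (g : R -> C) (z : C) : C :=
  / (RtoC (2 * PI) * Ci) *
  RInt (V := C_R_CompleteNormedModule) (fun t => loop_derivative g t / (g t - z)) 0 1.

Definition encircles (g : R -> C) (z : C) : Prop :=
  ~ on_loop g z /\ winding g z <> RtoC 0.

Definition clockwise (g : R -> C) : Prop :=
  forall z, encircles g z -> winding g z = RtoC (-1).

Definition on_or_inside (g : R -> C) (z : C) : Prop := on_loop g z \/ encircles g z.

Definition contour (x y : R) (g0 g1 : R -> C) : Prop :=
  smooth_loop g0 /\ smooth_loop g1 /\
  clockwise g0 /\ clockwise g1 /\
  (forall z, ~ (on_or_inside g0 z /\ on_or_inside g1 z)) /\
  (forall P z, Sigma0 x y P -> F_map P = Fin z -> encircles g0 z) /\
  (forall P z, Sigma1 x y P -> F_map P = Fin z -> encircles g1 z) /\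
  ~ on_or_inside g0 (RtoC 0) /\ ~ on_or_inside g1 (RtoC 0).

(* Sectors with vertex g t about the left and right normals; every closed sector
   strictly between the two tangent directions lies in one of them for small c. *)
Definition left_sector (g : R -> C) (t c : R) (z : C) : Prop :=
  (c * (Cmod (z - g t) * Cmod (loop_derivative g t)) <
   Im ((z - g t) * Cconj (loop_derivative g t)))%R.

Definition right_sector (g : R -> C) (t c : R) (z : C) : Prop :=
  (c * (Cmod (z - g t) * Cmod (loop_derivative g t)) <
   - Im ((z - g t) * Cconj (loop_derivative g t)))%R.

Definition left_value (g : R -> C) (m : C -> C) (t : R) (l : C) : Prop :=
  forall c, (0 < c)%R ->
    filterlim m (within (left_sector g t c) (locally (g t))) (locally l).

Definition right_value (g : R -> C) (m : C -> C) (t : R) (l : C) : Prop :=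
  forall c, (0 < c)%R ->
    filterlim m (within (right_sector g t c) (locally (g t))) (locally l).

Definition jump_across (g : R -> C) (v : C -> C -> Prop) (m : C -> C) : Prop :=
  forall t, exists mp mm w,
    left_value g m t mp /\ right_value g m t mm /\ v (g t) w /\ mp = mm + w.

(* Continuity up to the contour of the restriction of m to the region A. Where p is
   not adherent to A the filter is improper and the condition holds trivially. *)
Definition continuous_up_to (A B : C -> Prop) (m : C -> C) : Prop :=
  forall p, B p -> exists l, filterlim m (within A (locally p)) (locally l).

(* The boundary values are taken in the classical sense: m is continuous up to the
   contour from each side. Pointwise nontangential limits alone would not determine
   m: there are entire functions h tending to 0 at infinity in every closed sector
   that avoids the positive real axis, and then h(e/(z-p)) - h(0), with p on the
   contour and e a tangent vector there, solves the problem with zero jump. *)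
Definition RH_solution (g0 g1 : R -> C) (v0 v1 : C -> C -> Prop) (m : C -> C) : Prop :=
  (forall z, ~ on_loop g0 z -> ~ on_loop g1 z ->
     ex_derive (K := C_AbsRing) (V := C_NormedModule) m z) /\
  continuous_up_to (encircles g0) (fun p => on_loop g0 p \/ on_loop g1 p) m /\
  continuous_up_to (encircles g1) (fun p => on_loop g0 p \/ on_loop g1 p) m /\
  continuous_up_to (fun z => ~ on_or_inside g0 z /\ ~ on_or_inside g1 z)
    (fun p => on_loop g0 p \/ on_loop g1 p) m /\
  jump_across g0 v0 m /\ jump_across g1 v1 m /\
  (exists M r : R, (0 < r)%R /\ forall z, (r < Cmod z)%R ->
     ~ on_loop g0 z -> ~ on_loop g1 z -> (Cmod (m z) <= M / Cmod z)%R).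

(* m is arbitrary on the contour, so uniqueness is uniqueness off it. *)
Definition unique_RH_solution (g0 g1 : R -> C) (v0 v1 : C -> C -> Prop) (m : C -> C) : Prop :=
  RH_solution g0 g1 v0 v1 m /\
  forall m', RH_solution g0 g1 v0 v1 m' ->
    forall z, ~ on_loop g0 z -> ~ on_loop g1 z -> m' z = m z.

Lemma Cmod_sqr (z : C) : (Cmod z * Cmod z = Re z * Re z + Im z * Im z)%R.
Proof.
unfold Cmod, Re, Im; rewrite sqrt_sqrt; [ring|].
generalize (pow2_ge_0 (fst z)) (pow2_ge_0 (snd z)); lra.
Qed.

Lemma csqrt_sqr (z : C) : csqrt z * csqrt z = z.
Proof.
destruct z as [a b]; unfold csqrt.
assert (Hm := Cmod_ge_0 (a, b)). assert (Hs := Cmod_sqr (a, b)). simpl in *.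
set (r := Cmod (a, b)) in *.
assert (H1 : (- r <= a <= r)%R) by nra.
assert (Hp : (sqrt ((r + a) / 2) * sqrt ((r + a) / 2) = (r + a) / 2)%R)
  by (apply sqrt_sqrt; lra).
assert (Hq : (sqrt ((r - a) / 2) * sqrt ((r - a) / 2) = (r - a) / 2)%R)
  by (apply sqrt_sqrt; lra).
assert (Hpq : (2 * (sqrt ((r + a) / 2) * sqrt ((r - a) / 2)) = Rabs b)%R).
{ rewrite <- sqrt_mult by lra.
  replace ((r + a) / 2 * ((r - a) / 2))%R with (Rsqr (b / 2)) by (unfold Rsqr; nra).
  rewrite sqrt_Rsqr_abs. unfold Rdiv; rewrite Rabs_mult, (Rabs_pos_eq (/ 2)); lra. }
unfold Cmult; simpl.
destruct (Rle_dec 0 b) as [Hb|Hb]; f_equal;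
  [ | rewrite Rabs_pos_eq in Hpq by lra | | rewrite Rabs_left in Hpq by lra ]; nra.
Qed.

Lemma csqrt_Re_pos (z : C) : (0 < Re z)%R \/ Im z <> 0%R -> (0 < Re (csqrt z))%R.
Proof.
destruct z as [a b]; simpl; intros H. apply sqrt_lt_R0.
assert (Hm := Cmod_ge_0 (a, b)). assert (Hs := Cmod_sqr (a, b)). simpl in *.
destruct H as [H|H]; [lra|].
assert (0 < b * b)%R by (destruct (Rdichotomy _ _ H); nra). nra.
Qed.

Lemma RtoC_neq (a b : R) : a <> b -> RtoC a <> RtoC b.
Proof. intros H E; apply H, RtoC_inj, E. Qed.

Lemma F_onto (x y : R) (z : C) :
  (x + y < 1)%R -> exists P, surface x y P /\ F_map P = Fin z.
Proof.
intros Hxy.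
destruct (Ceq_dec z (RtoC (-1))) as [->|Hz1].
{ exists (Infty, Fin (RtoC x)); split; reflexivity. }
assert (Hd : z + RtoC 1 <> RtoC 0).
{ intros E; apply Hz1. replace z with (z + RtoC 1 - RtoC 1) by ring.
  rewrite E; unfold RtoC, Cminus, Cplus, Copp; simpl; f_equal; ring. }
set (l := (z - RtoC 1) / (z + RtoC 1)).
assert (H2 : RtoC 2 <> RtoC 0) by (apply RtoC_neq; lra).
assert (E1 : RtoC 1 - l = RtoC 2 / (z + RtoC 1)).
{ unfold l. replace (RtoC 2) with (RtoC 1 + RtoC 1) by (rewrite <- RtoC_plus; f_equal; ring).
  field; exact Hd. }
assert (E2 : RtoC 1 + l = RtoC 2 * z / (z + RtoC 1)).
{ unfold l. replace (RtoC 2) with (RtoC 1 + RtoC 1) by (rewrite <- RtoC_plus; f_equal; ring).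
  field; exact Hd. }
assert (N1 : RtoC 1 - l <> RtoC 0).
{ rewrite E1; intros E. apply H2.
  replace (RtoC 2) with (RtoC 2 / (z + RtoC 1) * (z + RtoC 1)) by (field; exact Hd).
  rewrite E; ring. }
assert (HF : forall k, F_map (Fin l, k) = Fin z).
{ intros k; unfold F_map; simpl. destruct (Ceq_dec l (RtoC 1)) as [E|_].
  - elim N1; rewrite E; ring.
  - f_equal; rewrite E1, E2; field; repeat split; assumption. }
destruct (Ceq_dec z (RtoC 0)) as [Hz0|Hz0].
{ exists (Fin l, Infty); split; [|apply HF]. right; unfold l; rewrite Hz0.
  apply injective_projections; unfold Cdiv, Cminus, Cplus, Copp, Cmult, Cinv, RtoC;
  simpl; field; lra. }
assert (N2 : RtoC 1 + l <> RtoC 0).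
{ rewrite E2; intros E. apply (Cmult_neq_0 _ _ H2 Hz0).
  replace (RtoC 2 * z) with (RtoC 2 * z / (z + RtoC 1) * (z + RtoC 1)) by (field; exact Hd).
  rewrite E; ring. }
assert (Hq : RtoC 1 - l * l <> RtoC 0).
{ replace (RtoC 1 - l * l) with ((RtoC 1 - l) * (RtoC 1 + l)) by ring.
  apply Cmult_neq_0; assumption. }
assert (Ha : RtoC (1 - y) - RtoC x <> RtoC 0).
{ rewrite <- RtoC_minus; apply RtoC_neq; lra. }
set (k := (RtoC (1 - y) - RtoC x * (l * l)) / (RtoC 1 - l * l)).
assert (Ek : k - RtoC x = (RtoC (1 - y) - RtoC x) / (RtoC 1 - l * l))
  by (unfold k; field; exact Hq).
assert (Nk : k - RtoC x <> RtoC 0).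
{ rewrite Ek; intros E; apply Ha.
  replace (RtoC (1 - y) - RtoC x)
    with ((RtoC (1 - y) - RtoC x) / (RtoC 1 - l * l) * (RtoC 1 - l * l)) by (field; exact Hq).
  rewrite E; ring. }
exists (Fin l, Fin k); split; [|apply HF]; split.
- intros E; apply Nk; rewrite E; ring.
- rewrite Ek. unfold k. field; repeat split; assumption.
Qed.

Lemma Finv_spec (x y : R) (z : C) :
  (x + y < 1)%R -> surface x y (Finv x y z) /\ F_map (Finv x y z) = Fin z.
Proof. intros H; unfold Finv; apply epsilon_spec, F_onto, H. Qed.

Lemma F_injective (x y : R) (P Q : point) :
  (x + y < 1)%R -> surface x y P -> surface x y Q -> F_map P = F_map Q -> P = Q.
Proof.
intros Hxy.
assert (H2 : RtoC 2 <> RtoC 0) by (apply RtoC_neq; lra).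
assert (Ha : RtoC (1 - y) - RtoC x <> RtoC 0).
{ rewrite <- RtoC_minus; apply RtoC_neq; lra. }
assert (K0 : forall a, a <> RtoC 1 -> RtoC 1 - a <> RtoC 0).
{ intros a N E; apply N. replace a with (RtoC 1 - (RtoC 1 - a)) by ring. rewrite E; ring. }
assert (K : forall a, a <> RtoC 1 -> (RtoC 1 + a) / (RtoC 1 - a) <> RtoC (-1)).
{ intros a N E; apply H2.
  assert (E' : RtoC 1 + a = RtoC (-1) * (RtoC 1 - a)).
  { rewrite <- E; field; apply K0, N. }
  replace (RtoC 2) with ((RtoC 1 + a) - RtoC (-1) * (RtoC 1 - a)).
  - rewrite E'; ring.
  - apply injective_projections; simpl; ring. }
assert (L : forall a b, a <> RtoC 1 -> b <> RtoC 1 ->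
  (RtoC 1 + a) / (RtoC 1 - a) = (RtoC 1 + b) / (RtoC 1 - b) -> a = b).
{ intros a b Na Nb E.
  assert (E' : (RtoC 1 + a) * (RtoC 1 - b) = (RtoC 1 + b) * (RtoC 1 - a)).
  { transitivity ((RtoC 1 + a) / (RtoC 1 - a) * ((RtoC 1 - a) * (RtoC 1 - b))).
    - field; apply K0, Na.
    - rewrite E; field; apply K0, Nb. }
  assert (E2 : RtoC 2 * (a - b) = RtoC 0).
  { replace (RtoC 2 * (a - b))
      with ((RtoC 1 + a) * (RtoC 1 - b) - (RtoC 1 + b) * (RtoC 1 - a)).
    - rewrite E'; ring.
    - replace (RtoC 2) with (RtoC 1 + RtoC 1) by (rewrite <- RtoC_plus; f_equal; ring).
      ring. }
  replace a with (b + RtoC 2 * (a - b) / RtoC 2) by (field; exact H2).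
  rewrite E2; field; exact H2. }
assert (M : forall k, k <> RtoC x ->
  (k - RtoC (1 - y)) / (k - RtoC x) <> RtoC 1).
{ intros k N E. assert (N' : k - RtoC x <> RtoC 0).
  { intros E0; apply N. replace k with (k - RtoC x + RtoC x) by ring. rewrite E0; ring. }
  apply Ha.
  replace (RtoC (1 - y) - RtoC x)
    with (k - RtoC x - (k - RtoC (1 - y)) / (k - RtoC x) * (k - RtoC x))
    by (field; exact N').
  rewrite E; ring. }
assert (J : forall k k', k <> RtoC x -> k' <> RtoC x ->
  (k - RtoC (1 - y)) / (k - RtoC x) = (k' - RtoC (1 - y)) / (k' - RtoC x) -> k = k').
{ intros k k' N N' E.
  assert (A : k - RtoC x <> RtoC 0).
  { intros E0; apply N. replace k with (k - RtoC x + RtoC x) by ring. rewrite E0; ring. }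
  assert (A' : k' - RtoC x <> RtoC 0).
  { intros E0; apply N'. replace k' with (k' - RtoC x + RtoC x) by ring. rewrite E0; ring. }
  assert (E' : (k - RtoC (1 - y)) * (k' - RtoC x) = (k' - RtoC (1 - y)) * (k - RtoC x)).
  { transitivity ((k - RtoC (1 - y)) / (k - RtoC x) * ((k - RtoC x) * (k' - RtoC x))).
    - field; exact A.
    - rewrite E; field; exact A'. }
  assert (E2 : (k - k') * (RtoC (1 - y) - RtoC x) = RtoC 0).
  { replace ((k - k') * (RtoC (1 - y) - RtoC x))
      with ((k - RtoC (1 - y)) * (k' - RtoC x) - (k' - RtoC (1 - y)) * (k - RtoC x)) by ring.
    rewrite E'; ring. }
  replace k with (k' + (k - k') * (RtoC (1 - y) - RtoC x) / (RtoC (1 - y) - RtoC x))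
    by (field; exact Ha).
  rewrite E2; field; exact Ha. }
assert (FI : forall a b, Fin a = Fin b -> a = b) by congruence.
assert (S1 : RtoC 1 * RtoC 1 = RtoC 1) by ring.
assert (S2 : RtoC (-1) * RtoC (-1) = RtoC 1)
  by (apply injective_projections; simpl; ring).
assert (Z : forall l k, k <> RtoC x /\ l * l = (k - RtoC (1 - y)) / (k - RtoC x) ->
  l = RtoC 1 \/ l = RtoC (-1) -> False).
{ intros l k [N E] [H|H]; apply (M k N); rewrite <- E, H; assumption. }
destruct P as [[l|] [k|]], Q as [[l'|] [k'|]]; unfold F_map; cbn [fst snd surface];
  intros HP HQ; try tauto;
  repeat match goal with
  | |- context [Ceq_dec ?a ?b] => destruct (Ceq_dec a b)
  end; intros E; try discriminate; try apply FI in E;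
  try (exfalso; first [apply (K _ n E) | apply (K _ n (eq_sym E))]);
  try (assert (E3 : l = l') by (apply L; assumption));
  try (assert (E3 : l = l') by congruence);
  try (rewrite <- E3 in HQ; try (exfalso; eapply Z; eassumption); rewrite <- E3);
  try reflexivity; try congruence.
all: destruct HP, HQ; assert (Ek : k = k') by (apply J; congruence); rewrite Ek; reflexivity.
Qed.

(* Main.v *)
(** On the surface, lambda(t,0,.) with 0 <= t <= x is (k - x) lambda(x,y,.) (k - 1) times the product
    of the Cauchy integrals 1 / sqrt ((k - t) (k - x)) and 1 / sqrt ((k - 1 + y) (k - 1)), taken
    over [t,x] and [1-y,1]. Partial fractions split it into a part alpha that is singular only on
    F(Sigma_0) and vanishes at infinity, and a part beta that is singular only on F(Sigma_1). After
    integration against V_0' (by parts, since V_0' may blow up at 0) the jump on Gamma_0 becomes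
    A_0 + B_0; the jump on Gamma_1 becomes A_1 + B_1 by the symmetry x <-> y, k -> 1 - k, z -> -z.
    Hence m is A_1 - B_0 inside Gamma_0, A_0 - B_1 inside Gamma_1 and A_0 + A_1 outside, and m(0) is
    explicit. Two solutions differ by a bounded function that extends continuously across Gamma, so
    uniqueness is Liouville's theorem.

    At z = 0 this gives V(x,y) = P_0(x,y) + P_1(y,x), where P_i(x,y) is the integral of V_i'(t)
    against the average over theta of (1 - k)^(1/2) (1 - y - k)^(-1/2) at
    k = t + (x - t) sin^2 (theta/2). The Euler-Darboux operator maps the integrand to a total
    theta-derivative, which yields the equation; all differentiations are performed under the
    integral.

    For the uniqueness of V, let p = U_x and q = U_y for a difference U of two solutions. They vanish
    on the axes y = 0 and x = 0, and p_y = q_x = (p + q) / (2 (1 - x - y)). In the sup norm of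
    x^a p and y^a q weighted by exp (- l (x^(1-a) + y^(1-a))), l large, integrating this system is a
    contraction. *)

Require Import Defs.
From Stdlib Require Import Reals ZArith Lra Psatz ClassicalEpsilon Lia.
From Coquelicot Require Import Coquelicot.

Local Open Scope R_scope.

(** The contour consists of arbitrary smooth loops, and their inside is defined by the winding
    number. What is proved about it is local: near g t, in sectors about the two normals, the
    winding number takes its two values, by comparison of g t + w with g t - w. The solution being
    glued from explicit functions, each analytic outside one of the loops, this gives its boundary
    values and jumps.

    Uniqueness needs Liouville's theorem for a function continuous everywhere but differentiable
    only off the loops. Its integral over a square vanishes by Goursat's bisection, the loops being
    negligible because O(1/h) squares of side h cover them.

    Square roots are handled without following branches: the Cauchy integrals are averages over an
    angle, a differential equation yields their squares, and signs are fixed by continuity along a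
    deformation.

    The data enter the construction through U = V_i(max 0 .), continuous on (-oo, 1) and zero at 0.
    After integration by parts no V_i' stands under an integral, and the integrals are continuous on
    an open neighbourhood of D; the singular behaviour at the axes sits in single explicit terms. *)

Ltac eq_in T := match goal with |- ?a = ?b => change (@eq T a b) end.

(** * Limits and continuity of complex-valued functions *)

Lemma locally_Cmod (z : C) (P : C -> Prop) :
  locally z P <-> exists d : R, 0 < d /\ forall w, Cmod (w - z) < d -> P w.
Proof.
split.
- intros [e He]. exists e; split; [apply e|]. intros w Hw. apply He.
  apply (C_NormedModule_mixin_compat1 z w e). exact Hw.
- intros [d [Hd H]].
  (* Neighbourhoods in [C] are squares of the product topology; the one of half-side d / 2 lies
     within sqrt 2 * d / 2 < d of z. *)
  assert (Hp : 0 < d / 2) by lra.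
  exists (mkposreal _ Hp). intros w Hw. apply H.
  generalize (C_NormedModule_mixin_compat2 z w (mkposreal _ Hp) Hw); simpl.
  intros H1. change (minus w z) with (w - z)%C in H1.
  assert (sqrt 2 < 2).
  { rewrite <- (sqrt_Rsqr 2) at 2 by lra. apply sqrt_lt_1; unfold Rsqr; lra. }
  nra.
Qed.

Lemma filterlim_Cmod {T : Type} (F : (T -> Prop) -> Prop) {FF : Filter F} (f : T -> C) (l : C) :
  filterlim f F (locally l) <->
  forall e : R, 0 < e -> F (fun x => Cmod (f x - l) < e).
Proof.
split.
- intros H e He. refine (H (fun w => Cmod (w - l) < e)%C _). apply locally_Cmod. exists e; split; [exact He|]. tauto.
- intros H P HP. apply locally_Cmod in HP. destruct HP as [d [Hd HP]].
  unfold filtermap. apply filter_imp with (2 := H d Hd). intros x; apply HP.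
Qed.

Lemma continuous_C {U : UniformSpace} (f : U -> C) (x : U) :
  continuous (fun t => Re (f t)) x -> continuous (fun t => Im (f t)) x -> continuous f x.
Proof.
intros H1 H2. 
apply continuous_ext with (fun t => (Re (f t), Im (f t))).
{ intros t; destruct (f t); reflexivity. }
apply (continuous_comp_2 (fun t => Re (f t)) (fun t => Im (f t)) (fun a b => (a, b) : prod_UniformSpace R_UniformSpace R_UniformSpace) x H1 H2).
intros P HP. unfold filtermap. apply filter_imp with (2 := HP). intros [a b]; tauto.
Qed.

Lemma continuous_Re {U : UniformSpace} (f : U -> C) (x : U) :
  continuous f x -> continuous (fun t => Re (f t)) x.
Proof.
intros H. apply (continuous_comp f (fun z : prod_UniformSpace R_UniformSpace R_UniformSpace => fst z)); [exact H|].
destruct (f x); apply continuous_fst.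
Qed.

Lemma continuous_Im {U : UniformSpace} (f : U -> C) (x : U) :
  continuous f x -> continuous (fun t => Im (f t)) x.
Proof.
intros H. apply (continuous_comp f (fun z : prod_UniformSpace R_UniformSpace R_UniformSpace => snd z)); [exact H|].
destruct (f x); apply continuous_snd.
Qed.

Lemma continuous_Rplus {U : UniformSpace} (f g : U -> R) (x : U) :
  continuous f x -> continuous g x -> continuous (fun t => f t + g t) x.
Proof. exact (continuous_plus f g x). Qed.
Lemma continuous_Rminus {U : UniformSpace} (f g : U -> R) (x : U) :
  continuous f x -> continuous g x -> continuous (fun t => f t - g t) x.
Proof. exact (continuous_minus f g x). Qed.
Lemma continuous_Rmult {U : UniformSpace} (f g : U -> R) (x : U) :
  continuous f x -> continuous g x -> continuous (fun t => f t * g t) x.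
Proof. exact (continuous_mult f g x). Qed.
Lemma continuous_Ropp {U : UniformSpace} (f : U -> R) (x : U) :
  continuous f x -> continuous (fun t => - f t) x.
Proof. exact (continuous_opp f x). Qed.
Lemma continuous_Rinv' {U : UniformSpace} (f : U -> R) (x : U) :
  continuous f x -> f x <> 0 -> continuous (fun t => / f t) x.
Proof. intros H Hn. apply (continuous_comp f Rinv); [exact H| apply continuous_Rinv, Hn]. Qed.
Lemma continuous_Rdiv {U : UniformSpace} (f g : U -> R) (x : U) :
  continuous f x -> continuous g x -> g x <> 0 -> continuous (fun t => f t / g t) x.
Proof. intros; apply continuous_Rmult; [|apply continuous_Rinv']; assumption. Qed.

Lemma continuous_RtoC {U : UniformSpace} (f : U -> R) (x : U) :
  continuous f x -> continuous (fun t => RtoC (f t)) x.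
Proof. intros H; apply continuous_C; simpl; [exact H|apply continuous_const]. Qed.
Lemma continuous_Cplus {U : UniformSpace} (f g : U -> C) (x : U) :
  continuous f x -> continuous g x -> continuous (fun t => f t + g t)%C x.
Proof.
intros Hf Hg; apply continuous_C.
- exact (continuous_Rplus _ _ x (continuous_Re f x Hf) (continuous_Re g x Hg)).
- exact (continuous_Rplus _ _ x (continuous_Im f x Hf) (continuous_Im g x Hg)).
Qed.
Lemma continuous_Copp {U : UniformSpace} (f : U -> C) (x : U) :
  continuous f x -> continuous (fun t => - f t)%C x.
Proof.
intros Hf; apply continuous_C.
- exact (continuous_Ropp _ x (continuous_Re f x Hf)).
- exact (continuous_Ropp _ x (continuous_Im f x Hf)).
Qed.
Lemma continuous_Cminus {U : UniformSpace} (f g : U -> C) (x : U) :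
  continuous f x -> continuous g x -> continuous (fun t => f t - g t)%C x.
Proof. intros; apply continuous_Cplus; [|apply continuous_Copp]; assumption. Qed.
Lemma continuous_Cmult {U : UniformSpace} (f g : U -> C) (x : U) :
  continuous f x -> continuous g x -> continuous (fun t => f t * g t)%C x.
Proof.
intros Hf Hg.
assert (F1 := continuous_Re f x Hf). assert (F2 := continuous_Im f x Hf).
assert (G1 := continuous_Re g x Hg). assert (G2 := continuous_Im g x Hg).
apply continuous_C.
- exact (continuous_Rminus _ _ x (continuous_Rmult _ _ x F1 G1) (continuous_Rmult _ _ x F2 G2)).
- exact (continuous_Rplus _ _ x (continuous_Rmult _ _ x F1 G2) (continuous_Rmult _ _ x F2 G1)).
Qed.

Lemma Cnorm2_neq_0 (z : C) : z <> RtoC 0 -> fst z ^ 2 + snd z ^ 2 <> 0.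
Proof.
destruct z as [a b]; simpl; intros H E. apply H. unfold RtoC.
assert (a = 0) by nra. assert (b = 0) by nra. congruence.
Qed.

Lemma continuous_Cinv {U : UniformSpace} (f : U -> C) (x : U) :
  continuous f x -> f x <> RtoC 0 -> continuous (fun t => / f t)%C x.
Proof.
intros Hf Hn. apply Cnorm2_neq_0 in Hn.
assert (Hr := continuous_Re f x Hf). assert (Hi := continuous_Im f x Hf).
assert (Hs : continuous (fun t => fst (f t) ^ 2 + snd (f t) ^ 2) x).
{ apply continuous_ext with (fun t => Re (f t) * Re (f t) + Im (f t) * Im (f t)).
  (* The type of the equation is a carrier projected from a structure; restated over [R], it is
     recognised by [ring]. *)
  - intros t; eq_in R; unfold Re, Im; ring.
  - apply continuous_Rplus; apply continuous_Rmult; assumption. }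
apply continuous_C; unfold Cinv; cbn [Re Im fst snd]; apply continuous_Rdiv; try assumption.
apply continuous_Ropp; assumption.
Qed.
Lemma continuous_Cdiv {U : UniformSpace} (f g : U -> C) (x : U) :
  continuous f x -> continuous g x -> g x <> RtoC 0 -> continuous (fun t => f t / g t)%C x.
Proof. intros; apply continuous_Cmult; [|apply continuous_Cinv]; assumption. Qed.

(** * Integrals of complex-valued functions over real intervals *)

Notation CInt := (RInt (V := C_R_CompleteNormedModule)).
Notation ex_CInt := (ex_RInt (V := C_R_NormedModule)).
Notation is_CInt := (is_RInt (V := C_R_NormedModule)).

Lemma ex_CInt_continuous (f : R -> C) (a b : R) : a <= b ->
  (forall t, a <= t <= b -> continuous f t) -> ex_CInt f a b.
Proof.
intros Hab H. apply (ex_RInt_continuous (V := C_R_CompleteNormedModule)).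
rewrite Rmin_left, Rmax_right by lra. exact H.
Qed.

Lemma CInt_correct (f : R -> C) (a b : R) : ex_CInt f a b -> is_CInt f a b (CInt f a b).
Proof. exact (RInt_correct (V := C_R_CompleteNormedModule) f a b). Qed.

Lemma CInt_unique (f : R -> C) (a b : R) (l : C) : is_CInt f a b l -> CInt f a b = l.
Proof. exact (is_RInt_unique (V := C_R_CompleteNormedModule) f a b l). Qed.

Lemma is_CInt_pair (f : R -> C) (a b : R) (l : C) :
  is_RInt (fun t => Re (f t)) a b (Re l) -> is_RInt (fun t => Im (f t)) a b (Im l) ->
  is_CInt f a b l.
Proof.
intros H1 H2. destruct l as [l1 l2].
exact (is_RInt_fct_extend_pair (U := R_NormedModule) (V := R_NormedModule) f a b l1 l2 H1 H2).
Qed.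

Lemma is_CInt_Re (f : R -> C) (a b : R) (l : C) :
  is_CInt f a b l -> is_RInt (fun t => Re (f t)) a b (Re l).
Proof. exact (is_RInt_fct_extend_fst (U := R_NormedModule) (V := R_NormedModule) f a b l). Qed.

Lemma is_CInt_Im (f : R -> C) (a b : R) (l : C) :
  is_CInt f a b l -> is_RInt (fun t => Im (f t)) a b (Im l).
Proof. exact (is_RInt_fct_extend_snd (U := R_NormedModule) (V := R_NormedModule) f a b l). Qed.

Lemma Re_CInt (f : R -> C) (a b : R) :
  ex_CInt f a b -> Re (CInt f a b) = RInt (fun t => Re (f t)) a b.
Proof. intros H; symmetry; apply is_RInt_unique, is_CInt_Re, CInt_correct, H. Qed.

Lemma Im_CInt (f : R -> C) (a b : R) :
  ex_CInt f a b -> Im (CInt f a b) = RInt (fun t => Im (f t)) a b.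
Proof. intros H; symmetry; apply is_RInt_unique, is_CInt_Im, CInt_correct, H. Qed.

Lemma CInt_RtoC (f : R -> R) (a b : R) :
  ex_RInt f a b -> CInt (fun t => RtoC (f t)) a b = RtoC (RInt f a b).
Proof.
intros H. apply CInt_unique, is_CInt_pair; simpl; [apply (RInt_correct f a b H)|].
assert (E := is_RInt_const (V := R_NormedModule) a b 0).
exact (eq_ind _ (is_RInt (V := R_NormedModule) (fun _ => 0) a b) E _ (Rmult_0_r (b - a))).
Qed.

Lemma is_CInt_plus (f g : R -> C) (a b : R) (lf lg : C) :
  is_CInt f a b lf -> is_CInt g a b lg -> is_CInt (fun t => f t + g t)%C a b (lf + lg)%C.
Proof. exact (is_RInt_plus f g a b lf lg). Qed.

Lemma is_CInt_minus (f g : R -> C) (a b : R) (lf lg : C) :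
  is_CInt f a b lf -> is_CInt g a b lg -> is_CInt (fun t => f t - g t)%C a b (lf - lg)%C.
Proof. exact (is_RInt_minus f g a b lf lg). Qed.

(** [C] is here a normed module over the reals, so a complex factor leaves the integral by way of
    real and imaginary parts. *)
Lemma is_CInt_scal (c : C) (f : R -> C) (a b : R) (l : C) :
  is_CInt f a b l -> is_CInt (fun t => c * f t)%C a b (c * l)%C.
Proof.
intros H. assert (H1 := is_CInt_Re _ _ _ _ H). assert (H2 := is_CInt_Im _ _ _ _ H).
apply is_CInt_pair; simpl.
- exact (is_RInt_minus _ _ a b _ _ (is_RInt_scal _ a b (Re c) _ H1) (is_RInt_scal _ a b (Im c) _ H2)).
- exact (is_RInt_plus _ _ a b _ _ (is_RInt_scal _ a b (Re c) _ H2) (is_RInt_scal _ a b (Im c) _ H1)).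
Qed.

Lemma CInt_plus (f g : R -> C) (a b : R) : ex_CInt f a b -> ex_CInt g a b ->
  CInt (fun t => f t + g t)%C a b = (CInt f a b + CInt g a b)%C.
Proof. intros; apply CInt_unique, is_CInt_plus; apply CInt_correct; assumption. Qed.
Lemma CInt_minus (f g : R -> C) (a b : R) : ex_CInt f a b -> ex_CInt g a b ->
  CInt (fun t => f t - g t)%C a b = (CInt f a b - CInt g a b)%C.
Proof. intros; apply CInt_unique, is_CInt_minus; apply CInt_correct; assumption. Qed.
Lemma CInt_scal (c : C) (f : R -> C) (a b : R) : ex_CInt f a b ->
  CInt (fun t => c * f t)%C a b = (c * CInt f a b)%C.
Proof. intros; apply CInt_unique, is_CInt_scal; apply CInt_correct; assumption. Qed.
Lemma ex_CInt_plus (f g : R -> C) (a b : R) : ex_CInt f a b -> ex_CInt g a b ->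
  ex_CInt (fun t => f t + g t)%C a b.
Proof. exact (ex_RInt_plus f g a b). Qed.
Lemma ex_CInt_scal (c : C) (f : R -> C) (a b : R) : ex_CInt f a b ->
  ex_CInt (fun t => c * f t)%C a b.
Proof. intros [l H]; exists (c * l)%C; apply is_CInt_scal, H. Qed.

Lemma CInt_const (c : C) (a b : R) : CInt (fun _ => c) a b = (RtoC (b - a) * c)%C.
Proof.
apply CInt_unique. replace (RtoC (b - a) * c)%C with (scal (b - a) c).
- apply (is_RInt_const (V := C_R_NormedModule) a b c).
- destruct c as [u v]. apply injective_projections; unfold scal; simpl; unfold scal, mult; simpl; unfold mult; simpl; ring.
Qed.

Lemma CInt_bound (f : R -> C) (a b M : R) : a <= b -> ex_CInt f a b ->
  (forall t, a <= t <= b -> Cmod (f t) <= M) -> Cmod (CInt f a b) <= (b - a) * M.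
Proof.
intros Hab He H. rewrite Cmod_norm.
apply (norm_RInt_le_const (V := C_R_NormedModule) f a b); [exact Hab| |apply CInt_correct, He].
intros t Ht. rewrite <- Cmod_norm; apply H, Ht.
Qed.

Lemma CInt_ext (f g : R -> C) (a b : R) : a <= b ->
  (forall t, a <= t <= b -> f t = g t) -> CInt f a b = CInt g a b.
Proof.
intros Hab H. apply RInt_ext. rewrite Rmin_left, Rmax_right by lra. intros; apply H; lra.
Qed.

Lemma CInt_Chasles (f : R -> C) (a b c : R) : ex_CInt f a b -> ex_CInt f b c ->
  (CInt f a b + CInt f b c)%C = CInt f a c.
Proof. exact (RInt_Chasles (V := C_R_CompleteNormedModule) f a b c). Qed.

(** * Goursat's theorem *)

Definition Cderiv (f : C -> C) (z l : C) : Prop :=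
  forall e, 0 < e -> exists d, 0 < d /\ forall w, Cmod (w - z) < d ->
    Cmod (f w - f z - l * (w - z)) <= e * Cmod (w - z).

Lemma Cderiv_is_derive (f : C -> C) (z l : C) :
  Cderiv f z l <-> is_derive (K := C_AbsRing) (V := C_NormedModule) f z l.
Proof.
split.
- intros H. split; [apply is_linear_scal_l|].
  intros x Hx. assert (E := is_filter_lim_locally_unique _ _ Hx). rewrite <- E. clear x Hx E.
  intros [e He]. destruct (H e He) as [d [Hd H']].
  (* [is_derive] over [C_AbsRing] works with discs, [locally_Cmod] with the product topology;
     [locally_C] identifies the two. *)
  apply locally_C. apply locally_Cmod. exists d; split; [exact Hd|].
  intros w Hw. specialize (H' w Hw).
  change (Cmod (f w - f z - (w - z) * l) <= e * Cmod (w - z)).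
  rewrite (Cmult_comm (w - z)). exact H'.
- intros [_ H] e He. specialize (H z (fun P HP => HP) (mkposreal e He)).
  apply locally_C in H. apply locally_Cmod in H. destruct H as [d [Hd H]].
  exists d; split; [exact Hd|]. intros w Hw. specialize (H w Hw).
  change (Cmod (f w - f z - (w - z) * l) <= e * Cmod (w - z)) in H.
  rewrite (Cmult_comm (w - z)) in H. exact H.
Qed.

Lemma Cderiv_ex (f : C -> C) (z : C) :
  ex_derive (K := C_AbsRing) (V := C_NormedModule) f z <-> exists l, Cderiv f z l.
Proof. split; intros [l H]; exists l; apply Cderiv_is_derive, H. Qed.

Lemma continuous_Cmod (f : C -> C) (z : C) :
  continuous f z <-> forall e, 0 < e -> exists d, 0 < d /\ forall w, Cmod (w - z) < d -> Cmod (f w - f z) < e.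
Proof.
split.
- intros H e He. apply (filterlim_Cmod (locally z) f (f z)) in He; [|exact H].
  apply locally_Cmod in He. exact He.
- intros H. apply filterlim_Cmod; [apply locally_filter|]. intros e He. apply locally_Cmod, H, He.
Qed.

Lemma Cderiv_continuous (f : C -> C) (z l : C) : Cderiv f z l -> continuous f z.
Proof.
intros H. apply continuous_Cmod. intros e He.
destruct (H 1 Rlt_0_1) as [d [Hd H']].
assert (Hl := Cmod_ge_0 l).
assert (Hm : 0 < e / (2 * (1 + Cmod l))) by (apply Rdiv_lt_0_compat; lra).
exists (Rmin d (e / (2 * (1 + Cmod l)))); split; [apply Rmin_pos; lra|].
intros w Hw. assert (H1 := Rmin_l d (e / (2 * (1 + Cmod l)))).
assert (H2 := Rmin_r d (e / (2 * (1 + Cmod l)))).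
specialize (H' w ltac:(lra)).
replace (f w - f z)%C with ((f w - f z - l * (w - z)) + l * (w - z))%C by ring.
eapply Rle_lt_trans; [apply Cmod_triangle|]. rewrite Cmod_mult.
assert (H3 : Cmod (w - z) * (1 + Cmod l) <= e / 2).
{ replace (e / 2) with (e / (2 * (1 + Cmod l)) * (1 + Cmod l)) by (field; lra).
  apply Rmult_le_compat_r; lra. }
nra.
Qed.

(** The integral of f dz along the boundary of the rectangle, counterclockwise: bottom, right, top,
    left. *)
Definition rect (f : C -> C) (a1 a2 b1 b2 : R) : C :=
  (CInt (fun s => f (s, b1)) a1 a2 + Ci * CInt (fun s => f (a2, s)) b1 b2
   - CInt (fun s => f (s, b2)) a1 a2 - Ci * CInt (fun s => f (a1, s)) b1 b2)%C.

Lemma continuous_hline (f : C -> C) (b s : R) :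
  (forall z, continuous f z) -> continuous (fun s => f (s, b)) s.
Proof.
intros H. apply (continuous_comp (fun s => (s, b) : C) f); [|apply H].
apply continuous_C; simpl; [apply continuous_id|apply continuous_const].
Qed.
Lemma continuous_vline (f : C -> C) (a s : R) :
  (forall z, continuous f z) -> continuous (fun s => f (a, s)) s.
Proof.
intros H. apply (continuous_comp (fun s => (a, s) : C) f); [|apply H].
apply continuous_C; simpl; [apply continuous_const|apply continuous_id].
Qed.

Lemma ex_hline (f : C -> C) (b a1 a2 : R) :
  (forall z, continuous f z) -> ex_CInt (fun s => f (s, b)) a1 a2.
Proof.
intros H. apply (ex_RInt_continuous (V := C_R_CompleteNormedModule)).
intros; apply continuous_hline, H.
Qed.
Lemma ex_vline (f : C -> C) (a b1 b2 : R) :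
  (forall z, continuous f z) -> ex_CInt (fun s => f (a, s)) b1 b2.
Proof.
intros H. apply (ex_RInt_continuous (V := C_R_CompleteNormedModule)).
intros; apply continuous_vline, H.
Qed.

Lemma rect_split_h (f : C -> C) (a1 a2 a3 b1 b2 : R) : (forall z, continuous f z) ->
  (rect f a1 a2 b1 b2 + rect f a2 a3 b1 b2)%C = rect f a1 a3 b1 b2.
Proof.
intros H. unfold rect.
rewrite <- (CInt_Chasles (fun s => f (s, b1)) a1 a2 a3), <- (CInt_Chasles (fun s => f (s, b2)) a1 a2 a3)
  by (apply ex_hline, H).
ring.
Qed.

Lemma rect_split_v (f : C -> C) (a1 a2 b1 b2 b3 : R) : (forall z, continuous f z) ->
  (rect f a1 a2 b1 b2 + rect f a1 a2 b2 b3)%C = rect f a1 a2 b1 b3.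
Proof.
intros H. unfold rect.
rewrite <- (CInt_Chasles (fun s => f (a1, s)) b1 b2 b3), <- (CInt_Chasles (fun s => f (a2, s)) b1 b2 b3)
  by (apply ex_vline, H).
ring.
Qed.

Lemma rect_minus (f g : C -> C) (a1 a2 b1 b2 : R) :
  (forall z, continuous f z) -> (forall z, continuous g z) ->
  rect (fun z => f z - g z)%C a1 a2 b1 b2 = (rect f a1 a2 b1 b2 - rect g a1 a2 b1 b2)%C.
Proof.
intros Hf Hg. unfold rect.
assert (Eh : forall b, CInt (fun s => f (s, b) - g (s, b))%C a1 a2 =
  (CInt (fun s => f (s, b)) a1 a2 - CInt (fun s => g (s, b)) a1 a2)%C)
  by (intros b; apply CInt_minus; apply ex_hline; assumption).
assert (Ev : forall a, CInt (fun s => f (a, s) - g (a, s))%C b1 b2 =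
  (CInt (fun s => f (a, s)) b1 b2 - CInt (fun s => g (a, s)) b1 b2)%C)
  by (intros a; apply CInt_minus; apply ex_vline; assumption).
eapply eq_trans.
- exact (f_equal4 (fun u v w z => u + Ci * v - w - Ci * z)%C (Eh b1) (Ev a2) (Eh b2) (Ev a1)).
- ring.
Qed.

Lemma is_RInt_affine (p q a b : R) :
  is_RInt (fun s => p + q * s) a b (p * (b - a) + q * (b ^ 2 - a ^ 2) / 2).
Proof.
replace (p * (b - a) + q * (b ^ 2 - a ^ 2) / 2)
  with (minus (p * b + q * b ^ 2 / 2) (p * a + q * a ^ 2 / 2))
  by (unfold minus, plus, opp; simpl; field).
apply (is_RInt_derive (fun s => p * s + q * s ^ 2 / 2)).
- intros; auto_derive; [exact I|]. field.
- intros; apply continuous_Rplus; [apply continuous_const|].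
  apply continuous_Rmult; [apply continuous_const|apply continuous_id].
Qed.

Lemma rect_affine (c l : C) (a1 a2 b1 b2 : R) : rect (fun z => c + l * z)%C a1 a2 b1 b2 = RtoC 0.
Proof.
destruct c as [c1 c2], l as [l1 l2]. unfold rect.
assert (Hh : forall b, CInt (fun s => (c1, c2) + (l1, l2) * (s, b))%C a1 a2 =
  ((c1 - l2 * b) * (a2 - a1) + l1 * (a2 ^ 2 - a1 ^ 2) / 2,
   (c2 + l1 * b) * (a2 - a1) + l2 * (a2 ^ 2 - a1 ^ 2) / 2)).
{ intros b. apply CInt_unique, is_CInt_pair; cbn [Re Im fst snd].
  - eapply is_RInt_ext; [|apply (is_RInt_affine (c1 - l2 * b) l1)].
    intros; simpl; ring.
  - eapply is_RInt_ext; [|apply (is_RInt_affine (c2 + l1 * b) l2)].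
    intros; simpl; ring. }
assert (Hv : forall a, CInt (fun s => (c1, c2) + (l1, l2) * (a, s))%C b1 b2 =
  ((c1 + l1 * a) * (b2 - b1) + (- l2) * (b2 ^ 2 - b1 ^ 2) / 2,
   (c2 + l2 * a) * (b2 - b1) + l1 * (b2 ^ 2 - b1 ^ 2) / 2)).
{ intros a. apply CInt_unique, is_CInt_pair; cbn [Re Im fst snd].
  - eapply is_RInt_ext; [|apply (is_RInt_affine (c1 + l1 * a) (- l2))].
    intros; simpl; ring.
  - eapply is_RInt_ext; [|apply (is_RInt_affine (c2 + l2 * a) l1)].
    intros; simpl; ring. }
rewrite !Hh, !Hv. apply injective_projections; simpl; field.
Qed.

Lemma rect_bound (f : C -> C) (a1 a2 b1 b2 M : R) : (forall z, continuous f z) ->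
  a1 <= a2 -> b1 <= b2 ->
  (forall s t, a1 <= s <= a2 -> b1 <= t <= b2 -> Cmod (f (s, t)) <= M) ->
  Cmod (rect f a1 a2 b1 b2) <= M * (2 * ((a2 - a1) + (b2 - b1))).
Proof.
intros H Ha Hb HM. unfold rect.
assert (Hh : forall b, b1 <= b <= b2 -> Cmod (CInt (fun s => f (s, b)) a1 a2) <= (a2 - a1) * M).
{ intros b Hb'. apply CInt_bound; [exact Ha|apply ex_hline, H|]. intros; apply HM; lra. }
assert (Hv : forall a, a1 <= a <= a2 -> Cmod (Ci * CInt (fun s => f (a, s)) b1 b2) <= (b2 - b1) * M).
{ intros a Ha'. rewrite Cmod_mult, Cmod_Ci, Rmult_1_l. apply CInt_bound; [exact Hb|apply ex_vline, H|]. intros; apply HM; lra. }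
unfold Cminus.
eapply Rle_trans; [apply Cmod_triangle|]. rewrite Cmod_opp.
assert (X1 := Hv a1 ltac:(lra)). assert (X2 := Hv a2 ltac:(lra)).
assert (X3 := Hh b1 ltac:(lra)). assert (X4 := Hh b2 ltac:(lra)).
match goal with |- Cmod (?u + - ?v) + _ <= _ => assert (Y := Cmod_triangle u (-v)%C); rewrite Cmod_opp in Y end.
match type of Y with _ <= Cmod (?u + ?v) + _ => assert (Y' := Cmod_triangle u v) end.
lra.
Qed.

Definition quarterable (P : R -> R -> R -> Prop) : Prop := forall a b h, 0 < h ->
  P a b (h / 2) -> P (a + h / 2) b (h / 2) -> P a (b + h / 2) (h / 2) ->
  P (a + h / 2) (b + h / 2) (h / 2) -> P a b h.

(** A square is given by its lower left corner and its side. The choice falls on a quarter without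
    P; the fourth is taken when the other three satisfy P. *)
Definition sq_step (P : R -> R -> R -> Prop) (q : R * R * R) : R * R * R :=
  let '(a, b, h) := q in
  if excluded_middle_informative (~ P a b (h / 2)) then (a, b, h / 2) else
  if excluded_middle_informative (~ P (a + h / 2) b (h / 2)) then (a + h / 2, b, h / 2) else
  if excluded_middle_informative (~ P a (b + h / 2) (h / 2)) then (a, b + h / 2, h / 2) else
  (a + h / 2, b + h / 2, h / 2).

Fixpoint sq_seq (P : R -> R -> R -> Prop) (q : R * R * R) (n : nat) : R * R * R :=
  match n with O => q | S n => sq_step P (sq_seq P q n) end.

Lemma sq_step_spec (P : R -> R -> R -> Prop) (Hquarter : quarterable P) (a b h : R) : 0 < h -> ~ P a b h ->
  let '(a', b', h') := sq_step P (a, b, h) in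
  ~ P a' b' h' /\ h' = h / 2 /\ (a <= a' /\ a' + h' <= a + h) /\ (b <= b' /\ b' + h' <= b + h).
Proof.
intros Hh HP. unfold sq_step.
repeat destruct (excluded_middle_informative _) as [?|?]; repeat split; try assumption; try lra.
intros H4. apply HP. apply Hquarter; [exact Hh| | | |exact H4]; apply NNPP; assumption.
Qed.

(** Cousin's lemma for squares: were P false, repeated quartering would produce nested squares
    without P that shrink to a point, against the local hypothesis there. It serves Goursat's
    theorem and, further on, boundedness on compact sets. *)
Lemma square_bisection (P : R -> R -> R -> Prop) (Hquarter : quarterable P) :
  forall a b h, 0 < h ->
  (forall x y, a <= x <= a + h -> b <= y <= b + h ->
    exists d, 0 < d /\ forall a' b' h', 0 < h' < d -> a' <= x <= a' + h' -> b' <= y <= b' + h' -> P a' b' h') ->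
  P a b h.
Proof.
intros a b h Hh Hloc. apply NNPP; intros HP.
set (A := fun n => fst (fst (sq_seq P (a, b, h) n))).
set (B := fun n => snd (fst (sq_seq P (a, b, h) n))).
set (H := fun n => snd (sq_seq P (a, b, h) n)).
assert (Hs : forall n, ~ P (A n) (B n) (H n) /\ H n = h / 2 ^ n).
{ unfold A, B, H. induction n as [|n [IH1 IH2]]; cbn [sq_seq].
  - split; [exact HP|]. simpl; field.
  - destruct (sq_seq P (a, b, h) n) as [[a' b'] h'] eqn:E. simpl in IH1, IH2.
    assert (Hp : 0 < h') by (rewrite IH2; apply Rdiv_lt_0_compat; [lra|apply pow_lt; lra]).
    assert (X := sq_step_spec P Hquarter a' b' h' Hp IH1).
    destruct (sq_step P (a', b', h')) as [[a2 b2] h2]. simpl.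
    destruct X as [X1 [X2 _]]. split; [exact X1|]. rewrite X2, IH2. field. apply pow_nonzero; lra. }
assert (Hstep : forall n, (A n <= A (S n) /\ A (S n) + H (S n) <= A n + H n) /\
                          (B n <= B (S n) /\ B (S n) + H (S n) <= B n + H n)).
{ intros n. destruct (Hs n) as [IH1 IH2]. unfold A, B, H in *. cbn [sq_seq].
  destruct (sq_seq P (a, b, h) n) as [[a' b'] h'] eqn:E. cbn [fst snd] in *.
  assert (Hp : 0 < h') by (rewrite IH2; apply Rdiv_lt_0_compat; [lra|apply pow_lt; lra]).
  assert (X := sq_step_spec P Hquarter a' b' h' Hp IH1).
  destruct (sq_step P (a', b', h')) as [[a2 b2] h2]. cbn [fst snd]. tauto. }
assert (Hpos : forall n, 0 < H n).
{ intros n. destruct (Hs n) as [_ ->]. apply Rdiv_lt_0_compat; [lra|apply pow_lt; lra]. }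
assert (Hmono : forall n m, (n <= m)%nat -> (A n <= A m /\ A m + H m <= A n + H n) /\
                          (B n <= B m /\ B m + H m <= B n + H n)).
{ intros n m Hnm. induction Hnm as [|m Hnm IH]; [lra|]. assert (X := Hstep m). lra. }
assert (Hlim : forall X : nat -> R,
  (forall n m, (n <= m)%nat -> X n <= X m /\ X m + H m <= X n + H n) ->
  exists x, forall n, X n <= x <= X n + H n).
{ intros X HX.
  destruct (completeness (fun r => exists n, r = X n)) as [x [Hx1 Hx2]].
  - exists (X 0%nat + H 0%nat). intros r [n ->]. assert (Z := HX 0%nat n ltac:(lia)).
    assert (Z' := Hpos n). lra.
  - exists (X 0%nat), 0%nat; reflexivity.
  - exists x. intros n. split; [apply Hx1; exists n; reflexivity|].
    apply Hx2. intros r [m ->].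
    destruct (Nat.le_gt_cases n m) as [L|L].
    + assert (Z := HX n m L). assert (Z' := Hpos m). lra.
    + assert (Z := HX m n ltac:(lia)). assert (Z' := Hpos n). lra. }
destruct (Hlim A) as [x Hx]; [intros; apply Hmono; assumption|].
destruct (Hlim B) as [y Hy]; [intros; apply Hmono; assumption|].
destruct (Hloc x y (Hx 0%nat) (Hy 0%nat)) as [d [Hd HPd]].
destruct (pow_lt_1_zero (/ 2) ltac:(rewrite Rabs_pos_eq; lra) (d / h)) as [n Hn].
{ apply Rdiv_lt_0_compat; lra. }
specialize (Hn n ltac:(lia)).
destruct (Hs n) as [HP' HH]. apply HP'. apply HPd; [|apply Hx|apply Hy].
split; [apply Hpos|]. rewrite HH.
rewrite Rabs_pos_eq in Hn by (apply pow_le; lra). rewrite pow_inv in Hn.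
replace d with (h * (d / h)) by (field; lra). unfold Rdiv at 1.
apply Rmult_lt_compat_l; lra.
Qed.

Lemma Cmod_le_abs (z : C) : Cmod z <= Rabs (Re z) + Rabs (Im z).
Proof.
destruct z as [a b]. unfold Re, Im; simpl fst; simpl snd.
replace (a, b) with (RtoC a + Ci * RtoC b)%C by (apply injective_projections; simpl; ring).
eapply Rle_trans; [apply Cmod_triangle|]. rewrite Cmod_mult, Cmod_Ci, !Cmod_R. lra.
Qed.

Lemma Cmod_in_square (a b h s t x y : R) : a <= s <= a + h -> b <= t <= b + h ->
  a <= x <= a + h -> b <= y <= b + h -> Cmod ((s, t) - (x, y)) <= 2 * h.
Proof.
intros. eapply Rle_trans; [apply Cmod_le_abs|]. simpl.
assert (Rabs (s + - x) <= h) by (apply Rabs_le; lra).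
assert (Rabs (t + - y) <= h) by (apply Rabs_le; lra). lra.
Qed.

(** The bound e h^2 on the boundary integral adds up over quarters. Near a point of
    differentiability the affine part of f integrates to zero, and the remainder, at most e/8 times
    the distance 2 h, is integrated over a perimeter 4 h: this is e h^2. *)
Lemma goursat_square (f : C -> C) (a b h : R) : 0 < h -> (forall z, continuous f z) ->
  (forall x y, a <= x <= a + h -> b <= y <= b + h -> exists l, Cderiv f (x, y) l) ->
  rect f a (a + h) b (b + h) = RtoC 0.
Proof.
intros Hh Hf Hd.
assert (Hall : forall e, 0 < e -> Cmod (rect f a (a + h) b (b + h)) <= e * h ^ 2).
{ intros e He.
  apply (square_bisection (fun a b h => Cmod (rect f a (a + h) b (b + h)) <= e * h ^ 2)).
  - clear a b h Hh Hd. intros a b h Hh P1 P2 P3 P4.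
    rewrite <- (rect_split_h f a (a + h / 2) (a + h)) by exact Hf.
    rewrite <- (rect_split_v f a _ b (b + h / 2) (b + h)) by exact Hf.
    rewrite <- (rect_split_v f _ (a + h) b (b + h / 2) (b + h)) by exact Hf.
    replace (a + h / 2 + h / 2) with (a + h) in P2, P4 by field.
    replace (b + h / 2 + h / 2) with (b + h) in P3, P4 by field.
    eapply Rle_trans; [apply Cmod_triangle|].
    eapply Rle_trans; [apply Rplus_le_compat; apply Cmod_triangle|].
    replace (e * h ^ 2) with (4 * (e * (h / 2) ^ 2)) by field. lra.
  - exact Hh.
  - intros x y Hx Hy. destruct (Hd x y Hx Hy) as [l Hl].
    destruct (Hl (e / 8) ltac:(lra)) as [d [Hd0 Hd1]].
    exists (d / 2); split; [lra|]. intros a' b' h' Hh' Hx' Hy'.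
    set (g := fun w : C => ((f (x, y) - l * (x, y)) + l * w)%C).
    assert (Hg : forall z, continuous g z).
    { intros z. apply continuous_Cplus; [apply continuous_const|].
      apply continuous_Cmult; [apply continuous_const|apply continuous_id]. }
    assert (E : rect f a' (a' + h') b' (b' + h') = rect (fun z => f z - g z)%C a' (a' + h') b' (b' + h')).
    { rewrite rect_minus by assumption. unfold g. rewrite rect_affine. ring. }
    rewrite E.
    replace (e * h' ^ 2) with (e / 8 * (2 * h') * (2 * ((a' + h' - a') + (b' + h' - b')))) by field.
    apply rect_bound; [|lra|lra|].
    + intros z. apply continuous_Cminus; [apply Hf|apply Hg].
    + intros s t Hs Ht. assert (Hst := Cmod_in_square a' b' h' s t x y Hs Ht Hx' Hy').
      replace (f (s, t) - g (s, t))%C with (f (s, t) - f (x, y) - l * ((s, t) - (x, y)))%C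
        by (unfold g; ring).
      eapply Rle_trans; [apply Hd1; lra|]. apply Rmult_le_compat_l; lra. }
apply Cmod_eq_0. apply Rle_antisym; [|apply Cmod_ge_0].
apply le_epsilon. intros e He. rewrite Rplus_0_l.
assert (Hh2 : 0 < h ^ 2) by (apply pow_lt; lra).
replace e with (e / h ^ 2 * h ^ 2) by (field; lra). apply Hall. apply Rdiv_lt_0_compat; lra.
Qed.

(** * Liouville's theorem across thin sets *)

Fixpoint bsum (F : nat -> R) (n : nat) : R :=
  match n with O => 0 | S n => bsum F n + F n end.

Lemma bsum_le (F G : nat -> R) (n : nat) :
  (forall i, (i < n)%nat -> F i <= G i) -> bsum F n <= bsum G n.
Proof.
induction n as [|n IH]; simpl; intros H; [lra|].
apply Rplus_le_compat; [apply IH; intros; apply H; lia|apply H; lia].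
Qed.
Lemma bsum_ext (F G : nat -> R) (n : nat) : (forall i, F i = G i) -> bsum F n = bsum G n.
Proof. intros H; induction n as [|n IH]; simpl; congruence. Qed.
Lemma bsum_scal (c : R) (F : nat -> R) (n : nat) : bsum (fun i => c * F i) n = c * bsum F n.
Proof. induction n as [|n IH]; simpl; [|rewrite IH]; ring. Qed.
Lemma bsum_plus (F G : nat -> R) (n : nat) : bsum (fun i => F i + G i) n = bsum F n + bsum G n.
Proof. induction n as [|n IH]; simpl; [|rewrite IH]; ring. Qed.
Lemma bsum_const (c : R) (n : nat) : bsum (fun _ => c) n = INR n * c.
Proof. induction n as [|n IH]; [simpl; ring|]. cbn [bsum]. rewrite IH, S_INR; ring. Qed.
Lemma bsum_swap (F : nat -> nat -> R) (n m : nat) :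
  bsum (fun i => bsum (fun k => F i k) m) n = bsum (fun k => bsum (fun i => F i k) n) m.
Proof.
induction n as [|n IH]; simpl; [rewrite bsum_const; ring|].
rewrite IH, <- bsum_plus. reflexivity.
Qed.
Lemma bsum_ge_term (F : nat -> R) (n k : nat) :
  (forall i, 0 <= F i) -> (k < n)%nat -> F k <= bsum F n.
Proof.
intros H. induction n as [|n IH]; intros Hk; [lia|]. simpl.
assert (0 <= bsum F n). { clear -H. induction n; simpl; [lra|specialize (H n); lra]. }
destruct (Nat.eq_dec k n) as [->|]; [lra|]. specialize (IH ltac:(lia)). specialize (H n). lra.
Qed.

Definition near (r : R) (i : nat) : R := if Rle_dec (Rabs (INR i - r)) 2 then 1 else 0.
Lemma near_nonneg (r : R) (i : nat) : 0 <= near r i.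
Proof. unfold near; destruct Rle_dec; lra. Qed.
(** An interval of length 4 contains at most five integers. The induction needs the sharper count of
    those below n, which is the expression with [Rmax] and [Rmin]. *)
Lemma bsum_near (r : R) (n : nat) : bsum (near r) n <= 5.
Proof.
assert (H : bsum (near r) n <= Rmax 0 (Rmin 5 (INR n - r + 2))).
{ induction n as [|n IH]; [apply Rmax_l|]. cbn [bsum]. rewrite S_INR. revert IH.
  unfold near; destruct Rle_dec as [L|L]; revert L; unfold Rmax, Rmin, Rabs;
  repeat (destruct Rle_dec || destruct Rcase_abs); lra. }
revert H. unfold Rmax, Rmin; repeat destruct Rle_dec; lra.
Qed.

(* E is covered by M / h squares of side 2 h. A bisection argument over such squares lets the
   Goursat integral ignore E where the function is merely continuous. *)
Definition thin (E : C -> Prop) (M : R) : Prop := forall h, 0 < h <= 1 ->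
  exists (K : nat) (p : nat -> C), INR K * h <= M /\
    forall z, E z -> exists k, (k < K)%nat /\ Rabs (Re z - Re (p k)) <= h /\ Rabs (Im z - Im (p k)) <= h.

Lemma thin_union (E1 E2 : C -> Prop) (M1 M2 : R) :
  thin E1 M1 -> thin E2 M2 -> thin (fun z => E1 z \/ E2 z) (M1 + M2).
Proof.
intros H1 H2 h Hh. destruct (H1 h Hh) as [K1 [p1 [A1 B1]]], (H2 h Hh) as [K2 [p2 [A2 B2]]].
exists (K1 + K2)%nat, (fun k => if Compare_dec.lt_dec k K1 then p1 k else p2 (k - K1)%nat).
split; [rewrite plus_INR; lra|].
intros z [Hz|Hz].
- destruct (B1 z Hz) as [k [Hk H]]. exists k; split; [lia|].
  destruct Compare_dec.lt_dec; [exact H|lia].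
- destruct (B2 z Hz) as [k [Hk H]]. exists (K1 + k)%nat; split; [lia|].
  destruct Compare_dec.lt_dec; [lia|]. replace (K1 + k - K1)%nat with k by lia. exact H.
Qed.

Lemma thin_singleton (z0 : C) : thin (fun z => z = z0) 1.
Proof.
intros h Hh. exists 1%nat, (fun _ => z0). split; [simpl; lra|].
intros z ->. exists 0%nat. split; [lia|]. rewrite !Rminus_diag, Rabs_R0. lra.
Qed.

Lemma thin_sub (E E' : C -> Prop) (M : R) : (forall z, E z -> E' z) -> thin E' M -> thin E M.
Proof.
intros H1 H2 h Hh. destruct (H2 h Hh) as [K [p [A B]]]. exists K, p; split; [exact A|].
intros z Hz; apply B, H1, Hz.
Qed.

Lemma nat_above (r : R) : exists n : nat, r <= INR n.
Proof.
destruct (INR_unbounded r) as [n Hn]. exists n; lra.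
Qed.

(** With n > L / h equal parameter steps, each step moves g by at most h; since n <= L / h + 1 and h
    <= 1, the n + 1 sample points cost at most L + 2. *)
Lemma thin_curve (g : R -> C) (L : R) : 0 <= L ->
  (forall s t, 0 <= s <= 1 -> 0 <= t <= 1 -> Cmod (g s - g t) <= L * Rabs (s - t)) ->
  thin (fun z => exists t, 0 <= t <= 1 /\ g t = z) (L + 4).
Proof.
intros HL Hg h Hh.
destruct (nfloor_ex (L / h + 1)) as [n [Hn1 Hn2]].
{ assert (0 <= L / h) by (apply Rdiv_le_0_compat; lra). lra. }
assert (Hn0 : 0 <= L / h) by (apply Rdiv_le_0_compat; lra).
assert (Hnp : 0 < INR n) by lra.
exists (S n), (fun k => g (INR k / INR n)). split.
{ rewrite S_INR. replace (L + 4) with ((L / h + 4 / h) * h) by (field; lra).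
  apply Rmult_le_compat_r; [lra|].
  assert (4 <= 4 / h). { apply Rmult_le_reg_r with h; [lra|]. unfold Rdiv. rewrite Rmult_assoc, Rinv_l by lra. nra. }
  lra. }
intros z [t [Ht <-]].
destruct (nfloor_ex (t * INR n)) as [k [Hk1 Hk2]]; [nra|].
assert (Hkn : INR k <= INR n) by nra.
exists k. split; [apply INR_le in Hkn; lia|].
assert (Hkt : 0 <= INR k / INR n <= 1).
{ split; [apply Rdiv_le_0_compat; [apply pos_INR|lra]|].
  apply Rmult_le_reg_r with (INR n); [lra|]. unfold Rdiv. rewrite Rmult_assoc, Rinv_l; lra. }
assert (Hd : Rabs (t - INR k / INR n) <= / INR n).
{ apply Rabs_le. split.
  - apply Rmult_le_reg_r with (INR n); [lra|]. rewrite Rmult_minus_distr_r.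
    unfold Rdiv. rewrite Rmult_assoc, Ropp_mult_distr_l_reverse, Rinv_l by lra. lra.
  - apply Rmult_le_reg_r with (INR n); [lra|]. rewrite Rmult_minus_distr_r.
    unfold Rdiv. rewrite Rmult_assoc, Rinv_l by lra. lra. }
assert (Hle : Cmod (g t - g (INR k / INR n)) <= h).
{ eapply Rle_trans; [apply Hg; assumption|].
  assert (L * / INR n <= h).
  { apply Rmult_le_reg_r with (INR n); [lra|]. rewrite Rmult_assoc, Rinv_l by lra.
    replace L with (h * (L / h)) at 1 by (field; lra). nra. }
  nra. }
split.
- eapply Rle_trans; [|exact Hle]. apply (re_le_Cmod (g t - g (INR k / INR n)%R)%C).
- eapply Rle_trans; [|exact Hle].
  eapply Rle_trans; [|apply (Rmax_Cmod (g t - g (INR k / INR n)%R)%C)]. apply Rmax_r.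
Qed.

Lemma rect_row_bound (f : C -> C) (a h b1 b2 : R) (n : nat) : (forall z, continuous f z) ->
  Cmod (rect f a (a + INR n * h) b1 b2) <=
  bsum (fun i => Cmod (rect f (a + INR i * h) (a + INR i * h + h) b1 b2)) n.
Proof.
intros Hf. induction n as [|n IH]; cbn [bsum].
- simpl. rewrite Rmult_0_l, Rplus_0_r. unfold rect. rewrite !RInt_point.
  match goal with |- Cmod ?z <= _ => replace z with (RtoC 0) end; [rewrite Cmod_0; lra|].
  change (@zero _) with (RtoC 0). ring.
- rewrite S_INR. replace (a + (INR n + 1) * h) with (a + INR n * h + h) by ring.
  rewrite <- (rect_split_h f a (a + INR n * h)) by exact Hf.
  eapply Rle_trans; [apply Cmod_triangle|]. apply Rplus_le_compat_r, IH.
Qed.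

Lemma rect_col_bound (f : C -> C) (a1 a2 b h : R) (n : nat) : (forall z, continuous f z) ->
  Cmod (rect f a1 a2 b (b + INR n * h)) <=
  bsum (fun j => Cmod (rect f a1 a2 (b + INR j * h) (b + INR j * h + h))) n.
Proof.
intros Hf. induction n as [|n IH]; cbn [bsum].
- simpl. rewrite Rmult_0_l, Rplus_0_r. unfold rect. rewrite !RInt_point.
  match goal with |- Cmod ?z <= _ => replace z with (RtoC 0) end; [rewrite Cmod_0; lra|].
  change (@zero _) with (RtoC 0). ring.
- rewrite S_INR. replace (b + (INR n + 1) * h) with (b + INR n * h + h) by ring.
  rewrite <- (rect_split_v f a1 a2 b (b + INR n * h)) by exact Hf.
  eapply Rle_trans; [apply Cmod_triangle|]. apply Rplus_le_compat_r, IH.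
Qed.

Lemma uniform_continuity_square (f : C -> C) (a b H e : R) : (forall z, continuous f z) -> 0 < e ->
  exists d, 0 < d /\ forall s t u v, a <= s <= a + H -> b <= t <= b + H ->
    a <= u <= a + H -> b <= v <= b + H -> Rabs (u - s) < d -> Rabs (v - t) < d ->
    Cmod (f (u, v) - f (s, t)) < e.
Proof.
intros Hf He. assert (He' : 0 < e / 2) by lra.
destruct (uniform_continuity_2d (fun s t => Re (f (s, t))) a (a + H) b (b + H)) with (eps := mkposreal _ He') as [d1 H1].
{ intros s t _ _. apply continuity_2d_pt_filterlim.
  apply (filterlim_ext (fun z : R * R => Re (f z))); [intros [? ?]; reflexivity|].
  apply (continuous_Re f (s, t) (Hf (s, t))). }
destruct (uniform_continuity_2d (fun s t => Im (f (s, t))) a (a + H) b (b + H)) with (eps := mkposreal _ He') as [d2 H2].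
{ intros s t _ _. apply continuity_2d_pt_filterlim.
  apply (filterlim_ext (fun z : R * R => Im (f z))); [intros [? ?]; reflexivity|].
  apply (continuous_Im f (s, t) (Hf (s, t))). }
exists (Rmin d1 d2); split; [apply Rmin_pos; [apply d1|apply d2]|].
intros s t u v Hs Ht Hu Hv Hus Hvt.
assert (M1 := Rmin_l d1 d2). assert (M2 := Rmin_r d1 d2).
specialize (H1 s t u v Hs Ht Hu Hv ltac:(lra) ltac:(lra)).
specialize (H2 s t u v Hs Ht Hu Hv ltac:(lra) ltac:(lra)). simpl in H1, H2.
eapply Rle_lt_trans; [apply Cmod_le_abs|]. simpl. unfold Re, Im, Rminus in *. lra.
Qed.

(** The square is cut into cells of side h. A cell that misses E contributes nothing, by Goursat.
    Each of the K squares covering E touches at most 5 columns and 5 rows of cells, and a cell that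
    meets E contributes at most 4 h e by uniform continuity. With K h <= M the total is at most 100
    M e. *)
Lemma rect_thin (f : C -> C) (E : C -> Prop) (M a b H : R) : 0 < H ->
  (forall z, continuous f z) -> thin E M -> (forall z, ~ E z -> exists l, Cderiv f z l) ->
  rect f a (a + H) b (b + H) = RtoC 0.
Proof.
intros HH Hf HE Hd.
assert (HM : 0 <= M).
{ destruct (HE 1 ltac:(lra)) as [K [p [A _]]]. assert (X := pos_INR K). lra. }
assert (Hall : forall e, 0 < e -> Cmod (rect f a (a + H) b (b + H)) <= 100 * M * e).
{ intros e He. destruct (uniform_continuity_square f a b H e Hf He) as [d [Hd0 Hd1]].
  (* So large that h = H / N is below d and also at most 1, the range in which [thin] provides a
     cover. *)
  destruct (nat_above (H / d + H + 1)) as [N HN].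
  assert (HHd : 0 < H / d) by (apply Rdiv_lt_0_compat; lra).
  assert (HNp : 0 < INR N) by lra.
  set (h := H / INR N).
  assert (Hh : 0 < h) by (apply Rdiv_lt_0_compat; lra).
  assert (HhN : INR N * h = H) by (unfold h; field; lra).
  assert (Hh1 : h <= 1) by nra.
  assert (Hhd : h < d).
  { apply Rmult_lt_reg_r with (INR N); [lra|]. rewrite Rmult_comm, HhN.
    replace H with (d * (H / d)) by (field; lra). apply Rmult_lt_compat_l; lra. }
  destruct (HE h ltac:(lra)) as [K [p [HK Hp]]].
  set (ra := fun k => (Re (p k) - a) / h). set (rb := fun k => (Im (p k) - b) / h).
  set (cell := fun i j => Cmod (rect f (a + INR i * h) (a + INR i * h + h) (b + INR j * h) (b + INR j * h + h))).
  assert (Hin : forall i, (i < N)%nat -> INR i * h + h <= H).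
  { intros i Hi. assert (INR i + 1 <= INR N) by (rewrite <- S_INR; apply le_INR; lia). nra. }
  assert (Hcell : forall i j, (i < N)%nat -> (j < N)%nat ->
    cell i j <= bsum (fun k => 4 * h * e * (near (ra k) i * near (rb k) j)) K).
  { intros i j Hi Hj. unfold cell.
    assert (Hnn : forall k, 0 <= 4 * h * e * (near (ra k) i * near (rb k) j)).
    { intros k. apply Rmult_le_pos; [nra|]. apply Rmult_le_pos; apply near_nonneg. }
    assert (Xi := Hin i Hi). assert (Xj := Hin j Hj).
    assert (Pi := pos_INR i). assert (Pj := pos_INR j).
    assert (Pih : 0 <= INR i * h) by nra. assert (Pjh : 0 <= INR j * h) by nra.
    destruct (classic (exists x y, a + INR i * h <= x <= a + INR i * h + h /\
       b + INR j * h <= y <= b + INR j * h + h /\ E (x, y))) as [[x [y [Hx [Hy HExy]]]]|Hno].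
    - destruct (Hp _ HExy) as [k [Hk [K1 K2]]]. cbn [Re Im fst snd] in K1, K2.
      eapply Rle_trans; [|apply (bsum_ge_term _ K k Hnn Hk)].
      assert (Hnear : near (ra k) i = 1 /\ near (rb k) j = 1).
      { apply Rabs_le_between in K1. apply Rabs_le_between in K2. unfold near, ra, rb.
        split; destruct Rle_dec as [L|L]; try reflexivity; exfalso; apply L; apply Rabs_le.
        - replace (INR i - (Re (p k) - a) / h) with ((a + INR i * h - Re (p k)) / h) by (field; lra).
          split; [apply Rle_div_r|apply Rle_div_l]; lra.
        - replace (INR j - (Im (p k) - b) / h) with ((b + INR j * h - Im (p k)) / h) by (field; lra).
          split; [apply Rle_div_r|apply Rle_div_l]; lra. }
      destruct Hnear as [-> ->].
      set (c := f (a + INR i * h, b + INR j * h)).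
      (* A constant in affine form, so that [rect_affine] applies to it. *)
      set (g := fun w : C => (c + RtoC 0 * w)%C).
      assert (Hg : forall z, continuous g z).
      { intros z. apply continuous_Cplus; [apply continuous_const|].
        apply continuous_Cmult; [apply continuous_const|apply continuous_id]. }
      assert (domE : rect f (a + INR i * h) (a + INR i * h + h) (b + INR j * h) (b + INR j * h + h) =
        rect (fun z => f z - g z)%C (a + INR i * h) (a + INR i * h + h) (b + INR j * h) (b + INR j * h + h)).
      { rewrite rect_minus by assumption. unfold g. rewrite rect_affine. ring. }
      rewrite domE.
      replace (4 * h * e * (1 * 1)) with
        (e * (2 * ((a + INR i * h + h - (a + INR i * h)) + (b + INR j * h + h - (b + INR j * h))))) by ring.
      apply rect_bound; [|lra|lra|].
      + intros z. apply continuous_Cminus; [apply Hf|apply Hg].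
      + intros s t Hs Ht. replace (f (s, t) - g (s, t))%C with (f (s, t) - c)%C by (unfold g; ring).
        apply Rlt_le, Hd1; try lra; apply Rabs_def1; lra.
    - rewrite (goursat_square f _ _ h Hh Hf).
      + rewrite Cmod_0. rewrite <- (Rmult_0_r (INR K)), <- bsum_const. apply bsum_le; intros; apply Hnn.
      + intros x y Hx Hy. apply Hd. intros HExy. apply Hno. exists x, y; tauto. }
  assert (S1 : Cmod (rect f a (a + H) b (b + H)) <= bsum (fun i => bsum (fun j => cell i j) N) N).
  { rewrite <- HhN at 1 2. eapply Rle_trans; [apply rect_row_bound, Hf|].
    apply bsum_le; intros i Hi. apply rect_col_bound, Hf. }
  eapply Rle_trans; [exact S1|].
  eapply Rle_trans.
  { apply bsum_le; intros i Hi. apply bsum_le; intros j Hj. apply (Hcell i j Hi Hj). }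
  eapply Rle_trans.
  { apply bsum_le; intros i Hi. rewrite bsum_swap. apply Rle_refl. }
  rewrite bsum_swap.
  apply Rle_trans with (bsum (fun k => 4 * h * e * 25) K).
  - apply bsum_le; intros k Hk.
    rewrite (bsum_ext _ (fun i => (4 * h * e * bsum (near (rb k)) N) * near (ra k) i)).
    + rewrite bsum_scal. assert (Q1 := bsum_near (ra k) N). assert (Q2 := bsum_near (rb k) N).
      assert (Q3 : 0 <= bsum (near (rb k)) N).
      { rewrite <- (Rmult_0_r (INR N)), <- bsum_const. apply bsum_le; intros; apply near_nonneg. }
      assert (0 <= 4 * h * e) by nra.
      apply Rle_trans with (4 * h * e * bsum (near (rb k)) N * 5); [apply Rmult_le_compat_l; [nra|lra]|].
      rewrite Rmult_assoc. apply Rmult_le_compat_l; nra.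
    + intros i. rewrite (bsum_ext _ (fun j => (4 * h * e * near (ra k) i) * near (rb k) j)) by (intros; ring).
      rewrite bsum_scal. ring.
  - rewrite bsum_const. nra. }
apply Cmod_eq_0. apply Rle_antisym; [|apply Cmod_ge_0].
apply le_epsilon. intros e He. rewrite Rplus_0_l.
eapply Rle_trans; [apply (Hall (e / (100 * M + 1)))|].
- apply Rdiv_lt_0_compat; nra.
- replace e with ((100 * M + 1) * (e / (100 * M + 1))) at 2 by (field; nra).
  apply Rmult_le_compat_r; [|lra]. apply Rlt_le, Rdiv_lt_0_compat; nra.
Qed.

(** * Rules for the complex derivative *)

Lemma Cminus_neq_0 (a b : C) : a <> b -> (a - b)%C <> RtoC 0.
Proof. intros H E; apply H. replace a with (a - b + b)%C by ring. rewrite E; ring. Qed.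

(** Caratheodory's form of the derivative: the slope extends continuously to z. Products, inverses
    and parameter integrals then reduce to algebra on slopes. *)
Lemma Cderiv_slope (f : C -> C) (z l : C) : Cderiv f z l <->
  exists phi : C -> C, continuous phi z /\ phi z = l /\
    locally z (fun w => f w - f z = phi w * (w - z))%C.
Proof.
split.
- intros H. exists (fun w => if Ceq_dec w z then l else ((f w - f z) / (w - z))%C).
  assert (Ez : (if Ceq_dec z z then l else ((f z - f z) / (z - z))%C) = l)
    by (destruct (Ceq_dec z z); [reflexivity|tauto]).
  repeat split.
  + apply continuous_Cmod. intros e He. rewrite Ez. destruct (H (e / 2) ltac:(lra)) as [d [Hd H']].
    exists d; split; [exact Hd|]. intros w Hw. destruct (Ceq_dec w z) as [->|Hn].
    * replace (l - l)%C with (RtoC 0) by ring. rewrite Cmod_0; exact He.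
    * specialize (H' w Hw). assert (Hn' := Cminus_neq_0 w z Hn).
      replace ((f w - f z) / (w - z) - l)%C with ((f w - f z - l * (w - z)) / (w - z))%C by (field; exact Hn').
      assert (Hp := proj1 (Cmod_gt_0 _) Hn').
      rewrite Cmod_div by exact Hn'. apply Rle_lt_trans with (e / 2); [|lra].
      apply Rle_div_l; lra.
  + exact Ez.
  + apply locally_Cmod. exists 1; split; [lra|]. intros w _. destruct (Ceq_dec w z) as [->|Hn]; [ring|].
    field. apply Cminus_neq_0, Hn.
- intros [phi [Hc [<- Hl]]] e He.
  apply locally_Cmod in Hl. destruct Hl as [d1 [Hd1 H1]].
  destruct (proj1 (continuous_Cmod phi z) Hc e He) as [d2 [Hd2 H2]].
  exists (Rmin d1 d2); split; [apply Rmin_pos; lra|]. intros w Hw.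
  assert (M1 := Rmin_l d1 d2). assert (M2 := Rmin_r d1 d2).
  rewrite H1 by lra. replace (phi w * (w - z) - phi z * (w - z))%C with ((phi w - phi z) * (w - z))%C by ring.
  rewrite Cmod_mult. apply Rmult_le_compat_r; [apply Cmod_ge_0|]. apply Rlt_le, H2; lra.
Qed.

Lemma Cderiv_const (c z : C) : Cderiv (fun _ => c) z (RtoC 0).
Proof.
apply Cderiv_slope. exists (fun _ => RtoC 0). repeat split; [apply continuous_const|].
apply filter_forall; intros; ring.
Qed.
Lemma Cderiv_id (z : C) : Cderiv (fun w => w) z (RtoC 1).
Proof.
apply Cderiv_slope. exists (fun _ => RtoC 1). repeat split; [apply continuous_const|].
apply filter_forall; intros; ring.
Qed.
Lemma Cderiv_plus (f g : C -> C) (z l l' : C) :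
  Cderiv f z l -> Cderiv g z l' -> Cderiv (fun w => f w + g w)%C z (l + l')%C.
Proof.
rewrite !Cderiv_slope. intros [p [P1 [<- P3]]] [q [Q1 [<- Q3]]].
exists (fun w => p w + q w)%C. repeat split; [apply continuous_Cplus; assumption|].
generalize (filter_and _ _ P3 Q3). apply filter_imp. intros w [Ep Eq].
replace (f w + g w - (f z + g z))%C with ((f w - f z) + (g w - g z))%C by ring.
rewrite Ep, Eq. ring.
Qed.
Lemma Cderiv_mult (f g : C -> C) (z l l' : C) :
  Cderiv f z l -> Cderiv g z l' -> Cderiv (fun w => f w * g w)%C z (l * g z + f z * l')%C.
Proof.
intros Hf Hg. assert (Cg := Cderiv_continuous _ _ _ Hg). revert Hf Hg.
rewrite !Cderiv_slope. intros [p [P1 [<- P3]]] [q [Q1 [<- Q3]]].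
exists (fun w => p w * g w + f z * q w)%C. repeat split.
- apply continuous_Cplus; apply continuous_Cmult; try assumption. apply continuous_const.
- generalize (filter_and _ _ P3 Q3). apply filter_imp. intros w [Ep Eq].
  replace (f w * g w - f z * g z)%C with ((f w - f z) * g w + f z * (g w - g z))%C by ring.
  rewrite Ep, Eq. ring.
Qed.
Lemma Cderiv_opp (f : C -> C) (z l : C) : Cderiv f z l -> Cderiv (fun w => - f w)%C z (- l)%C.
Proof.
rewrite !Cderiv_slope. intros [p [P1 [<- P3]]].
exists (fun w => - p w)%C. repeat split; [apply continuous_Copp; assumption|].
revert P3. apply filter_imp. intros w Ep.
replace (- f w - - f z)%C with (- (f w - f z))%C by ring. rewrite Ep. ring.
Qed.
Lemma Cderiv_minus (f g : C -> C) (z l l' : C) :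
  Cderiv f z l -> Cderiv g z l' -> Cderiv (fun w => f w - g w)%C z (l - l')%C.
Proof. intros; apply Cderiv_plus; [|apply Cderiv_opp]; assumption. Qed.

Lemma continuous_neq_0_locally (f : C -> C) (z : C) :
  continuous f z -> f z <> RtoC 0 -> locally z (fun w => f w <> RtoC 0).
Proof.
intros Hc Hn. apply locally_Cmod.
destruct (proj1 (continuous_Cmod f z) Hc (Cmod (f z)) (proj1 (Cmod_gt_0 _) Hn)) as [d [Hd H]].
exists d; split; [exact Hd|]. intros w Hw E. specialize (H w Hw). rewrite E in H.
replace (RtoC 0 - f z)%C with (- f z)%C in H by ring. rewrite Cmod_opp in H. lra.
Qed.

Lemma Cderiv_inv (f : C -> C) (z l : C) : Cderiv f z l -> f z <> RtoC 0 ->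
  Cderiv (fun w => / f w)%C z (- l / (f z * f z))%C.
Proof.
intros Hf Hn. assert (Cf := Cderiv_continuous _ _ _ Hf). revert Hf.
assert (Hl := continuous_neq_0_locally f z Cf Hn).
rewrite !Cderiv_slope. intros [p [P1 [<- P3]]].
exists (fun w => - p w / (f w * f z))%C. repeat split.
- apply continuous_Cdiv.
  + apply continuous_Copp, P1.
  + apply continuous_Cmult; [exact Cf|apply continuous_const].
  + apply Cmult_neq_0; exact Hn.
- generalize (filter_and _ _ Hl P3). apply filter_imp. intros w [Hw Ep].
  replace (/ f w - / f z)%C with (- (f w - f z) / (f w * f z))%C by (field; split; assumption).
  rewrite Ep. field; split; assumption.
Qed.

Lemma Cderiv_ext_loc (f g : C -> C) (z l : C) :
  locally z (fun w => f w = g w) -> Cderiv f z l -> Cderiv g z l.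
Proof.
intros Hl. assert (Ez : f z = g z) by exact (locally_singleton _ _ Hl).
rewrite !Cderiv_slope. intros [p [P1 [<- P3]]].
exists p. repeat split; [exact P1|].
generalize (filter_and _ _ Hl P3). apply filter_imp. intros w [E Ep]. rewrite <- E, <- Ez. exact Ep.
Qed.

Lemma locally_neq (z z0 : C) : z <> z0 -> locally z (fun w => w <> z0).
Proof.
intros H. apply locally_Cmod. assert (Hp := proj1 (Cmod_gt_0 _) (Cminus_neq_0 z z0 H)).
exists (Cmod (z - z0)); split; [exact Hp|]. intros w Hw ->.
replace (z0 - z)%C with (- (z - z0))%C in Hw by ring. rewrite Cmod_opp in Hw. lra.
Qed.

Lemma CInt_shift (f : R -> C) (v a b : R) : ex_CInt f (a + v) (b + v) ->
  CInt (fun s => f (s + v)) a b = CInt f (a + v) (b + v).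
Proof.
intros H. generalize (RInt_comp_lin (V := C_R_CompleteNormedModule) f 1 v a b).
rewrite !Rmult_1_l. intros E. rewrite <- (E H). apply RInt_ext. intros s _.
rewrite Rmult_1_l. symmetry. exact (scal_one (V := C_R_NormedModule) _).
Qed.

(** With all four sides over the common parameter interval [-L, L], the contributions of 1 / (w -
    z0) in [thin_liouville] combine into one positive kernel. *)
Lemma rect_centered (f : C -> C) (x0 y0 L : R) : (forall z, continuous f z) ->
  rect f (x0 - L) (x0 + L) (y0 - L) (y0 + L) =
  CInt (fun s => f (s + x0, y0 - L)%R + Ci * f (x0 + L, s + y0)%R - f (s + x0, y0 + L)%R
         - Ci * f (x0 - L, s + y0)%R)%C (- L) L.
Proof.
intros Hf. symmetry. apply CInt_unique. unfold rect.
replace (x0 - L) with (- L + x0) by ring. replace (x0 + L) with (L + x0) by ring.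
replace (y0 - L) with (- L + y0) by ring. replace (y0 + L) with (L + y0) by ring.
assert (Hh : forall b, is_CInt (fun s => f (s + x0, b)) (- L) L (CInt (fun s => f (s, b)) (- L + x0) (L + x0))).
{ intros b. rewrite <- (CInt_shift (fun s => f (s, b))) by (apply ex_hline, Hf). apply CInt_correct.
  apply (ex_RInt_continuous (V := C_R_CompleteNormedModule)). intros s _.
  apply (continuous_comp (fun s => s + x0) (fun s => f (s, b))); [|apply continuous_hline, Hf].
  apply continuous_Rplus; [apply continuous_id|apply continuous_const]. }
assert (Hv : forall a, is_CInt (fun s => Ci * f (a, s + y0)%R)%C (- L) L (Ci * CInt (fun s => f (a, s)) (- L + y0) (L + y0))%C).
{ intros a. apply is_CInt_scal. rewrite <- (CInt_shift (fun s => f (a, s))) by (apply ex_vline, Hf). apply CInt_correct.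
  apply (ex_RInt_continuous (V := C_R_CompleteNormedModule)). intros s _.
  apply (continuous_comp (fun s => s + y0) (fun s => f (a, s))); [|apply continuous_vline, Hf].
  apply continuous_Rplus; [apply continuous_id|apply continuous_const]. }
apply is_CInt_minus; [|apply Hv]. apply is_CInt_minus; [|apply Hh]. apply is_CInt_plus; [apply Hh|apply Hv].
Qed.

(** The difference quotient h at z0, completed by l, is continuous and differentiable off E and z0,
    so its integral over the boundary of the square of half-side L about z0 vanishes. Hence D z0
    times the integral of 1 / (w - z0) equals the integral of D w / (w - z0). On the boundary |D w|
    <= 2 M / L and |w - z0| >= L, which makes the latter at most 16 M / L. *)
Lemma thin_liouville (D : C -> C) (E : C -> Prop) (M0 M r : R) : thin E M0 -> 0 < r ->
  (forall z, continuous D z) -> (forall z, ~ E z -> exists l, Cderiv D z l) ->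
  (forall z, r < Cmod z -> Cmod (D z) <= M / Cmod z) ->
  forall z, ~ E z -> D z = RtoC 0.
Proof.
intros HE Hr Hc Hd HM z0 Hz0. destruct (Hd z0 Hz0) as [l Hl].
assert (HM0 : 0 <= M).
{ assert (Hx : r < Cmod (RtoC (r + 1))) by (rewrite Cmod_R, Rabs_pos_eq; lra).
  assert (X := HM _ Hx). assert (Y := Cmod_ge_0 (D (RtoC (r + 1)))).
  apply Rnot_lt_le; intros Hneg. assert (M / Cmod (RtoC (r + 1)) < 0); [|lra].
  apply Rdiv_neg_pos; lra. }
set (h := fun w => if Ceq_dec w z0 then l else ((D w - D z0) / (w - z0))%C).
assert (Hq : forall w, w <> z0 -> locally w (fun v => ((D v - D z0) / (v - z0))%C = h v)).
{ intros w Hw. generalize (locally_neq w z0 Hw). apply filter_imp. intros v Hv. unfold h.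
  destruct (Ceq_dec v z0); [tauto|reflexivity]. }
assert (Hhc : forall z, continuous h z).
{ intros z. destruct (Ceq_dec z z0) as [->|Hz].
  - apply continuous_Cmod. intros e He. destruct (Hl (e / 2) ltac:(lra)) as [d [Hd0 Hd1]].
    exists d; split; [exact Hd0|]. intros w Hw. unfold h. destruct (Ceq_dec z0 z0); [|tauto].
    destruct (Ceq_dec w z0) as [->|Hn].
    + replace (l - l)%C with (RtoC 0) by ring. rewrite Cmod_0; exact He.
    + specialize (Hd1 w Hw). assert (Hn' := Cminus_neq_0 w z0 Hn).
      replace ((D w - D z0) / (w - z0) - l)%C with ((D w - D z0 - l * (w - z0)) / (w - z0))%C by (field; exact Hn').
      assert (Hp := proj1 (Cmod_gt_0 _) Hn').
      rewrite Cmod_div by exact Hn'. apply Rle_lt_trans with (e / 2); [|lra]. apply Rle_div_l; lra.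
  - eapply continuous_ext_loc; [apply (Hq z Hz)|].
    apply continuous_Cdiv; [| |apply Cminus_neq_0, Hz].
    + apply (continuous_Cminus D); [apply Hc|apply continuous_const].
    + apply (continuous_Cminus (fun w => w)); [apply continuous_id|apply continuous_const]. }
assert (Hhd : forall z, ~ (E z \/ z = z0) -> exists l, Cderiv h z l).
{ intros z Hz. apply not_or_and in Hz. destruct Hz as [Hz1 Hz2]. destruct (Hd z Hz1) as [l' Hl'].
  eexists. eapply Cderiv_ext_loc; [apply (Hq z Hz2)|].
  apply Cderiv_mult; [apply Cderiv_minus; [exact Hl'|apply Cderiv_const]|].
  apply Cderiv_inv; [apply Cderiv_minus; [apply Cderiv_id|apply Cderiv_const]|apply Cminus_neq_0, Hz2]. }
assert (Hall : forall L, 2 * Cmod z0 + 2 * r < L -> Cmod (D z0) * 4 <= 16 * M / L).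
{ intros L HL. assert (Hz0p := Cmod_ge_0 z0). assert (HLp : 0 < L) by lra.
  assert (Ez0 : exists x0 y0, z0 = (x0, y0)) by (exists (fst z0), (snd z0); destruct z0; reflexivity).
  destruct Ez0 as [x0 [y0 Ez0]].
  assert (R0 := rect_thin h _ _ (x0 - L) (y0 - L) (2 * L) ltac:(lra) Hhc
                 (thin_union _ _ _ _ HE (thin_singleton z0)) Hhd).
  replace (x0 - L + 2 * L) with (x0 + L) in R0 by ring.
  replace (y0 - L + 2 * L) with (y0 + L) in R0 by ring.
  rewrite rect_centered in R0 by exact Hhc.
  set (I := fun s => (h (s + x0, y0 - L)%R + Ci * h (x0 + L, s + y0)%R - h (s + x0, y0 + L)%R
         - Ci * h (x0 - L, s + y0)%R)%C) in R0.
  assert (HcI : forall s, continuous I s).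
  { assert (P1 : forall b s, continuous (fun s => h (s + x0, b)) s).
    { intros b s. apply (continuous_comp (fun s => s + x0) (fun s => h (s, b))); [|apply continuous_hline, Hhc].
      apply continuous_Rplus; [apply continuous_id|apply continuous_const]. }
    assert (P2 : forall a s, continuous (fun s => Ci * h (a, s + y0)%R)%C s).
    { intros a s. apply continuous_Cmult; [apply continuous_const|].
      apply (continuous_comp (fun s => s + y0) (fun s => h (a, s))); [|apply continuous_vline, Hhc].
      apply continuous_Rplus; [apply continuous_id|apply continuous_const]. }
    intros s. unfold I. apply continuous_Cminus; [|apply P2]. apply continuous_Cminus; [|apply P1].
    apply continuous_Cplus; [apply P1|apply P2]. }
  assert (HsL : forall s, 0 < s ^ 2 + L ^ 2) by (intros s; assert (0 < L ^ 2) by (apply pow_lt; lra); assert (0 <= s ^ 2) by apply pow2_ge_0; lra).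
  (* The oriented sum of 1 / (w - z0) over the four sides, divided by i. The exact integral is 2 pi;
     the lower bound 4, from k >= 2 / L, suffices. *)
  set (k := fun s : R => 4 * L / (s ^ 2 + L ^ 2)).
  assert (Hck : forall s, continuous k s).
  { intros s. apply continuous_Rdiv; [apply continuous_const| |apply Rgt_not_eq, HsL].
    apply (ex_derive_continuous (fun s => s ^ 2 + L ^ 2)). auto_derive. exact Logic.I. }
  assert (Hexk : ex_RInt k (- L) L) by (apply (ex_RInt_continuous (V := R_CompleteNormedModule)); intros; apply Hck).
  set (G := fun s => (I s + (D z0 * Ci) * RtoC (k s))%C).
  assert (HexI : ex_CInt I (- L) L) by (apply ex_CInt_continuous; [lra|intros; apply HcI]).
  assert (HexK : ex_CInt (fun s => RtoC (k s)) (- L) L).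
  { apply ex_CInt_continuous; [lra|]. intros. apply continuous_RtoC, Hck. }
  assert (HexG : ex_CInt G (- L) L) by (apply ex_CInt_plus; [exact HexI|apply ex_CInt_scal, HexK]).
  assert (EG : CInt G (- L) L = (D z0 * Ci * RtoC (RInt k (- L) L))%C).
  { unfold G. rewrite CInt_plus, CInt_scal, R0, CInt_RtoC; try assumption; [eq_in C; ring|apply ex_CInt_scal, HexK]. }
  assert (Hk4 : 4 <= RInt k (- L) L).
  { replace 4 with (RInt (fun _ => 2 / L) (- L) L) by (rewrite RInt_const; unfold scal; simpl; unfold mult; simpl; field; lra).
    apply RInt_le; [lra|apply ex_RInt_const|exact Hexk|]. intros s Hs. unfold k.
    apply (Rle_div_r (2 / L) (4 * L) (s ^ 2 + L ^ 2)); [apply HsL|].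
    assert (s ^ 2 <= L ^ 2) by nra.
    apply Rle_trans with (2 / L * (L ^ 2 + L ^ 2)); [apply Rmult_le_compat_l|apply Req_le; field; lra].
    - apply Rlt_le, Rdiv_lt_0_compat; lra.
    - lra. }
  assert (HG : forall s, - L <= s <= L -> Cmod (G s) <= 8 * M / L ^ 2).
  { intros s Hs.
    assert (Hbd : forall w, L <= Cmod (w - z0) -> Cmod (D w / (w - z0)) <= 2 * M / L ^ 2).
    { intros w Hw. assert (Hw0 : (w - z0)%C <> RtoC 0) by (apply Cmod_gt_0; lra).
      rewrite Cmod_div by exact Hw0.
      assert (Hw1 : L / 2 <= Cmod w).
      { assert (T := Cmod_triangle w (- z0)%C). rewrite Cmod_opp in T. unfold Cminus in Hw. lra. }
      assert (HDw : Cmod (D w) <= 2 * M / L).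
      { eapply Rle_trans; [apply HM; lra|]. apply Rle_div_l; [lra|].
        replace M with (2 * M / L * (L / 2)) at 1 by (field; lra).
        apply Rmult_le_compat_l; [|lra]. apply Rdiv_le_0_compat; lra. }
      replace (2 * M / L ^ 2) with (2 * M / L / L) by (field; lra).
      apply Rmult_le_compat; [apply Cmod_ge_0| |exact HDw|].
      - apply Rlt_le, Rinv_0_lt_compat; lra.
      - apply Rinv_le_contravar; lra. }
    assert (HLC : forall a b : R, (a = L \/ a = - L \/ b = L \/ b = - L) -> L <= Cmod (a, b)).
    { intros a b Hab. eapply Rle_trans; [|apply Rmax_Cmod]. simpl.
      assert (Q1 := Rmax_l (Rabs a) (Rabs b)). assert (Q2 := Rmax_r (Rabs a) (Rabs b)).
      assert (A1 : Rabs L = L) by (apply Rabs_pos_eq; lra).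
      assert (A2 : Rabs (- L) = L) by (rewrite Rabs_Ropp; exact A1).
      destruct Hab as [->|[->|[->| ->]]]; lra. }
    assert (Hdiff : forall a b : R, ((a + x0, b + y0)%R - z0)%C = (a, b)).
    { intros a b. rewrite Ez0. apply injective_projections; simpl; eq_in R; ring. }
    assert (Hside : forall a b : R, (a = L \/ a = - L \/ b = L \/ b = - L) ->
      h (a + x0, b + y0)%R = ((D (a + x0, b + y0)%R - D z0) / (a, b))%C /\
      (a, b) <> RtoC 0 /\ Cmod (D (a + x0, b + y0)%R / (a, b)) <= 2 * M / L ^ 2).
    { intros a b Hab. assert (X := HLC a b Hab). assert (Xn : (a, b) <> RtoC 0) by (apply Cmod_gt_0; lra).
      assert (E1 := Hdiff a b). split; [|split; [exact Xn|]].
      - unfold h. destruct (Ceq_dec (a + x0, b + y0)%R z0) as [Q|Q].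
        + exfalso. apply Xn. rewrite <- E1, Q. eq_in C; ring.
        + rewrite E1. reflexivity.
      - rewrite <- E1. apply Hbd. rewrite E1. exact X. }
    destruct (Hside s (- L) ltac:(tauto)) as [A1 [A2 A3]].
    destruct (Hside L s ltac:(tauto)) as [B1 [B2 B3]].
    destruct (Hside s L ltac:(tauto)) as [C1 [C2 C3]].
    destruct (Hside (- L) s ltac:(tauto)) as [D1 [D2 D3]].
    replace (- L + y0) with (y0 - L) in * by ring. replace (L + x0) with (x0 + L) in * by ring.
    replace (L + y0) with (y0 + L) in * by ring. replace (- L + x0) with (x0 - L) in * by ring.
    assert (EGs : G s = (D (s + x0, y0 - L)%R / (s, (- L)%R) + Ci * (D (x0 + L, s + y0)%R / (L, s))
       + - (D (s + x0, y0 + L)%R / (s, L)) + - (Ci * (D ((x0 - L)%R, (s + y0)%R) / ((- L)%R, s))))%C).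
    { unfold G, I, k. rewrite A1, B1, C1, D1.
      assert (Ek : (RtoC (4 * L / (s ^ 2 + L ^ 2)) * Ci = / (s, (- L)%R) + Ci / (L, s) - / (s, L) - Ci / ((- L)%R, s))%C).
      { assert (Q := HsL s). apply injective_projections; simpl; field; repeat split; nra. }
      transitivity ((D (s + x0, y0 - L)%R - D z0) / (s, (- L)%R) + Ci * ((D (x0 + L, s + y0)%R - D z0) / (L, s)) -
        (D (s + x0, y0 + L)%R - D z0) / (s, L) - Ci * ((D ((x0 - L)%R, (s + y0)%R) - D z0) / ((- L)%R, s)) +
         D z0 * (RtoC (4 * L / (s ^ 2 + L ^ 2)) * Ci))%C; [eq_in C; ring|].
      rewrite Ek. unfold Cdiv. eq_in C; ring. }
    rewrite EGs. 
    eapply Rle_trans; [apply Cmod_triangle|].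
    eapply Rle_trans; [apply Rplus_le_compat_r, Cmod_triangle|].
    eapply Rle_trans; [apply Rplus_le_compat_r, Rplus_le_compat_r, Cmod_triangle|].
    rewrite !Cmod_opp, !(Cmod_mult Ci), Cmod_Ci, !Rmult_1_l. 
    replace (8 * M / L ^ 2) with (2 * M / L ^ 2 + 2 * M / L ^ 2 + 2 * M / L ^ 2 + 2 * M / L ^ 2) by (field; lra).
    lra. }
  assert (Hfin := CInt_bound G (- L) L _ ltac:(lra) HexG HG).
  rewrite EG, !Cmod_mult, Cmod_Ci, Cmod_R, Rabs_pos_eq in Hfin by lra.
  replace ((L - - L) * (8 * M / L ^ 2)) with (16 * M / L) in Hfin by (field; lra).
  assert (Q := Cmod_ge_0 (D z0)). nra. }
apply Cmod_eq_0. apply Rle_antisym; [|apply Cmod_ge_0].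
apply le_epsilon. intros e He. rewrite Rplus_0_l.
assert (Hz0p := Cmod_ge_0 z0).
set (L := 2 * Cmod z0 + 2 * r + 1 + 4 * M / e).
assert (Q : 0 <= 4 * M / e) by (apply Rdiv_le_0_compat; lra).
assert (X := Hall L ltac:(unfold L; lra)).
assert (HLp : 0 < L) by (unfold L; lra).
assert (16 * M / L <= 4 * e); [|lra]. apply Rle_div_l; [lra|].
replace (16 * M) with (4 * e * (4 * M / e)) by (field; lra).
apply Rmult_le_compat_l; [lra|]. unfold L; lra.
Qed.

(** * Smooth loops *)

Lemma loop_derive (g : R -> C) (t : R) : smooth_loop g ->
  is_derive (fun s => Re (g s)) t (Re (loop_derivative g t)) /\
  is_derive (fun s => Im (g s)) t (Im (loop_derivative g t)).
Proof.
intros [H _]. destruct (H 1%nat t) as [H1 H2]. split; apply Derive_correct; assumption.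
Qed.

Lemma loop_continuous (g : R -> C) (t : R) : smooth_loop g -> continuous g t.
Proof.
intros Hg. destruct (loop_derive g t Hg) as [H1 H2].
apply continuous_C; apply (ex_derive_continuous (V := R_NormedModule)); eexists; eassumption.
Qed.

Lemma loop_derivative_continuous (g : R -> C) (t : R) : smooth_loop g -> continuous (loop_derivative g) t.
Proof.
intros [H _]. destruct (H 2%nat t) as [H1 H2].
apply continuous_C; apply (ex_derive_continuous (V := R_NormedModule)); assumption.
Qed.

Lemma loop_period (g : R -> C) (t : R) (k : Z) : smooth_loop g -> g (t + IZR k) = g t.
Proof.
intros [_ [_ [H _]]].
assert (Hn : forall n t, g (t + INR n) = g t).
{ induction n as [|n IH]; intros s; [simpl; f_equal; ring|].
  rewrite S_INR, <- Rplus_assoc, H. apply IH. }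
destruct (Z_le_gt_dec 0 k) as [Hk|Hk].
- rewrite <- (Z2Nat.id k Hk), <- INR_IZR_INZ. apply Hn.
- rewrite <- (Hn (Z.to_nat (- k)) (t + IZR k)). f_equal. rewrite INR_IZR_INZ, Z2Nat.id, opp_IZR by lia. ring.
Qed.

Lemma loop_derivative_period (g : R -> C) (t : R) (k : Z) : smooth_loop g ->
  loop_derivative g (t + IZR k) = loop_derivative g t.
Proof.
intros Hg. unfold loop_derivative.
f_equal.
- rewrite (Derive_ext (fun s => Re (g s)) (fun s => Re (g (s + IZR (- k)))))
    by (intros s; rewrite loop_period; [reflexivity|exact Hg]).
  apply is_derive_unique. destruct (loop_derive g t Hg) as [H1 H2].
  replace (Derive _ t) with (1 * Re (loop_derivative g t)) by (simpl; ring).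
  apply (is_derive_comp (fun s => Re (g s)) (fun s => s + IZR (- k))).
  + replace (t + IZR k + IZR (- k)) with t by (rewrite opp_IZR; ring). exact H1.
  + auto_derive; [exact I|ring].
- rewrite (Derive_ext (fun s => Im (g s)) (fun s => Im (g (s + IZR (- k)))))
    by (intros s; rewrite loop_period; [reflexivity|exact Hg]).
  apply is_derive_unique. destruct (loop_derive g t Hg) as [H1 H2].
  replace (Derive _ t) with (1 * Im (loop_derivative g t)) by (simpl; ring).
  apply (is_derive_comp (fun s => Im (g s)) (fun s => s + IZR (- k))).
  + replace (t + IZR k + IZR (- k)) with t by (rewrite opp_IZR; ring). exact H2.
  + auto_derive; [exact I|ring].
Qed.

Lemma shift_into (a t : R) : exists k : Z, a <= t + IZR k < a + 1.
Proof.
exists (- Int_part (t - a))%Z. rewrite opp_IZR. assert (H := base_Int_part (t - a)). lra.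
Qed.

(** Injectivity is given on [0, 1). Both parameters are shifted there by integers, and the
    difference of s and t becomes an integer of modulus below 1. *)
Lemma loop_simple (g : R -> C) (s t : R) : smooth_loop g -> Rabs (s - t) < 1 -> g s = g t -> s = t.
Proof.
intros Hg Hst E. destruct (shift_into 0 s) as [k Hk], (shift_into 0 t) as [l Hl].
assert (E' : s + IZR k = t + IZR l).
{ apply Hg; try lra. rewrite !loop_period by exact Hg. exact E. }
assert (Es : s - t = IZR (l - k)) by (rewrite minus_IZR; lra).
rewrite Es in Hst. apply Rabs_def2 in Hst. destruct Hst as [A B].
apply lt_IZR in A. apply (lt_IZR (-1)) in B. assert (l - k = 0)%Z by lia. rewrite H in Es. lra.
Qed.

Lemma continuous_Cmod_comp (h : R -> C) (t : R) : continuous h t -> continuous (fun s => Cmod (h s)) t.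
Proof.
intros H. unfold Cmod. apply (continuous_comp _ sqrt); [|apply continuous_sqrt].
apply continuous_ext with (fun s => Re (h s) * Re (h s) + Im (h s) * Im (h s)).
- intros s. eq_in R. unfold Re, Im. ring.
- assert (H1 := continuous_Re h t H). assert (H2 := continuous_Im h t H).
  apply continuous_Rplus; apply continuous_Rmult; assumption.
Qed.

Lemma Cmod_min (h : R -> C) (a b : R) : a <= b -> (forall t, a <= t <= b -> continuous h t) ->
  (forall t, a <= t <= b -> h t <> RtoC 0) -> exists d, 0 < d /\ forall t, a <= t <= b -> d <= Cmod (h t).
Proof.
intros Hab Hc Hn.
destruct (continuity_ab_min (fun s => Cmod (h s)) a b Hab) as [m [Hm1 Hm2]].
- intros t Ht. apply continuity_pt_filterlim. apply continuous_Cmod_comp, Hc, Ht.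
- exists (Cmod (h m)); split; [apply Cmod_gt_0, Hn, Hm2|exact Hm1].
Qed.

Lemma Cmod_max (h : R -> C) (a b : R) : a <= b -> (forall t, a <= t <= b -> continuous h t) ->
  exists d, 0 < d /\ forall t, a <= t <= b -> Cmod (h t) <= d.
Proof.
intros Hab Hc.
destruct (continuity_ab_maj (fun s => Cmod (h s)) a b Hab) as [m [Hm1 Hm2]].
- intros t Ht. apply continuity_pt_filterlim. apply continuous_Cmod_comp, Hc, Ht.
- exists (Cmod (h m) + 1); split; [assert (X := Cmod_ge_0 (h m)); lra|]. intros t Ht. specialize (Hm1 t Ht). lra.
Qed.

Lemma loop_bound (g : R -> C) : smooth_loop g ->
  exists B, 0 < B /\ forall t, Cmod (loop_derivative g t) <= B /\ Cmod (g t) <= B.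
Proof.
intros Hg.
destruct (Cmod_max (loop_derivative g) 0 1 ltac:(lra)) as [B1 [P1 H1]].
{ intros; apply loop_derivative_continuous, Hg. }
destruct (Cmod_max g 0 1 ltac:(lra)) as [B2 [P2 H2]].
{ intros; apply loop_continuous, Hg. }
exists (B1 + B2); split; [lra|]. intros t. destruct (shift_into 0 t) as [k Hk].
rewrite <- (loop_period g t k Hg), <- (loop_derivative_period g t k Hg).
split; [specialize (H1 (t + IZR k) ltac:(lra))|specialize (H2 (t + IZR k) ltac:(lra))]; lra.
Qed.

Lemma loop_dist (g : R -> C) (p : C) : smooth_loop g -> ~ on_loop g p ->
  exists d, 0 < d /\ forall t, d <= Cmod (g t - p).
Proof.
intros Hg Hp. destruct (Cmod_min (fun t => g t - p)%C 0 1 ltac:(lra)) as [d [Hd H]].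
- intros; apply continuous_Cminus; [apply loop_continuous, Hg|apply continuous_const].
- intros t _ E. apply Hp. exists t. replace (g t) with (g t - p + p)%C by ring. rewrite E; ring.
- exists d; split; [exact Hd|]. intros t. destruct (shift_into 0 t) as [k Hk].
  rewrite <- (loop_period g t k Hg). apply H; lra.
Qed.

Lemma Cmod_ge_diff (a b : C) : Cmod a - Cmod b <= Cmod (a - b).
Proof.
assert (H := Cmod_triangle (a - b)%C b). replace (a - b + b)%C with a in H by ring. lra.
Qed.

Lemma loop_dist_near (g : R -> C) (p z : C) (d t : R) : (forall t, d <= Cmod (g t - p)) ->
  Cmod (z - p) <= d / 2 -> d / 2 <= Cmod (g t - z).
Proof.
intros H Hz. specialize (H t). assert (X := Cmod_ge_diff (g t - p)%C (z - p)%C).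
replace (g t - p - (z - p))%C with (g t - z)%C in X by ring. lra.
Qed.

Lemma winding_integrand_continuous (g : R -> C) (z : C) (t : R) : smooth_loop g -> ~ on_loop g z ->
  continuous (fun t => loop_derivative g t / (g t - z))%C t.
Proof.
intros Hg Hz. apply continuous_Cdiv.
- apply loop_derivative_continuous, Hg.
- apply continuous_Cminus; [apply loop_continuous, Hg|apply continuous_const].
- intros E. apply Hz. exists t. replace (g t) with (g t - z + z)%C by ring. rewrite E; ring.
Qed.

Lemma two_pi_i_neq_0 : (RtoC (2 * PI) * Ci)%C <> RtoC 0.
Proof.
assert (H := PI_RGT_0). intros E. assert (E' := f_equal Im E). simpl in E'. lra.
Qed.

Lemma winding_diff (g : R -> C) (z p : C) : smooth_loop g -> ~ on_loop g z -> ~ on_loop g p ->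
  (winding g z - winding g p)%C = (/ (RtoC (2 * PI) * Ci) *
    CInt (fun t => loop_derivative g t * (z - p) / ((g t - z) * (g t - p))) 0 1)%C.
Proof.
intros Hg Hz Hp. unfold winding.
assert (Ez : ex_CInt (fun t => loop_derivative g t / (g t - z))%C 0 1)
  by (apply ex_CInt_continuous; [lra|]; intros; apply winding_integrand_continuous; assumption).
assert (Ep : ex_CInt (fun t => loop_derivative g t / (g t - p))%C 0 1)
  by (apply ex_CInt_continuous; [lra|]; intros; apply winding_integrand_continuous; assumption).
rewrite (CInt_ext (fun t => loop_derivative g t * (z - p) / ((g t - z) * (g t - p)))%C
  (fun t => loop_derivative g t / (g t - z) - loop_derivative g t / (g t - p))%C); [|lra|].
- rewrite CInt_minus by assumption. ring.
- intros t _. field. split; apply Cminus_neq_0; intros E.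
  + apply Hp; exists t; exact E.
  + apply Hz; exists t; exact E.
Qed.

Lemma winding_close (g : R -> C) (p : C) : smooth_loop g -> ~ on_loop g p ->
  exists d K, 0 < d /\ 0 < K /\ forall z, Cmod (z - p) <= d -> ~ on_loop g z /\
    Cmod (winding g z - winding g p) <= K * Cmod (z - p).
Proof.
intros Hg Hp. destruct (loop_dist g p Hg Hp) as [d [Hd H]]. destruct (loop_bound g Hg) as [B [HB HB']].
assert (Hpi := proj1 (Cmod_gt_0 _) two_pi_i_neq_0).
exists (d / 2), (/ Cmod (RtoC (2 * PI) * Ci) * (B * / (d / 2) * / d)).
assert (Hd2 : 0 < / (d / 2)) by (apply Rinv_0_lt_compat; lra).
assert (Hd3 : 0 < / d) by (apply Rinv_0_lt_compat; lra).
assert (Hpi' := Rinv_0_lt_compat _ Hpi).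
split; [lra|]. split.
{ apply Rmult_lt_0_compat; [exact Hpi'|]. repeat apply Rmult_lt_0_compat; assumption. }
intros z Hz.
assert (Hnz : ~ on_loop g z).
{ intros [t Ht]. assert (X := loop_dist_near g p z d t H Hz). rewrite Ht in X.
  replace (z - z)%C with (RtoC 0) in X by ring. rewrite Cmod_0 in X. lra. }
split; [exact Hnz|]. rewrite winding_diff by assumption.
rewrite Cmod_mult, Cmod_inv by apply two_pi_i_neq_0. rewrite Rmult_assoc.
apply Rmult_le_compat_l; [lra|].
replace (B * / (d / 2) * / d * Cmod (z - p)) with ((1 - 0) * (B * Cmod (z - p) * (/ (d / 2) * / d))) by ring.
apply CInt_bound; [lra| |].
- apply ex_CInt_continuous; [lra|]. intros t _. 
  assert (N1 : (g t - z)%C <> RtoC 0) by (apply Cminus_neq_0; intros E; apply Hnz; exists t; exact E).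
  assert (N2 : (g t - p)%C <> RtoC 0) by (apply Cminus_neq_0; intros E; apply Hp; exists t; exact E).
  apply continuous_Cdiv; [| |apply Cmult_neq_0; assumption].
  + apply continuous_Cmult; [apply loop_derivative_continuous, Hg|apply continuous_const].
  + apply continuous_Cmult; (apply continuous_Cminus; [apply loop_continuous, Hg|apply continuous_const]).
- intros t _.
  assert (N1 : (g t - z)%C <> RtoC 0) by (apply Cminus_neq_0; intros E; apply Hnz; exists t; exact E).
  assert (N2 : (g t - p)%C <> RtoC 0) by (apply Cminus_neq_0; intros E; apply Hp; exists t; exact E).
  assert (M1 := proj1 (Cmod_gt_0 _) N1). assert (M2 := proj1 (Cmod_gt_0 _) N2).
  rewrite Cmod_div by (apply Cmult_neq_0; assumption). rewrite !Cmod_mult. unfold Rdiv at 1. rewrite Rinv_mult.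
  destruct (HB' t) as [X _].
  apply Rmult_le_compat.
  + apply Rmult_le_pos; apply Cmod_ge_0.
  + apply Rmult_le_pos; apply Rlt_le, Rinv_0_lt_compat; assumption.
  + apply Rmult_le_compat_r; [apply Cmod_ge_0|exact X].
  + apply Rmult_le_compat; try (apply Rlt_le, Rinv_0_lt_compat; assumption).
    * apply Rinv_le_contravar; [lra|]. apply loop_dist_near with p; assumption.
    * apply Rinv_le_contravar; [lra|apply H].
Qed.

Lemma winding_values (g : R -> C) (z : C) : clockwise g -> ~ on_loop g z ->
  (~ encircles g z /\ winding g z = RtoC 0) \/ (encircles g z /\ winding g z = RtoC (-1)).
Proof.
intros Hc Hz. destruct (Ceq_dec (winding g z) (RtoC 0)) as [E|N].
- left. split; [|exact E]. intros [_ X]; tauto.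
- right. assert (X : encircles g z) by (split; assumption). split; [exact X|apply Hc, X].
Qed.

(** Off a clockwise loop the winding number is 0 or -1, so a change of modulus below 1 is no change;
    [winding_close] bounds the change. *)
Lemma encircles_locally (g : R -> C) (p : C) : smooth_loop g -> clockwise g -> ~ on_loop g p ->
  exists d, 0 < d /\ forall z, Cmod (z - p) < d -> ~ on_loop g z /\ (encircles g z <-> encircles g p).
Proof.
intros Hg Hc Hp. destruct (winding_close g p Hg Hp) as [d [K [Hd [HK H]]]].
assert (HK' := Rinv_0_lt_compat _ HK).
exists (Rmin d (/ K)); split; [apply Rmin_pos; lra|]. intros z Hz.
assert (M1 := Rmin_l d (/ K)). assert (M2 := Rmin_r d (/ K)).
destruct (H z ltac:(lra)) as [Hnz Hw]. split; [exact Hnz|].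
assert (Hw' : Cmod (winding g z - winding g p) < 1).
{ eapply Rle_lt_trans; [exact Hw|]. replace 1 with (K * / K) by (field; lra). apply Rmult_lt_compat_l; lra. }
destruct (winding_values g z Hc Hnz) as [[A1 A2]|[A1 A2]], (winding_values g p Hc Hp) as [[B1 B2]|[B1 B2]];
  [split; intros X; [elim (A1 X)|elim (B1 X)]| | |split; intros _; assumption];
  rewrite A2, B2 in Hw'; exfalso; revert Hw';
  match goal with |- Cmod (RtoC ?a - RtoC ?b) < 1 -> _ => rewrite <- (RtoC_minus a b) end;
  rewrite Cmod_R; unfold Rabs; destruct Rcase_abs; lra.
Qed.

Lemma encircles_far (g : R -> C) : smooth_loop g -> clockwise g ->
  exists r, 0 < r /\ forall z, r < Cmod z -> ~ on_loop g z /\ ~ encircles g z.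
Proof.
intros Hg Hc. destruct (loop_bound g Hg) as [B [HB HB']].
assert (Hpi := proj1 (Cmod_gt_0 _) two_pi_i_neq_0).
assert (Hpi' := Rinv_0_lt_compat _ Hpi).
set (P := / Cmod (RtoC (2 * PI) * Ci)) in *.
(* Beyond this radius the distance to the loop exceeds 1 + P B, and the winding number is at most P
   B / (1 + P B) < 1 in modulus. *)
exists (B + 1 + P * B); split; [nra|]. intros z Hz.
assert (Hdist : forall t, 1 + P * B < Cmod (g t - z)).
{ intros t. destruct (HB' t) as [_ X]. assert (Y := Cmod_ge_diff z (g t)).
  replace (z - g t)%C with (- (g t - z))%C in Y by ring. rewrite Cmod_opp in Y. lra. }
assert (HPB : 0 < P * B) by (apply Rmult_lt_0_compat; assumption).
assert (Hnz : ~ on_loop g z).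
{ intros [t Ht]. specialize (Hdist t). rewrite Ht in Hdist.
  replace (z - z)%C with (RtoC 0) in Hdist by ring. rewrite Cmod_0 in Hdist. lra. }
split; [exact Hnz|]. intros He.
assert (E := Hc z He).
assert (Hb : Cmod (winding g z) <= P * ((1 - 0) * (B * / (1 + P * B)))).
{ unfold winding. rewrite Cmod_mult, Cmod_inv by apply two_pi_i_neq_0.
  apply Rmult_le_compat_l; [lra|]. apply CInt_bound; [lra| |].
  - apply ex_CInt_continuous; [lra|]. intros; apply winding_integrand_continuous; assumption.
  - intros t _. assert (N1 : (g t - z)%C <> RtoC 0) by (apply Cminus_neq_0; intros X; apply Hnz; exists t; exact X).
    rewrite Cmod_div by exact N1. specialize (Hdist t). apply Rmult_le_compat.
    + apply Cmod_ge_0.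
    + apply Rlt_le, Rinv_0_lt_compat; lra.
    + apply HB'.
    + apply Rinv_le_contravar; lra. }
rewrite E, Cmod_R in Hb. replace (Rabs (-1)) with 1 in Hb by (unfold Rabs; destruct Rcase_abs; lra).
assert (P * ((1 - 0) * (B * / (1 + P * B))) < 1); [|lra].
replace (P * ((1 - 0) * (B * / (1 + P * B)))) with (P * B / (1 + P * B)) by (unfold Rdiv; ring).
apply Rlt_div_l; lra.
Qed.

Lemma Im_le_Cmod (z : C) : Rabs (Im z) <= Cmod z.
Proof. eapply Rle_trans; [|apply Rmax_Cmod]. apply Rmax_r. Qed.

Lemma Im_div (a b : C) : b <> RtoC 0 -> Im (a / b) = Im (a * Cconj b) / Cmod b ^ 2.
Proof.
intros Hb. apply Cnorm2_neq_0 in Hb. destruct a as [a1 a2], b as [b1 b2]. rewrite Cmod2_alt. simpl in *. field.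
intros E; apply Hb; rewrite <- E; ring.
Qed.

(* With u the tangential coordinate along the curve and q in a sector about the normal,
   [2 q du / (u^2 - q^2)] has positive imaginary part, as it has for real u. *)
Lemma sector_integrand_pos (c e v : R) (U U' q : C) :
  0 < c -> 0 <= e -> e <= c / 20 -> e <= / 20 ->
  Cmod (U - v) <= e * Rabs v -> Cmod (U' - RtoC 1) <= e -> c * Cmod q < Im q ->
  (U * U - q * q)%C <> RtoC 0 /\
  c * Cmod q / (4 * (v ^ 2 + Cmod q ^ 2)) <= Im (RtoC 2 * q * U' / (U * U - q * q)).
Proof.
intros Hc He1 He2 He3 HU HU' Hq.
set (m := Cmod q) in *. assert (Hm0 : 0 <= m) by apply Cmod_ge_0.
assert (Hmp : 0 < m).
{ assert (Im q <= m) by (eapply Rle_trans; [apply Rle_abs|apply Im_le_Cmod]). nra. }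
assert (Hv0 := Rabs_pos v). assert (Hv2 : Rabs v * Rabs v = v ^ 2) by (rewrite <- (pow2_abs v); ring).
assert (CU : Cmod U <= (1 + e) * Rabs v).
{ replace U with ((U - v) + v)%C by ring. eapply Rle_trans; [apply Cmod_triangle|]. rewrite Cmod_R. lra. }
assert (CUc : Cmod (Cconj U - v) <= e * Rabs v).
{ replace (Cconj U - v)%C with (Cconj (U - v)); [rewrite Cmod_conj; exact HU|].
  destruct U; apply injective_projections; simpl; ring. }
(* The quotient is multiplied by the conjugate of its denominator; E1 is the error of replacing U by
   v and U' by 1 in U' conj(U)^2. *)
set (E1 := (U' * (Cconj U * Cconj U) - RtoC (v ^ 2))%C).
assert (HE1 : Cmod E1 <= 4 * e * v ^ 2).
{ replace E1 with ((U' - RtoC 1) * (Cconj U * Cconj U) + (Cconj U - v) * (Cconj U + v))%C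
    by (unfold E1; rewrite RtoC_pow; simpl; ring).
  eapply Rle_trans; [apply Cmod_triangle|]. rewrite !Cmod_mult, !Cmod_conj.
  assert (X : Cmod (Cconj U + v) <= (2 + e) * Rabs v).
  { eapply Rle_trans; [apply Cmod_triangle|]. rewrite Cmod_R, Cmod_conj. lra. }
  assert (Y : Cmod U * Cmod U <= ((1 + e) * Rabs v) * ((1 + e) * Rabs v)).
  { apply Rmult_le_compat; try apply Cmod_ge_0; assumption. }
  assert (Z1 : Cmod (U' - 1) * (Cmod U * Cmod U) <= e * (((1 + e) * Rabs v) * ((1 + e) * Rabs v))).
  { apply Rmult_le_compat; [apply Cmod_ge_0| |assumption|assumption]. apply Rmult_le_pos; apply Cmod_ge_0. }
  assert (Z2 : Cmod (Cconj U - v) * Cmod (Cconj U + v) <= (e * Rabs v) * ((2 + e) * Rabs v)).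
  { apply Rmult_le_compat; try apply Cmod_ge_0; assumption. }
  replace (e * ((1 + e) * Rabs v * ((1 + e) * Rabs v))) with (e * (1 + e) ^ 2 * v ^ 2) in Z1 by (rewrite <- Hv2; ring).
  replace (e * Rabs v * ((2 + e) * Rabs v)) with (e * (2 + e) * v ^ 2) in Z2 by (rewrite <- Hv2; ring).
  assert (0 <= v ^ 2) by apply pow2_ge_0.
  assert ((1 + e) ^ 2 + (2 + e) <= 4) by nra.
  assert (0 <= e * v ^ 2) by nra.
  replace (4 * e * v ^ 2) with (4 * (e * v ^ 2)) by ring. nra. }
assert (Ep : (RtoC 2 * q * U' * Cconj (U * U - q * q) =
  RtoC 2 * (RtoC (v ^ 2) * q + q * E1 - RtoC (m ^ 2) * (Cconj q + Cconj q * (U' - RtoC 1))))%C).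
{ unfold E1, m. rewrite Cmod2_conj, RtoC_pow.
  replace (Cconj (U * U - q * q)) with (Cconj U * Cconj U - Cconj q * Cconj q)%C
    by (destruct U, q; apply injective_projections; simpl; ring).
  simpl. ring. }
(* The conjugate of q enters with a minus sign, so the main terms v^2 Im q and m^2 Im q are both
   positive. With e <= c / 20 the errors cost at most half of them. *)
assert (Hnum : c * m * (v ^ 2 + m ^ 2) <= Im (RtoC 2 * q * U' * Cconj (U * U - q * q))%C).
{ rewrite Ep.
  assert (A1 : - (m * (4 * e * v ^ 2)) <= Im (q * E1)%C).
  { assert (X := Im_le_Cmod (q * E1)%C). rewrite Cmod_mult in X. fold m in X.
    assert (m * Cmod E1 <= m * (4 * e * v ^ 2)) by (apply Rmult_le_compat_l; lra).
    apply Rabs_le_between in X. lra. }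
  assert (A2 : Im (Cconj q * (U' - RtoC 1))%C <= m * e).
  { assert (X := Im_le_Cmod (Cconj q * (U' - RtoC 1))%C). rewrite Cmod_mult, Cmod_conj in X. fold m in X.
    assert (m * Cmod (U' - RtoC 1) <= m * e) by (apply Rmult_le_compat_l; lra).
    apply Rabs_le_between in X. lra. }
  assert (EI : Im (RtoC 2 * (RtoC (v ^ 2) * q + q * E1 - RtoC (m ^ 2) * (Cconj q + Cconj q * (U' - RtoC 1))))%C
    = 2 * (v ^ 2 * Im q + Im (q * E1)%C - m ^ 2 * (- Im q + Im (Cconj q * (U' - RtoC 1))%C))).
  { generalize (q * E1)%C, (Cconj q * (U' - RtoC 1))%C; intros [x1 x2] [y1 y2]; destruct q as [q1 q2].
    cbn -[pow]. unfold Rminus; ring. }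
  rewrite EI. assert (0 <= v ^ 2) by apply pow2_ge_0. assert (0 <= m ^ 2) by apply pow2_ge_0.
  assert (B1 : v ^ 2 * (c * m) <= v ^ 2 * Im q) by (apply Rmult_le_compat_l; lra).
  assert (B2 : m ^ 2 * (c * m) <= m ^ 2 * Im q) by (apply Rmult_le_compat_l; lra).
  assert (B3 : m ^ 2 * Im (Cconj q * (U' - RtoC 1))%C <= m ^ 2 * (m * e)) by (apply Rmult_le_compat_l; lra).
  assert (B4 : m * e <= m * (c / 20)) by (apply Rmult_le_compat_l; lra).
  assert (B5 : m * e * v ^ 2 <= m * (c / 20) * v ^ 2) by (apply Rmult_le_compat_r; lra).
  assert (B6 : m ^ 2 * (m * e) <= m ^ 2 * (m * (c / 20))) by (apply Rmult_le_compat_l; lra).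
  assert (B7 : 0 <= c * m * v ^ 2) by (apply Rmult_le_pos; nra).
  assert (B8 : 0 <= c * m * m ^ 2) by (apply Rmult_le_pos; nra). nra. }
assert (Hpos : 0 < c * m * (v ^ 2 + m ^ 2)).
{ assert (0 <= v ^ 2) by apply pow2_ge_0. assert (0 < m ^ 2) by (apply pow_lt; lra).
  apply Rmult_lt_0_compat; [nra|lra]. }
assert (Hne : (U * U - q * q)%C <> RtoC 0).
{ intros E. rewrite E in Hnum.
  replace (RtoC 2 * q * U' * Cconj (RtoC 0))%C with (RtoC 0) in Hnum by (apply injective_projections; simpl; ring).
  simpl in Hnum. simpl in Hpos. lra. }
split; [exact Hne|]. rewrite Im_div by exact Hne.
assert (Hden0 : 0 < Cmod (U * U - q * q)) by (apply Cmod_gt_0, Hne).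
assert (Hs0 : 0 < v ^ 2 + m ^ 2).
{ assert (0 <= v ^ 2) by apply pow2_ge_0. assert (0 < m ^ 2) by (apply pow_lt; lra). lra. }
assert (Hden : Cmod (U * U - q * q) <= 2 * (v ^ 2 + m ^ 2)).
{ unfold Cminus. eapply Rle_trans; [apply Cmod_triangle|]. rewrite Cmod_opp, !Cmod_mult. fold m.
  assert (Cmod U * Cmod U <= ((1 + e) * Rabs v) * ((1 + e) * Rabs v))
    by (apply Rmult_le_compat; try apply Cmod_ge_0; assumption).
  replace ((1 + e) * Rabs v * ((1 + e) * Rabs v)) with ((1 + e) ^ 2 * v ^ 2) in H by (rewrite <- Hv2; ring).
  assert (0 <= v ^ 2) by apply pow2_ge_0. assert ((1 + e) ^ 2 <= 2) by nra. nra. }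
apply (Rle_div_r (c * m / (4 * (v ^ 2 + m ^ 2)))); [apply Rlt_gt; apply pow_lt; exact Hden0|].
apply Rle_trans with (c * m / (4 * (v ^ 2 + m ^ 2)) * (2 * (v ^ 2 + m ^ 2)) ^ 2).
- apply Rmult_le_compat_l.
  + apply Rdiv_le_0_compat; [nra|lra].
  + apply pow_incr; lra.
- eapply Rle_trans; [|exact Hnum]. apply Req_le. field. lra.
Qed.

Lemma RInt_ge_const (F : R -> R) (a b m : R) : a <= b -> (forall s, continuous F s) ->
  (forall s, a <= s <= b -> m <= F s) -> m * (b - a) <= RInt F a b.
Proof.
intros Hab HF Hm. replace (m * (b - a)) with (RInt (fun _ => m) a b)
  by (rewrite RInt_const; unfold scal; simpl; unfold mult; simpl; ring).
apply RInt_le; [exact Hab|apply ex_RInt_const| |intros; apply Hm; lra].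
apply (ex_RInt_continuous (V := R_CompleteNormedModule)). intros; apply HF.
Qed.

Lemma RInt_periodic (F : R -> R) (a : R) : (forall s, continuous F s) -> (forall s, F (s + 1) = F s) ->
  RInt F a (a + 1) = RInt F 0 1.
Proof.
intros Hc Hp.
assert (Hex : forall a b, ex_RInt F a b)
  by (intros; apply (ex_RInt_continuous (V := R_CompleteNormedModule)); intros; apply Hc).
assert (E : RInt F 0 a = RInt F 1 (a + 1)).
{ assert (X := RInt_comp_lin F 1 1 0 a). rewrite !Rmult_1_l, Rplus_0_l in X. rewrite <- X by apply Hex.
  apply RInt_ext. intros s _. unfold scal; simpl; unfold mult; simpl. rewrite !Rmult_1_l. symmetry; apply Hp. }
assert (C1 := RInt_Chasles F 0 a (a + 1) (Hex _ _) (Hex _ _)).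
assert (C2 := RInt_Chasles F 0 1 (a + 1) (Hex _ _) (Hex _ _)).
unfold plus in C1, C2; simpl in C1, C2. lra.
Qed.

(** First-order expansion at t with an error uniform in s: the mean value theorem for the real and
    imaginary parts of the remainder r, each with half of e. The bound d < 1/2 keeps the window
    within one period. *)
Lemma loop_tangent (g : R -> C) (t e : R) : smooth_loop g -> 0 < e ->
  exists d, 0 < d < / 2 /\ forall s, Rabs (s - t) <= d ->
    Cmod (loop_derivative g s / loop_derivative g t - RtoC 1) <= e /\
    Cmod ((g s - g t) / loop_derivative g t - RtoC (s - t)) <= e * Rabs (s - t).
Proof.
intros Hg He. set (T := loop_derivative g t).
assert (HT : T <> RtoC 0) by apply Hg.
assert (Hc : continuous (fun s => loop_derivative g s / T)%C t).
{ apply continuous_Cdiv; [apply loop_derivative_continuous, Hg|apply continuous_const|exact HT]. }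
destruct (proj1 (filterlim_Cmod (locally t) _ _) Hc (e / 2) ltac:(lra)) as [d Hd].
exists (Rmin (d / 2) (/ 4)).
assert (M1 := Rmin_l (d / 2) (/ 4)). assert (M2 := Rmin_r (d / 2) (/ 4)).
assert (Hd0 := cond_pos d).
split; [split; [apply Rmin_pos; lra|lra]|].
assert (Hclose : forall s, Rabs (s - t) <= Rmin (d / 2) (/ 4) -> Cmod (loop_derivative g s / T - RtoC 1) < e / 2).
{ intros s Hs. assert (X := Hd s). fold T in X. replace (T / T)%C with (RtoC 1) in X by (field; exact HT).
  apply X. change (Rabs (s - t) < d). lra. }
intros s Hs. split; [specialize (Hclose s Hs); lra|].
set (r := fun s => ((g s - g t) / T - RtoC (s - t))%C).
set (dr := fun s => (loop_derivative g s / T - RtoC 1)%C).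
assert (Dr : forall s, is_derive (fun s => Re (r s)) s (Re (dr s)) /\ is_derive (fun s => Im (r s)) s (Im (dr s))).
{ intros x. destruct (loop_derive g x Hg) as [D1 D2].
  destruct (/ T)%C as [a b] eqn:ET.
  split.
  - apply is_derive_ext with (fun s => a * Re (g s) - b * Im (g s) - (a * Re (g t) - b * Im (g t)) - (s - t)).
    + intros y. unfold r, Cdiv. rewrite ET. destruct (g y), (g t); simpl. eq_in R; ring.
    + unfold dr, Cdiv. rewrite ET. match goal with |- is_derive _ _ (Re ?z) => replace (Re z) with (a * Re (loop_derivative g x) - b * Im (loop_derivative g x) - 0 - 1)
        by (destruct (loop_derivative g x); simpl; ring) end.
      apply (is_derive_minus (V := R_NormedModule)); [|auto_derive; [exact I|eq_in R; ring]].
      apply (is_derive_minus (V := R_NormedModule)); [|exact (is_derive_const (V := R_NormedModule) _ _)].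
      apply (is_derive_minus (V := R_NormedModule)); apply is_derive_scal; assumption.
  - apply is_derive_ext with (fun s => a * Im (g s) + b * Re (g s) - (a * Im (g t) + b * Re (g t))).
    + intros y. unfold r, Cdiv. rewrite ET. destruct (g y), (g t); simpl. eq_in R; ring.
    + unfold dr, Cdiv. rewrite ET. match goal with |- is_derive _ _ (Im ?z) => replace (Im z) with (a * Im (loop_derivative g x) + b * Re (loop_derivative g x) - 0)
        by (destruct (loop_derivative g x); simpl; ring) end.
      apply (is_derive_minus (V := R_NormedModule)); [|exact (is_derive_const (V := R_NormedModule) _ _)].
      apply (is_derive_plus (V := R_NormedModule)); apply is_derive_scal; assumption. }
assert (Hr0 : r t = RtoC 0).
{ unfold r. replace (t - t) with 0 by ring. unfold Cdiv. ring. }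
assert (Hbetween : forall x, Rmin t s <= x <= Rmax t s -> Rabs (x - t) <= Rabs (s - t)).
{ intros x. unfold Rmin, Rmax, Rabs. repeat (destruct Rle_dec || destruct Rcase_abs); lra. }
eapply Rle_trans; [apply Cmod_le_abs|]. fold (r s).
assert (B1 : Rabs (Re (r s)) <= e / 2 * Rabs (s - t)).
{ destruct (MVT_gen (fun s => Re (r s)) t s (fun s => Re (dr s))) as [x [Hx Ex]].
  - intros u _; exact (proj1 (Dr u)).
  - intros u _. apply continuity_pt_filterlim, (ex_derive_continuous (V := R_NormedModule) (fun s => Re (r s))). exists (Re (dr u)); exact (proj1 (Dr u)).
  - rewrite Hr0 in Ex. change (Re (RtoC 0)) with 0 in Ex. rewrite Rminus_0_r in Ex. rewrite Ex, Rabs_mult.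
    apply Rmult_le_compat_r; [apply Rabs_pos|].
    eapply Rle_trans; [apply (re_le_Cmod (dr x))|]. left. apply (Hclose x). specialize (Hbetween x Hx). lra. }
assert (B2 : Rabs (Im (r s)) <= e / 2 * Rabs (s - t)).
{ destruct (MVT_gen (fun s => Im (r s)) t s (fun s => Im (dr s))) as [x [Hx Ex]].
  - intros u _; exact (proj2 (Dr u)).
  - intros u _. apply continuity_pt_filterlim, (ex_derive_continuous (V := R_NormedModule) (fun s => Im (r s))). exists (Im (dr u)); exact (proj2 (Dr u)).
  - rewrite Hr0 in Ex. change (Im (RtoC 0)) with 0 in Ex. rewrite Rminus_0_r in Ex. rewrite Ex, Rabs_mult.
    apply Rmult_le_compat_r; [apply Rabs_pos|].
    eapply Rle_trans; [apply (Im_le_Cmod (dr x))|]. left. apply (Hclose x). specialize (Hbetween x Hx). lra. }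
lra.
Qed.

(** A local Jordan curve theorem. The difference of the winding numbers at g t + w and g t - w has
    real part 1 / (2 pi) times the integral of Im F. Near t the function Im F is nonnegative by
    [sector_integrand_pos], with a contribution from |s - t| <= |q| that does not shrink with w,
    while the rest of the loop contributes little. So the winding number is strictly larger at g t +
    w, and the two values can only be 0 and -1. *)
Lemma loop_sector (g : R -> C) (t c : R) : smooth_loop g -> clockwise g -> 0 < c ->
  exists d, 0 < d /\ forall w, Cmod w < d -> c * (Cmod w * Cmod (loop_derivative g t)) < Im (w * Cconj (loop_derivative g t)) ->
    ~ on_loop g (g t + w) /\ ~ encircles g (g t + w) /\ encircles g (g t - w).
Proof.
intros Hg Hcw Hc. set (T := loop_derivative g t). set (p := g t).
assert (HT : T <> RtoC 0) by apply Hg. assert (HTp := proj1 (Cmod_gt_0 _) HT).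
set (e := Rmin (c / 20) (/ 20)).
assert (He : 0 < e) by (apply Rmin_pos; lra).
assert (He1 : e <= c / 20) by apply Rmin_l. assert (He2 : e <= / 20) by apply Rmin_r.
destruct (loop_tangent g t e Hg He) as [d [Hd Htan]]. fold T p in Htan.
destruct (loop_bound g Hg) as [B [HB HB']].
(* Outside the window about t, and up to half a period, the loop stays away from p, by simplicity
   and compactness. *)
assert (Hfar : exists d0, 0 < d0 /\ forall s, d <= Rabs (s - t) <= / 2 -> d0 <= Cmod (g s - p)).
{ assert (Hcont : forall s, continuous (fun s => g s - p)%C s)
    by (intros; apply continuous_Cminus; [apply loop_continuous, Hg|apply continuous_const]).
  assert (Hne : forall s, d <= Rabs (s - t) <= / 2 -> (g s - p)%C <> RtoC 0).
  { intros s Hs. apply Cminus_neq_0. intros E. apply (loop_simple g s t Hg) in E; [|lra].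
    rewrite E, Rminus_diag, Rabs_R0 in Hs. lra. }
  destruct (Cmod_min (fun s => g s - p)%C (t + d) (t + / 2) ltac:(lra)) as [d1 [P1 Q1]].
  { intros; apply Hcont. }
  { intros s Hs; apply Hne. rewrite Rabs_pos_eq; lra. }
  destruct (Cmod_min (fun s => g s - p)%C (t - / 2) (t - d) ltac:(lra)) as [d2 [P2 Q2]].
  { intros; apply Hcont. }
  { intros s Hs; apply Hne. rewrite Rabs_left1; lra. }
  exists (Rmin d1 d2). split; [apply Rmin_pos; lra|].
  assert (M1 := Rmin_l d1 d2). assert (M2 := Rmin_r d1 d2).
  intros s Hs. revert Hs. unfold Rabs; destruct Rcase_abs; intros Hs.
  - eapply Rle_trans; [exact M2|]. apply Q2; lra.
  - eapply Rle_trans; [exact M1|]. apply Q1; lra. }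
destruct Hfar as [d0 [Hd0 Hfar]].
set (K := 4 * B / d0 ^ 2).
assert (Hd02 : 0 < d0 ^ 2) by (apply pow_lt; lra).
assert (HK : 0 < K) by (apply Rdiv_lt_0_compat; lra).
(* The three bounds on |w| keep the far denominators above d0^2 / 2, place |q| inside the tangent
   window, and make |F| at most c / 8 far from t. *)
exists (Rmin (d0 / 2) (Rmin (d * Cmod T) (c / 8 / K))).
assert (M1 := Rmin_l (d0 / 2) (Rmin (d * Cmod T) (c / 8 / K))).
assert (M2 := Rmin_r (d0 / 2) (Rmin (d * Cmod T) (c / 8 / K))).
assert (M3 := Rmin_l (d * Cmod T) (c / 8 / K)).
assert (M4 := Rmin_r (d * Cmod T) (c / 8 / K)).
split. { repeat apply Rmin_pos; try lra; [nra|]. apply Rdiv_lt_0_compat; lra. }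
intros w Hw Hsec.
set (q := (w / T)%C). assert (Eq : w = (q * T)%C) by (unfold q; field; exact HT).
assert (Cq : Cmod w = Cmod q * Cmod T) by (rewrite Eq, Cmod_mult; reflexivity).
assert (Hq : c * Cmod q < Im q).
{ unfold q. rewrite Im_div, Cmod_div by exact HT. apply (Rlt_div_r (c * (Cmod w / Cmod T))); [apply Rlt_gt, pow_lt, HTp|].
  replace (c * (Cmod w / Cmod T) * Cmod T ^ 2) with (c * (Cmod w * Cmod T)) by (field; lra). exact Hsec. }
assert (Hmp : 0 < Cmod q).
{ assert (Im q <= Cmod q) by (eapply Rle_trans; [apply Rle_abs|apply Im_le_Cmod]).
  assert (Q := Cmod_ge_0 q). nra. }
assert (Hqd : Cmod q < d) by (apply Rmult_lt_reg_r with (Cmod T); lra).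
(* The product of g s - (p + w) and g s - (p - w), the common denominator of the two winding
   integrands. *)
set (den := fun s => ((g s - p) * (g s - p) - w * w)%C).
set (F := fun s => (loop_derivative g s * (RtoC 2 * w) / den s)%C).
assert (Hnear : forall s, Rabs (s - t) <= d -> den s <> RtoC 0 /\
  c * Cmod q / (4 * ((s - t) ^ 2 + Cmod q ^ 2)) <= Im (F s)).
{ intros s Hs. destruct (Htan s Hs) as [A1 A2].
  destruct (sector_integrand_pos c e (s - t) ((g s - p) / T) (loop_derivative g s / T) q
              Hc (Rlt_le _ _ He) He1 He2 A2 A1 Hq) as [X1 X2].
  assert (Eden : den s = ((((g s - p) / T) * ((g s - p) / T) - q * q) * (T * T))%C).
  { unfold den. rewrite Eq. field. exact HT. }
  split.
  - rewrite Eden. apply Cmult_neq_0; [exact X1|apply Cmult_neq_0; exact HT].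
  - replace (F s) with (RtoC 2 * q * (loop_derivative g s / T) / ((g s - p) / T * ((g s - p) / T) - q * q))%C; [exact X2|].
    unfold F. rewrite Eden, Eq. set (Y := ((g s - p) / T * ((g s - p) / T) - q * q)%C) in *. field. split; assumption. }
assert (Hfarden : forall s, d <= Rabs (s - t) <= / 2 -> d0 ^ 2 / 2 <= Cmod (den s)).
{ intros s Hs. specialize (Hfar s Hs). unfold den.
  eapply Rle_trans; [|apply Cmod_ge_diff]. rewrite !Cmod_mult.
  assert (Cmod w * Cmod w <= d0 / 2 * (d0 / 2)) by (apply Rmult_le_compat; try apply Cmod_ge_0; lra).
  assert (d0 * d0 <= Cmod (g s - p) * Cmod (g s - p)) by (apply Rmult_le_compat; lra). nra. }
assert (Hden : forall s, den s <> RtoC 0).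
{ assert (Hd1 : forall s, Rabs (s - t) <= / 2 -> den s <> RtoC 0).
  { intros s Hs. destruct (Rle_dec (Rabs (s - t)) d) as [L|L]; [apply Hnear, L|].
    apply Cmod_gt_0. specialize (Hfarden s ltac:(lra)). lra. }
  intros s. destruct (shift_into (t - / 2) s) as [k Hk].
  unfold den. rewrite <- (loop_period g s k Hg). apply Hd1. apply Rabs_le; lra. }
assert (Hn1 : ~ on_loop g (p + w)).
{ intros [s Es]. apply (Hden s). unfold den. rewrite Es. ring. }
assert (Hn2 : ~ on_loop g (p - w)).
{ intros [s Es]. apply (Hden s). unfold den. rewrite Es. ring. }
assert (HFc : forall s, continuous F s).
{ intros s. assert (continuous (fun s => g s - p)%C s)
    by (apply continuous_Cminus; [apply loop_continuous, Hg|apply continuous_const]).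
  apply continuous_Cdiv; [|apply continuous_Cminus; [apply continuous_Cmult; assumption|apply continuous_const]|apply Hden].
  apply continuous_Cmult; [apply loop_derivative_continuous, Hg|apply continuous_const]. }
set (Fi := fun s : R => Im (F s)).
assert (HIc : forall s, continuous Fi s) by (intros s; apply (continuous_Im F), HFc).
assert (Hper : forall s, Fi (s + 1) = Fi s).
{ intros s. unfold Fi, F, den. rewrite (loop_period g s 1 Hg), (loop_derivative_period g s 1 Hg). reflexivity. }
assert (Hex : forall a b, ex_RInt Fi a b)
  by (intros; apply (ex_RInt_continuous (V := R_CompleteNormedModule)); intros; apply HIc).
assert (HexF : ex_CInt F 0 1) by (apply ex_CInt_continuous; [lra|intros; apply HFc]).
assert (Hfarval : forall s, d <= Rabs (s - t) <= / 2 -> - (c / 8) <= Im (F s)).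
{ intros s Hs. specialize (Hfarden s Hs).
  assert (X := Im_le_Cmod (F s)). apply Rabs_le_between in X.
  assert (Cmod (F s) <= c / 8); [|lra].
  unfold F. rewrite Cmod_div, !Cmod_mult, Cmod_R, (Rabs_pos_eq 2) by (lra || apply Hden).
  apply Rle_div_l; [lra|].
  apply Rle_trans with (B * (2 * Cmod w)).
  - apply Rmult_le_compat_r; [assert (Q := Cmod_ge_0 w); lra|apply HB'].
  - apply Rle_trans with (c / 8 * (d0 ^ 2 / 2)); [|apply Rmult_le_compat_l; lra].
    assert (Hw4 : Cmod w <= c / 8 / K) by lra.
    assert (Cmod w * K <= c / 8) by (apply (Rle_div_r (Cmod w) (c / 8) K); lra).
    replace (B * (2 * Cmod w)) with (Cmod w * K * (d0 ^ 2 / 2)) by (unfold K; field; lra).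
    apply Rmult_le_compat_r; lra. }
assert (Hnearval : forall s, Rabs (s - t) <= d -> 0 <= Im (F s)).
{ intros s Hs. destruct (Hnear s Hs) as [_ X]. eapply Rle_trans; [|exact X].
  assert (0 <= (s - t) ^ 2) by apply pow2_ge_0. assert (0 < Cmod q ^ 2) by (apply pow_lt, Hmp).
  apply Rdiv_le_0_compat; nra. }
set (m := Cmod q) in *.
assert (Hcore : forall s, t - m <= s <= t + m -> c / (8 * m) <= Im (F s)).
{ intros s Hs. destruct (Hnear s ltac:(apply Rabs_le; lra)) as [_ X]. eapply Rle_trans; [|exact X].
  assert (0 <= (s - t) ^ 2) by apply pow2_ge_0. assert (0 < m ^ 2) by (apply pow_lt, Hmp).
  assert ((s - t) ^ 2 <= m ^ 2) by nra.
  apply (Rle_div_r (c / (8 * m)) (c * m)); [lra|].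
  apply Rle_trans with (c / (8 * m) * (8 * m ^ 2)); [apply Rmult_le_compat_l; [|lra]|apply Req_le; field; lra].
  apply Rlt_le, Rdiv_lt_0_compat; lra. }
(* Over a period centred at t, the core |s - t| <= m gives at least c / 4, and the two far pieces
   together lose at most c / 8. *)
assert (HI : 0 < RInt Fi 0 1).
{ rewrite <- (RInt_periodic Fi (t - / 2) HIc Hper).
  replace (t - / 2 + 1) with (t + / 2) by field.
  assert (Q1 := RInt_ge_const Fi (t - / 2) (t - d) (- (c / 8)) ltac:(lra) HIc
    ltac:(intros s Hs; apply Hfarval; rewrite Rabs_left1; lra)).
  assert (Q2 := RInt_ge_const Fi (t - d) (t - m) 0 ltac:(lra) HIc
    ltac:(intros s Hs; apply Hnearval; apply Rabs_le; lra)).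
  assert (Q3 := RInt_ge_const Fi (t - m) (t + m) (c / (8 * m)) ltac:(lra) HIc Hcore).
  assert (Q4 := RInt_ge_const Fi (t + m) (t + d) 0 ltac:(lra) HIc
    ltac:(intros s Hs; apply Hnearval; apply Rabs_le; lra)).
  assert (Q5 := RInt_ge_const Fi (t + d) (t + / 2) (- (c / 8)) ltac:(lra) HIc
    ltac:(intros s Hs; apply Hfarval; rewrite Rabs_pos_eq; lra)).
  assert (C1 := RInt_Chasles Fi _ (t - d) (t + / 2) (Hex (t - / 2) _) (Hex _ _)).
  assert (C2 := RInt_Chasles Fi _ (t - m) (t + / 2) (Hex (t - d) _) (Hex _ _)).
  assert (C3 := RInt_Chasles Fi _ (t + m) (t + / 2) (Hex (t - m) _) (Hex _ _)).
  assert (C4 := RInt_Chasles Fi _ (t + d) (t + / 2) (Hex (t + m) _) (Hex _ _)).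
  unfold plus in C1, C2, C3, C4; simpl in C1, C2, C3, C4.
  replace (c / (8 * m) * (t + m - (t - m))) with (c / 4) in Q3 by (field; lra).
  assert (- (c / 8) * (t - d - (t - / 2)) >= - (c / 16)) by nra.
  assert (- (c / 8) * (t + / 2 - (t + d)) >= - (c / 16)) by nra.
  lra. }
assert (Hdiff : 0 < Re (winding g (p + w) - winding g (p - w))).
{ rewrite winding_diff by assumption.
  rewrite (CInt_ext _ F); [|lra|].
  - assert (HPI := PI_RGT_0).
    assert (HI2 : 0 < Im (CInt F 0 1)) by (rewrite (Im_CInt F 0 1 HexF); exact HI). destruct (CInt F 0 1) as [u v]. simpl in *.
    match goal with |- 0 < ?x => replace x with (v / (2 * PI)) by (field; lra) end.
    apply Rdiv_lt_0_compat; lra.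
  - intros s _. unfold F, den. replace (p + w - (p - w))%C with (RtoC 2 * w)%C
      by (replace (RtoC 2) with (RtoC 1 + RtoC 1)%C by (rewrite <- RtoC_plus; f_equal; ring); ring).
    replace ((g s - p) * (g s - p) - w * w)%C with ((g s - (p + w)) * (g s - (p - w)))%C by ring. reflexivity. }
fold p. split; [exact Hn1|].
destruct (winding_values g (p + w) Hcw Hn1) as [[A1 A2]|[A1 A2]], (winding_values g (p - w) Hcw Hn2) as [[B1 B2]|[B1 B2]];
  rewrite A2, B2 in Hdiff; simpl in Hdiff; try lra. tauto.
Qed.

(** * The additive Riemann-Hilbert problem *)

Definition off_loops (g0 g1 : R -> C) (z : C) : Prop := ~ on_loop g0 z /\ ~ on_loop g1 z.
Definition outside (g0 g1 : R -> C) (z : C) : Prop := ~ on_or_inside g0 z /\ ~ on_or_inside g1 z.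

Lemma loop_thin (g : R -> C) : smooth_loop g -> exists M, thin (on_loop g) M.
Proof.
intros Hg. destruct (loop_bound g Hg) as [B [HB HB']].
exists (2 * B + 4). apply thin_sub with (fun z => exists t, 0 <= t <= 1 /\ g t = z).
- intros z [t <-]. destruct (shift_into 0 t) as [k Hk]. exists (t + IZR k). split; [lra|apply loop_period, Hg].
- apply thin_curve; [lra|]. intros s t _ _.
  eapply Rle_trans; [apply Cmod_le_abs|].
  destruct (MVT_gen (fun s => Re (g s)) t s (fun s => Re (loop_derivative g s))) as [x [_ Ex]].
  { intros u _; exact (proj1 (loop_derive g u Hg)). }
  { intros. apply continuity_pt_filterlim, (continuous_Re g), loop_continuous, Hg. }
  destruct (MVT_gen (fun s => Im (g s)) t s (fun s => Im (loop_derivative g s))) as [y [_ Ey]].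
  { intros u _; exact (proj2 (loop_derive g u Hg)). }
  { intros. apply continuity_pt_filterlim, (continuous_Im g), loop_continuous, Hg. }
  change (Re (g s - g t)%C) with (Re (g s) - Re (g t)). change (Im (g s - g t)%C) with (Im (g s) - Im (g t)).
  rewrite Ex, Ey, !Rabs_mult.
  assert (X1 := re_le_Cmod (loop_derivative g x)). assert (X2 := Im_le_Cmod (loop_derivative g y)).
  destruct (HB' x) as [Y1 _], (HB' y) as [Y2 _].
  assert (Z := Rabs_pos (s - t)). 
  assert (Rabs (Re (loop_derivative g x)) * Rabs (s - t) <= B * Rabs (s - t)) by (apply Rmult_le_compat_r; lra).
  assert (Rabs (Im (loop_derivative g y)) * Rabs (s - t) <= B * Rabs (s - t)) by (apply Rmult_le_compat_r; lra).
  lra.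
Qed.

Lemma left_sector_spec (g : R -> C) (t c : R) : smooth_loop g -> clockwise g -> 0 < c ->
  exists d, 0 < d /\ forall z, Cmod (z - g t) < d -> left_sector g t c z -> ~ on_or_inside g z.
Proof.
intros Hg Hcw Hc. destruct (loop_sector g t c Hg Hcw Hc) as [d [Hd H]].
exists d; split; [exact Hd|]. intros z Hz Hs. destruct (H (z - g t)%C Hz Hs) as [A [B _]].
replace (g t + (z - g t))%C with z in * by ring. intros [X|X]; tauto.
Qed.

Lemma right_sector_spec (g : R -> C) (t c : R) : smooth_loop g -> clockwise g -> 0 < c ->
  exists d, 0 < d /\ forall z, Cmod (z - g t) < d -> right_sector g t c z -> encircles g z.
Proof.
intros Hg Hcw Hc. destruct (loop_sector g t c Hg Hcw Hc) as [d [Hd H]].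
exists d; split; [exact Hd|]. intros z Hz Hs. destruct (H (- (z - g t))%C) as [_ [_ B]].
- rewrite Cmod_opp; exact Hz.
- rewrite Cmod_opp. eapply Rlt_le_trans; [exact Hs|]. apply Req_le.
  unfold loop_derivative. destruct z, (g t). simpl. ring.
- replace (g t - - (z - g t))%C with z in B by ring. exact B.
Qed.

(** The sectors accumulate at their vertex, which makes limits along them unique. *)
Lemma sector_points (g : R -> C) (t d : R) : smooth_loop g -> 0 < d ->
  (exists z, Cmod (z - g t) < d /\ left_sector g t (/ 2) z) /\
  (exists z, Cmod (z - g t) < d /\ right_sector g t (/ 2) z).
Proof.
intros Hg Hd. set (T := loop_derivative g t).
assert (HT : T <> RtoC 0) by apply Hg. assert (HTp := proj1 (Cmod_gt_0 _) HT).
set (r := d / (2 * Cmod T)). assert (Hr : 0 < r) by (apply Rdiv_lt_0_compat; lra).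
set (w := (RtoC r * Ci * T)%C).
assert (Hw : Cmod w = d / 2).
{ unfold w. rewrite !Cmod_mult, Cmod_Ci, Cmod_R, Rabs_pos_eq by lra. unfold r. field. lra. }
assert (Hs : / 2 * (Cmod w * Cmod T) < Im (w * Cconj T)).
{ rewrite Hw. replace (w * Cconj T)%C with (RtoC r * Ci * RtoC (Cmod T ^ 2))%C
    by (unfold w; rewrite Cmod2_conj; ring).
  replace (Im _) with (r * Cmod T ^ 2) by (cbn -[pow]; ring).
  replace (r * Cmod T ^ 2) with (d / 2 * Cmod T) by (unfold r; field; lra). nra. }
split.
- exists (g t + w)%C. unfold left_sector. replace (g t + w - g t)%C with w by ring. split; [lra|exact Hs].
- exists (g t - w)%C. unfold right_sector. replace (g t - w - g t)%C with (- w)%C by ring. rewrite Cmod_opp.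
  split; [lra|]. eapply Rlt_le_trans; [exact Hs|]. apply Req_le. fold T. destruct w, T; simpl; ring.
Qed.

Lemma filterlim_within (P : C -> Prop) (p l : C) (f : C -> C) :
  filterlim f (within P (locally p)) (locally l) <->
  forall e, 0 < e -> exists d, 0 < d /\ forall w, Cmod (w - p) < d -> P w -> Cmod (f w - l) < e.
Proof.
rewrite (filterlim_Cmod (within P (locally p))). unfold within. split; intros H e He; specialize (H e He).
- apply locally_Cmod in H. exact H.
- apply locally_Cmod. exact H.
Qed.

Lemma filterlim_within_unique (P : C -> Prop) (p l l' : C) (f : C -> C) :
  (forall d, 0 < d -> exists w, Cmod (w - p) < d /\ P w) ->
  filterlim f (within P (locally p)) (locally l) ->
  filterlim f (within P (locally p)) (locally l') -> l = l'.
Proof.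
rewrite !filterlim_within. intros HP H H'.
assert (E : (l - l')%C = RtoC 0).
{ apply Cmod_eq_0. apply Rle_antisym; [|apply Cmod_ge_0]. apply le_epsilon. intros e He. rewrite Rplus_0_l.
  destruct (H (e / 2) ltac:(lra)) as [d [Hd Hd1]]. destruct (H' (e / 2) ltac:(lra)) as [d' [Hd' Hd1']].
  destruct (HP (Rmin d d') ltac:(apply Rmin_pos; lra)) as [w [Hw Pw]].
  assert (M1 := Rmin_l d d'). assert (M2 := Rmin_r d d').
  specialize (Hd1 w ltac:(lra) Pw). specialize (Hd1' w ltac:(lra) Pw).
  replace (l - l')%C with (- (f w - l) + (f w - l'))%C by ring.
  eapply Rle_trans; [apply Cmod_triangle|]. rewrite Cmod_opp. lra. }
replace l with (l - l' + l')%C by ring. rewrite E. ring.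
Qed.

Lemma filterlim_within_near (P Q : C -> Prop) (p l : C) (f h : C -> C) (d : R) : 0 < d ->
  (forall w, Cmod (w - p) < d -> Q w -> P w /\ h w = f w) ->
  filterlim f (within P (locally p)) (locally l) -> filterlim h (within Q (locally p)) (locally l).
Proof.
rewrite !filterlim_within. intros Hd HQ H e He. destruct (H e He) as [d' [Hd' H']].
exists (Rmin d d'). split; [apply Rmin_pos; lra|]. intros w Hw Qw.
assert (M1 := Rmin_l d d'). assert (M2 := Rmin_r d d').
destruct (HQ w ltac:(lra) Qw) as [Pw ->]. apply H'; [lra|exact Pw].
Qed.

Lemma continuous_within {T U : UniformSpace} (P : T -> Prop) (p : T) (f : T -> U) : continuous f p ->
  filterlim f (within P (locally p)) (locally (f p)).
Proof. intros H Q HQ. apply filter_le_within. exact (H Q HQ). Qed.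

Definition loop_pair (g0 g1 : R -> C) : Prop :=
  smooth_loop g0 /\ smooth_loop g1 /\ clockwise g0 /\ clockwise g1 /\
  (forall z, ~ (on_or_inside g0 z /\ on_or_inside g1 z)).

Lemma loop_pair_sym (g0 g1 : R -> C) : loop_pair g0 g1 -> loop_pair g1 g0.
Proof. intros [A [B [D [E F]]]]. refine (conj B (conj A (conj E (conj D _)))). intros z [X Y]; apply (F z); tauto. Qed.

Lemma near_loop (g0 g1 : R -> C) (t : R) : loop_pair g0 g1 ->
  exists d, 0 < d /\ forall z, Cmod (z - g0 t) < d -> ~ on_or_inside g1 z.
Proof.
intros [H0 [H1 [C0 [C1 Hd]]]].
assert (Hn : ~ on_or_inside g1 (g0 t)) by (intros X; apply (Hd (g0 t)); split; [left; exists t; reflexivity|exact X]).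
destruct (encircles_locally g1 (g0 t) H1 C1) as [d [Hd0 Hd1]].
{ intros X; apply Hn; left; exact X. }
exists d; split; [exact Hd0|]. intros z Hz [X|X]; destruct (Hd1 z Hz) as [A B]; [exact (A X)|].
apply Hn; right; exact (proj1 B X).
Qed.

(* The solution of the problem with jumps A0 + B0 across g0 and A1 + B1 across g1. *)
Definition pieces (g0 g1 : R -> C) (A0 B0 A1 B1 m : C -> C) : Prop :=
  (forall z, encircles g0 z -> m z = A1 z - B0 z)%C /\
  (forall z, encircles g1 z -> m z = A0 z - B1 z)%C /\
  (forall z, outside g0 g1 z -> m z = A0 z + A1 z)%C.

Definition analytic_off (g : R -> C) (f : C -> C) : Prop :=
  forall z, ~ encircles g z -> exists l, Cderiv f z l.

Lemma analytic_off_continuous (g : R -> C) (f : C -> C) (z : C) :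
  analytic_off g f -> ~ encircles g z -> continuous f z.
Proof. intros H Hz. destruct (H z Hz) as [l Hl]. eapply Cderiv_continuous, Hl. Qed.

Lemma pieces_sym (g0 g1 : R -> C) (A0 B0 A1 B1 m : C -> C) :
  pieces g0 g1 A0 B0 A1 B1 m -> pieces g1 g0 A1 B1 A0 B0 m.
Proof.
intros [H1 [H2 H3]]. refine (conj H2 (conj H1 _)). intros z [Hz1 Hz2].
rewrite (H3 z (conj Hz2 Hz1)). ring.
Qed.

Lemma pieces_exists (g0 g1 : R -> C) (A0 B0 A1 B1 : C -> C) : loop_pair g0 g1 ->
  exists m, pieces g0 g1 A0 B0 A1 B1 m.
Proof.
intros [_ [_ [_ [_ Hd]]]].
exists (fun z => if excluded_middle_informative (encircles g0 z) then (A1 z - B0 z)%C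
  else if excluded_middle_informative (encircles g1 z) then (A0 z - B1 z)%C else (A0 z + A1 z)%C).
split; [|split]; intros z Hz.
- destruct excluded_middle_informative as [E|E]; [reflexivity|elim (E Hz)].
- destruct excluded_middle_informative as [E|E].
  + exfalso; apply (Hd z); split; right; assumption.
  + destruct excluded_middle_informative as [E'|E']; [reflexivity|elim (E' Hz)].
- destruct excluded_middle_informative as [E|E]; [exfalso; apply (proj1 Hz); right; exact E|].
  destruct excluded_middle_informative as [E'|E']; [exfalso; apply (proj2 Hz); right; exact E'|reflexivity].
Qed.

Lemma encircles_ball (g : R -> C) (z : C) : smooth_loop g -> clockwise g -> encircles g z ->
  locally z (encircles g).
Proof.
intros Hg Hc Hz. destruct (encircles_locally g z Hg Hc (proj1 Hz)) as [d [Hd H]].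
apply locally_Cmod. exists d; split; [exact Hd|]. intros w Hw. apply H; assumption.
Qed.
Lemma outside_ball (g : R -> C) (z : C) : smooth_loop g -> clockwise g -> ~ on_or_inside g z ->
  locally z (fun w => ~ on_or_inside g w).
Proof.
intros Hg Hc Hz. destruct (encircles_locally g z Hg Hc) as [d [Hd H]].
{ intros X; apply Hz; left; exact X. }
apply locally_Cmod. exists d; split; [exact Hd|]. intros w Hw [X|X]; destruct (H w Hw) as [P Q]; [exact (P X)|].
apply Hz; right; exact (proj1 Q X).
Qed.

Lemma pieces_derivable (g0 g1 : R -> C) (A0 B0 A1 B1 m : C -> C) (z : C) : loop_pair g0 g1 ->
  analytic_off g0 A0 -> analytic_off g1 B0 -> analytic_off g1 A1 -> analytic_off g0 B1 ->
  pieces g0 g1 A0 B0 A1 B1 m -> off_loops g0 g1 z -> exists l, Cderiv m z l.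
Proof.
intros Hp HA0 HB0 HA1 HB1 [P0 [P1 P2]] [N0 N1]. destruct Hp as [H0 [H1 [C0 [C1 Hd]]]].
assert (Hex : forall f h, (exists l, Cderiv f z l) -> locally z (fun w => f w = h w) -> exists l, Cderiv h z l).
{ intros f h [l Hl] E. exists l. eapply Cderiv_ext_loc; eassumption. }
destruct (classic (encircles g0 z)) as [E0|E0]; [|destruct (classic (encircles g1 z)) as [E1|E1]].
- assert (E1 : ~ encircles g1 z) by (intros X; apply (Hd z); split; right; assumption).
  apply Hex with (fun w => A1 w - B0 w)%C.
  + destruct (HA1 z E1) as [l Hl], (HB0 z E1) as [l' Hl']. eexists; apply Cderiv_minus; eassumption.
  + generalize (encircles_ball g0 z H0 C0 E0). apply filter_imp. intros w Hw; symmetry; apply P0, Hw.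
- apply Hex with (fun w => A0 w - B1 w)%C.
  + destruct (HA0 z E0) as [l Hl], (HB1 z E0) as [l' Hl']. eexists; apply Cderiv_minus; eassumption.
  + generalize (encircles_ball g1 z H1 C1 E1). apply filter_imp. intros w Hw; symmetry; apply P1, Hw.
- apply Hex with (fun w => A0 w + A1 w)%C.
  + destruct (HA0 z E0) as [l Hl], (HA1 z E1) as [l' Hl']. eexists; apply Cderiv_plus; eassumption.
  + generalize (@filter_and _ _ (@filter_filter _ _ (locally_filter (z : C_UniformSpace))) _ _
      (outside_ball g0 z H0 C0 (fun X => match X with or_introl Y => N0 Y | or_intror Y => E0 Y end))
      (outside_ball g1 z H1 C1 (fun X => match X with or_introl Y => N1 Y | or_intror Y => E1 Y end))).
    apply filter_imp. intros w Hw; symmetry; apply P2, Hw.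
Qed.

Lemma pieces_inside (g0 g1 : R -> C) (A0 B0 A1 B1 m : C -> C) : loop_pair g0 g1 ->
  analytic_off g1 B0 -> analytic_off g1 A1 -> pieces g0 g1 A0 B0 A1 B1 m ->
  continuous_up_to (encircles g0) (fun p => on_loop g0 p \/ on_loop g1 p) m.
Proof.
intros Hp HB0 HA1 [P0 _] p [[t <-]|[t <-]].
- destruct (near_loop g0 g1 t Hp) as [d [Hd H]].
  assert (E1 : ~ encircles g1 (g0 t)).
  { intros X. apply (H (g0 t)); [|right; exact X]. replace (g0 t - g0 t)%C with (RtoC 0) by ring. rewrite Cmod_0; exact Hd. }
  exists (A1 (g0 t) - B0 (g0 t))%C.
  apply (filterlim_within_near (encircles g0) _ _ _ (fun w => A1 w - B0 w)%C m 1); [lra| |].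
  + intros w _ Hw. split; [exact Hw|apply P0, Hw].
  + apply (continuous_within _ _ (fun w => A1 w - B0 w)%C).
    apply continuous_Cminus; [exact (analytic_off_continuous g1 A1 _ HA1 E1)|exact (analytic_off_continuous g1 B0 _ HB0 E1)].
- destruct (near_loop g1 g0 t (loop_pair_sym _ _ Hp)) as [d [Hd H]].
  (* Near a point of g1 no point is encircled by g0: the filter is improper and any value is a
     limit. *)
  exists (RtoC 0). apply filterlim_within. intros e He. exists d; split; [exact Hd|].
  intros w Hw X. exfalso. apply (H w Hw). right; exact X.
Qed.

Lemma loop_not_encircled (g : R -> C) (t : R) : ~ encircles g (g t).
Proof. intros [X _]. apply X. exists t; reflexivity. Qed.

Lemma loop_not_encircled' (g0 g1 : R -> C) (t : R) : loop_pair g0 g1 -> ~ encircles g1 (g0 t).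
Proof. intros [_ [_ [_ [_ Hd]]]] X. apply (Hd (g0 t)). split; [left; exists t; reflexivity|right; exact X]. Qed.

Lemma pieces_outside (g0 g1 : R -> C) (A0 B0 A1 B1 m : C -> C) : loop_pair g0 g1 ->
  analytic_off g0 A0 -> analytic_off g1 A1 -> pieces g0 g1 A0 B0 A1 B1 m ->
  continuous_up_to (outside g0 g1) (fun p => on_loop g0 p \/ on_loop g1 p) m.
Proof.
intros Hp HA0 HA1 [_ [_ P2]] p Hp'.
assert (E : ~ encircles g0 p /\ ~ encircles g1 p).
{ destruct Hp' as [[t <-]|[t <-]]; split; try apply loop_not_encircled; apply loop_not_encircled';
  [exact Hp|apply loop_pair_sym, Hp]. }
exists (A0 p + A1 p)%C.
apply (filterlim_within_near (outside g0 g1) _ _ _ (fun w => A0 w + A1 w)%C m 1); [lra| |].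
- intros w _ Hw. split; [exact Hw|apply P2, Hw].
- apply (continuous_within _ _ (fun w => A0 w + A1 w)%C).
  apply continuous_Cplus; [exact (analytic_off_continuous g0 A0 _ HA0 (proj1 E))|exact (analytic_off_continuous g1 A1 _ HA1 (proj2 E))].
Qed.

(** The left side of a clockwise loop is its outside, so the jump is (A0 + A1) - (A1 - B0). *)
Lemma pieces_jump (g0 g1 : R -> C) (A0 B0 A1 B1 m : C -> C) (v : C -> C -> Prop) : loop_pair g0 g1 ->
  analytic_off g0 A0 -> analytic_off g1 B0 -> analytic_off g1 A1 -> pieces g0 g1 A0 B0 A1 B1 m ->
  (forall z, on_loop g0 z -> v z (A0 z + B0 z)%C) -> jump_across g0 v m.
Proof.
intros Hp HA0 HB0 HA1 [P0 [_ P2]] Hv t.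
assert (E1 := loop_not_encircled' g0 g1 t Hp). assert (E0 := loop_not_encircled g0 t).
destruct (near_loop g0 g1 t Hp) as [d [Hd Hnear]]. destruct Hp as [H0 [H1 [C0 [C1 Hdis]]]].
exists (A0 (g0 t) + A1 (g0 t))%C, (A1 (g0 t) - B0 (g0 t))%C, (A0 (g0 t) + B0 (g0 t))%C.
repeat split.
- intros c Hc. destruct (left_sector_spec g0 t c H0 C0 Hc) as [d' [Hd' Hs]].
  apply (filterlim_within_near (fun _ => True) _ _ _ (fun w => A0 w + A1 w)%C m (Rmin d d')); [apply Rmin_pos; lra| |].
  + intros w Hw Hsec. split; [exact I|]. assert (M1 := Rmin_l d d'). assert (M2 := Rmin_r d d').
    apply P2. split; [apply Hs; [lra|exact Hsec]|apply Hnear; lra].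
  + apply (continuous_within _ _ (fun w => A0 w + A1 w)%C).
    apply continuous_Cplus; [exact (analytic_off_continuous g0 A0 _ HA0 E0)|exact (analytic_off_continuous g1 A1 _ HA1 E1)].
- intros c Hc. destruct (right_sector_spec g0 t c H0 C0 Hc) as [d' [Hd' Hs]].
  apply (filterlim_within_near (fun _ => True) _ _ _ (fun w => A1 w - B0 w)%C m d'); [lra| |].
  + intros w Hw Hsec. split; [exact I|]. apply P0. apply Hs; assumption.
  + apply (continuous_within _ _ (fun w => A1 w - B0 w)%C).
    apply continuous_Cminus; [exact (analytic_off_continuous g1 A1 _ HA1 E1)|exact (analytic_off_continuous g1 B0 _ HB0 E1)].
- apply Hv. exists t; reflexivity.
- ring.
Qed.

(** Each sector lies in one side of the loop, so the nontangential values in [jump_across] coincide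
    with the full limits from the two sides. *)
Lemma jump_limits (g0 g1 : R -> C) (v : C -> C -> Prop) (m : C -> C) (t : R) : loop_pair g0 g1 ->
  continuous_up_to (encircles g0) (fun p => on_loop g0 p \/ on_loop g1 p) m ->
  continuous_up_to (outside g0 g1) (fun p => on_loop g0 p \/ on_loop g1 p) m ->
  jump_across g0 v m ->
  exists l w, v (g0 t) w /\
    filterlim m (within (encircles g0) (locally (g0 t))) (locally l) /\
    filterlim m (within (outside g0 g1) (locally (g0 t))) (locally (l + w)%C).
Proof.
intros Hp Hi Ho Hj. destruct (near_loop g0 g1 t Hp) as [d [Hd Hnear]]. destruct Hp as [H0 [H1 [C0 [C1 Hdis]]]].
destruct (Hi (g0 t)) as [li Hli]; [left; exists t; reflexivity|].
destruct (Ho (g0 t)) as [lo Hlo]; [left; exists t; reflexivity|].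
destruct (Hj t) as [mp [mm [w [Hmp [Hmm [Hw E]]]]]].
assert (Hhalf : 0 < / 2) by lra.
destruct (left_sector_spec g0 t _ H0 C0 Hhalf) as [d1 [Hd1 Hs1]].
destruct (right_sector_spec g0 t _ H0 C0 Hhalf) as [d2 [Hd2 Hs2]].
assert (E1 : mp = lo).
{ apply (filterlim_within_unique (left_sector g0 t (/ 2)) (g0 t) mp lo m).
  - intros e He. apply (proj1 (sector_points g0 t e H0 He)).
  - apply Hmp, Hhalf.
  - apply (filterlim_within_near (outside g0 g1) _ _ _ m m (Rmin d d1)); [apply Rmin_pos; lra| |exact Hlo].
    intros z Hz Hsec. split; [|reflexivity]. assert (M1 := Rmin_l d d1). assert (M2 := Rmin_r d d1).
    split; [apply Hs1; [lra|exact Hsec]|apply Hnear; lra]. }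
assert (E2 : mm = li).
{ apply (filterlim_within_unique (right_sector g0 t (/ 2)) (g0 t) mm li m).
  - intros e He. apply (proj2 (sector_points g0 t e H0 He)).
  - apply Hmm, Hhalf.
  - apply (filterlim_within_near (encircles g0) _ _ _ m m d2); [lra| |exact Hli].
    intros z Hz Hsec. split; [|reflexivity]. apply Hs2; assumption. }
exists li, w. split; [exact Hw|]. split; [exact Hli|]. rewrite <- E2, <- E, E1. exact Hlo.
Qed.

Lemma difference_limit (g0 g1 : R -> C) (v : C -> C -> Prop) (m m' : C -> C) (t : R) : loop_pair g0 g1 ->
  (forall w w', v (g0 t) w -> v (g0 t) w' -> w = w') ->
  continuous_up_to (encircles g0) (fun p => on_loop g0 p \/ on_loop g1 p) m ->
  continuous_up_to (outside g0 g1) (fun p => on_loop g0 p \/ on_loop g1 p) m ->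
  jump_across g0 v m ->
  continuous_up_to (encircles g0) (fun p => on_loop g0 p \/ on_loop g1 p) m' ->
  continuous_up_to (outside g0 g1) (fun p => on_loop g0 p \/ on_loop g1 p) m' ->
  jump_across g0 v m' ->
  exists l, filterlim (fun z => m' z - m z)%C (within (off_loops g0 g1) (locally (g0 t))) (locally l).
Proof.
intros Hp Hv A1 A2 A3 B1 B2 B3.
destruct (jump_limits g0 g1 v m t Hp A1 A2 A3) as [l [w [Hw [L1 L2]]]].
destruct (jump_limits g0 g1 v m' t Hp B1 B2 B3) as [l' [w' [Hw' [L1' L2']]]].
rewrite <- (Hv w w' Hw Hw') in L2'.
destruct (near_loop g0 g1 t Hp) as [d [Hd Hnear]].
exists (l' - l)%C. apply filterlim_within. intros e He.
rewrite filterlim_within in L1, L2, L1', L2'.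
destruct (L1 (e / 2) ltac:(lra)) as [d1 [Hd1 Q1]]. destruct (L2 (e / 2) ltac:(lra)) as [d2 [Hd2 Q2]].
destruct (L1' (e / 2) ltac:(lra)) as [d3 [Hd3 Q3]]. destruct (L2' (e / 2) ltac:(lra)) as [d4 [Hd4 Q4]].
exists (Rmin d (Rmin (Rmin d1 d2) (Rmin d3 d4))). split; [repeat apply Rmin_pos; lra|].
intros z Hz [N0 N1].
assert (Hz' : Cmod (z - g0 t) < d /\ Cmod (z - g0 t) < d1 /\ Cmod (z - g0 t) < d2 /\ Cmod (z - g0 t) < d3 /\ Cmod (z - g0 t) < d4).
{ revert Hz. unfold Rmin. repeat destruct Rle_dec; lra. }
destruct Hz' as [Z0 [Z1 [Z2 [Z3 Z4]]]].
assert (Tri : forall a b c' : C, Cmod (m' z - a) < e / 2 -> Cmod (m z - b) < e / 2 -> (a - b)%C = c' -> Cmod (m' z - m z - c') < e).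
{ intros a b c' Ha Hb <-. replace (m' z - m z - (a - b))%C with ((m' z - a) + - (m z - b))%C by ring.
  eapply Rle_lt_trans; [apply Cmod_triangle|]. rewrite Cmod_opp. lra. }
destruct (classic (encircles g0 z)) as [E0|E0].
- apply (Tri l' l); [apply Q3|apply Q1|ring]; assumption.
- assert (Ho : outside g0 g1 z) by (split; [intros [X|X]; tauto|apply Hnear, Z0]).
  apply (Tri (l' + w)%C (l + w)%C); [apply Q4|apply Q2|ring]; assumption.
Qed.

Lemma off_loops_dense (g0 g1 : R -> C) (p : C) (d : R) : loop_pair g0 g1 -> 0 < d ->
  exists w, Cmod (w - p) < d /\ off_loops g0 g1 w.
Proof.
assert (Hone : forall g0 g1 t d, loop_pair g0 g1 -> 0 < d -> exists w, Cmod (w - g0 t) < d /\ off_loops g0 g1 w).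
{ clear. intros g0 g1 t d Hp Hd. destruct (near_loop g0 g1 t Hp) as [d1 [Hd1 Hnear]].
  destruct Hp as [H0 [H1 [C0 [C1 Hdis]]]].
  destruct (left_sector_spec g0 t (/ 2) H0 C0 ltac:(lra)) as [d2 [Hd2 Hs]].
  destruct (proj1 (sector_points g0 t (Rmin d (Rmin d1 d2)) H0 ltac:(repeat apply Rmin_pos; lra))) as [w [Hw Hsec]].
  assert (Hw' : Cmod (w - g0 t) < d /\ Cmod (w - g0 t) < d1 /\ Cmod (w - g0 t) < d2).
  { revert Hw. unfold Rmin. repeat destruct Rle_dec; lra. }
  exists w. split; [tauto|]. split; intros X.
  - apply (Hs w); [tauto|exact Hsec|left; exact X].
  - apply (Hnear w); [tauto|left; exact X]. }
intros Hp Hd.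
destruct (classic (on_loop g0 p)) as [[t <-]|N0]; [apply Hone; assumption|].
destruct (classic (on_loop g1 p)) as [[t <-]|N1].
- destruct (Hone g1 g0 t d (loop_pair_sym _ _ Hp) Hd) as [w [Hw [X Y]]]. exists w; split; [exact Hw|split; assumption].
- exists p. split; [|split; assumption]. replace (p - p)%C with (RtoC 0) by ring. rewrite Cmod_0; exact Hd.
Qed.

(** Outside the loops m consists of [A0] and [A1], and the decay condition concerns these. In the
    application [B0] contains the constant 1 of [beta], but it occurs in m only inside g0. *)
Theorem scalar_RH (g0 g1 : R -> C) (v0 v1 : C -> C -> Prop) (A0 B0 A1 B1 : C -> C) : loop_pair g0 g1 ->
  ~ on_or_inside g0 (RtoC 0) -> ~ on_or_inside g1 (RtoC 0) ->
  analytic_off g0 A0 -> analytic_off g1 B0 -> analytic_off g1 A1 -> analytic_off g0 B1 ->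
  (exists M r, 0 < r /\ forall z, r < Cmod z -> Cmod (A0 z) <= M / Cmod z /\ Cmod (A1 z) <= M / Cmod z) ->
  (forall z w, on_loop g0 z -> (v0 z w <-> w = (A0 z + B0 z)%C)) ->
  (forall z w, on_loop g1 z -> (v1 z w <-> w = (A1 z + B1 z)%C)) ->
  exists m, unique_RH_solution g0 g1 v0 v1 m /\ m (RtoC 0) = (A0 (RtoC 0) + A1 (RtoC 0))%C.
Proof.
intros Hp Z0 Z1 HA0 HB0 HA1 HB1 [M [r [Hr Hdecay]]] Hv0 Hv1.
assert (Hps := loop_pair_sym _ _ Hp).
destruct (pieces_exists g0 g1 A0 B0 A1 B1 Hp) as [m Hm]. assert (Hms := pieces_sym _ _ _ _ _ _ _ Hm).
assert (Hp' := Hp). destruct Hp' as [H0 [H1 [C0 [C1 Hdis]]]].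
destruct (encircles_far g0 H0 C0) as [r0 [Hr0 Hf0]]. destruct (encircles_far g1 H1 C1) as [r1 [Hr1 Hf1]].
assert (Hout : forall (m : C -> C), continuous_up_to (outside g1 g0) (fun p => on_loop g1 p \/ on_loop g0 p) m <->
  continuous_up_to (outside g0 g1) (fun p => on_loop g0 p \/ on_loop g1 p) m).
{ intros f. split; intros H p Hpp; destruct (H p (proj1 (or_comm _ _) Hpp)) as [l Hl]; exists l.
  - refine (filterlim_within_near (outside g1 g0) (outside g0 g1) p l f f 1 Rlt_0_1 _ Hl).
    intros w _ [X Y]; split; [exact (conj Y X)|reflexivity].
  - refine (filterlim_within_near (outside g0 g1) (outside g1 g0) p l f f 1 Rlt_0_1 _ Hl).
    intros w _ [X Y]; split; [exact (conj Y X)|reflexivity]. }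
assert (Hin : forall (E : C -> Prop) (m : C -> C), continuous_up_to E (fun p => on_loop g1 p \/ on_loop g0 p) m <->
  continuous_up_to E (fun p => on_loop g0 p \/ on_loop g1 p) m).
{ intros E f. split; intros H p Hpp; exact (H p (proj1 (or_comm _ _) Hpp)). }
assert (Hsol : RH_solution g0 g1 v0 v1 m).
{ split; [|split; [|split; [|split; [|split; [|split]]]]].
  - intros z N0 N1. apply Cderiv_ex. exact (pieces_derivable g0 g1 A0 B0 A1 B1 m z Hp HA0 HB0 HA1 HB1 Hm (conj N0 N1)).
  - exact (pieces_inside g0 g1 A0 B0 A1 B1 m Hp HB0 HA1 Hm).
  - apply Hin. exact (pieces_inside g1 g0 A1 B1 A0 B0 m Hps HB1 HA0 Hms).
  - exact (pieces_outside g0 g1 A0 B0 A1 B1 m Hp HA0 HA1 Hm).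
  - apply (pieces_jump g0 g1 A0 B0 A1 B1 m v0 Hp HA0 HB0 HA1 Hm). intros z Hz. apply Hv0; [exact Hz|reflexivity].
  - apply (pieces_jump g1 g0 A1 B1 A0 B0 m v1 Hps HA1 HB1 HA0 Hms). intros z Hz. apply Hv1; [exact Hz|reflexivity].
  - exists (2 * M), (r + r0 + r1). split; [lra|]. intros z Hz N0 N1.
    destruct Hm as [_ [_ P2]]. rewrite P2.
    + eapply Rle_trans; [apply Cmod_triangle|]. destruct (Hdecay z ltac:(lra)). 
      replace (2 * M / Cmod z) with (M / Cmod z + M / Cmod z) by (unfold Rdiv; ring). lra.
    + destruct (Hf0 z ltac:(lra)), (Hf1 z ltac:(lra)). split; intros [X|X]; tauto. }
exists m. split.
2: { destruct Hm as [_ [_ P2]]. apply P2. split; assumption. }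
split; [exact Hsol|]. intros m' Hsol'.
destruct Hsol as [S1 [S2 [S3 [S4 [S5 [S6 [M1 [q1 [Hq1 S7]]]]]]]]].
destruct Hsol' as [T1 [T2 [T3 [T4 [T5 [T6 [M2 [q2 [Hq2 T7]]]]]]]]].
set (D0 := fun z => (m' z - m z)%C).
assert (HD0 : forall z, off_loops g0 g1 z -> exists l, Cderiv D0 z l).
{ intros z [N0 N1]. destruct (proj1 (Cderiv_ex _ _) (S1 z N0 N1)) as [l Hl].
  destruct (proj1 (Cderiv_ex _ _) (T1 z N0 N1)) as [l' Hl']. eexists; apply Cderiv_minus; eassumption. }
assert (Hlim : forall p, exists l, filterlim D0 (within (off_loops g0 g1) (locally p)) (locally l) /\
   (off_loops g0 g1 p -> l = D0 p)).
{ intros p. destruct (classic (off_loops g0 g1 p)) as [Ho|Ho].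
  - exists (D0 p). split; [|reflexivity]. apply continuous_within. destruct (HD0 p Ho) as [l Hl]. eapply Cderiv_continuous, Hl.
  - assert (Hor : on_loop g0 p \/ on_loop g1 p) by (unfold off_loops in Ho; tauto).
    destruct Hor as [[t <-]|[t <-]].
    + assert (Huniq : forall w w', v0 (g0 t) w -> v0 (g0 t) w' -> w = w').
      { intros w w' Hw Hw'. apply Hv0 in Hw; [|exists t; reflexivity]. apply Hv0 in Hw'; [congruence|exists t; reflexivity]. }
      destruct (difference_limit g0 g1 v0 m m' t Hp Huniq S2 S4 S5 T2 T4 T5) as [l Hl].
      exists l; split; [exact Hl|tauto].
    + assert (Huniq : forall w w', v1 (g1 t) w -> v1 (g1 t) w' -> w = w').
      { intros w w' Hw Hw'. apply Hv1 in Hw; [|exists t; reflexivity]. apply Hv1 in Hw'; [congruence|exists t; reflexivity]. }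
      destruct (difference_limit g1 g0 v1 m m' t Hps Huniq (proj2 (Hin _ m) S3) (proj2 (Hout m) S4) S6
        (proj2 (Hin _ m') T3) (proj2 (Hout m') T4) T6) as [l Hl].
      exists l; split; [|tauto]. eapply (filterlim_within_near _ _ _ _ _ D0 1); [lra| |exact Hl].
        intros w _ [X Y]; split; [exact (conj Y X)|reflexivity]. }

(* The extension of [D0] by its limits along the complement of the loops. It is continuous because
   this complement is dense. *)
destruct (classic (exists D : C -> C, forall p, filterlim D0 (within (off_loops g0 g1) (locally p)) (locally (D p)) /\
   (off_loops g0 g1 p -> D p = D0 p))) as [[D HD]|HnD].
2: { exfalso; apply HnD. exists (fun p => proj1_sig (constructive_indefinite_description _ (Hlim p))).
     intros p. destruct constructive_indefinite_description as [l Hl]. exact Hl. }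
assert (HDc : forall p, continuous D p).
{ intros p. apply continuous_Cmod. intros e He. destruct (HD p) as [Hp1 _]. rewrite filterlim_within in Hp1.
  destruct (Hp1 (e / 2) ltac:(lra)) as [d [Hd Hd1]]. exists d; split; [exact Hd|]. intros q Hq.
  destruct (HD q) as [Hq' _]. rewrite filterlim_within in Hq'.
  destruct (Hq' (e / 2) ltac:(lra)) as [d' [Hd' Hd1']].
  destruct (off_loops_dense g0 g1 q (Rmin d' (d - Cmod (q - p))) Hp ltac:(apply Rmin_pos; lra)) as [w [Hw Ow]].
  assert (L1 := Rmin_l d' (d - Cmod (q - p))). assert (L2 := Rmin_r d' (d - Cmod (q - p))).
  assert (Hwp : Cmod (w - p) < d).
  { replace (w - p)%C with ((w - q) + (q - p))%C by ring. eapply Rle_lt_trans; [apply Cmod_triangle|]. lra. }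
  specialize (Hd1 w Hwp Ow). specialize (Hd1' w ltac:(lra) Ow).
  replace (D q - D p)%C with (- (D0 w - D q) + (D0 w - D p))%C by ring.
  eapply Rle_lt_trans; [apply Cmod_triangle|]. rewrite Cmod_opp. lra. }
destruct (loop_thin g0 H0) as [K0 HK0]. destruct (loop_thin g1 H1) as [K1 HK1].
assert (HDd : forall z, ~ (on_loop g0 z \/ on_loop g1 z) -> exists l, Cderiv D z l).
{ intros z Hz. assert (Ho : off_loops g0 g1 z) by (unfold off_loops; tauto).
  destruct (HD0 z Ho) as [l Hl]. exists l. eapply Cderiv_ext_loc; [|exact Hl].
  destruct (encircles_locally g0 z H0 C0 (proj1 Ho)) as [d [Hd Q]].
  destruct (encircles_locally g1 z H1 C1 (proj2 Ho)) as [d' [Hd' Q']].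
  apply locally_Cmod. exists (Rmin d d'). split; [apply Rmin_pos; lra|]. intros w Hw.
  assert (L1 := Rmin_l d d'). assert (L2 := Rmin_r d d').
  symmetry. apply HD. split; [exact (proj1 (Q w ltac:(lra)))|exact (proj1 (Q' w ltac:(lra)))]. }
assert (Hfin := thin_liouville D _ _ (M1 + M2) (q1 + q2 + r0 + r1) (thin_union _ _ _ _ HK0 HK1) ltac:(lra) HDc HDd).
intros z N0 N1.
assert (E : D z = RtoC 0).
{ apply Hfin; [|tauto]. intros w Hw. destruct (Hf0 w ltac:(lra)) as [X0 _]. destruct (Hf1 w ltac:(lra)) as [X1 _].
  rewrite (proj2 (HD w) (conj X0 X1)). unfold D0, Cminus.
  eapply Rle_trans; [apply Cmod_triangle|]. rewrite Cmod_opp.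
  assert (Y1 := S7 w ltac:(lra) X0 X1). assert (Y2 := T7 w ltac:(lra) X0 X1).
  replace ((M1 + M2) / Cmod w) with (M1 / Cmod w + M2 / Cmod w) by (unfold Rdiv; ring). lra. }
rewrite (proj2 (HD z) (conj N0 N1)) in E.
replace (m' z) with (D0 z + m z)%C by (unfold D0; ring). rewrite E. ring.
Qed.

(** * Integrals depending on a parameter *)

(** Joint continuity at each (s, p0) gives a gauge on [a, b]; [compactness_value_1d] turns it into
    one neighbourhood of p0. *)
Lemma tube {T : UniformSpace} {V : NormedModule R_AbsRing} (h : R -> T -> V) (a b : R) (p0 : T) (e : R) :
  0 < e ->
  (forall s, a <= s <= b -> continuous (fun q : R * T => h (fst q) (snd q)) (s, p0)) ->
  locally p0 (fun p => forall s, a <= s <= b -> norm (minus (h s p) (h s p0)) < e).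
Proof.
intros He Hc.
assert (Hd : forall s, exists d : posreal, a <= s <= b -> forall s' p, Rabs (s' - s) < d -> ball p0 d p ->
  norm (minus (h s' p) (h s p0)) < e / 2).
{ intros s. destruct (classic (a <= s <= b)) as [Hs|Hs]; [|exists (mkposreal 1 Rlt_0_1); tauto].
  assert (He2 : 0 < e / 2) by lra.
  destruct (proj1 (filterlim_locally_ball_norm _ _) (Hc s Hs) (mkposreal _ He2)) as [d H].
  exists d. intros _ s' p Hs' Hp. apply (H (s', p)). split; [exact Hs'|exact Hp]. }
set (delta := fun s => proj1_sig (constructive_indefinite_description _ (Hd s))).
assert (Hdelta : forall s, a <= s <= b -> forall s' p, Rabs (s' - s) < delta s -> ball p0 (delta s) p ->
  norm (minus (h s' p) (h s p0)) < e / 2).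
{ intros s. unfold delta. destruct constructive_indefinite_description as [d H]. exact H. }
destruct (compactness_value_1d a b delta) as [d H].
exists d. intros p Hp s Hs. apply NNPP. intros Hn. apply (H s Hs). intros [t [Ht [H1 H2]]]. apply Hn.
assert (N1 := Hdelta t Ht s p H1 (ball_le _ _ _ H2 _ Hp)).
assert (N2 := Hdelta t Ht s p0 H1 (ball_center _ _)).
replace (minus (h s p) (h s p0)) with (plus (minus (h s p) (h t p0)) (opp (minus (h s p0) (h t p0)))).
- eapply Rle_lt_trans; [apply norm_triangle|]. rewrite norm_opp. lra.
- rewrite opp_minus. symmetry; apply minus_trans.
Qed.

Lemma continuous_RInt_parameter {T : UniformSpace} {V : CompleteNormedModule R_AbsRing}
  (h : R -> T -> V) (a b : R) (p0 : T) : a <= b ->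
  (forall s, a <= s <= b -> continuous (fun q : R * T => h (fst q) (snd q)) (s, p0)) ->
  locally p0 (fun p => ex_RInt (fun s => h s p) a b) ->
  continuous (fun p => RInt (fun s => h s p) a b) p0.
Proof.
intros Hab Hc Hex. refine (proj2 (filterlim_locally_ball_norm (K := R_AbsRing) (U := CompleteNormedModule.NormedModule _ V) _ _) _). intros [e He]. simpl.
assert (He' : 0 < e / (2 * (b - a + 1))) by (apply Rdiv_lt_0_compat; lra).
generalize (filter_and _ _ Hex (tube h a b p0 _ He' Hc)). apply filter_imp. intros p [Hp Ht].
unfold ball_norm. assert (Hp0 : ex_RInt (fun s => h s p0) a b) by exact (locally_singleton _ _ Hex).
assert (HI := is_RInt_minus _ _ a b _ _ (RInt_correct _ a b Hp) (RInt_correct _ a b Hp0)).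
apply Rle_lt_trans with ((b - a) * (e / (2 * (b - a + 1)))).
- refine (norm_RInt_le_const _ a b _ _ Hab _ HI).
  intros s Hs. apply Rlt_le. exact (Ht s Hs).
- simpl. apply Rmult_lt_reg_r with (2 * (b - a + 1)); [lra|].
  replace ((b - a) * (e / (2 * (b - a + 1))) * (2 * (b - a + 1))) with ((b - a) * e) by (field; lra). nra.
Qed.

Lemma continuous_RInt_everywhere {T : UniformSpace} {V : CompleteNormedModule R_AbsRing}
  (h : R -> T -> V) (a b : R) (p0 : T) : a <= b ->
  locally p0 (fun p => forall s, a <= s <= b -> continuous (fun q : R * T => h (fst q) (snd q)) (s, p)) ->
  continuous (fun p => RInt (fun s => h s p) a b) p0.
Proof.
intros Hab H. apply continuous_RInt_parameter; [exact Hab|exact (locally_singleton _ _ H)|].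
revert H. apply filter_imp. intros p Hp. apply ex_RInt_continuous.
rewrite Rmin_left, Rmax_right by lra. intros s Hs.
apply (continuous_comp_2 (fun s => s) (fun _ => p) (fun s p => h s p)); [apply continuous_id|apply continuous_const|apply Hp, Hs].
Qed.

(** The slope of the integral is the integral of the slopes, and this is continuous as a parameter
    integral. *)
Lemma Cderiv_CInt (h phi : R -> C -> C) (a b : R) (z : C) : a <= b ->
  locally z (fun w => forall s, a <= s <= b -> (h s w - h s z = phi s w * (w - z))%C) ->
  locally z (fun w => ex_CInt (fun s => h s w) a b) ->
  locally z (fun w => forall s, a <= s <= b -> continuous (fun q : R * C => phi (fst q) (snd q)) (s, w)) ->
  Cderiv (fun w => CInt (fun s => h s w) a b) z (CInt (fun s => phi s z) a b).
Proof.
intros Hab Hs Hex Hc. apply Cderiv_slope. exists (fun w => CInt (fun s => phi s w) a b).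
split; [|split; [reflexivity|]].
- apply (continuous_RInt_everywhere (V := C_R_CompleteNormedModule) phi); assumption.
- assert (Hexz : ex_CInt (fun s => h s z) a b) by exact (locally_singleton _ _ Hex).
  generalize (filter_and _ _ Hs (filter_and _ _ Hex Hc)). apply filter_imp. intros w [E [Hw Hcw]].
  rewrite <- CInt_minus by assumption.
  rewrite (CInt_ext _ (fun s => (w - z) * phi s w)%C); [|exact Hab|].
  + rewrite CInt_scal; [eq_in C; ring|]. apply ex_CInt_continuous; [exact Hab|]. intros s Hs'.
    apply (continuous_comp_2 (fun s : R => s) (fun _ => w) (fun s p => phi s p)); [apply continuous_id|apply continuous_const|apply Hcw, Hs'].
  + intros s Hs'. rewrite (E s Hs'). ring.
Qed.

Lemma Cderiv_real (f : C -> C) (s : R) (l : C) : Cderiv f (RtoC s) l ->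
  is_derive (fun t : R => Re (f (RtoC t))) s (Re l) /\ is_derive (fun t : R => Im (f (RtoC t))) s (Im l).
Proof.
intros H.
assert (Hb : forall e, 0 < e -> exists d, 0 < d /\ forall t : R, Rabs (t - s) < d ->
  Cmod (f (RtoC t) - f (RtoC s) - RtoC (t - s) * l) <= e * Rabs (t - s)).
{ intros e He. destruct (H e He) as [d [Hd Hd']]. exists d; split; [exact Hd|]. intros t Ht.
  specialize (Hd' (RtoC t)). rewrite <- RtoC_minus, Cmod_R in Hd'. specialize (Hd' Ht).
  replace (RtoC (t - s) * l)%C with (l * RtoC (t - s))%C by ring. exact Hd'. }
split; (split; [apply is_linear_scal_l|]); intros x Hx;
  rewrite <- (is_filter_lim_locally_unique _ _ Hx); intros [e He];
  destruct (Hb e He) as [d [Hd Hd']]; exists (mkposreal d Hd); intros t Ht;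
  specialize (Hd' t Ht); (eapply Rle_trans; [|exact Hd']).
- eapply Rle_trans; [|apply re_le_Cmod]. apply Req_le. destruct (f (RtoC t)), (f (RtoC s)), l.
  simpl. unfold norm, minus, plus, opp, scal; simpl; unfold abs, mult; simpl. f_equal. ring.
- eapply Rle_trans; [|apply Im_le_Cmod]. apply Req_le. destruct (f (RtoC t)), (f (RtoC s)), l.
  simpl. unfold norm, minus, plus, opp, scal; simpl; unfold abs, mult; simpl. f_equal. ring.
Qed.

Lemma Cderiv_0_segment (f : C -> C) (a b : R) : a <= b ->
  (forall s, a <= s <= b -> Cderiv f (RtoC s) (RtoC 0)) -> f (RtoC b) = f (RtoC a).
Proof.
intros Hab H.
apply injective_projections.
- destruct (MVT_gen (fun t => Re (f (RtoC t))) a b (fun _ => 0)) as [c [_ E]].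
  + intros t Ht. rewrite Rmin_left, Rmax_right in Ht by lra. exact (proj1 (Cderiv_real f t _ (H t ltac:(lra)))).
  + intros t Ht. rewrite Rmin_left, Rmax_right in Ht by lra.
    apply continuity_pt_filterlim, (ex_derive_continuous (V := R_NormedModule) (fun t => Re (f (RtoC t)))). exists 0. exact (proj1 (Cderiv_real f t _ (H t ltac:(lra)))).
  + unfold Re in E. lra.
- destruct (MVT_gen (fun t => Im (f (RtoC t))) a b (fun _ => 0)) as [c [_ E]].
  + intros t Ht. rewrite Rmin_left, Rmax_right in Ht by lra. exact (proj2 (Cderiv_real f t _ (H t ltac:(lra)))).
  + intros t Ht. rewrite Rmin_left, Rmax_right in Ht by lra.
    apply continuity_pt_filterlim, (ex_derive_continuous (V := R_NormedModule) (fun t => Im (f (RtoC t)))). exists 0. exact (proj2 (Cderiv_real f t _ (H t ltac:(lra)))).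
  + unfold Im in E. lra.
Qed.

(** As functions of the upper limit b both sides vanish at a and have the same derivative. *)
Lemma RInt_fubini (F : R -> R -> R) (a b c d : R) : a <= b -> c <= d ->
  (forall x y, continuous (fun q : R * R => F (fst q) (snd q)) (x, y)) ->
  RInt (fun x => RInt (fun y => F x y) c d) a b = RInt (fun y => RInt (fun x => F x y) a b) c d.
Proof.
intros Hab Hcd HF.
assert (Hx : forall x y, continuous (fun x => F x y) x).
{ intros x y. apply (continuous_comp_2 (fun x => x) (fun _ => y) (fun x y => F x y)); [apply continuous_id|apply continuous_const|apply HF]. }
assert (Hy : forall x y, continuous (fun y => F x y) y).
{ intros x y. apply (continuous_comp_2 (fun _ => x) (fun y => y) (fun x y => F x y)); [apply continuous_const|apply continuous_id|apply HF]. }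
assert (Hin : forall x, continuous (fun x => RInt (fun y => F x y) c d) x).
{ intros x. apply (continuous_RInt_everywhere (V := R_CompleteNormedModule) (fun y x => F x y)); [exact Hcd|].
  apply filter_forall. intros x' y _.
  apply (continuous_comp_2 (fun q : R * R => snd q) (fun q : R * R => fst q) (fun x y => F x y)); [apply continuous_snd|apply continuous_fst|apply HF]. }
assert (Hexx : forall y u v, ex_RInt (fun x => F x y) u v)
  by (intros; apply (ex_RInt_continuous (V := R_CompleteNormedModule)); intros; apply Hx).
assert (Hout : forall X, is_derive (fun X => RInt (fun y => RInt (fun x => F x y) a X) c d) X (RInt (fun y => F X y) c d)).
{ intros X.
  assert (HD : forall y u, is_derive (fun z => RInt (fun x => F x y) a z) u (F u y)).
  { intros y u. apply (is_derive_RInt (fun x => F x y) _ a).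
    - apply filter_forall. intros v. apply (RInt_correct (V := R_CompleteNormedModule)), Hexx.
    - apply Hx. }
  replace (RInt (fun y => F X y) c d) with (RInt (fun y => Derive (fun z => RInt (fun x => F x y) a z) X) c d).
  - apply (is_derive_RInt_param (fun X y => RInt (fun x => F x y) a X)).
    + apply filter_forall. intros u y _. eexists; apply HD.
    + intros y _. apply continuity_2d_pt_ext with (fun u v => F u v).
      { intros u v. symmetry. apply is_derive_unique, HD. }
      apply continuity_2d_pt_filterlim. apply HF.
    + apply filter_forall. intros u. apply (ex_RInt_continuous (V := R_CompleteNormedModule)). intros y _.
      destruct (Rle_dec a u) as [L|L].
      * apply (continuous_RInt_everywhere (V := R_CompleteNormedModule) (fun x y => F x y)); [exact L|].
        apply filter_forall. intros; apply HF.
      * apply continuous_ext with (fun y => - RInt (fun x => F x y) u a).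
        { intros v. apply (opp_RInt_swap (fun x => F x v)), Hexx. }
        apply continuous_Ropp.
        apply (continuous_RInt_everywhere (V := R_CompleteNormedModule) (fun x y => F x y)); [lra|].
        apply filter_forall. intros; apply HF.
  - apply RInt_ext. intros y _. apply is_derive_unique, HD. }
assert (HL : forall X, is_derive (fun X => RInt (fun x => RInt (fun y => F x y) c d) a X) X (RInt (fun y => F X y) c d)).
{ intros X. apply (is_derive_RInt (fun x => RInt (fun y => F x y) c d) _ a).
  - apply filter_forall. intros v. apply (RInt_correct (V := R_CompleteNormedModule)).
    apply (ex_RInt_continuous (V := R_CompleteNormedModule)). intros; apply Hin.
  - apply Hin. }
set (G1 := fun X => RInt (fun x => RInt (fun y => F x y) c d) a X) in HL.
set (G2 := fun X => RInt (fun y => RInt (fun x => F x y) a X) c d) in Hout.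
change (G1 b = G2 b).
assert (HG : forall X, is_derive (fun X => G1 X - G2 X) X 0).
{ intros X. evar_last; [exact (is_derive_minus (V := R_NormedModule) G1 G2 X _ _ (HL X) (Hout X))|]. apply Rminus_diag. }
destruct (MVT_gen (fun X => G1 X - G2 X) a b (fun _ => 0)) as [u [_ E]].
- intros X _. exact (HG X).
- intros X _. apply continuity_pt_filterlim. apply (ex_derive_continuous (V := R_NormedModule) (fun X => G1 X - G2 X)).
  exists 0. exact (HG X).
- rewrite Rmult_0_l in E. unfold G1 at 2, G2 at 2 in E. rewrite RInt_point in E.
  assert (E0 : RInt (fun y => RInt (fun x => F x y) a a) c d = RInt (fun _ : R => 0) c d).
  { apply RInt_ext. intros y _. exact (RInt_point (V := R_CompleteNormedModule) a (fun x => F x y)). }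
  assert (E1 : RInt (fun _ : R => 0) c d = (d - c) * 0) by exact (RInt_const (V := R_CompleteNormedModule) c d 0).
  change (@zero _) with 0 in E. rewrite E0, E1 in E. lra.
Qed.

Lemma CInt_fubini (F : R -> R -> C) (a b c d : R) : a <= b -> c <= d ->
  (forall x y, continuous (fun q : R * R => F (fst q) (snd q)) (x, y)) ->
  CInt (fun x => CInt (fun y => F x y) c d) a b = CInt (fun y => CInt (fun x => F x y) a b) c d.
Proof.
intros Hab Hcd HF.
assert (Hx : forall x y, continuous (fun x => F x y) x).
{ intros x y. apply (continuous_comp_2 (fun x => x) (fun _ => y) (fun x y => F x y)); [apply continuous_id|apply continuous_const|apply HF]. }
assert (Hy : forall x y, continuous (fun y => F x y) y).
{ intros x y. apply (continuous_comp_2 (fun _ => x) (fun y => y) (fun x y => F x y)); [apply continuous_const|apply continuous_id|apply HF]. }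
assert (Ex : forall y, ex_CInt (fun x => F x y) a b) by (intros; apply ex_CInt_continuous; [exact Hab|intros; apply Hx]).
assert (Ey : forall x, ex_CInt (fun y => F x y) c d) by (intros; apply ex_CInt_continuous; [exact Hcd|intros; apply Hy]).
assert (E1 : ex_CInt (fun x => CInt (fun y => F x y) c d) a b).
{ apply ex_CInt_continuous; [exact Hab|]. intros x _.
  apply (continuous_RInt_everywhere (V := C_R_CompleteNormedModule) (fun y x => F x y)); [exact Hcd|].
  apply filter_forall. intros x' y _.
  apply (continuous_comp_2 (fun q : R * R => snd q) (fun q : R * R => fst q) (fun x y => F x y)); [apply continuous_snd|apply continuous_fst|apply HF]. }
assert (E2 : ex_CInt (fun y => CInt (fun x => F x y) a b) c d).
{ apply ex_CInt_continuous; [exact Hcd|]. intros y _.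
  apply (continuous_RInt_everywhere (V := C_R_CompleteNormedModule) (fun x y => F x y)); [exact Hab|].
  apply filter_forall. intros; apply HF. }
apply injective_projections.
- etransitivity; [apply (Re_CInt _ _ _ E1)|]. etransitivity; [|symmetry; apply (Re_CInt _ _ _ E2)].
  rewrite (RInt_ext _ (fun x => RInt (fun y => Re (F x y)) c d)) by (intros; apply Re_CInt, Ey).
  rewrite (RInt_ext (fun y => Re _) (fun y => RInt (fun x => Re (F x y)) a b)) by (intros; apply Re_CInt, Ex).
  apply (RInt_fubini (fun x y => Re (F x y))); [exact Hab|exact Hcd|]. intros; apply (continuous_Re (fun q => F (fst q) (snd q))), HF.
- etransitivity; [apply (Im_CInt _ _ _ E1)|]. etransitivity; [|symmetry; apply (Im_CInt _ _ _ E2)].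
  rewrite (RInt_ext _ (fun x => RInt (fun y => Im (F x y)) c d)) by (intros; apply Im_CInt, Ey).
  rewrite (RInt_ext (fun y => Im _) (fun y => RInt (fun x => Im (F x y)) a b)) by (intros; apply Im_CInt, Ex).
  apply (RInt_fubini (fun x y => Im (F x y))); [exact Hab|exact Hcd|]. intros; apply (continuous_Im (fun q => F (fst q) (snd q))), HF.
Qed.

(** * Continuity of composite expressions *)

Lemma continuous_fst_at {U V : UniformSpace} (p : U * V) : continuous (fun q : U * V => fst q) p.
Proof. destruct p; apply continuous_fst. Qed.
Lemma continuous_snd_at {U V : UniformSpace} (p : U * V) : continuous (fun q : U * V => snd q) p.
Proof. destruct p; apply continuous_snd. Qed.
Lemma continuous_fst_comp {T U V : UniformSpace} (f : T -> U * V) (x : T) :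
  continuous f x -> continuous (fun t => fst (f t)) x.
Proof. intros H. apply (continuous_comp f (fun q : U * V => fst q)); [exact H|apply continuous_fst_at]. Qed.
Lemma continuous_snd_comp {T U V : UniformSpace} (f : T -> U * V) (x : T) :
  continuous f x -> continuous (fun t => snd (f t)) x.
Proof. intros H. apply (continuous_comp f (fun q : U * V => snd q)); [exact H|apply continuous_snd_at]. Qed.
Lemma continuous_Rpower_comp {T : UniformSpace} (f : T -> R) (e : R) (x : T) :
  continuous f x -> 0 < f x -> continuous (fun t => Rpower (f t) e) x.
Proof.
intros H Hp. apply (continuous_comp f (fun u => Rpower u e)); [exact H|].
apply (ex_derive_continuous (V := R_NormedModule)). unfold Rpower. auto_derive. exact Hp.
Qed.
Lemma continuous_cos_comp {T : UniformSpace} (f : T -> R) (x : T) :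
  continuous f x -> continuous (fun t => cos (f t)) x.
Proof. intros H. apply (continuous_comp f cos); [exact H|apply continuous_cos]. Qed.
Lemma continuous_sin_comp {T : UniformSpace} (f : T -> R) (x : T) :
  continuous f x -> continuous (fun t => sin (f t)) x.
Proof. intros H. apply (continuous_comp f sin); [exact H|apply continuous_sin]. Qed.

(* sin^2 (th / 2); the substitution k = a + (b - a) sg th removes the endpoint singularities
   of dk / sqrt ((k - a) (b - k)), which becomes dth. *)
Definition sg (th : R) : R := (1 - cos th) / 2.
Lemma sg_bounds (th : R) : 0 <= sg th <= 1.
Proof. unfold sg. assert (H := COS_bound th). lra. Qed.
Lemma continuous_sg_comp {T : UniformSpace} (f : T -> R) (x : T) :
  continuous f x -> continuous (fun t => sg (f t)) x.
Proof.
intros H. unfold sg. apply (continuous_Rdiv (fun t => 1 - cos (f t)) (fun _ => 2)); [|apply continuous_const|lra].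
apply continuous_Rminus; [apply continuous_const|apply continuous_cos_comp, H].
Qed.
Lemma is_derive_sg (th : R) : is_derive sg th (sin th / 2).
Proof. unfold sg. auto_derive; [exact I|field]. Qed.

(** Each step removes the head operation by a second-order pattern, constants first. The leaves of
    the expression and the side conditions of inverses, quotients and powers remain as goals. *)
Ltac cont_step := lazymatch goal with
  | |- continuous (fun _ => ?c) _ => apply continuous_const
  | |- continuous (fun t => t) _ => apply continuous_id
  | |- continuous (fun t => Cplus (@?f t) (@?g t)) _ => apply (continuous_Cplus f g)
  | |- continuous (fun t => Cminus (@?f t) (@?g t)) _ => apply (continuous_Cminus f g)
  | |- continuous (fun t => Cmult (@?f t) (@?g t)) _ => apply (continuous_Cmult f g)
  | |- continuous (fun t => Cdiv (@?f t) (@?g t)) _ => apply (continuous_Cdiv f g)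
  | |- continuous (fun t => Copp (@?f t)) _ => apply (continuous_Copp f)
  | |- continuous (fun t => Cinv (@?f t)) _ => apply (continuous_Cinv f)
  | |- continuous (fun t => RtoC (@?f t)) _ => apply (continuous_RtoC f)
  | |- continuous (fun t => Rplus (@?f t) (@?g t)) _ => apply (continuous_Rplus f g)
  | |- continuous (fun t => Rminus (@?f t) (@?g t)) _ => apply (continuous_Rminus f g)
  | |- continuous (fun t => Rmult (@?f t) (@?g t)) _ => apply (continuous_Rmult f g)
  | |- continuous (fun t => Rdiv (@?f t) (@?g t)) _ => apply (continuous_Rdiv f g)
  | |- continuous (fun t => Ropp (@?f t)) _ => apply (continuous_Ropp f)
  | |- continuous (fun t => Rinv (@?f t)) _ => apply (continuous_Rinv' f)
  | |- continuous (fun t => Rpower (@?f t) ?e) _ => apply (continuous_Rpower_comp f e)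
  | |- continuous (fun t => cos (@?f t)) _ => apply (continuous_cos_comp f)
  | |- continuous (fun t => sin (@?f t)) _ => apply (continuous_sin_comp f)
  | |- continuous (fun t => sg (@?f t)) _ => apply (continuous_sg_comp f)
  | |- continuous (fun t => fst (@?f t)) _ => apply (continuous_fst_comp f)
  | |- continuous (fun t => snd (@?f t)) _ => apply (continuous_snd_comp f)
  end.
Ltac cont := repeat (cbv beta; cont_step).

(** * Derivatives of complex functions of a real variable *)

Definition RCd (f : R -> C) (t : R) (l : C) : Prop :=
  is_derive (fun s => Re (f s)) t (Re l) /\ is_derive (fun s => Im (f s)) t (Im l).

Lemma RCd_continuous (f : R -> C) (t : R) (l : C) : RCd f t l -> continuous f t.
Proof.
intros [H1 H2]. apply continuous_C; apply (ex_derive_continuous (V := R_NormedModule)); eexists; eassumption.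
Qed.
Lemma RCd_ext (f g : R -> C) (t : R) (l l' : C) : (forall s, f s = g s) -> l = l' -> RCd f t l -> RCd g t l'.
Proof.
intros H <- [H1 H2]. split.
- exact (is_derive_ext _ _ _ _ (fun s => f_equal Re (H s)) H1).
- exact (is_derive_ext _ _ _ _ (fun s => f_equal Im (H s)) H2).
Qed.
Lemma RCd_const (c : C) (t : R) : RCd (fun _ => c) t (RtoC 0).
Proof. split; exact (is_derive_const (V := R_NormedModule) _ t). Qed.
Lemma RCd_RtoC (f : R -> R) (t l : R) : is_derive f t l -> RCd (fun s => RtoC (f s)) t (RtoC l).
Proof. intros H; split; [exact H|exact (is_derive_const (V := R_NormedModule) _ t)]. Qed.
Lemma RCd_plus (f g : R -> C) (t : R) (l l' : C) : RCd f t l -> RCd g t l' -> RCd (fun s => f s + g s)%C t (l + l')%C.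
Proof. intros [H1 H2] [G1 G2]. split; apply (is_derive_plus (V := R_NormedModule)); assumption. Qed.
Lemma RCd_mult (f g : R -> C) (t : R) (l l' : C) : RCd f t l -> RCd g t l' ->
  RCd (fun s => f s * g s)%C t (l * g t + f t * l')%C.
Proof.
intros [H1 H2] [G1 G2]. split.
- evar_last.
  + apply (is_derive_minus (V := R_NormedModule)); apply (is_derive_mult (K := R_AbsRing)); try eassumption; exact Rmult_comm.
  + unfold minus, plus, opp, mult; simpl. unfold Re, Im. ring.
- evar_last.
  + apply (is_derive_plus (V := R_NormedModule)); apply (is_derive_mult (K := R_AbsRing)); try eassumption; exact Rmult_comm.
  + unfold minus, plus, opp, mult; simpl. unfold Re, Im. ring.
Qed.
Lemma RCd_inv (f : R -> C) (t : R) (l : C) : RCd f t l -> f t <> RtoC 0 ->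
  RCd (fun s => / f s)%C t (- l / (f t * f t))%C.
Proof.
intros [H1 H2] Hn. apply Cnorm2_neq_0 in Hn.
set (u := fun s => Re (f s)) in *. set (v := fun s => Im (f s)) in *.
assert (Eu : u t = fst (f t)) by reflexivity. assert (Ev : v t = snd (f t)) by reflexivity.
rewrite <- Eu, <- Ev in Hn.
assert (Hd : is_derive (fun s => u s ^ 2 + v s ^ 2) t (2 * u t * Re l + 2 * v t * Im l)).
{ evar_last.
  - apply (is_derive_plus (V := R_NormedModule)); apply is_derive_pow; eassumption.
  - unfold plus; simpl. ring. }
split.
- evar_last; [apply (is_derive_div u (fun s => u s ^ 2 + v s ^ 2)); [exact H1|exact Hd|exact Hn]|].
  unfold Cdiv, Cmult, Cinv, Copp. cbn [Re Im fst snd]. rewrite <- Eu, <- Ev. unfold Re, Im. field. nra.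
- evar_last; [apply (is_derive_div (fun s => - v s) (fun s => u s ^ 2 + v s ^ 2)); [apply (is_derive_opp (V := R_NormedModule)); exact H2|exact Hd|exact Hn]|].
  unfold opp; simpl. rewrite <- Eu, <- Ev. unfold Re, Im. field. nra.
Qed.

Lemma CInt_RCd (f df : R -> C) (a b : R) : a <= b -> (forall t, a <= t <= b -> RCd f t (df t)) ->
  (forall t, a <= t <= b -> continuous df t) -> CInt df a b = (f b - f a)%C.
Proof.
intros Hab Hd Hc. apply CInt_unique, is_CInt_pair.
- apply (is_RInt_derive (V := R_CompleteNormedModule) (fun t => Re (f t)) (fun t => Re (df t)));
  rewrite Rmin_left, Rmax_right by lra; intros t Ht; [apply Hd, Ht|apply (continuous_Re df), Hc, Ht].
- apply (is_RInt_derive (V := R_CompleteNormedModule) (fun t => Im (f t)) (fun t => Im (df t)));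
  rewrite Rmin_left, Rmax_right by lra; intros t Ht; [apply Hd, Ht|apply (continuous_Im df), Hc, Ht].
Qed.

Lemma is_derive_RInt_parameter (h h' : R -> R -> R) (a b c t0 : R) : a <= b -> b < c ->
  locally t0 (fun t => forall s, s < c -> is_derive (fun t => h s t) t (h' s t)) ->
  locally t0 (fun t => forall s, s < c -> continuous (fun s => h s t) s) ->
  (forall s, s < c -> continuous (fun q : R * R => h' (fst q) (snd q)) (s, t0)) ->
  is_derive (fun t => RInt (fun s => h s t) a b) t0 (RInt (fun s => h' s t0) a b).
Proof.
intros Hab Hbc Hd Hc Hc'.
replace (RInt (fun s => h' s t0) a b) with (RInt (fun s => Derive (fun t => h s t) t0) a b).
- apply (is_derive_RInt_param (fun t s => h s t)); rewrite ?Rmin_left, ?Rmax_right by lra.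
  + revert Hd. apply filter_imp. intros t Ht s Hs. exists (h' s t). apply Ht; lra.
  + intros s Hs. apply continuity_2d_pt_ext_loc with (fun u v => h' v u).
    { destruct Hd as [d Hd]. assert (He : 0 < Rmin d (c - s)) by (apply Rmin_pos; [apply cond_pos|lra]).
      exists (mkposreal _ He). simpl. intros u v Hu Hv. symmetry. apply is_derive_unique, Hd.
      - eapply Rlt_le_trans; [exact Hu|apply Rmin_l].
      - assert (X := Rmin_r d (c - s)). apply Rabs_def2 in Hv. lra. }
    apply continuity_2d_pt_filterlim.
    apply (continuous_comp_2 (fun q : R * R => snd q) (fun q : R * R => fst q) (fun u v => h' u v));
      [apply continuous_snd|apply continuous_fst|apply Hc'; simpl; lra].
  + revert Hc. apply filter_imp. intros t Ht. apply (ex_RInt_continuous (V := R_CompleteNormedModule)).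
    rewrite Rmin_left, Rmax_right by lra. intros; apply Ht; lra.
- apply RInt_ext. rewrite Rmin_left, Rmax_right by lra. intros s Hs. apply is_derive_unique. apply (locally_singleton _ _ Hd s); lra.
Qed.

Lemma RCd_CInt (h h' : R -> R -> C) (a b t0 : R) : a <= b ->
  locally t0 (fun t => forall s, RCd (fun t => h s t) t (h' s t)) ->
  locally t0 (fun t => forall s, continuous (fun s => h s t) s) ->
  (forall s, continuous (fun q : R * R => h' (fst q) (snd q)) (s, t0)) ->
  RCd (fun t => CInt (fun s => h s t) a b) t0 (CInt (fun s => h' s t0) a b).
Proof.
intros Hab Hd Hc Hc'.
assert (Hex : locally t0 (fun t => ex_CInt (fun s => h s t) a b)).
{ revert Hc. apply filter_imp. intros t Ht. apply ex_CInt_continuous; [exact Hab|]. intros; apply Ht. }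
assert (Hex' : ex_CInt (fun s => h' s t0) a b).
{ apply ex_CInt_continuous; [exact Hab|]. intros s _.
  apply (continuous_comp_2 (fun s : R => s) (fun _ => t0) (fun u v => h' u v)); [apply continuous_id|apply continuous_const|apply Hc']. }
split.
- rewrite (Re_CInt _ _ _ Hex'). apply is_derive_ext_loc with (fun t => RInt (fun s => Re (h s t)) a b).
  { revert Hex. apply filter_imp. intros t Ht. symmetry. exact (Re_CInt _ _ _ Ht). }
  apply (is_derive_RInt_parameter (fun s t => Re (h s t)) (fun s t => Re (h' s t)) a b (b + 1)); [exact Hab|lra| | |].
  + revert Hd. apply filter_imp. intros t Ht s _; apply Ht.
  + revert Hc. apply filter_imp. intros t Ht s _. apply (continuous_Re (fun s => h s t)), Ht.
  + intros s _. apply (continuous_Re (fun q : R * R => h' (fst q) (snd q))), Hc'.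
- rewrite (Im_CInt _ _ _ Hex'). apply is_derive_ext_loc with (fun t => RInt (fun s => Im (h s t)) a b).
  { revert Hex. apply filter_imp. intros t Ht. symmetry. exact (Im_CInt _ _ _ Ht). }
  apply (is_derive_RInt_parameter (fun s t => Im (h s t)) (fun s t => Im (h' s t)) a b (b + 1)); [exact Hab|lra| | |].
  + revert Hd. apply filter_imp. intros t Ht s _; apply Ht.
  + revert Hc. apply filter_imp. intros t Ht s _. apply (continuous_Im (fun s => h s t)), Ht.
  + intros s _. apply (continuous_Im (fun q : R * R => h' (fst q) (snd q))), Hc'.
Qed.

Lemma tube_neq_0 {T : UniformSpace} (h : R -> T -> C) (a b : R) (p0 : T) : a <= b ->
  (forall s, a <= s <= b -> continuous (fun q : R * T => h (fst q) (snd q)) (s, p0)) ->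
  (forall s, a <= s <= b -> h s p0 <> RtoC 0) ->
  locally p0 (fun p => forall s, a <= s <= b -> h s p <> RtoC 0).
Proof.
intros Hab Hc Hn.
destruct (Cmod_min (fun s => h s p0) a b Hab) as [m [Hm Hm']]; [|exact Hn|].
{ intros s Hs. apply (continuous_comp_2 (fun s : R => s) (fun _ => p0) (fun u v => h u v)); [apply continuous_id|apply continuous_const|apply Hc, Hs]. }
generalize (tube (V := C_R_NormedModule) h a b p0 m Hm Hc). apply filter_imp. intros p Hp s Hs E.
specialize (Hp s Hs). specialize (Hm' s Hs). rewrite <- Cmod_norm in Hp.
change (minus (h s p) (h s p0)) with (h s p - h s p0)%C in Hp. rewrite E in Hp. replace (RtoC 0 - h s p0)%C with (- h s p0)%C in Hp by ring.
rewrite Cmod_opp in Hp. lra.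
Qed.

(** * Mean values over [0, pi] *)

(** Under k = a + (b - a) [sg th] this is the mean for the arcsine law on [a, b], of density 1 / (pi
    sqrt ((k - a) (b - k))). *)
Definition Cavg (h : R -> C) : C := (/ RtoC PI * CInt h 0 PI)%C.

Lemma PI_neq_0_C : RtoC PI <> RtoC 0.
Proof. apply RtoC_neq, PI_neq0. Qed.
Lemma PI_ge_0 : 0 <= PI.
Proof. apply Rlt_le, PI_RGT_0. Qed.
Lemma ex_Cavg (h : R -> C) : (forall s, continuous h s) -> ex_CInt h 0 PI.
Proof. intros H. apply ex_CInt_continuous; [apply PI_ge_0|intros; apply H]. Qed.
Lemma Cavg_ext (h g : R -> C) : (forall s, h s = g s) -> Cavg h = Cavg g.
Proof. intros H. unfold Cavg. apply (f_equal (fun u => (/ RtoC PI * u)%C)). apply CInt_ext; [apply PI_ge_0|intros; apply H]. Qed.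
Lemma Cavg_plus (h g : R -> C) : (forall s, continuous h s) -> (forall s, continuous g s) ->
  Cavg (fun s => h s + g s)%C = (Cavg h + Cavg g)%C.
Proof. intros Hh Hg. unfold Cavg. rewrite CInt_plus by (apply ex_Cavg; assumption). ring. Qed.
Lemma Cavg_minus (h g : R -> C) : (forall s, continuous h s) -> (forall s, continuous g s) ->
  Cavg (fun s => h s - g s)%C = (Cavg h - Cavg g)%C.
Proof. intros Hh Hg. unfold Cavg. rewrite CInt_minus by (apply ex_Cavg; assumption). ring. Qed.
Lemma Cavg_scal (c : C) (h : R -> C) : (forall s, continuous h s) ->
  Cavg (fun s => c * h s)%C = (c * Cavg h)%C.
Proof. intros Hh. unfold Cavg. rewrite CInt_scal by (apply ex_Cavg; assumption). ring. Qed.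
Lemma Cavg_const (c : C) : Cavg (fun _ => c) = c.
Proof. unfold Cavg. rewrite CInt_const, Rminus_0_r. field. apply PI_neq_0_C. Qed.
Lemma Cavg_fubini (F : R -> R -> C) : (forall x y, continuous (fun q : R * R => F (fst q) (snd q)) (x, y)) ->
  Cavg (fun x => Cavg (fun y => F x y)) = Cavg (fun y => Cavg (fun x => F x y)).
Proof.
intros HF.
assert (E1 : forall x y, continuous (fun x => F x y) x).
{ intros x y. apply (continuous_comp_2 (fun x => x) (fun _ => y) (fun x y => F x y)); [apply continuous_id|apply continuous_const|apply HF]. }
assert (E2 : forall x y, continuous (fun y => F x y) y).
{ intros x y. apply (continuous_comp_2 (fun _ => x) (fun y => y) (fun x y => F x y)); [apply continuous_const|apply continuous_id|apply HF]. }
unfold Cavg. apply (f_equal (fun u => (/ RtoC PI * u)%C)).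
rewrite CInt_scal, CInt_scal.
- apply (f_equal (fun u => (/ RtoC PI * u)%C)). apply CInt_fubini; [apply PI_ge_0|apply PI_ge_0|exact HF].
- apply ex_Cavg. intros y. apply (continuous_RInt_everywhere (V := C_R_CompleteNormedModule) (fun x y => F x y)); [apply PI_ge_0|].
  apply filter_forall. intros; apply HF.
- apply ex_Cavg. intros y. apply (continuous_RInt_everywhere (V := C_R_CompleteNormedModule) (fun y x => F x y)); [apply PI_ge_0|].
  apply filter_forall. intros x' y' _.
  apply (continuous_comp_2 (fun q : R * R => snd q) (fun q : R * R => fst q) (fun x y => F x y)); [apply continuous_snd|apply continuous_fst|apply HF].
Qed.
Lemma continuous_Cavg {T : UniformSpace} (h : R -> T -> C) (p0 : T) :
  locally p0 (fun p => forall s, continuous (fun q : R * T => h (fst q) (snd q)) (s, p)) ->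
  continuous (fun p => Cavg (fun s => h s p)) p0.
Proof.
intros H. unfold Cavg. apply continuous_Cmult; [apply continuous_const|].
apply (continuous_RInt_everywhere (V := C_R_CompleteNormedModule) h); [apply PI_ge_0|].
revert H. apply filter_imp. intros p Hp s _. apply Hp.
Qed.
Lemma Cderiv_Cavg (h phi : R -> C -> C) (z : C) :
  locally z (fun w => forall s, (h s w - h s z = phi s w * (w - z))%C) ->
  locally z (fun w => forall s, continuous (fun s => h s w) s) ->
  locally z (fun w => forall s, continuous (fun q : R * C => phi (fst q) (snd q)) (s, w)) ->
  Cderiv (fun w => Cavg (fun s => h s w)) z (Cavg (fun s => phi s z)).
Proof.
intros H1 H2 H3. unfold Cavg.
assert (E : (/ RtoC PI * CInt (fun s => phi s z) 0 PI = RtoC 0 * CInt (fun s => h s z) 0 PI + / RtoC PI * CInt (fun s => phi s z) 0 PI)%C) by ring.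
rewrite E. apply (Cderiv_mult (fun _ => / RtoC PI)%C (fun w => CInt (fun s => h s w) 0 PI)); [apply Cderiv_const|].
apply Cderiv_CInt; [apply PI_ge_0| | |].
- revert H1; apply filter_imp. intros w Hw s _; apply Hw.
- revert H2; apply filter_imp. intros w Hw. apply ex_Cavg, Hw.
- revert H3; apply filter_imp. intros w Hw s _; apply Hw.
Qed.
Lemma RCd_Cavg (h h' : R -> R -> C) (t0 : R) :
  locally t0 (fun t => forall s, RCd (fun t => h s t) t (h' s t)) ->
  locally t0 (fun t => forall s, continuous (fun s => h s t) s) ->
  (forall s, continuous (fun q : R * R => h' (fst q) (snd q)) (s, t0)) ->
  RCd (fun t => Cavg (fun s => h s t)) t0 (Cavg (fun s => h' s t0)).
Proof.
intros H1 H2 H3. unfold Cavg.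
assert (E : (/ RtoC PI * CInt (fun s => h' s t0) 0 PI = RtoC 0 * CInt (fun s => h s t0) 0 PI + / RtoC PI * CInt (fun s => h' s t0) 0 PI)%C) by ring.
rewrite E. apply (RCd_mult (fun _ => / RtoC PI)%C (fun w => CInt (fun s => h s w) 0 PI)); [apply RCd_const|].
apply RCd_CInt; [apply PI_ge_0|assumption|assumption|assumption].
Qed.

(** * Splitting lambda over the two cuts *)

Definition off_seg (a b : R) (kap : C) : Prop := forall k, a <= k <= b -> kap <> RtoC k.
Definition seg (a b th : R) : R := a + (b - a) * sg th.
(* Equals 1 / sqrt ((kap - a) (kap - b)), the branch being cut along [a, b]. *)
Definition Jk (a b : R) (kap : C) : C := Cavg (fun th => / (kap - RtoC (seg a b th)))%C.

Lemma seg_bounds (a b th : R) : a <= b -> a <= seg a b th <= b.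
Proof. intros H. unfold seg. assert (X := sg_bounds th). nra. Qed.

Lemma continuous_seg_comp {T : UniformSpace} (f g h : T -> R) (x : T) :
  continuous f x -> continuous g x -> continuous h x -> continuous (fun t => seg (f t) (g t) (h t)) x.
Proof. intros. unfold seg. cont; assumption. Qed.

Lemma Ceq_0_of_mult (a b : C) : (a * b)%C = RtoC 0 -> a = RtoC 0 \/ b = RtoC 0.
Proof.
intros H. destruct (Ceq_dec a (RtoC 0)) as [E|N]; [left; exact E|right].
replace b with (a * b / a)%C by (field; exact N). rewrite H. unfold Cdiv; ring.
Qed.

(** The left side is the mean of the derivative in th of - d sin th / (p + s u), which vanishes at 0
    and at pi. *)
Lemma J_ode (p : C) (d s : R) : 0 <= d ->
  (forall u, 0 <= u <= d -> (p + RtoC s * RtoC u)%C <> RtoC 0) ->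
  (RtoC 2 * Cavg (fun th => - (RtoC (d * (1 - sg th))) / ((p + RtoC s * RtoC (d * (1 - sg th))) * (p + RtoC s * RtoC (d * (1 - sg th))))) * (p + RtoC s * RtoC d)
   + RtoC d * Cavg (fun th => / (p + RtoC s * RtoC (d * (1 - sg th)))))%C = RtoC 0.
Proof.
intros Hd Hn. set (u := fun th => d * (1 - sg th)).
assert (Hu : forall th, 0 <= u th <= d) by (intros th; unfold u; assert (X := sg_bounds th); nra).
assert (HD : forall th, (p + RtoC s * RtoC (u th))%C <> RtoC 0) by (intros th; apply Hn, Hu).
assert (Hcu : forall th, continuous u th) by (intros; unfold u; cont).
assert (C1 : forall th, continuous (fun th => - (RtoC (u th)) / ((p + RtoC s * RtoC (u th)) * (p + RtoC s * RtoC (u th))))%C th).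
{ intros th. cont; try apply Hcu. apply Cmult_neq_0; apply HD. }
assert (C2 : forall th, continuous (fun th => / (p + RtoC s * RtoC (u th)))%C th).
{ intros th. cont; [apply Hcu|apply HD]. }
change ((RtoC 2 * Cavg (fun th => - (RtoC (u th)) / ((p + RtoC s * RtoC (u th)) * (p + RtoC s * RtoC (u th)))) * (p + RtoC s * RtoC d)
   + RtoC d * Cavg (fun th => / (p + RtoC s * RtoC (u th))))%C = RtoC 0).
transitivity (Cavg (fun th => (RtoC 2 * (p + RtoC s * RtoC d)) * (- (RtoC (u th)) / ((p + RtoC s * RtoC (u th)) * (p + RtoC s * RtoC (u th))))
  + RtoC d * / (p + RtoC s * RtoC (u th)))%C).
{ rewrite Cavg_plus, Cavg_scal, Cavg_scal; try assumption; [ring| |];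
  intros th; apply continuous_Cmult; try apply continuous_const; [apply C1|apply C2]. }
set (Psi := fun th => (RtoC (- d * sin th) * / (p + RtoC s * RtoC (u th)))%C).
unfold Cavg. rewrite (CInt_RCd Psi).
- unfold Psi. rewrite sin_PI, sin_0, Rmult_0_r. ring.
- apply PI_ge_0.
- intros th _. eapply RCd_ext; [reflexivity| |].
  2:{ apply RCd_mult.
    - apply RCd_RtoC. apply (is_derive_scal sin th (- d)). apply is_derive_sin.
    - apply RCd_inv; [|apply HD]. apply RCd_plus; [apply RCd_const|]. apply RCd_mult; [apply RCd_const|].
      apply RCd_RtoC. unfold u. 
      evar_last; [apply is_derive_scal; apply (is_derive_minus (V := R_NormedModule)); [apply (is_derive_const (V := R_NormedModule))|apply is_derive_sg]|].
      reflexivity. }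
  cbv beta. unfold minus, plus, opp, zero, mult; simpl.
  assert (Eu : RtoC (u th) = (RtoC d * (RtoC 1 + RtoC (cos th)) / RtoC 2)%C).
  { unfold u, sg. unfold Cdiv. rewrite <- (RtoC_inv 2), <- RtoC_plus, <- !RtoC_mult by lra. f_equal. field. }
  assert (ES : (RtoC (sin th) * RtoC (sin th) = RtoC 1 - RtoC (cos th) * RtoC (cos th))%C).
  { rewrite <- !RtoC_mult, <- RtoC_minus. f_equal. assert (X := sin2_cos2 th). unfold Rsqr in X. lra. }
  assert (HDt := HD th). set (D := (p + RtoC s * RtoC (u th))%C) in *.
  assert (ED : D = (p + RtoC s * RtoC (u th))%C) by reflexivity.
  replace (RtoC (d * (0 + - (sin th / 2)))) with (- RtoC d * RtoC (sin th) / RtoC 2)%C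
    by (unfold Cdiv; rewrite <- (RtoC_inv 2), <- RtoC_opp, <- !RtoC_mult by lra; f_equal; field).
  rewrite (RtoC_mult (- d) (sin th)), (RtoC_mult (- d) (cos th)), RtoC_opp.
  assert (H2 : RtoC 2 <> RtoC 0) by (apply RtoC_neq; lra).
  transitivity ((- RtoC d * RtoC (cos th) * D - RtoC s * RtoC d * RtoC d * (RtoC (sin th) * RtoC (sin th)) / RtoC 2) / (D * D))%C.
  { field; repeat split; assumption. }
  rewrite ES.
  transitivity ((- RtoC 2 * (p + RtoC s * RtoC d) * RtoC (u th) + RtoC d * D) / (D * D))%C; [|field; assumption].
  apply (f_equal (fun v => v / (D * D))%C). rewrite ED, Eu. field.
- intros th _. cont; try apply Hcu; try apply HD. apply Cmult_neq_0; apply HD.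
Qed.

(** The segment is shrunk to its end point b. With p = kap - b and d = b - a, the quantity J(s)^2 p
    (p + s d) has derivative zero on [0, 1] by [J_ode], equals 1 at s = 0, and at s = 1 is the left
    side. No branch of the root is chosen. *)
Lemma J_sqr (a b : R) (kap : C) : a <= b -> off_seg a b kap ->
  (Jk a b kap * Jk a b kap * ((kap - RtoC a) * (kap - RtoC b)) = RtoC 1)%C.
Proof.
intros Hab Hoff. set (p := (kap - RtoC b)%C). set (d := b - a).
set (u := fun th => d * (1 - sg th)).
assert (Hd : 0 <= d) by (unfold d; lra).
assert (Hu : forall th, 0 <= u th <= d) by (intros th; unfold u; assert (X := sg_bounds th); nra).
assert (Hcu : forall th, continuous u th) by (intros; unfold u; cont).
assert (Hne : forall s v, 0 <= s <= 1 -> 0 <= v <= d -> (p + RtoC s * RtoC v)%C <> RtoC 0).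
{ intros s v Hs Hv E. apply (Hoff (b - s * v)); [unfold d in Hv; nra|].
  replace kap with ((p + RtoC s * RtoC v) + RtoC (b - s * v))%C by (unfold p; rewrite RtoC_minus, RtoC_mult; ring).
  rewrite E; ring. }
set (J := fun w : C => Cavg (fun th => / (p + w * RtoC (u th)))%C).
set (G := fun w : C => (J w * J w * (p * (p + w * RtoC d)))%C).
assert (Hder : forall s, 0 <= s <= 1 -> Cderiv G (RtoC s) (RtoC 0)).
{ intros s Hs.
  assert (HJ : Cderiv J (RtoC s) (Cavg (fun th => - (RtoC (u th)) / ((p + RtoC s * RtoC (u th)) * (p + RtoC s * RtoC (u th)))))%C).
  { assert (Hloc : locally (RtoC s : C_UniformSpace) (fun w : C => forall v, 0 <= v <= d -> (p + w * RtoC v)%C <> RtoC 0)).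
    { apply (tube_neq_0 (T := C_UniformSpace) (fun v w => (p + w * RtoC v)%C)); [exact Hd| |].
      - intros v _. cont.
      - intros v Hv. apply Hne; assumption. }
    apply (Cderiv_Cavg (fun th w => / (p + w * RtoC (u th)))%C
      (fun th w => - RtoC (u th) / ((p + RtoC s * RtoC (u th)) * (p + w * RtoC (u th))))%C).
    - revert Hloc. apply filter_imp. intros w Hw th. field. split; [apply Hw, Hu|apply Hne; [exact Hs|apply Hu]].
    - revert Hloc. apply filter_imp. intros w Hw th. cont; [apply Hcu|apply Hw, Hu].
    - revert Hloc. apply filter_imp. intros w Hw th.
      assert (Hcu' : continuous (fun t : R * C => u (fst t)) (th, w)) by (apply (continuous_comp (fun t : R * C => fst t) u); [apply continuous_fst_at|apply Hcu]).
      cont; try apply Hcu'.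
      apply Cmult_neq_0; [apply Hne; [exact Hs|apply Hu]|apply Hw, Hu]. }
  set (J' := Cavg (fun th => - (RtoC (u th)) / ((p + RtoC s * RtoC (u th)) * (p + RtoC s * RtoC (u th))))%C) in HJ.
  assert (Hode := J_ode p d s Hd (fun v Hv => Hne s v Hs Hv)).
  change (RtoC 2 * J' * (p + RtoC s * RtoC d) + RtoC d * J (RtoC s) = RtoC 0)%C in Hode.
  replace (RtoC 0) with ((J' * J (RtoC s) + J (RtoC s) * J') * (p * (p + RtoC s * RtoC d))
    + J (RtoC s) * J (RtoC s) * (RtoC 0 * (p + RtoC s * RtoC d) + p * (RtoC 0 + (RtoC 1 * RtoC d + RtoC s * RtoC 0))))%C.
  - unfold G. apply (Cderiv_mult (fun w => J w * J w)%C (fun w => p * (p + w * RtoC d))%C); [exact (Cderiv_mult J J _ _ _ HJ HJ)|].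
    apply (Cderiv_mult (fun _ => p) (fun w => p + w * RtoC d)%C); [apply Cderiv_const|].
    apply (Cderiv_plus (fun _ => p) (fun w => w * RtoC d)%C); [apply Cderiv_const|].
    apply (Cderiv_mult (fun w => w) (fun _ => RtoC d)); [apply Cderiv_id|apply Cderiv_const].
  - transitivity (J (RtoC s) * p * (RtoC 2 * J' * (p + RtoC s * RtoC d) + RtoC d * J (RtoC s)))%C; [|rewrite Hode; ring].
    replace (RtoC 2) with (RtoC 1 + RtoC 1)%C by (rewrite <- RtoC_plus; f_equal; ring). ring. }
assert (E := Cderiv_0_segment G 0 1 Rle_0_1 Hder).
assert (Hp : p <> RtoC 0).
{ intros X. apply (Hne 0 0); [lra|lra|]. rewrite X. ring. }
assert (E0 : G (RtoC 0) = RtoC 1).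
{ unfold G. replace (J (RtoC 0)) with (/ p)%C.
  - field. exact Hp.
  - unfold J. rewrite (Cavg_ext _ (fun _ => / p)%C); [rewrite Cavg_const; reflexivity|].
    intros th. f_equal. ring. }
assert (E1 : J (RtoC 1) = Jk a b kap).
{ unfold J, Jk. apply Cavg_ext. intros th. apply (f_equal Cinv). unfold p, u, d, seg.
  rewrite !RtoC_mult, !RtoC_plus, !RtoC_mult, !RtoC_minus. ring. }
rewrite E0 in E. unfold G in E. rewrite E1 in E. rewrite <- E. unfold p, d. rewrite RtoC_minus. ring.
Qed.

Lemma Cavg_RtoC_pos (h : R -> R) : (forall th, continuous h th) -> (forall th, 0 < h th) ->
  exists rho, 0 < rho /\ Cavg (fun th => RtoC (h th)) = RtoC rho.
Proof.
intros Hc Hp. exists (/ PI * RInt h 0 PI). split.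
- apply Rmult_lt_0_compat; [apply Rinv_0_lt_compat, PI_RGT_0|].
  apply RInt_gt_0; [apply PI_RGT_0|intros; apply Hp|intros; apply Hc].
- unfold Cavg. rewrite CInt_RtoC, RtoC_mult, RtoC_inv; [reflexivity|apply PI_neq0|].
  apply (ex_RInt_continuous (V := R_CompleteNormedModule)). intros; apply Hc.
Qed.

Lemma Rsqr_pos_inj (a b : R) : 0 < a -> 0 < b -> a * a = b * b -> a = b.
Proof. intros. assert ((a - b) * (a + b) = 0) by lra. apply Rmult_integral in H2. lra. Qed.

Lemma Rpower_half_sqr (u : R) : 0 < u -> Rpower u (- / 2) * Rpower u (- / 2) = / u.
Proof.
intros H. rewrite <- Rpower_plus. replace (- / 2 + - / 2) with (Ropp 1) by field.
rewrite Rpower_Ropp, Rpower_1; [reflexivity|exact H].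
Qed.

(** [J_sqr] gives the square and the sign of the integrand selects the root. *)
Lemma J_right (a b k : R) : a <= b -> b < k ->
  Jk a b (RtoC k) = RtoC (Rpower (k - a) (- / 2) * Rpower (k - b) (- / 2)).
Proof.
intros Hab Hk.
assert (Hpos : forall th, 0 < k - seg a b th) by (intros th; assert (X := seg_bounds a b th Hab); lra).
destruct (Cavg_RtoC_pos (fun th => / (k - seg a b th))) as [rho [Hr E]].
- intros th. unfold seg in *. cont. specialize (Hpos th). lra.
- intros th. apply Rinv_0_lt_compat, Hpos.
- assert (E1 : Jk a b (RtoC k) = RtoC rho).
  { rewrite <- E. unfold Jk. apply Cavg_ext. intros th. specialize (Hpos th). rewrite RtoC_inv, RtoC_minus by lra; reflexivity. }
  rewrite E1. f_equal.
  assert (E2 := J_sqr a b (RtoC k) Hab ltac:(intros u Hu X; apply RtoC_inj in X; lra)).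
  rewrite E1, <- !RtoC_minus, <- !RtoC_mult in E2. apply RtoC_inj in E2.
  apply Rsqr_pos_inj; [exact Hr|apply Rmult_lt_0_compat; apply exp_pos|].
  transitivity (/ (k - a) * / (k - b)).
  + rewrite <- Rinv_mult. apply Rmult_eq_reg_r with ((k - a) * (k - b)); [|nra]. rewrite E2. field. nra.
  + rewrite <- (Rpower_half_sqr (k - a)), <- (Rpower_half_sqr (k - b)) by lra. ring.
Qed.

Lemma J_left (a b k : R) : a <= b -> k < a ->
  Jk a b (RtoC k) = (- RtoC (Rpower (a - k) (- / 2) * Rpower (b - k) (- / 2)))%C.
Proof.
intros Hab Hk.
assert (Hpos : forall th, 0 < seg a b th - k) by (intros th; assert (X := seg_bounds a b th Hab); lra).
destruct (Cavg_RtoC_pos (fun th => / (seg a b th - k))) as [rho [Hr E]].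
- intros th. unfold seg in *. cont. specialize (Hpos th). lra.
- intros th. apply Rinv_0_lt_compat, Hpos.
- assert (E1 : Jk a b (RtoC k) = (- RtoC rho)%C).
  { rewrite <- E. unfold Jk.
    transitivity (Cavg (fun th => RtoC (-1) * RtoC (/ (seg a b th - k)))%C).
    - apply Cavg_ext. intros th. specialize (Hpos th). rewrite RtoC_inv, RtoC_minus by lra.
      replace (RtoC (-1)) with (- RtoC 1)%C by (rewrite <- RtoC_opp; f_equal; ring). field.
      split; rewrite <- RtoC_minus; apply RtoC_neq; lra.
    - rewrite Cavg_scal.
      + replace (RtoC (-1)) with (- RtoC 1)%C by (rewrite <- RtoC_opp; f_equal; ring). ring.
      + intros th. unfold seg in *. cont. specialize (Hpos th). lra. }
  rewrite E1. do 2 f_equal.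
  assert (E2 := J_sqr a b (RtoC k) Hab ltac:(intros u Hu X; apply RtoC_inj in X; lra)).
  rewrite E1, <- RtoC_opp, <- !RtoC_minus, <- !RtoC_mult in E2. apply RtoC_inj in E2.
  apply Rsqr_pos_inj; [exact Hr|apply Rmult_lt_0_compat; apply exp_pos|].
  transitivity (/ (a - k) * / (b - k)).
  + rewrite <- Rinv_mult. apply Rmult_eq_reg_r with ((a - k) * (b - k)); [|nra].
    replace (rho * rho * ((a - k) * (b - k))) with (- rho * - rho * ((k - a) * (k - b))) by ring. rewrite E2. field. nra.
  + rewrite <- (Rpower_half_sqr (a - k)), <- (Rpower_half_sqr (b - k)) by lra. ring.
Qed.

Definition slit (z : C) : Prop := 0 < Re z \/ Im z <> 0.

Lemma csqrt_slit (z : C) : slit z -> csqrt z = (sqrt ((Cmod z + Re z) / 2), Im z / (2 * sqrt ((Cmod z + Re z) / 2))).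
Proof.
intros Hz. assert (Hp := csqrt_Re_pos z Hz). assert (E := f_equal Im (csqrt_sqr z)).
assert (Er : Re (csqrt z) = sqrt ((Cmod z + Re z) / 2)) by reflexivity.
rewrite <- Er. destruct (csqrt z) as [u v]. cbn in E, Hp. cbn [Re fst].
rewrite <- E. f_equal. field. lra.
Qed.

Lemma continuous_csqrt {T : UniformSpace} (f : T -> C) (x : T) :
  continuous f x -> slit (f x) -> locally x (fun t => slit (f t)) -> continuous (fun t => csqrt (f t)) x.
Proof.
intros Hc Hs Hl. apply continuous_ext_loc with
  (fun t => (sqrt ((Cmod (f t) + Re (f t)) / 2), Im (f t) / (2 * sqrt ((Cmod (f t) + Re (f t)) / 2)))).
{ revert Hl. apply filter_imp. intros t Ht. symmetry. apply csqrt_slit, Ht. }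
assert (Hre := continuous_Re f x Hc). assert (Him := continuous_Im f x Hc).
assert (Hsq : continuous (fun t => sqrt ((Cmod (f t) + Re (f t)) / 2)) x).
{ apply (continuous_comp (fun t => (Cmod (f t) + Re (f t)) / 2) sqrt); [|apply continuous_sqrt].
  cont; try lra; [|exact Hre].
  unfold Cmod. apply (continuous_comp (fun t => fst (f t) ^ 2 + snd (f t) ^ 2) sqrt); [|apply continuous_sqrt].
  apply continuous_ext with (fun t => Re (f t) * Re (f t) + Im (f t) * Im (f t)).
  { intros t; eq_in R; unfold Re, Im; ring. }
  cont; assumption. }
apply continuous_C; cbn [Re Im fst snd]; [exact Hsq|].
cont; [exact Him|exact Hsq|]. assert (Hp := csqrt_Re_pos _ Hs). simpl in Hp. unfold Re in *. simpl in *. lra.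
Qed.

Lemma sqrt_unique_C (l m : C) : (l * l = m * m)%C -> 0 < Re l -> 0 < Re m -> l = m.
Proof.
intros E Hl Hm. destruct (Ceq_0_of_mult (l - m) (l + m)) as [X|X].
- replace ((l - m) * (l + m))%C with (l * l - m * m)%C by ring. rewrite E; ring.
- replace l with (l - m + m)%C by ring. rewrite X; ring.
- exfalso. apply (f_equal Re) in X. simpl in X. unfold Re in *. lra.
Qed.

Lemma slit_sq_Re (l w : C) : (l * l = w)%C -> slit w -> Re l <> 0.
Proof.
intros <- Hs E. destruct l as [a b]. simpl in E. subst a. unfold slit in Hs. simpl in Hs. nra.
Qed.

(** If the ratio were a real v <= 0, then kap = (b - v a) / (1 - v) would be a convex combination of
    a and b. *)
Lemma slit_ratio (a b : R) (kap : C) : a <= b -> off_seg a b kap ->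
  slit ((kap - RtoC b) / (kap - RtoC a)).
Proof.
intros Hab Hoff. unfold slit. set (w := ((kap - RtoC b) / (kap - RtoC a))%C).
destruct (Rlt_dec 0 (Re w)) as [L|L]; [left; exact L|right]. intros Hi.
assert (Ew : w = RtoC (Re w)) by (destruct w; simpl in *; unfold RtoC; congruence).
set (v := Re w) in *.
assert (Hna : (kap - RtoC a)%C <> RtoC 0) by (apply Cminus_neq_0, Hoff; lra).
assert (E : (kap - RtoC b = RtoC v * (kap - RtoC a))%C).
{ rewrite <- Ew. unfold w. field. exact Hna. }
assert (H1v : RtoC (1 - v) <> RtoC 0) by (apply RtoC_neq; lra).
apply (Hoff ((b - v * a) / (1 - v))).
- split.
  + apply Rmult_le_reg_r with (1 - v); [lra|]. unfold Rdiv. rewrite Rmult_assoc, Rinv_l by lra. nra.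
  + apply Rmult_le_reg_r with (1 - v); [lra|]. unfold Rdiv. rewrite Rmult_assoc, Rinv_l by lra. nra.
- rewrite RtoC_div by lra.
  replace (RtoC (b - v * a)) with (kap * RtoC (1 - v))%C.
  + field. exact H1v.
  + rewrite RtoC_minus, RtoC_minus, RtoC_mult.
    transitivity (kap - RtoC v * (kap - RtoC a) - RtoC v * RtoC a)%C; [ring|]. rewrite <- E. ring.
Qed.

Lemma off_seg_sub (a b a' b' : R) (kap : C) : off_seg a b kap -> a <= a' -> b' <= b -> off_seg a' b' kap.
Proof. intros H Ha Hb k Hk; apply H; lra. Qed.

Lemma continuous_Jk (a b : R -> R) (kap : C) (s : R) : continuous a s -> continuous b s ->
  locally s (fun t => a t <= b t /\ off_seg (a t) (b t) kap) ->
  locally s (fun t => continuous a t /\ continuous b t) ->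
  continuous (fun t => Jk (a t) (b t) kap) s.
Proof.
intros Ha Hb Hl Hcl. unfold Jk.
apply (continuous_Cavg (fun th t => / (kap - RtoC (seg (a t) (b t) th)))%C).
generalize (filter_and _ _ Hl Hcl). apply filter_imp. intros t [[Hab Hoff] [Ha' Hb']] th.
assert (continuous (fun q : R * R => a (snd q)) (th, t)) by (apply (continuous_comp (fun q : R * R => snd q) a); [apply continuous_snd_at|exact Ha']).
assert (continuous (fun q : R * R => b (snd q)) (th, t)) by (apply (continuous_comp (fun q : R * R => snd q) b); [apply continuous_snd_at|exact Hb']).
cont.
- apply (continuous_seg_comp (fun q : R * R => a (snd q)) (fun q : R * R => b (snd q)) (fun q : R * R => fst q)); try assumption. apply continuous_fst_at.
- apply Cminus_neq_0, Hoff. cbn [fst snd]. apply seg_bounds, Hab.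
Qed.

Lemma same_sign (f : R -> R) (a b : R) : (forall s, continuous f s) -> (forall s, f s <> 0) ->
  0 < f a -> 0 < f b.
Proof.
intros Hc Hn Ha. destruct (Rlt_dec 0 (f b)) as [L|L]; [exact L|exfalso].
destruct (IVT_gen f a b 0) as [c [_ E]].
- intros s. apply continuity_pt_filterlim, Hc.
- unfold Rmin, Rmax; repeat destruct Rle_dec; lra.
- exact (Hn c E).
Qed.

Lemma Lam_sqr (x y t : R) (kap l : C) : 0 <= t <= x -> 0 <= y -> x + y < 1 -> off_seg 0 1 kap ->
  (l * l = (kap - RtoC (1 - y)) / (kap - RtoC x))%C ->
  let L := ((kap - RtoC x) * l * (kap - RtoC 1) * Jk t x kap * Jk (1 - y) 1 kap)%C in
  (L * L = (kap - RtoC 1) / (kap - RtoC t))%C.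
Proof.
intros Ht Hy Hxy Hoff Hl L.
assert (N : forall k, 0 <= k <= 1 -> (kap - RtoC k)%C <> RtoC 0) by (intros k Hk; apply Cminus_neq_0, Hoff, Hk).
assert (J1 := J_sqr t x kap ltac:(lra) (off_seg_sub 0 1 t x kap Hoff ltac:(lra) ltac:(lra))).
assert (J2 := J_sqr (1 - y) 1 kap ltac:(lra) (off_seg_sub 0 1 (1 - y) 1 kap Hoff ltac:(lra) ltac:(lra))).
unfold L.
transitivity ((kap - RtoC x) * (kap - RtoC x) * (l * l) * ((kap - RtoC 1) * (kap - RtoC 1)) * (Jk t x kap * Jk t x kap) * (Jk (1 - y) 1 kap * Jk (1 - y) 1 kap))%C; [ring|].
rewrite Hl.
set (P := (Jk t x kap * Jk t x kap)%C) in *. set (Q := (Jk (1 - y) 1 kap * Jk (1 - y) 1 kap)%C) in *.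
assert (EP : P = (RtoC 1 / ((kap - RtoC t) * (kap - RtoC x)))%C).
{ rewrite <- J1 at 1. field. split; apply N; lra. }
assert (EQ : Q = (RtoC 1 / ((kap - RtoC (1 - y)) * (kap - RtoC 1)))%C).
{ transitivity (Q * ((kap - RtoC (1 - y)) * (kap - RtoC 1)) / ((kap - RtoC (1 - y)) * (kap - RtoC 1)))%C.
  - field. split; apply N; lra.
  - rewrite J2. reflexivity. }
rewrite EP, EQ. field. repeat split; apply N; lra.
Qed.

(** By [Lam_sqr] both sides have the same square. The sign is settled by deforming from y = 0, t =
    x, where the Cauchy integrals degenerate to 1 / (kap - 1) and 1 / (kap - x) and the product is a
    [csqrt] with positive real part. Along the deformation the square stays off (-oo, 0], so the
    real part of the product cannot vanish. *)
Lemma lambda_upper (x y t : R) (kap l : C) : 0 <= t <= x -> 0 <= y -> x + y < 1 -> off_seg 0 1 kap ->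
  (l * l = (kap - RtoC (1 - y)) / (kap - RtoC x))%C -> 0 < Re l ->
  lambda t 0 Upper kap = ((kap - RtoC x) * l * (kap - RtoC 1) * Jk t x kap * Jk (1 - y) 1 kap)%C.
Proof.
intros Ht Hy Hxy Hoff Hl Hlp.
assert (N : forall k, 0 <= k <= 1 -> (kap - RtoC k)%C <> RtoC 0) by (intros k Hk; apply Cminus_neq_0, Hoff, Hk).
assert (Hslit : forall a b, 0 <= a <= b -> b <= 1 -> slit ((kap - RtoC b) / (kap - RtoC a))).
{ intros a b Ha Hb. apply slit_ratio; [lra|]. apply (off_seg_sub 0 1); [exact Hoff|lra|lra]. }
(* The deformation parameter is an angle passed through [sg], so that the bounds on [ys] and [ts]
   hold for every real th. *)
set (ys := fun th => sg th * y). set (ts := fun th => x - sg th * (x - t)).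
assert (Hys : forall th, 0 <= ys th <= y) by (intros th; unfold ys; assert (X := sg_bounds th); nra).
assert (Hts : forall th, t <= ts th <= x) by (intros th; unfold ts; assert (X := sg_bounds th); nra).
assert (Cys : forall th, continuous ys th) by (intros; unfold ys; cont).
assert (Cts : forall th, continuous ts th) by (intros; unfold ts; cont).
set (ls := fun th => csqrt ((kap - RtoC (1 - ys th)) / (kap - RtoC x))).
set (L := fun th => ((kap - RtoC x) * ls th * (kap - RtoC 1) * Jk (ts th) x kap * Jk (1 - ys th) 1 kap)%C).
assert (HL2 : forall th, (L th * L th = (kap - RtoC 1) / (kap - RtoC (ts th)))%C).
{ intros th. specialize (Hys th). specialize (Hts th). apply (Lam_sqr x (ys th) (ts th)); try lra; [exact Hoff|].
  apply csqrt_sqr. }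
assert (HLn : forall th, Re (L th) <> 0).
{ intros th. apply (slit_sq_Re _ _ (HL2 th)). specialize (Hts th). apply Hslit; lra. }
assert (HLc : forall th, continuous L th).
{ intros th. unfold L. 
  assert (continuous ls th).
  { unfold ls. apply (continuous_csqrt (fun th => (kap - RtoC (1 - ys th)) / (kap - RtoC x))%C).
    - cont; [apply Cys|apply N; lra].
    - specialize (Hys th). apply Hslit; lra.
    - apply filter_forall. intros u. specialize (Hys u). apply Hslit; lra. }
  assert (continuous (fun th => Jk (ts th) x kap) th).
  { apply (continuous_Jk ts (fun _ => x)); [apply Cts|apply continuous_const| |].
    - apply filter_forall. intros u. specialize (Hts u). split; [lra|]. apply (off_seg_sub 0 1); [exact Hoff|lra|lra].
    - apply filter_forall. intros u. split; [apply Cts|apply continuous_const]. }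
  assert (continuous (fun th => Jk (1 - ys th) 1 kap) th).
  { apply (continuous_Jk (fun th => 1 - ys th) (fun _ => 1)); [cont; apply Cys|apply continuous_const| |].
    - apply filter_forall. intros u. specialize (Hys u). split; [lra|]. apply (off_seg_sub 0 1); [exact Hoff|lra|lra].
    - apply filter_forall. intros u. split; [cont; apply Cys|apply continuous_const]. }
  cont; assumption. }
assert (Hself : forall a k, Jk k k a = (/ (a - RtoC k))%C).
{ intros a k. unfold Jk, seg. rewrite (Cavg_ext _ (fun _ => / (a - RtoC k))%C); [apply Cavg_const|].
  intros th. do 3 f_equal. ring. }
assert (H0 : 0 < Re (L 0)).
{ assert (S0 : sg 0 = 0) by (unfold sg; rewrite cos_0; field).
  assert (E : L 0 = ls 0).
  { unfold L. replace (ts 0) with x by (unfold ts; rewrite S0; ring). replace (1 - ys 0) with 1 by (unfold ys; rewrite S0; ring).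
    rewrite !Hself. field. split; apply N; lra. }
  rewrite E. apply csqrt_Re_pos. specialize (Hys 0). apply Hslit; lra. }
assert (H1 := same_sign (fun th => Re (L th)) 0 PI (fun s => continuous_Re L s (HLc s)) HLn H0). cbv beta in H1.
assert (S1 : sg PI = 1) by (unfold sg; rewrite cos_PI; field).
assert (E1 : ls PI = l).
{ apply sqrt_unique_C; [|apply csqrt_Re_pos; specialize (Hys PI); apply Hslit; lra|exact Hlp].
  unfold ls. rewrite csqrt_sqr, Hl. replace (ys PI) with y by (unfold ys; rewrite S1; ring). reflexivity. }
assert (E2 : L PI = ((kap - RtoC x) * l * (kap - RtoC 1) * Jk t x kap * Jk (1 - y) 1 kap)%C).
{ unfold L. rewrite E1. replace (ts PI) with t by (unfold ts; rewrite S1; ring). replace (ys PI) with y by (unfold ys; rewrite S1; ring). reflexivity. }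
rewrite <- E2. apply sqrt_unique_C; [|apply csqrt_Re_pos|exact H1].
- unfold lambda. rewrite csqrt_sqr, HL2. replace (ts PI) with t by (unfold ts; rewrite S1; ring).
  rewrite Rminus_0_r. reflexivity.
- rewrite Rminus_0_r. apply Hslit; lra.
Qed.

(** On the lower sheet both sides change sign together; Re l cannot vanish because l^2 avoids (-oo,
    0]. *)
Lemma lambda_sheet (x y t : R) (kap l : C) : 0 <= t <= x -> 0 <= y -> x + y < 1 -> off_seg 0 1 kap ->
  (l * l = (kap - RtoC (1 - y)) / (kap - RtoC x))%C ->
  lambda t 0 (if Rlt_dec 0 (Re l) then Upper else Lower) kap =
  ((kap - RtoC x) * l * (kap - RtoC 1) * Jk t x kap * Jk (1 - y) 1 kap)%C.
Proof.
intros Ht Hy Hxy Hoff Hl. destruct (Rlt_dec 0 (Re l)) as [L|L]; [apply lambda_upper; assumption|].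
assert (Hn : Re l <> 0).
{ apply (slit_sq_Re _ _ Hl). apply slit_ratio; [lra|]. apply (off_seg_sub 0 1); [exact Hoff|lra|lra]. }
change (lambda t 0 Lower kap) with (- lambda t 0 Upper kap)%C.
rewrite (lambda_upper x y t kap (- l)%C); try assumption.
- ring.
- rewrite <- Hl. ring.
- simpl. unfold Re in *. lra.
Qed.

(** [ff y k] is the value of (k - 1) [Jk (1 - y) 1 k] for k to the left of [1 - y, 1], and
    [gg t x k] that of [Jk t x k] for k to the right of [t, x]: on each cut, the factor that is
    regular there. *)
Definition ff (y k : R) : R := Rpower (1 - k) (/ 2) * Rpower (1 - y - k) (- / 2).
Definition gg (t x k : R) : R := Rpower (k - t) (- / 2) * Rpower (k - x) (- / 2).
Definition cc (x y k : R) : R := 2 + 4 * (x - k) / (1 - x - y).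
(* The two zeros of Dc x y k are the images under F of the two points over k. *)
Definition Dc (x y k : R) (z : C) : C := (z * z + RtoC (cc x y k) * z + RtoC 1)%C.
(** A Cauchy kernel for the pole k, lifted to the surface: it is 1 - [Sk] / ([kap] - k) by [MM_kap],
    tends to 0 as z tends to infinity, and is 2 at z = 0. *)
Definition MM (x y k : R) (z : C) : C := ((RtoC (cc x y k) * z + RtoC 2) / Dc x y k z)%C.
(* lambda(t,0,.) = alpha + beta on the surface, where alpha is singular only on F(Sigma_0) and
   beta only on F(Sigma_1). *)
Definition alpha (x y t : R) (z : C) : C :=
  (- Cavg (fun th => RtoC (ff y (seg t x th)) * MM x y (seg t x th) z))%C.
Definition beta (x y t : R) (z : C) : C :=
  (RtoC 1 + Cavg (fun th => RtoC ((1 - seg (1 - y) 1 th) * gg t x (seg (1 - y) 1 th)) * MM x y (seg (1 - y) 1 th) z))%C.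
(* The k-coordinate of Finv x y z. *)
Definition kap (x y : R) (z : C) : C :=
  (RtoC x + RtoC (1 - x - y) * ((z + RtoC 1) * (z + RtoC 1)) / (RtoC 4 * z))%C.
(** Equals (k - x) lambda(x,y,.) by [kap_lambda], that is, the root of (k - x) (k - 1 + y) as a
    function on the surface. *)
Definition Sk (x y : R) (z : C) : C := (RtoC (1 - x - y) * (z * z - RtoC 1) / (RtoC 4 * z))%C.

Lemma Dc_kap (x y k : R) (z : C) : x + y < 1 -> z <> RtoC 0 ->
  (Dc x y k z = RtoC 4 * z / RtoC (1 - x - y) * (kap x y z - RtoC k))%C.
Proof.
intros Hxy Hz. unfold Dc, kap, cc. assert (Hr : RtoC (1 - x - y) <> RtoC 0) by (apply RtoC_neq; lra).
rewrite RtoC_plus, RtoC_div, RtoC_mult, RtoC_minus by lra.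
assert (H4 : RtoC 4 <> RtoC 0) by (apply RtoC_neq; lra).
replace (RtoC 4) with (RtoC 2 + RtoC 2)%C in * by (rewrite <- RtoC_plus; f_equal; ring).
replace (RtoC 2) with (RtoC 1 + RtoC 1)%C in * by (rewrite <- RtoC_plus; f_equal; ring).
field. split; assumption.
Qed.

Lemma MM_kap (x y k : R) (z : C) : x + y < 1 -> z <> RtoC 0 -> kap x y z <> RtoC k ->
  (MM x y k z = RtoC 1 - Sk x y z / (kap x y z - RtoC k))%C.
Proof.
intros Hxy Hz Hk. assert (E := Dc_kap x y k z Hxy Hz).
assert (Hr : RtoC (1 - x - y) <> RtoC 0) by (apply RtoC_neq; lra).
assert (H4 : RtoC 4 <> RtoC 0) by (apply RtoC_neq; lra).
assert (kernel_avg := Cminus_neq_0 _ _ Hk).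
assert (ND : Dc x y k z <> RtoC 0).
{ intros X. apply kernel_avg.
  transitivity (Dc x y k z * RtoC (1 - x - y) / (RtoC 4 * z))%C; [rewrite E; field; repeat split; assumption|].
  rewrite X. unfold Cdiv; ring. }
replace (Sk x y z / (kap x y z - RtoC k))%C with ((z * z - RtoC 1) / Dc x y k z)%C.
- unfold MM. transitivity ((Dc x y k z - (z * z - RtoC 1)) / Dc x y k z)%C; [|field; exact ND].
  apply (f_equal (fun u => u / Dc x y k z)%C). unfold Dc.
  replace (RtoC 2) with (RtoC 1 + RtoC 1)%C by (rewrite <- RtoC_plus; f_equal; ring). ring.
- rewrite E. unfold Sk. field. repeat split; assumption.
Qed.

Lemma Rpower_half (u : R) : 0 < u -> Rpower u (/ 2) = u * Rpower u (- / 2).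
Proof.
intros H. replace (u * Rpower u (- / 2)) with (Rpower u 1 * Rpower u (- / 2)) by (rewrite Rpower_1 by exact H; reflexivity).
rewrite <- Rpower_plus. f_equal. field.
Qed.

(** [J_left] together with (1 - k) / (l - k) = 1 + (1 - l) / (l - k). *)
Lemma ff_average (y k : R) : 0 <= y -> k < 1 - y ->
  RtoC (ff y k) = (RtoC 1 + Cavg (fun th => RtoC ((1 - seg (1 - y) 1 th) / (seg (1 - y) 1 th - k))))%C.
Proof.
intros Hy Hk.
assert (Hpos : forall th, 0 < seg (1 - y) 1 th - k) by (intros th; assert (X := seg_bounds (1 - y) 1 th ltac:(lra)); lra).
assert (E := J_left (1 - y) 1 k ltac:(lra) Hk).
transitivity (- RtoC (1 - k) * Jk (1 - y) 1 (RtoC k))%C.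
{ rewrite E. unfold ff. rewrite Rpower_half by lra. rewrite !RtoC_mult. ring. }
unfold Jk. rewrite <- Cavg_scal.
2:{ intros th. specialize (Hpos th). unfold seg in *. cont. rewrite <- RtoC_minus. apply RtoC_neq. lra. }
rewrite <- (Cavg_const (RtoC 1)). rewrite <- Cavg_plus.
2:{ intros th; apply continuous_const. }
2:{ intros th. specialize (Hpos th). unfold seg in *. cont. lra. }
apply Cavg_ext. intros th. specialize (Hpos th).
rewrite <- RtoC_minus, <- RtoC_opp, <- RtoC_inv, <- RtoC_mult, <- RtoC_plus by lra. f_equal. field. lra.
Qed.

Lemma gg_average (t x l : R) : t <= x -> x < l ->
  RtoC (gg t x l) = Cavg (fun th => RtoC (/ (l - seg t x th))).
Proof.
intros Ht Hl. unfold gg. rewrite <- (J_right t x l Ht Hl). apply Cavg_ext. intros th.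
assert (X := seg_bounds t x th Ht). rewrite RtoC_inv, RtoC_minus by lra. reflexivity.
Qed.

(* Partial fractions of the product of the Cauchy integrals of 1/sqrt((k-t)(k-x)) and
   sqrt((k-1)/(k-1+y)), followed by Fubini. *)
Lemma alpha_plus_beta (x y t : R) (z : C) : 0 <= t <= x -> 0 <= y -> x + y < 1 -> z <> RtoC 0 ->
  off_seg 0 1 (kap x y z) ->
  (alpha x y t z + beta x y t z =
   Sk x y z * (kap x y z - RtoC 1) * Jk t x (kap x y z) * Jk (1 - y) 1 (kap x y z))%C.
Proof.
intros Ht Hy Hxy Hz Hoff. set (K := kap x y z) in *. set (S := Sk x y z).
set (k := fun th => seg t x th). set (l := fun ph => seg (1 - y) 1 ph).
assert (Hk : forall th, t <= k th <= x) by (intros; apply seg_bounds; lra).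
assert (Hl : forall ph, 1 - y <= l ph <= 1) by (intros; apply seg_bounds; lra).
assert (NK : forall u, 0 <= u <= 1 -> (K - RtoC u)%C <> RtoC 0) by (intros u Hu; apply Cminus_neq_0, Hoff, Hu).
assert (NKk : forall th, (K - RtoC (k th))%C <> RtoC 0) by (intros th; apply NK; specialize (Hk th); lra).
assert (NKl : forall th, (K - RtoC (l th))%C <> RtoC 0) by (intros th; apply NK; specialize (Hl th); lra).
assert (Nlk : forall th ph, l ph - k th <> 0) by (intros th ph; specialize (Hk th); specialize (Hl ph); lra).
assert (Ck : forall (T : UniformSpace) (f : T -> R) p, continuous f p -> continuous (fun q => k (f q)) p).
{ intros T f p Hf. unfold k, seg. cont. exact Hf. }
assert (Cl : forall (T : UniformSpace) (f : T -> R) p, continuous f p -> continuous (fun q => l (f q)) p).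
{ intros T f p Hf. unfold l, seg. cont. exact Hf. }
set (W := fun th ph => (1 - l ph) / (l ph - k th)).
set (H := fun th ph => (RtoC (W th ph) * (RtoC 1 - S / (K - RtoC (l ph))))%C).
assert (CW : forall th ph, continuous (fun q : R * R => W (fst q) (snd q)) (th, ph)).
{ intros th ph. assert (A := Cl _ (fun q : R * R => snd q) (th, ph) (continuous_snd_at _)).
  assert (B := Ck _ (fun q : R * R => fst q) (th, ph) (continuous_fst_at _)).
  unfold W. cont; [exact A|exact A|exact B|apply Nlk]. }
assert (CH : forall th ph, continuous (fun q : R * R => H (fst q) (snd q)) (th, ph)).
{ intros th ph. unfold H. cont; [apply CW|apply Cl, continuous_snd_at|apply NKl]. }
assert (CW2 : forall th ph, continuous (fun ph => W th ph) ph).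
{ intros th ph. assert (A := Cl _ (fun q : R => q) ph (continuous_id _)).
  unfold W. cont; [exact A|exact A|apply Nlk]. }
assert (CH2 : forall th ph, continuous (fun ph => H th ph) ph).
{ intros th ph. unfold H. cont; [apply CW2|apply Cl, continuous_id|apply NKl]. }
assert (CIH : forall th, continuous (fun th => Cavg (fun ph => H th ph)) th).
{ intros th. apply (continuous_Cavg (fun ph th => H th ph)). apply filter_forall. intros u ph.
  apply (continuous_comp_2 (fun q : R * R => snd q) (fun q : R * R => fst q) (fun u v => H u v)); [apply continuous_snd|apply continuous_fst|apply CH]. }
assert (CIW : forall th, continuous (fun th => Cavg (fun ph => RtoC (W th ph))) th).
{ intros th. apply (continuous_Cavg (fun ph th => RtoC (W th ph))). apply filter_forall. intros u ph.
  apply (continuous_RtoC (fun q : R * R => W (snd q) (fst q))).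
  apply (continuous_comp_2 (fun q : R * R => snd q) (fun q : R * R => fst q) (fun u v => W u v)); [apply continuous_snd|apply continuous_fst|apply CW]. }
assert (Ea : alpha x y t z = (- Cavg (fun th => (RtoC 1 + Cavg (fun ph => RtoC (W th ph))) * (RtoC 1 - S / (K - RtoC (k th)))))%C).
{ unfold alpha. apply (f_equal Copp). apply Cavg_ext. intros th. 
  rewrite (ff_average y (seg t x th)) by (specialize (Hk th); unfold k in Hk; lra).
  rewrite MM_kap; [reflexivity|exact Hxy|exact Hz|]. apply Hoff. specialize (Hk th). unfold k in Hk. lra. }
assert (Eb : beta x y t z = (RtoC 1 + Cavg (fun ph => Cavg (fun th => H th ph)))%C).
{ unfold beta. apply (f_equal (fun u => RtoC 1 + u)%C). apply Cavg_ext. intros ph.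
  assert (Hlp := Hl ph). unfold l in Hlp. rewrite RtoC_mult, gg_average by lra.
  rewrite MM_kap by (try assumption; apply Hoff; lra). fold K S. fold (l ph).
  transitivity ((RtoC (1 - l ph) * (RtoC 1 - S / (K - RtoC (l ph)))) * Cavg (fun th => RtoC (/ (l ph - seg t x th))))%C; [ring|].
  rewrite <- Cavg_scal.
  - apply Cavg_ext. intros th. unfold H, W. fold (k th). unfold Rdiv. rewrite RtoC_mult. ring.
  - intros th. fold (k th). apply (continuous_RtoC (fun th => / (l ph - k th))). cont; [apply Ck, continuous_id|apply Nlk]. }
rewrite Ea, Eb, <- Cavg_fubini by exact CH.
transitivity (Cavg (fun th => (RtoC 1 + Cavg (fun ph => H th ph)) - (RtoC 1 + Cavg (fun ph => RtoC (W th ph))) * (RtoC 1 - S / (K - RtoC (k th)))))%C.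
{ rewrite Cavg_minus, Cavg_plus, Cavg_const; [ring|intros; apply continuous_const|exact CIH| |].
  - intros th. cont. apply CIH.
  - intros th. cont; [apply CIW|apply Ck, continuous_id|apply NKk]. }
transitivity (Cavg (fun th => (S * (K - RtoC 1) * Jk (1 - y) 1 K) * / (K - RtoC (k th))))%C.
2:{ rewrite Cavg_scal.
  - unfold Jk. unfold k, l. ring.
  - intros th. cont; [apply Ck, continuous_id|apply NKk]. }
apply Cavg_ext. intros th.
(* For fixed angles the denominator l - k of W cancels against the difference of the kernels at l
   and k. What remains is S / (K - k) * ((K - 1) / (K - l) - 1), whose mean over ph is a Cauchy
   integral over [1 - y, 1]. *)
assert (Ein : (Cavg (fun ph => H th ph) - Cavg (fun ph => RtoC (W th ph)) * (RtoC 1 - S / (K - RtoC (k th))))%C =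
  (S / (K - RtoC (k th)) * ((K - RtoC 1) * Jk (1 - y) 1 K - RtoC 1))%C).
{ rewrite (Cmult_comm (Cavg _)), <- Cavg_scal by (intros ph; apply continuous_RtoC, CW2).
  rewrite <- Cavg_minus; [|apply CH2|intros ph; apply continuous_Cmult; [apply continuous_const|apply (continuous_RtoC (fun ph => W th ph)), CW2]].
  assert (CJ : forall ph, continuous (fun ph => / (K - RtoC (l ph)))%C ph).
  { intros ph. apply (continuous_Cinv (fun ph => K - RtoC (l ph))%C); [|apply NKl].
    apply continuous_Cminus; [apply continuous_const|]. apply (continuous_RtoC l). apply (Cl _ (fun p => p)), continuous_id. }
  assert (EJ : ((K - RtoC 1) * Jk (1 - y) 1 K - RtoC 1)%C = Cavg (fun ph => ((K - RtoC 1) * / (K - RtoC (l ph)) - RtoC 1)%C)).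
  { rewrite Cavg_minus, Cavg_scal, Cavg_const; [reflexivity|exact CJ| |intros; apply continuous_const].
    intros ph. apply continuous_Cmult; [apply continuous_const|apply CJ]. }
  rewrite EJ, <- Cavg_scal.
  2:{ intros ph. apply continuous_Cminus; [|apply continuous_const]. apply continuous_Cmult; [apply continuous_const|apply CJ]. }
  apply Cavg_ext. intros ph. fold (l ph). unfold H, W. rewrite RtoC_div, !RtoC_minus by apply Nlk.
  assert (X : (RtoC (l ph) - RtoC (k th))%C <> RtoC 0) by (rewrite <- RtoC_minus; apply RtoC_neq, Nlk).
  field. repeat split; [apply NKl|apply NKk|exact X]. }
transitivity (S / (K - RtoC (k th)) + (Cavg (fun ph => H th ph) - Cavg (fun ph => RtoC (W th ph)) * (RtoC 1 - S / (K - RtoC (k th)))))%C; [ring|].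
rewrite Ein. field. apply NKk.
Qed.

(** * Analyticity of the two parts of the jump *)

(** [mq] is [MM] as a function of the coefficient c = [cc x y k], and [nq] is its derivative in c.
    [ms] and [ns] are the difference quotients of the two in z, free of the division by w - z and
    hence continuous at w = z. *)
Definition Dq (c : R) (z : C) : C := (z * z + RtoC c * z + RtoC 1)%C.
Definition mq (c : R) (z : C) : C := ((RtoC c * z + RtoC 2) / Dq c z)%C.
Definition nq (c : R) (z : C) : C := ((z * z * z - z) / (Dq c z * Dq c z))%C.
Definition ms (c : R) (z w : C) : C :=
  ((RtoC c * Dq c z - (RtoC c * z + RtoC 2) * (w + z + RtoC c)) / (Dq c w * Dq c z))%C.
Definition ns (c : R) (z w : C) : C :=
  (((w * w + w * z + z * z - RtoC 1) * (Dq c z * Dq c z)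
    - (z * z * z - z) * (w + z + RtoC c) * (Dq c w + Dq c z)) / (Dq c w * Dq c w * (Dq c z * Dq c z)))%C.

Lemma mq_slope (c : R) (z w : C) : Dq c z <> RtoC 0 -> Dq c w <> RtoC 0 ->
  (mq c w - mq c z = ms c z w * (w - z))%C.
Proof.
intros Hz Hw. unfold mq, ms.
assert (E : (Dq c w - Dq c z = (w - z) * (w + z + RtoC c))%C) by (unfold Dq; ring).
replace (Dq c w) with (Dq c z + (w - z) * (w + z + RtoC c))%C in * by (rewrite <- E; ring).
field. split; assumption.
Qed.
Lemma nq_slope (c : R) (z w : C) : Dq c z <> RtoC 0 -> Dq c w <> RtoC 0 ->
  (nq c w - nq c z = ns c z w * (w - z))%C.
Proof.
intros Hz Hw. unfold nq, ns.
assert (E : (Dq c w - Dq c z = (w - z) * (w + z + RtoC c))%C) by (unfold Dq; ring).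
replace (Dq c w) with (Dq c z + (w - z) * (w + z + RtoC c))%C in * by (rewrite <- E; ring).
field. split; assumption.
Qed.

Lemma continuous_Dq {T : UniformSpace} (c : T -> R) (w : T -> C) (x : T) :
  continuous c x -> continuous w x -> continuous (fun q => Dq (c q) (w q)) x.
Proof. intros Hc Hw. unfold Dq. cont; assumption. Qed.
Lemma continuous_mq {T : UniformSpace} (c : T -> R) (w : T -> C) (x : T) :
  continuous c x -> continuous w x -> Dq (c x) (w x) <> RtoC 0 -> continuous (fun q => mq (c q) (w q)) x.
Proof. intros Hc Hw Hn. unfold mq. cont; try assumption. apply continuous_Dq; assumption. Qed.
Lemma continuous_nq {T : UniformSpace} (c : T -> R) (w : T -> C) (x : T) :
  continuous c x -> continuous w x -> Dq (c x) (w x) <> RtoC 0 -> continuous (fun q => nq (c q) (w q)) x.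
Proof.
intros Hc Hw Hn. assert (HD := continuous_Dq c w x Hc Hw). unfold nq. cont; try exact Hw; try exact HD.
apply Cmult_neq_0; exact Hn.
Qed.
Lemma continuous_ms {T : UniformSpace} (c : T -> R) (z : C) (w : T -> C) (x : T) :
  continuous c x -> continuous w x -> Dq (c x) (w x) <> RtoC 0 -> Dq (c x) z <> RtoC 0 ->
  continuous (fun q => ms (c q) z (w q)) x.
Proof.
intros Hc Hw Hn Hz. assert (HD := continuous_Dq c w x Hc Hw).
assert (HDz := continuous_Dq c (fun _ => z) x Hc (continuous_const _ _)). unfold ms.
cont; try exact Hc; try exact Hw; try exact HD; try exact HDz. apply Cmult_neq_0; assumption.
Qed.
Lemma continuous_ns {T : UniformSpace} (c : T -> R) (z : C) (w : T -> C) (x : T) :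
  continuous c x -> continuous w x -> Dq (c x) (w x) <> RtoC 0 -> Dq (c x) z <> RtoC 0 ->
  continuous (fun q => ns (c q) z (w q)) x.
Proof.
intros Hc Hw Hn Hz. assert (HD := continuous_Dq c w x Hc Hw).
assert (HDz := continuous_Dq c (fun _ => z) x Hc (continuous_const _ _)). unfold ns.
cont; try exact Hc; try exact Hw; try exact HD; try exact HDz. repeat apply Cmult_neq_0; assumption.
Qed.

(* The coefficient functions depend on the averaging angle through sigma = sg th in [0,1]. *)
Definition jointly (f : R -> R -> R) (t : R) : Prop :=
  forall s, 0 <= s <= 1 -> continuous (fun q : R * R => f (fst q) (snd q)) (s, t).

Lemma jointly_comp {T : UniformSpace} (f : R -> R -> R) (th tt : T -> R) (x : T) :
  jointly f (tt x) -> continuous th x -> continuous tt x -> continuous (fun q => f (sg (th q)) (tt q)) x.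
Proof.
intros H Hth Htt.
apply (continuous_comp_2 (fun q => sg (th q)) tt f x); [apply continuous_sg_comp, Hth|exact Htt|apply H, sg_bounds].
Qed.

(** The common shape of [alpha], [beta] and their derivatives in t. The term with [nq] arises in the
    derivative of [alpha], where the point k of the kernel moves with t. *)
Definition Ker (p q c : R -> R -> R) (t : R) (z : C) : C :=
  Cavg (fun th => RtoC (p (sg th) t) * mq (c (sg th) t) z + RtoC (q (sg th) t) * nq (c (sg th) t) z)%C.
Definition Ksl (p q c : R -> R -> R) (z : C) (t : R) (w : C) : C :=
  Cavg (fun th => RtoC (p (sg th) t) * ms (c (sg th) t) z w + RtoC (q (sg th) t) * ns (c (sg th) t) z w)%C.
Definition regular (p q c : R -> R -> R) (t : R) : Prop := jointly p t /\ jointly q t /\ jointly c t.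
Definition nonvanishing (c : R -> R -> R) (t : R) (z : C) : Prop := forall s, 0 <= s <= 1 -> Dq (c s t) z <> RtoC 0.

Lemma continuous_fst_snd {T U V : UniformSpace} (p : T * (U * V)) :
  continuous (fun q : prod_UniformSpace T (prod_UniformSpace U V) => fst (snd q)) p.
Proof. apply (continuous_fst_comp (U := U) (V := V) (fun q : T * (U * V) => snd q)), continuous_snd_at. Qed.
Lemma continuous_snd_snd {T U V : UniformSpace} (p : T * (U * V)) :
  continuous (fun q : prod_UniformSpace T (prod_UniformSpace U V) => snd (snd q)) p.
Proof. apply (continuous_snd_comp (U := U) (V := V) (fun q : T * (U * V) => snd q)), continuous_snd_at. Qed.

Lemma nonzero_open (c : R -> R -> R) (t : R) (z : C) : jointly c t -> nonvanishing c t z ->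
  locally ((t, z) : prod_UniformSpace R_UniformSpace C_UniformSpace) (fun p => nonvanishing c (fst p) (snd p)).
Proof.
intros Hc Hn.
apply (tube_neq_0 (T := prod_UniformSpace R_UniformSpace C_UniformSpace) (fun s p => Dq (c s (fst p)) (snd p)) 0 1 (t, z)); [lra| |exact Hn].
intros s Hs. apply continuous_Dq.
- apply (continuous_comp_2 (fun q : R * (R * C) => fst q) (fun q : R * (R * C) => fst (snd q)) c); [apply continuous_fst_at|apply continuous_fst_snd|apply Hc, Hs].
- apply (continuous_snd_snd (T := R_UniformSpace) (U := R_UniformSpace) (V := C_UniformSpace)).
Qed.

Lemma Ker_continuous (p q c : R -> R -> R) (t : R) (z : C) :
  locally t (regular p q c) -> nonvanishing c t z ->
  continuous (fun u : R * C => Ker p q c (fst u) (snd u)) (t, z).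
Proof.
intros Hr Hn. destruct (locally_singleton _ _ Hr) as [_ [_ Hc]].
assert (Ho := nonzero_open c t z Hc Hn).
assert (Hr' : locally ((t, z) : prod_UniformSpace R_UniformSpace C_UniformSpace) (fun u => regular p q c (fst u))).
{ destruct Hr as [d Hd]. exists d. intros u [Hu _]. apply Hd, Hu. }
apply (continuous_Cavg (T := prod_UniformSpace R_UniformSpace C_UniformSpace)
  (fun th u => RtoC (p (sg th) (fst u)) * mq (c (sg th) (fst u)) (snd u) + RtoC (q (sg th) (fst u)) * nq (c (sg th) (fst u)) (snd u))%C).
generalize (filter_and _ _ Ho Hr'). apply filter_imp. intros u [Hn' [Rp [Rq Rc]]] th.
assert (C1 : continuous (fun v : R * (R * C) => fst v) (th, u)) by apply continuous_fst_at.
assert (C2 : continuous (fun v : R * (R * C) => fst (snd v)) (th, u)) by apply continuous_fst_snd.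
assert (C3 : continuous (fun v : R * (R * C) => snd (snd v)) (th, u)) by apply (continuous_snd_snd (T := R_UniformSpace) (U := R_UniformSpace) (V := C_UniformSpace)).
assert (P := jointly_comp p (fun v : R * (R * C) => fst v) (fun v => fst (snd v)) (th, u) Rp C1 C2).
assert (Q := jointly_comp q (fun v : R * (R * C) => fst v) (fun v => fst (snd v)) (th, u) Rq C1 C2).
assert (CC := jointly_comp c (fun v : R * (R * C) => fst v) (fun v => fst (snd v)) (th, u) Rc C1 C2).
apply continuous_Cplus; apply continuous_Cmult.
- apply (continuous_RtoC (fun v : R * (R * C) => p (sg (fst v)) (fst (snd v)))), P.
- apply (continuous_mq (fun v : R * (R * C) => c (sg (fst v)) (fst (snd v))) (fun v => snd (snd v))); [exact CC|exact C3|apply Hn', sg_bounds].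
- apply (continuous_RtoC (fun v : R * (R * C) => q (sg (fst v)) (fst (snd v)))), Q.
- apply (continuous_nq (fun v : R * (R * C) => c (sg (fst v)) (fst (snd v))) (fun v => snd (snd v))); [exact CC|exact C3|apply Hn', sg_bounds].
Qed.

Lemma Ksl_continuous (p q c : R -> R -> R) (t : R) (z w : C) :
  locally t (regular p q c) -> nonvanishing c t z -> nonvanishing c t w ->
  continuous (fun u : R * C => Ksl p q c z (fst u) (snd u)) (t, w).
Proof.
intros Hr Hnz Hn. destruct (locally_singleton _ _ Hr) as [_ [_ Hc]].
assert (Ho := nonzero_open c t w Hc Hn).
assert (Hz : locally t (fun t => nonvanishing c t z)).
{ destruct (nonzero_open c t z Hc Hnz) as [d Hd]. exists d. intros t' Ht'. apply (Hd (t', z)). split; [exact Ht'|apply ball_center]. }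
assert (Hr' : locally ((t, w) : prod_UniformSpace R_UniformSpace C_UniformSpace) (fun u => regular p q c (fst u) /\ nonvanishing c (fst u) z)).
{ destruct (filter_and _ _ Hr Hz) as [d Hd]. exists d. intros u [Hu _]. apply Hd, Hu. }
apply (continuous_Cavg (T := prod_UniformSpace R_UniformSpace C_UniformSpace)
  (fun th u => RtoC (p (sg th) (fst u)) * ms (c (sg th) (fst u)) z (snd u) + RtoC (q (sg th) (fst u)) * ns (c (sg th) (fst u)) z (snd u))%C).
generalize (filter_and _ _ Ho Hr'). apply filter_imp. intros u [Hn' [[Rp [Rq Rc]] Hnz']] th.
assert (C1 : continuous (fun v : R * (R * C) => fst v) (th, u)) by apply continuous_fst_at.
assert (C2 : continuous (fun v : R * (R * C) => fst (snd v)) (th, u)) by apply continuous_fst_snd.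
assert (C3 : continuous (fun v : R * (R * C) => snd (snd v)) (th, u)) by apply (continuous_snd_snd (T := R_UniformSpace) (U := R_UniformSpace) (V := C_UniformSpace)).
assert (P := jointly_comp p (fun v : R * (R * C) => fst v) (fun v => fst (snd v)) (th, u) Rp C1 C2).
assert (Q := jointly_comp q (fun v : R * (R * C) => fst v) (fun v => fst (snd v)) (th, u) Rq C1 C2).
assert (CC := jointly_comp c (fun v : R * (R * C) => fst v) (fun v => fst (snd v)) (th, u) Rc C1 C2).
apply continuous_Cplus; apply continuous_Cmult.
- apply (continuous_RtoC (fun v : R * (R * C) => p (sg (fst v)) (fst (snd v)))), P.
- apply (continuous_ms (fun v : R * (R * C) => c (sg (fst v)) (fst (snd v))) z (fun v => snd (snd v))); [exact CC|exact C3|apply Hn', sg_bounds|apply Hnz', sg_bounds].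
- apply (continuous_RtoC (fun v : R * (R * C) => q (sg (fst v)) (fst (snd v)))), Q.
- apply (continuous_ns (fun v : R * (R * C) => c (sg (fst v)) (fst (snd v))) z (fun v => snd (snd v))); [exact CC|exact C3|apply Hn', sg_bounds|apply Hnz', sg_bounds].
Qed.

Lemma Ker_integrand_continuous (p q c : R -> R -> R) (t th : R) (z : C) : regular p q c t -> nonvanishing c t z ->
  continuous (fun th => RtoC (p (sg th) t) * mq (c (sg th) t) z + RtoC (q (sg th) t) * nq (c (sg th) t) z)%C th.
Proof.
intros [Rp [Rq Rc]] Hn.
assert (P := jointly_comp p (fun v : R => v) (fun _ => t) th Rp (continuous_id _) (continuous_const _ _)).
assert (Q := jointly_comp q (fun v : R => v) (fun _ => t) th Rq (continuous_id _) (continuous_const _ _)).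
assert (CC := jointly_comp c (fun v : R => v) (fun _ => t) th Rc (continuous_id _) (continuous_const _ _)).
apply continuous_Cplus; apply continuous_Cmult.
- apply (continuous_RtoC (fun v : R => p (sg v) t)), P.
- apply (continuous_mq (fun v : R => c (sg v) t) (fun _ => z)); [exact CC|apply continuous_const|apply Hn, sg_bounds].
- apply (continuous_RtoC (fun v : R => q (sg v) t)), Q.
- apply (continuous_nq (fun v : R => c (sg v) t) (fun _ => z)); [exact CC|apply continuous_const|apply Hn, sg_bounds].
Qed.

Lemma Ksl_integrand_continuous (p q c : R -> R -> R) (t th : R) (z w : C) : regular p q c t ->
  nonvanishing c t z -> nonvanishing c t w ->
  continuous (fun th => RtoC (p (sg th) t) * ms (c (sg th) t) z w + RtoC (q (sg th) t) * ns (c (sg th) t) z w)%C th.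
Proof.
intros [Rp [Rq Rc]] Hz Hn.
assert (P := jointly_comp p (fun v : R => v) (fun _ => t) th Rp (continuous_id _) (continuous_const _ _)).
assert (Q := jointly_comp q (fun v : R => v) (fun _ => t) th Rq (continuous_id _) (continuous_const _ _)).
assert (CC := jointly_comp c (fun v : R => v) (fun _ => t) th Rc (continuous_id _) (continuous_const _ _)).
apply continuous_Cplus; apply continuous_Cmult.
- apply (continuous_RtoC (fun v : R => p (sg v) t)), P.
- apply (continuous_ms (fun v : R => c (sg v) t) z (fun _ => w)); [exact CC|apply continuous_const|apply Hn, sg_bounds|apply Hz, sg_bounds].
- apply (continuous_RtoC (fun v : R => q (sg v) t)), Q.
- apply (continuous_ns (fun v : R => c (sg v) t) z (fun _ => w)); [exact CC|apply continuous_const|apply Hn, sg_bounds|apply Hz, sg_bounds].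
Qed.

Lemma Ker_slope (p q c : R -> R -> R) (t : R) (z w : C) : regular p q c t -> nonvanishing c t z -> nonvanishing c t w ->
  (Ker p q c t w - Ker p q c t z = Ksl p q c z t w * (w - z))%C.
Proof.
intros Hr Hz Hw. unfold Ker, Ksl. rewrite <- Cavg_minus by (intros; apply Ker_integrand_continuous; assumption).
rewrite Cmult_comm, <- Cavg_scal by (intros; apply Ksl_integrand_continuous; assumption).
apply Cavg_ext. intros th. assert (B := sg_bounds th).
transitivity (RtoC (p (sg th) t) * (mq (c (sg th) t) w - mq (c (sg th) t) z) + RtoC (q (sg th) t) * (nq (c (sg th) t) w - nq (c (sg th) t) z))%C; [ring|].
rewrite mq_slope, nq_slope by (first [apply Hz|apply Hw]; exact B). ring.
Qed.

Lemma locally_pair_snd {U V : UniformSpace} (P : U * V -> Prop) (x : U) (y : V) :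
  locally ((x, y) : prod_UniformSpace U V) P -> locally y (fun v => P (x, v)).
Proof. intros [d Hd]. exists d. intros v Hv. apply Hd. split; [apply ball_center|exact Hv]. Qed.

Lemma Ker_derivable (p q c : R -> R -> R) (t : R) (z : C) : locally t (regular p q c) -> nonvanishing c t z ->
  exists l, Cderiv (fun w => Ker p q c t w) z l.
Proof.
intros Hr Hz. assert (Hr0 := locally_singleton _ _ Hr).
assert (Ho := locally_pair_snd _ _ _ (nonzero_open c t z (proj2 (proj2 Hr0)) Hz)). cbn [fst snd] in Ho.
exists (Ksl p q c z t z). apply Cderiv_slope. exists (fun w => Ksl p q c z t w). split; [|split; [reflexivity|]].
- apply (continuous_comp_2 (fun _ : C => t) (fun w : C => w) (fun t w => Ksl p q c z t w)); [apply continuous_const|apply continuous_id|].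
  apply Ksl_continuous; assumption.
- revert Ho. apply filter_imp. intros w Hw. apply Ker_slope; assumption.
Qed.

(* [nonvanishing] at all parameters of a compact interval is an open condition on z. *)
Lemma nonzero_uniform (c : R -> R -> R) (a b : R) (z : C) : a <= b ->
  (forall t, a <= t <= b -> jointly c t) -> (forall t, a <= t <= b -> nonvanishing c t z) ->
  locally z (fun w => forall t, a <= t <= b -> nonvanishing c t w).
Proof.
intros Hab Hc Hn.
assert (Hd : forall t, exists d : posreal, a <= t <= b -> forall t' w, Rabs (t' - t) < d -> ball z d w -> nonvanishing c t' w).
{ intros t. destruct (classic (a <= t <= b)) as [Ht|Ht]; [|exists (mkposreal 1 Rlt_0_1); tauto].
  destruct (nonzero_open c t z (Hc t Ht) (Hn t Ht)) as [d Hd]. exists d. intros _ t' w Ht' Hw. apply (Hd (t', w)). split; assumption. }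
set (delta := fun t => proj1_sig (constructive_indefinite_description _ (Hd t))).
assert (Hdelta : forall t, a <= t <= b -> forall t' w, Rabs (t' - t) < delta t -> ball z (delta t) w -> nonvanishing c t' w).
{ intros t. unfold delta. destruct constructive_indefinite_description as [d H]. exact H. }
destruct (compactness_value_1d a b delta) as [d H].
exists d. intros w Hw t Ht. apply NNPP. intros Hno. apply (H t Ht). intros [t0 [Ht0 [H1 H2]]]. apply Hno.
apply (Hdelta t0 Ht0); [exact H1|exact (ball_le _ _ _ H2 _ Hw)].
Qed.

Lemma Ker_integral_derivable (U : R -> R) (p q c : R -> R -> R) (b : R) (z : C) : 0 <= b ->
  (forall t, 0 <= t <= b -> continuous U t) -> (forall t, 0 <= t <= b -> locally t (regular p q c)) ->
  (forall t, 0 <= t <= b -> nonvanishing c t z) ->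
  exists l, Cderiv (fun w => CInt (fun t => RtoC (U t) * Ker p q c t w) 0 b)%C z l.
Proof.
intros Hb HU Hr Hz.
assert (Ho := nonzero_uniform c 0 b z Hb (fun t Ht => proj2 (proj2 (locally_singleton _ _ (Hr t Ht)))) Hz).
exists (CInt (fun t => RtoC (U t) * Ksl p q c z t z)%C 0 b).
apply (Cderiv_CInt (fun t w => RtoC (U t) * Ker p q c t w)%C (fun t w => RtoC (U t) * Ksl p q c z t w)%C); [exact Hb| | |].
- revert Ho. apply filter_imp. intros w Hw t Ht.
  assert (E := Ker_slope p q c t z w (locally_singleton _ _ (Hr t Ht)) (Hz t Ht) (Hw t Ht)).
  transitivity (RtoC (U t) * (Ker p q c t w - Ker p q c t z))%C; [ring|]. rewrite E. ring.
- revert Ho. apply filter_imp. intros w Hw. apply ex_CInt_continuous; [exact Hb|]. intros t Ht.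
  apply continuous_Cmult; [apply (continuous_RtoC U), HU, Ht|].
  apply (continuous_comp_2 (fun t : R => t) (fun _ => w) (fun t w => Ker p q c t w)); [apply continuous_id|apply continuous_const|].
  apply Ker_continuous; [apply Hr, Ht|apply Hw, Ht].
- revert Ho. apply filter_imp. intros w Hw t Ht.
  apply continuous_Cmult.
  + apply (continuous_RtoC (fun u : R * C => U (fst u))). apply (continuous_comp (fun u : R * C => fst u) U); [apply continuous_fst_at|apply HU, Ht].
  + apply Ksl_continuous; [apply Hr, Ht|apply Hz, Ht|apply Hw, Ht].
Qed.

(** Compactness by [square_bisection]; small squares about a point outside the rectangle miss it,
    and there any bound holds. *)
Lemma jointly_bounded (f : R -> R -> R) (b : R) : 0 <= b -> (forall t, 0 <= t <= b -> jointly f t) ->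
  exists M, forall s t, 0 <= s <= 1 -> 0 <= t <= b -> Rabs (f s t) <= M.
Proof.
intros Hb Hj.
set (P := fun a1 a2 h : R => exists M, forall s t, a1 <= s <= a1 + h -> a2 <= t <= a2 + h ->
   0 <= s <= 1 -> 0 <= t <= b -> Rabs (f s t) <= M).
assert (HP : P 0 0 (1 + b)).
{ apply (square_bisection P).
  - intros a1 a2 h Hh [M1 H1] [M2 H2] [M3 H3] [M4 H4].
    exists (Rmax (Rmax M1 M2) (Rmax M3 M4)). intros s t Hs Ht Hs' Ht'.
    assert (X1 := Rmax_l (Rmax M1 M2) (Rmax M3 M4)). assert (X2 := Rmax_r (Rmax M1 M2) (Rmax M3 M4)).
    assert (X3 := Rmax_l M1 M2). assert (X4 := Rmax_r M1 M2). assert (X5 := Rmax_l M3 M4). assert (X6 := Rmax_r M3 M4).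
    destruct (Rle_dec s (a1 + h / 2)), (Rle_dec t (a2 + h / 2)).
    + specialize (H1 s t ltac:(lra) ltac:(lra) Hs' Ht'). lra.
    + specialize (H3 s t ltac:(lra) ltac:(lra) Hs' Ht'). lra.
    + specialize (H2 s t ltac:(lra) ltac:(lra) Hs' Ht'). lra.
    + specialize (H4 s t ltac:(lra) ltac:(lra) Hs' Ht'). lra.
  - lra.
  - intros s0 t0 Hs0 Ht0. destruct (classic (0 <= s0 <= 1 /\ 0 <= t0 <= b)) as [[Hs1 Ht1]|Hout].
    + destruct (proj1 (filterlim_locally _ _) (Hj t0 Ht1 s0 Hs1) (mkposreal 1 Rlt_0_1)) as [d Hd].
      exists d; split; [apply cond_pos|]. intros a1 a2 h Hh H1 H2. exists (Rabs (f s0 t0) + 1).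
      intros s t Hs Ht _ _. specialize (Hd (s, t)).
      assert (X : Rabs (f s t - f s0 t0) < 1).
      { apply Hd. split; apply Rabs_def1; simpl; unfold minus, plus, opp; simpl; lra. }
      assert (T := Rabs_triang (f s t - f s0 t0) (f s0 t0)). replace (f s t - f s0 t0 + f s0 t0) with (f s t) in T by ring. lra.
    + assert (Hsep : exists d, 0 < d /\ forall s t, Rabs (s - s0) <= d -> Rabs (t - t0) <= d -> ~ (0 <= s <= 1 /\ 0 <= t <= b)).
      { assert (Hcase : s0 < 0 \/ 1 < s0 \/ t0 < 0 \/ b < t0) by lra.
        destruct Hcase as [L|[L|[L|L]]].
        - exists (- s0 / 2); split; [lra|]. intros s t Hs Ht [A B]. apply Rabs_le_between in Hs. lra.
        - exists ((s0 - 1) / 2); split; [lra|]. intros s t Hs Ht [A B]. apply Rabs_le_between in Hs. lra.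
        - exists (- t0 / 2); split; [lra|]. intros s t Hs Ht [A B]. apply Rabs_le_between in Ht. lra.
        - exists ((t0 - b) / 2); split; [lra|]. intros s t Hs Ht [A B]. apply Rabs_le_between in Ht. lra. }
      destruct Hsep as [d [Hd Hsep]]. exists d; split; [exact Hd|]. intros a1 a2 h Hh H1 H2.
      exists 0. intros s t Hs Ht Hs' Ht'. exfalso. apply (Hsep s t); [apply Rabs_le; lra|apply Rabs_le; lra|split; assumption]. }
destruct HP as [M HM]. exists M. intros s t Hs Ht. apply HM; lra.
Qed.

Lemma Dq_large (c M : R) (z : C) : Rabs c <= M -> 2 * M + 2 <= Cmod z -> Cmod z ^ 2 / 2 <= Cmod (Dq c z) /\ Dq c z <> RtoC 0.
Proof.
intros Hc Hz. assert (Hc0 := Rabs_pos c).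
assert (H : Cmod z ^ 2 / 2 <= Cmod (Dq c z)).
{ unfold Dq. replace (z * z + RtoC c * z + RtoC 1)%C with (z * z - (- (RtoC c * z) - RtoC 1))%C by ring.
  eapply Rle_trans; [|apply Cmod_ge_diff].
  assert (X : Cmod (- (RtoC c * z) - RtoC 1) <= M * Cmod z + 1).
  { unfold Cminus. eapply Rle_trans; [apply Cmod_triangle|]. rewrite !Cmod_opp, Cmod_mult, !Cmod_R, Rabs_R1.
    apply Rplus_le_compat_r, Rmult_le_compat_r; [apply Cmod_ge_0|exact Hc]. }
  rewrite Cmod_mult. nra. }
split; [exact H|]. apply Cmod_gt_0. nra.
Qed.

Lemma mq_large (c M : R) (z : C) : Rabs c <= M -> 2 * M + 2 <= Cmod z -> Cmod (mq c z) <= 2 * (M + 2) / Cmod z.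
Proof.
intros Hc Hz. destruct (Dq_large c M z Hc Hz) as [H Hn]. assert (Hc0 := Rabs_pos c). assert (Hzp : 0 < Cmod z) by lra.
unfold mq. rewrite Cmod_div by exact Hn. apply Rle_div_l; [apply Rlt_gt; nra|].
apply Rle_trans with ((M + 2) * Cmod z).
- eapply Rle_trans; [apply Cmod_triangle|]. rewrite Cmod_mult, !Cmod_R, (Rabs_pos_eq 2) by lra. nra.
- apply Rle_trans with (2 * (M + 2) / Cmod z * (Cmod z ^ 2 / 2)); [apply Req_le; field; lra|].
  apply Rmult_le_compat_l; [|exact H]. apply Rdiv_le_0_compat; lra.
Qed.

Lemma nq_large (c M : R) (z : C) : Rabs c <= M -> 2 * M + 2 <= Cmod z -> Cmod (nq c z) <= 8 / Cmod z.
Proof.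
intros Hc Hz. destruct (Dq_large c M z Hc Hz) as [H Hn]. assert (Hc0 := Rabs_pos c). assert (Hzp : 2 <= Cmod z) by lra.
unfold nq. rewrite Cmod_div by (apply Cmult_neq_0; exact Hn). apply Rle_div_l; [apply Rlt_gt, Cmod_gt_0, Cmult_neq_0; exact Hn|].
apply Rle_trans with (2 * Cmod z ^ 3).
- unfold Cminus. eapply Rle_trans; [apply Cmod_triangle|]. rewrite Cmod_opp, !Cmod_mult.
  assert (Cmod z <= Cmod z ^ 3) by (simpl; nra). simpl in *. lra.
- apply Rle_trans with (8 / Cmod z * (Cmod z ^ 2 / 2 * (Cmod z ^ 2 / 2))); [apply Req_le; field; lra|].
  apply Rmult_le_compat_l; [apply Rdiv_le_0_compat; lra|]. rewrite Cmod_mult. 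
  assert (0 <= Cmod z ^ 2 / 2) by nra. apply Rmult_le_compat; assumption.
Qed.

Lemma Cavg_bound (h : R -> C) (M : R) : (forall s, continuous h s) -> (forall s, Cmod (h s) <= M) -> Cmod (Cavg h) <= M.
Proof.
intros Hc HM. unfold Cavg. rewrite Cmod_mult.
assert (B := CInt_bound h 0 PI M PI_ge_0 (ex_Cavg h Hc) (fun t _ => HM t)).
rewrite Cmod_inv by apply PI_neq_0_C. rewrite Cmod_R, Rabs_pos_eq by apply PI_ge_0.
assert (P := PI_RGT_0). apply Rmult_le_reg_l with PI; [exact P|]. rewrite <- Rmult_assoc, Rinv_r by lra. lra.
Qed.

Lemma Ker_decay (p q c : R -> R -> R) (b : R) : 0 <= b -> (forall t, 0 <= t <= b -> regular p q c t) ->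
  exists M r, 0 < r /\ forall z t, r < Cmod z -> 0 <= t <= b ->
    Cmod (Ker p q c t z) <= M / Cmod z /\ nonvanishing c t z.
Proof.
intros Hb Hr.
destruct (jointly_bounded p b Hb (fun t Ht => proj1 (Hr t Ht))) as [Mp HMp].
destruct (jointly_bounded q b Hb (fun t Ht => proj1 (proj2 (Hr t Ht)))) as [Mq HMq].
destruct (jointly_bounded c b Hb (fun t Ht => proj2 (proj2 (Hr t Ht)))) as [Mc HMc].
assert (P0 : 0 <= Mp) by (eapply Rle_trans; [apply Rabs_pos|apply (HMp 0 0); lra]).
assert (Q0 : 0 <= Mq) by (eapply Rle_trans; [apply Rabs_pos|apply (HMq 0 0); lra]).
assert (C0 : 0 <= Mc) by (eapply Rle_trans; [apply Rabs_pos|apply (HMc 0 0); lra]).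
exists (Mp * (2 * (Mc + 2)) + Mq * 8), (2 * Mc + 2). split; [lra|]. intros z t Hz Ht.
assert (Hnv : nonvanishing c t z).
{ intros s Hs. apply (Dq_large (c s t) Mc); [apply HMc; assumption|lra]. }
split; [|exact Hnv]. unfold Ker. apply Cavg_bound.
- intros th. apply Ker_integrand_continuous; [apply Hr, Ht|exact Hnv].
- intros th. assert (B := sg_bounds th).
  assert (X1 := mq_large (c (sg th) t) Mc z (HMc _ _ B Ht) ltac:(lra)).
  assert (X2 := nq_large (c (sg th) t) Mc z (HMc _ _ B Ht) ltac:(lra)).
  eapply Rle_trans; [apply Cmod_triangle|]. rewrite !Cmod_mult, !Cmod_R.
  replace ((Mp * (2 * (Mc + 2)) + Mq * 8) / Cmod z) with (Mp * (2 * (Mc + 2) / Cmod z) + Mq * (8 / Cmod z)) by (field; lra).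
  apply Rplus_le_compat; apply Rmult_le_compat; try apply Rabs_pos; try apply Cmod_ge_0; try assumption; [apply HMp|apply HMq]; assumption.
Qed.

Definition domK (y k : R) : Prop := k < 1 /\ y + k < 1.
(** All derivatives of [ff] are [ff] times a polynomial in [ia] and [ib]. This makes them smooth at
    once and reduces identities between them to rational ones. *)
Definition ia (y k : R) : R := / (1 - k).
Definition ib (y k : R) : R := / (1 - y - k).
Definition dff (y k : R) : R := ff y k * (/ 2 * (ib y k - ia y k)).
Definition dgg (t x k : R) : R := / 2 * (Rpower (k - t) (- / 2 - 1) * Rpower (k - x) (- / 2)).

Lemma is_derive_Rpower_comp (f : R -> R) (t df e : R) : is_derive f t df -> 0 < f t ->
  is_derive (fun s => Rpower (f s) e) t (df * (e * Rpower (f t) (e - 1))).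
Proof.
intros Hf Hp. apply (is_derive_comp (fun u => Rpower u e) f); [|exact Hf].
apply is_derive_Reals, derivable_pt_lim_power, Hp.
Qed.

Lemma Rpower_pred (u e : R) : 0 < u -> Rpower u (e - 1) = Rpower u e * / u.
Proof. intros Hu. unfold Rminus. rewrite Rpower_plus, Rpower_Ropp, Rpower_1 by exact Hu. reflexivity. Qed.

Lemma is_derive_ff (y k : R) : domK y k -> is_derive (ff y) k (dff y k).
Proof.
intros [Hk Hy]. unfold ff. evar_last.
- apply (is_derive_mult (K := R_AbsRing) (fun k => Rpower (1 - k) (/ 2)) (fun k => Rpower (1 - y - k) (- / 2))).
  + apply (is_derive_Rpower_comp (fun k => 1 - k) k (-1)); [|lra]. auto_derive; [exact I|ring].
  + apply (is_derive_Rpower_comp (fun k => 1 - y - k) k (-1)); [|lra]. auto_derive; [exact I|ring].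
  + exact Rmult_comm.
- unfold plus, mult; simpl. unfold dff, ff, ia, ib. rewrite !Rpower_pred by lra. ring.
Qed.

Lemma is_derive_gg (t x k : R) : t < k -> is_derive (fun t => gg t x k) t (dgg t x k).
Proof.
intros Hk. unfold gg, dgg. evar_last.
- apply (is_derive_scal_l (K := R_AbsRing) (V := R_NormedModule) (fun t => Rpower (k - t) (- / 2))).
  apply (is_derive_Rpower_comp (fun t => k - t) t (-1)); [|lra]. auto_derive; [exact I|ring].
- unfold scal; simpl; unfold mult; simpl. ring.
Qed.

(** The points of the two cuts, with s in place of [sg th]; [ca] and [cb] are the coefficients of
    the kernel there. The suffix a refers to [t, x], the suffix b to [1 - y, 1], and a prime to the
    derivative in t. *)
Definition ka (x s t : R) : R := t + (x - t) * s.
Definition kb (y s : R) : R := 1 - y + (1 - (1 - y)) * s.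
Definition ca (x y s t : R) : R := cc x y (ka x s t).
Definition cb (x y s t : R) : R := cc x y (kb y s).
Definition pa' (x y s t : R) : R := (1 - s) * dff y (ka x s t).
Definition qa' (x y s t : R) : R := (1 - s) * ff y (ka x s t) * (- 4 / (1 - x - y)).
Definition alpha' (x y t : R) (z : C) : C := (- Ker (pa' x y) (qa' x y) (ca x y) t z)%C.
Definition pb (x y s t : R) : R := (1 - kb y s) * gg t x (kb y s).
Definition pb' (x y s t : R) : R := (1 - kb y s) * dgg t x (kb y s).
Definition zero2 (s t : R) : R := 0.
Definition beta' (x y t : R) (z : C) : C := Ker (pb' x y) zero2 (cb x y) t z.

Lemma alpha_Ker (x y t : R) (z : C) :
  alpha x y t z = (- Ker (fun s t => ff y (ka x s t)) zero2 (ca x y) t z)%C.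
Proof.
unfold alpha, Ker. apply (f_equal Copp). apply Cavg_ext. intros th.
unfold zero2, MM, mq, Dc, Dq, ca, ka, seg. ring.
Qed.

Lemma beta_Ker (x y t : R) (z : C) :
  beta x y t z = (RtoC 1 + Ker (pb x y) zero2 (cb x y) t z)%C.
Proof.
unfold beta, Ker. apply (f_equal (fun u => RtoC 1 + u)%C). apply Cavg_ext. intros th.
unfold zero2, pb, MM, mq, Dc, Dq, cb, kb, seg. ring.
Qed.

Lemma ka_lt (x y s t : R) : x < 1 - y -> t < 1 - y -> 0 <= s <= 1 -> ka x s t < 1 - y.
Proof.
intros Hx Ht Hs. unfold ka.
assert (0 <= (1 - y - t) * (1 - s)) by (apply Rmult_le_pos; lra).
destruct (Req_dec s 0) as [->|Hs0]; [lra|].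
assert (0 < (1 - y - x) * s) by (apply Rmult_lt_0_compat; lra). lra.
Qed.
Lemma kb_ge (y s : R) : 0 <= y -> 0 <= s <= 1 -> 1 - y <= kb y s <= 1.
Proof. intros. unfold kb. nra. Qed.

Lemma continuous_ff_comp {T : UniformSpace} (y : R) (f : T -> R) (p : T) : 0 <= y ->
  continuous f p -> f p < 1 - y -> continuous (fun q => ff y (f q)) p.
Proof. intros Hy Hf Hp. unfold ff. cont; try exact Hf; lra. Qed.
Lemma continuous_dff_comp {T : UniformSpace} (y : R) (f : T -> R) (p : T) : 0 <= y ->
  continuous f p -> f p < 1 - y -> continuous (fun q => dff y (f q)) p.
Proof. intros Hy Hf Hp. unfold dff, ff, ia, ib. cont; try exact Hf; lra. Qed.

Lemma continuous_ka_comp {T : UniformSpace} (x : R) (f g : T -> R) (p : T) :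
  continuous f p -> continuous g p -> continuous (fun q => ka x (f q) (g q)) p.
Proof. intros Hf Hg. unfold ka. cont; assumption. Qed.

Lemma jointly_zero2 (t : R) : jointly zero2 t.
Proof. intros s _. apply continuous_const. Qed.

Lemma ca_regular (x y t : R) : x + y < 1 -> jointly (ca x y) t.
Proof.
intros Hxy s _. unfold ca, cc, ka. cont; try apply continuous_fst_at; try apply continuous_snd_at. lra.
Qed.
Lemma cb_regular (x y t : R) : x + y < 1 -> jointly (cb x y) t.
Proof.
intros Hxy s _. unfold cb, cc, kb. cont; try apply continuous_fst_at; try apply continuous_snd_at. lra.
Qed.

Lemma ff_jointly (x y t : R) : 0 <= y -> x + y < 1 -> t < 1 - y -> jointly (fun s t => ff y (ka x s t)) t.
Proof.
intros Hy Hxy Ht s Hs. apply (continuous_ff_comp y (fun q : R * R => ka x (fst q) (snd q))); [exact Hy| |].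
- apply continuous_ka_comp; [apply continuous_fst_at|apply continuous_snd_at].
- apply ka_lt; simpl; lra.
Qed.
Lemma dff_jointly (x y t : R) : 0 <= y -> x + y < 1 -> t < 1 - y -> jointly (fun s t => dff y (ka x s t)) t.
Proof.
intros Hy Hxy Ht s Hs. apply (continuous_dff_comp y (fun q : R * R => ka x (fst q) (snd q))); [exact Hy| |].
- apply continuous_ka_comp; [apply continuous_fst_at|apply continuous_snd_at].
- apply ka_lt; simpl; lra.
Qed.

Lemma regular_a (x y t : R) : 0 <= y -> x + y < 1 -> t < 1 - y ->
  regular (fun s t => ff y (ka x s t)) zero2 (ca x y) t.
Proof.
intros Hy Hxy Ht. split; [|split]; [apply ff_jointly; assumption|apply jointly_zero2|apply ca_regular, Hxy].
Qed.
Lemma regular_a' (x y t : R) : 0 <= y -> x + y < 1 -> t < 1 - y -> regular (pa' x y) (qa' x y) (ca x y) t.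
Proof.
intros Hy Hxy Ht. split; [|split]; [| |apply ca_regular, Hxy].
- intros s Hs. assert (X := dff_jointly x y t Hy Hxy Ht s Hs). unfold pa'. cont; exact X.
- intros s Hs. assert (X := ff_jointly x y t Hy Hxy Ht s Hs). unfold qa'. cont; exact X.
Qed.
Lemma regular_b (x y t : R) : 0 <= y -> x + y < 1 -> t < 1 - y -> regular (pb x y) zero2 (cb x y) t.
Proof.
intros Hy Hxy Ht. split; [|split]; [|apply jointly_zero2|apply cb_regular, Hxy].
intros s Hs. assert (B := kb_ge y s Hy Hs). unfold pb, gg.
assert (X : continuous (fun q : R * R => kb y (fst q)) (s, t)) by (unfold kb; cont; apply continuous_fst_at).
cont; try exact X; try apply continuous_snd_at; cbn [fst snd]; lra.
Qed.
Lemma regular_b' (x y t : R) : 0 <= y -> x + y < 1 -> t < 1 - y -> regular (pb' x y) zero2 (cb x y) t.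
Proof.
intros Hy Hxy Ht. split; [|split]; [|apply jointly_zero2|apply cb_regular, Hxy].
intros s Hs. assert (B := kb_ge y s Hy Hs). unfold pb', dgg.
assert (X : continuous (fun q : R * R => kb y (fst q)) (s, t)) by (unfold kb; cont; apply continuous_fst_at).
cont; try exact X; try apply continuous_snd_at; cbn [fst snd]; lra.
Qed.

Lemma locally_lt (t b : R) (P : R -> Prop) : t < b -> (forall u, u < b -> P u) -> locally t P.
Proof.
intros Ht HP. assert (Hd : 0 < b - t) by lra. exists (mkposreal _ Hd). intros u Hu. apply HP.
apply Rabs_def2 in Hu. simpl in Hu. unfold minus, plus, opp in Hu; simpl in Hu. lra.
Qed.

Lemma RCd_mq (c : R -> R) (t dc : R) (z : C) : is_derive c t dc -> Dq (c t) z <> RtoC 0 ->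
  RCd (fun t => mq (c t) z) t (RtoC dc * nq (c t) z)%C.
Proof.
intros Hc Hn. unfold mq, nq.
assert (Hcz : RCd (fun t => RtoC (c t) * z)%C t (RtoC dc * z + RtoC (c t) * RtoC 0)%C)
  by exact (RCd_mult (fun t => RtoC (c t)) (fun _ => z) t _ _ (RCd_RtoC c t dc Hc) (RCd_const z t)).
assert (HN := RCd_plus _ _ t _ _ Hcz (RCd_const (RtoC 2) t)).
assert (HD := RCd_plus _ _ t _ _ (RCd_plus _ _ t _ _ (RCd_const (z * z)%C t) Hcz) (RCd_const (RtoC 1) t)).
assert (HI := RCd_inv (fun t => Dq (c t) z) t _ HD Hn).
refine (RCd_ext _ _ t _ _ (fun s => eq_refl) _ (RCd_mult _ _ t _ _ HN HI)).
cbv beta. set (D := Dq (c t) z) in *.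
transitivity ((RtoC dc * z * (D - (RtoC (c t) * z + RtoC 2))) / (D * D))%C; [field; exact Hn|].
transitivity (RtoC dc * (z * z * z - z) / (D * D))%C; [|field; exact Hn].
apply (f_equal (fun u => u / (D * D))%C). unfold D, Dq.
replace (RtoC 2) with (RtoC 1 + RtoC 1)%C by (rewrite <- RtoC_plus; f_equal; ring). ring.
Qed.

Lemma is_derive_ka (x s t : R) : is_derive (ka x s) t (1 - s).
Proof. unfold ka. auto_derive; [exact I|ring]. Qed.

Lemma nonzero_locally (c : R -> R -> R) (t : R) (z : C) : jointly c t -> nonvanishing c t z ->
  locally t (fun t => nonvanishing c t z).
Proof.
intros Hc Hnz. destruct (nonzero_open c t z Hc Hnz) as [d Hd]. exists d. intros t' Ht'.
apply (Hd (t', z)). split; [exact Ht'|apply ball_center].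
Qed.

Lemma RCd_alpha (x y t : R) (z : C) : 0 <= y -> x + y < 1 -> t < 1 - y -> nonvanishing (ca x y) t z ->
  RCd (fun t => alpha x y t z) t (alpha' x y t z).
Proof.
intros Hy Hxy Ht Hn.
assert (Hl := nonzero_locally _ _ _ (ca_regular x y t Hxy) Hn).
assert (Hl2 : locally t (fun t => t < 1 - y)) by (apply (locally_lt t (1 - y)); tauto).
assert (H := filter_and _ _ Hl Hl2).
eapply RCd_ext; [intros s; symmetry; apply alpha_Ker|reflexivity|].
unfold alpha'.
assert (HK : RCd (fun t => Ker (fun s t => ff y (ka x s t)) zero2 (ca x y) t z) t (Ker (pa' x y) (qa' x y) (ca x y) t z)).
{ unfold Ker.
  apply (RCd_Cavg (fun th t => RtoC (ff y (ka x (sg th) t)) * mq (ca x y (sg th) t) z + RtoC (zero2 (sg th) t) * nq (ca x y (sg th) t) z)%C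
    (fun th t => RtoC (pa' x y (sg th) t) * mq (ca x y (sg th) t) z + RtoC (qa' x y (sg th) t) * nq (ca x y (sg th) t) z)%C).
  - revert H. apply filter_imp. intros u [Hnu Hu] th. assert (B := sg_bounds th).
    assert (Hff : is_derive (fun t => ff y (ka x (sg th) t)) u (pa' x y (sg th) u)).
    { unfold pa'. apply (is_derive_comp (ff y) (ka x (sg th))); [apply is_derive_ff; assert (X := ka_lt x y (sg th) u ltac:(lra) ltac:(lra) (sg_bounds th)); unfold domK; lra|apply is_derive_ka]. }
    assert (Hc : is_derive (fun t => ca x y (sg th) t) u ((1 - sg th) * (- 4 / (1 - x - y)))).
    { unfold ca, cc, ka. auto_derive; [exact I|]. field. lra. }
    refine (RCd_ext _ _ u _ _ _ _ (RCd_plus _ _ u _ _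
      (RCd_mult _ _ u _ _ (RCd_RtoC _ u _ Hff) (RCd_mq _ u _ z Hc (Hnu _ B))) (RCd_const (RtoC 0) u))).
    + intros s. unfold zero2. ring.
    + unfold qa'. rewrite !RtoC_mult. ring.
  - revert H. apply filter_imp. intros u [Hnu Hu] th. exact (Ker_integrand_continuous (fun s t => ff y (ka x s t)) zero2 (ca x y) u th z (regular_a x y u Hy Hxy Hu) Hnu).
  - intros th. assert (B := sg_bounds th). destruct (regular_a' x y t Hy Hxy Ht) as [R1 [R2 R3]].
    assert (C1 : continuous (fun v : R * R => fst v) (th, t)) by apply continuous_fst_at.
    assert (C2 : continuous (fun v : R * R => snd v) (th, t)) by apply continuous_snd_at.
    assert (P := jointly_comp _ _ _ (th, t) R1 C1 C2). assert (Q := jointly_comp _ _ _ (th, t) R2 C1 C2).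
    assert (CC := jointly_comp _ _ _ (th, t) R3 C1 C2).
    apply continuous_Cplus; apply continuous_Cmult.
    + exact (continuous_RtoC _ _ P).
    + apply (continuous_mq (fun v : R * R => ca x y (sg (fst v)) (snd v)) (fun _ => z)); [exact CC|apply continuous_const|apply Hn, B].
    + exact (continuous_RtoC _ _ Q).
    + apply (continuous_nq (fun v : R * R => ca x y (sg (fst v)) (snd v)) (fun _ => z)); [exact CC|apply continuous_const|apply Hn, B]. }
destruct HK as [H1 H2]. split.
- exact (is_derive_opp (V := R_NormedModule) _ _ _ H1).
- exact (is_derive_opp (V := R_NormedModule) _ _ _ H2).
Qed.

Lemma RCd_beta (x y t : R) (z : C) : 0 <= y -> x + y < 1 -> t < 1 - y -> nonvanishing (cb x y) t z ->
  RCd (fun t => beta x y t z) t (beta' x y t z).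
Proof.
intros Hy Hxy Ht Hn.
assert (Hl := nonzero_locally _ _ _ (cb_regular x y t Hxy) Hn).
assert (Hl2 : locally t (fun t => t < 1 - y)) by (apply (locally_lt t (1 - y)); tauto).
assert (H := filter_and _ _ Hl Hl2).
eapply RCd_ext; [intros s; symmetry; apply beta_Ker| |].
2:{ apply RCd_plus; [apply RCd_const|]. unfold Ker.
  apply (RCd_Cavg (fun th t => RtoC (pb x y (sg th) t) * mq (cb x y (sg th) t) z + RtoC (zero2 (sg th) t) * nq (cb x y (sg th) t) z)%C
    (fun th t => RtoC (pb' x y (sg th) t) * mq (cb x y (sg th) t) z + RtoC (zero2 (sg th) t) * nq (cb x y (sg th) t) z)%C).
  - revert H. apply filter_imp. intros u [Hnu Hu] th. assert (B := sg_bounds th). assert (B' := kb_ge y _ Hy B).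
    assert (Hff : is_derive (fun t => pb x y (sg th) t) u (pb' x y (sg th) u)).
    { unfold pb, pb'. apply (is_derive_scal (fun t => gg t x (kb y (sg th)))). apply is_derive_gg. lra. }
    refine (RCd_ext _ _ u _ _ _ _ (RCd_plus _ _ u _ _
      (RCd_mult _ _ u _ _ (RCd_RtoC _ u _ Hff) (RCd_const (mq (cb x y (sg th) u) z) u)) (RCd_const (RtoC 0) u))).
    + intros s. unfold zero2, cb. ring.
    + unfold zero2. ring.
  - revert H. apply filter_imp. intros u [Hnu Hu] th. exact (Ker_integrand_continuous (pb x y) zero2 (cb x y) u th z (regular_b x y u Hy Hxy Hu) Hnu).
  - intros th. assert (B := sg_bounds th). destruct (regular_b' x y t Hy Hxy Ht) as [R1 [R2 R3]].
    assert (C1 : continuous (fun v : R * R => fst v) (th, t)) by apply continuous_fst_at.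
    assert (C2 : continuous (fun v : R * R => snd v) (th, t)) by apply continuous_snd_at.
    assert (P := jointly_comp _ _ _ (th, t) R1 C1 C2). assert (Q := jointly_comp _ _ _ (th, t) R2 C1 C2).
    assert (CC := jointly_comp _ _ _ (th, t) R3 C1 C2).
    apply continuous_Cplus; apply continuous_Cmult.
    + exact (continuous_RtoC _ _ P).
    + apply (continuous_mq (fun v : R * R => cb x y (sg (fst v)) (snd v)) (fun _ => z)); [exact CC|apply continuous_const|apply Hn, B].
    + exact (continuous_RtoC _ _ Q).
    + apply (continuous_nq (fun v : R * R => cb x y (sg (fst v)) (snd v)) (fun _ => z)); [exact CC|apply continuous_const|apply Hn, B]. }
unfold beta', Ker. ring.
Qed.

(** * The two parts of the jump, and their value at z = 0 *)

(** The integrals of U' [alpha] and U' [beta] over [0, x] after integration by parts; the boundary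
    term at 0 is absent because U 0 = 0. *)
Definition Af (x y : R) (U : R -> R) (z : C) : C :=
  (RtoC (U x) * alpha x y x z - CInt (fun t => RtoC (U t) * alpha' x y t z) 0 x)%C.
Definition Bf (x y : R) (U : R -> R) (z : C) : C :=
  (RtoC (U x) * beta x y x z - CInt (fun t => RtoC (U t) * beta' x y t z) 0 x)%C.

Lemma nonvanishing_a (x y t : R) (z : C) : 0 <= t <= x ->
  (forall k, 0 <= k <= x -> Dc x y k z <> RtoC 0) -> nonvanishing (ca x y) t z.
Proof. intros Ht H s Hs. apply (H (ka x s t)). unfold ka. nra. Qed.
Lemma nonvanishing_b (x y t : R) (z : C) : 0 <= y ->
  (forall k, 1 - y <= k <= 1 -> Dc x y k z <> RtoC 0) -> nonvanishing (cb x y) t z.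
Proof. intros Hy H s Hs. apply (H (kb y s)). apply kb_ge; assumption. Qed.

(* The sign of [alpha'] is moved to U, so that no integrability is needed. *)
Lemma Af_derivable (x y : R) (U : R -> R) (z : C) : 0 <= x -> 0 <= y -> x + y < 1 ->
  (forall t, t < 1 -> continuous U t) -> (forall k, 0 <= k <= x -> Dc x y k z <> RtoC 0) ->
  exists l, Cderiv (Af x y U) z l.
Proof.
intros Hx Hy Hxy HU HD.
destruct (Ker_derivable (fun s t => ff y (ka x s t)) zero2 (ca x y) x z) as [l1 H1].
{ apply (locally_lt x (1 - y)); [lra|]. intros; apply regular_a; lra. }
{ apply nonvanishing_a; [lra|exact HD]. }
destruct (Ker_integral_derivable (fun t => - U t) (pa' x y) (qa' x y) (ca x y) x z Hx) as [l2 H2].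
{ intros; apply continuous_Ropp, HU; lra. }
{ intros t Ht. apply (locally_lt t (1 - y)); [lra|]. intros; apply regular_a'; lra. }
{ intros t Ht. apply nonvanishing_a; [lra|exact HD]. }
assert (H3 := Cderiv_mult _ _ z _ _ (Cderiv_const (- RtoC (U x))%C z) H1).
assert (H4 := Cderiv_minus _ _ z _ _ H3 H2).
eexists. refine (Cderiv_ext_loc _ _ z _ _ H4). apply filter_forall. intros w. unfold Af.
rewrite alpha_Ker.
rewrite (CInt_ext (fun t => RtoC (U t) * alpha' x y t w)%C (fun t => RtoC (- U t) * Ker (pa' x y) (qa' x y) (ca x y) t w)%C); [eq_in C; ring|exact Hx|].
intros t _. unfold alpha'. rewrite RtoC_opp. ring.
Qed.

Lemma Bf_derivable (x y : R) (U : R -> R) (z : C) : 0 <= x -> 0 <= y -> x + y < 1 ->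
  (forall t, t < 1 -> continuous U t) -> (forall k, 1 - y <= k <= 1 -> Dc x y k z <> RtoC 0) ->
  exists l, Cderiv (Bf x y U) z l.
Proof.
intros Hx Hy Hxy HU HD.
destruct (Ker_derivable (pb x y) zero2 (cb x y) x z) as [l1 H1].
{ apply (locally_lt x (1 - y)); [lra|]. intros; apply regular_b; lra. }
{ apply nonvanishing_b; [exact Hy|exact HD]. }
destruct (Ker_integral_derivable U (pb' x y) zero2 (cb x y) x z Hx) as [l2 H2].
{ intros; apply HU; lra. }
{ intros t Ht. apply (locally_lt t (1 - y)); [lra|]. intros; apply regular_b'; lra. }
{ intros t Ht. apply nonvanishing_b; [exact Hy|exact HD]. }
assert (H3 := Cderiv_mult _ _ z _ _ (Cderiv_const (RtoC (U x)) z) (Cderiv_plus _ _ z _ _ (Cderiv_const (RtoC 1) z) H1)).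
assert (H4 := Cderiv_minus _ _ z _ _ H3 H2).
eexists. refine (Cderiv_ext_loc _ _ z _ _ H4). apply filter_forall. intros w. unfold Bf.
rewrite beta_Ker. reflexivity.
Qed.

Lemma alpha'_continuous (x y t : R) (z : C) : 0 <= y -> x + y < 1 -> t < 1 - y -> nonvanishing (ca x y) t z ->
  continuous (fun t => alpha' x y t z) t.
Proof.
intros Hy Hxy Ht Hn. unfold alpha'. apply continuous_Copp.
apply (continuous_comp_2 (fun t : R => t) (fun _ => z) (fun t w => Ker (pa' x y) (qa' x y) (ca x y) t w)); [apply continuous_id|apply continuous_const|].
apply Ker_continuous; [|exact Hn]. apply (locally_lt t (1 - y)); [exact Ht|]. intros; apply regular_a'; lra.
Qed.
Lemma beta'_continuous (x y t : R) (z : C) : 0 <= y -> x + y < 1 -> t < 1 - y -> nonvanishing (cb x y) t z ->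
  continuous (fun t => beta' x y t z) t.
Proof.
intros Hy Hxy Ht Hn. unfold beta'.
apply (continuous_comp_2 (fun t : R => t) (fun _ => z) (fun t w => Ker (pb' x y) zero2 (cb x y) t w)); [apply continuous_id|apply continuous_const|].
apply Ker_continuous; [|exact Hn]. apply (locally_lt t (1 - y)); [exact Ht|]. intros; apply regular_b'; lra.
Qed.

Lemma Af_decay (x y : R) (U : R -> R) : 0 <= x -> 0 <= y -> x + y < 1 ->
  (forall t, t < 1 -> continuous U t) ->
  exists M r, 0 < r /\ forall z, r < Cmod z -> Cmod (Af x y U z) <= M / Cmod z.
Proof.
intros Hx Hy Hxy HU.
destruct (Ker_decay (fun s t => ff y (ka x s t)) zero2 (ca x y) x Hx) as [M1 [r1 [Hr1 H1]]].
{ intros; apply regular_a; lra. }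
destruct (Ker_decay (pa' x y) (qa' x y) (ca x y) x Hx) as [M2 [r2 [Hr2 H2]]].
{ intros; apply regular_a'; lra. }
destruct (Cmod_max (fun t => RtoC (U t)) 0 x Hx) as [MU [HMU HU']].
{ intros; apply (continuous_RtoC U), HU; lra. }
exists (MU * M1 + x * (MU * M2)), (r1 + r2). split; [lra|]. intros z Hz.
assert (Hzp : 0 < Cmod z) by lra.
unfold Af, Cminus. eapply Rle_trans; [apply Cmod_triangle|]. rewrite Cmod_opp.
replace ((MU * M1 + x * (MU * M2)) / Cmod z) with (MU * (M1 / Cmod z) + (x - 0) * (MU * (M2 / Cmod z))) by (field; lra).
apply Rplus_le_compat.
- rewrite Cmod_mult, alpha_Ker, Cmod_opp. apply Rmult_le_compat; try apply Cmod_ge_0; [apply HU'; lra|apply H1; lra].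
- apply CInt_bound; [exact Hx| |].
  + apply ex_CInt_continuous; [exact Hx|]. intros t Ht. apply continuous_Cmult; [apply (continuous_RtoC U), HU; lra|].
    apply alpha'_continuous; [exact Hy|exact Hxy|lra|]. apply (H2 z t); lra.
  + intros t Ht. rewrite Cmod_mult. unfold alpha'. rewrite Cmod_opp.
    apply Rmult_le_compat; try apply Cmod_ge_0; [apply HU'; lra|apply H2; lra].
Qed.

Definition Ravg (h : R -> R) : R := / PI * RInt h 0 PI.
Definition Kt (x y t : R) : R := Ravg (fun th => pa' x y (sg th) t).
(* int_0^x W'(t) K(x,y,t) dt, K being the theta-average of ff y (ka x (sg theta) t), integrated by
   parts so that an unbounded W' does not occur. *)
Definition goursat_half (W : R -> R) (x y : R) : R := W x * ff y x - RInt (fun t => W t * Kt x y t) 0 x.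

Lemma Cavg_Ravg (h : R -> R) : (forall s, continuous h s) -> Cavg (fun s => RtoC (h s)) = RtoC (Ravg h).
Proof.
intros Hc. unfold Cavg, Ravg. rewrite CInt_RtoC, RtoC_mult, RtoC_inv; [reflexivity|apply PI_neq0|].
apply (ex_RInt_continuous (V := R_CompleteNormedModule)). intros; apply Hc.
Qed.

Lemma mq_0 (c : R) : mq c (RtoC 0) = RtoC 2.
Proof.
unfold mq, Dq. transitivity (RtoC 2 / RtoC 1)%C; [f_equal; ring|]. field.
Qed.
Lemma nq_0 (c : R) : nq c (RtoC 0) = RtoC 0.
Proof. unfold nq, Cdiv. ring. Qed.
Lemma Ker_0 (p q c : R -> R -> R) (t : R) : jointly p t ->
  Ker p q c t (RtoC 0) = RtoC (2 * Ravg (fun th => p (sg th) t)).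
Proof.
intros Hp. assert (Hc : forall th, continuous (fun th => p (sg th) t) th).
{ intros th. exact (jointly_comp p (fun v : R => v) (fun _ => t) th Hp (continuous_id _) (continuous_const _ _)). }
rewrite RtoC_mult, <- Cavg_Ravg by exact Hc. rewrite <- Cavg_scal by (intros; apply continuous_RtoC, Hc).
unfold Ker. apply Cavg_ext. intros th. rewrite mq_0, nq_0. ring.
Qed.

Lemma Ravg_const (c : R) : Ravg (fun _ => c) = c.
Proof. apply RtoC_inj. rewrite <- Cavg_Ravg by (intros; apply continuous_const). apply Cavg_const. Qed.

Lemma Kt_continuous (x y t : R) : 0 <= y -> x + y < 1 -> t < 1 - y -> continuous (Kt x y) t.
Proof.
intros Hy Hxy Ht. unfold Kt, Ravg. apply continuous_Rmult; [apply continuous_const|].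
apply (continuous_RInt_everywhere (V := R_CompleteNormedModule) (fun th t => pa' x y (sg th) t)); [apply PI_ge_0|].
apply (locally_lt t (1 - y)); [exact Ht|]. intros u Hu th _.
destruct (regular_a' x y u Hy Hxy Hu) as [R1 _].
exact (jointly_comp (pa' x y) (fun v : R * R => fst v) (fun v : R * R => snd v) (th, u) R1 (continuous_fst_at _) (continuous_snd_at _)).
Qed.

(** At z = 0 the kernel [mq] is 2 and [nq] is 0; with the sign of [alpha] this produces the factor
    -2, which the formula V = - m(0) / 2 undoes. *)
Lemma Af_at_0 (x y : R) (U : R -> R) : 0 <= x -> 0 <= y -> x + y < 1 -> (forall t, t < 1 -> continuous U t) ->
  Af x y U (RtoC 0) = RtoC (- 2 * goursat_half U x y).
Proof.
intros Hx Hy Hxy HU. unfold Af. rewrite alpha_Ker, Ker_0 by (apply ff_jointly; lra).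
replace (Ravg (fun th => ff y (ka x (sg th) x))) with (ff y x).
2:{ symmetry. rewrite <- (Ravg_const (ff y x)) at 1. unfold Ravg. f_equal. apply RInt_ext. intros th _.
    unfold ka. f_equal. ring. }
rewrite (CInt_ext _ (fun t => RtoC (- 2) * RtoC (U t * Kt x y t))%C); [|exact Hx|].
2:{ intros t Ht. unfold alpha'. rewrite Ker_0 by (apply regular_a'; lra).
    rewrite <- RtoC_opp, <- !RtoC_mult. f_equal. unfold Kt. ring. }
assert (Hex : ex_RInt (fun t => U t * Kt x y t) 0 x).
{ apply (ex_RInt_continuous (V := R_CompleteNormedModule)). rewrite Rmin_left, Rmax_right by lra. intros t Ht.
  apply continuous_Rmult; [apply HU; lra|apply Kt_continuous; lra]. }
rewrite CInt_scal, CInt_RtoC; [|exact Hex|].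
- rewrite <- RtoC_opp, <- !RtoC_mult, <- RtoC_minus. f_equal. unfold goursat_half. ring.
- apply ex_CInt_continuous; [exact Hx|]. intros t Ht. apply (continuous_RtoC (fun t => U t * Kt x y t)).
  apply continuous_Rmult; [apply HU; lra|apply Kt_continuous; lra].
Qed.

(** Integration by parts on [e, x]. As e tends to 0 the boundary term U e * h e vanishes, since U is
    continuous with U 0 = 0, and the remaining integrand is bounded near 0. The derivative u is used
    on (0, x] only, where it is continuous. *)
Lemma improper_parts (f h h' : R -> C) (U u : R -> R) (x : R) : 0 < x ->
  (forall t, 0 <= t <= x -> RCd h t (h' t)) -> (forall t, 0 <= t <= x -> continuous h' t) ->
  (forall t, 0 <= t <= x -> continuous U t) -> U 0 = 0 ->
  (forall t, 0 < t <= x -> is_derive U t (u t) /\ continuous u t) ->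
  (forall t, 0 < t <= x -> f t = (h t * RtoC (u t))%C) ->
  is_RInt_gen (V := C_R_NormedModule) f (at_right 0) (at_point x)
    (RtoC (U x) * h x - CInt (fun t => RtoC (U t) * h' t) 0 x)%C.
Proof.
intros Hx Hh Hh' HU HU0 Hu Hf.
set (g := fun t => (RtoC (U t) * h' t)%C).
assert (Hg : forall t, 0 <= t <= x -> continuous g t).
{ intros t Ht. apply continuous_Cmult; [apply (continuous_RtoC U), HU, Ht|apply Hh', Ht]. }
assert (Hhc : forall t, 0 <= t <= x -> continuous h t) by (intros t Ht; eapply RCd_continuous, Hh, Ht).
assert (Hpart : forall e, 0 < e <= x -> is_CInt f e x (RtoC (U x) * h x - RtoC (U e) * h e - CInt g e x)%C).
{ intros e He.
  set (F := fun t => (RtoC (U t) * h t)%C). set (dF := fun t => (RtoC (u t) * h t + RtoC (U t) * h' t)%C).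
  assert (HF : forall t, e <= t <= x -> RCd F t (dF t)).
  { intros t Ht. apply (RCd_mult (fun t => RtoC (U t)) h); [apply RCd_RtoC, Hu; lra|apply Hh; lra]. }
  assert (HdF : forall t, e <= t <= x -> continuous dF t).
  { intros t Ht. apply continuous_Cplus; [|apply Hg; lra]. apply continuous_Cmult; [|apply Hhc; lra].
    apply (continuous_RtoC u), Hu; lra. }
  assert (E := CInt_RCd F dF e x ltac:(lra) HF HdF).
  assert (X1 : ex_CInt dF e x) by (apply ex_CInt_continuous; [lra|exact HdF]).
  assert (X2 : ex_CInt g e x) by (apply ex_CInt_continuous; [lra|intros; apply Hg; lra]).
  assert (X3 := is_CInt_minus dF g e x _ _ (CInt_correct _ _ _ X1) (CInt_correct _ _ _ X2)).
  rewrite E in X3. 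
  apply (is_RInt_ext (V := C_R_NormedModule) (fun t => dF t - g t)%C); [|exact X3].
  rewrite Rmin_left, Rmax_right by lra. intros t Ht. rewrite Hf by lra. unfold dF, g. eq_in C. ring. }
set (L := (RtoC (U x) * h x - CInt g 0 x)%C).
intros P HP. apply locally_Cmod in HP. destruct HP as [eps [Heps HP]].
destruct (Cmod_max g 0 x ltac:(lra) Hg) as [M [HM HM']].
assert (HcF : continuous (fun t => (RtoC (U t) * h t)%C) 0).
{ apply continuous_Cmult; [apply (continuous_RtoC U), HU; lra|apply Hhc; lra]. }
destruct (proj1 (filterlim_Cmod (locally 0) _ _) HcF (eps / 2) ltac:(lra)) as [d Hd].
cbv beta in Hd. rewrite HU0 in Hd.
assert (Hd1 : 0 < Rmin (Rmin d x) (eps / (2 * M))).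
{ repeat apply Rmin_pos; [apply cond_pos|lra|]. apply Rdiv_lt_0_compat; lra. }
apply (Filter_prod _ _ _ (fun e => 0 < e < Rmin (Rmin d x) (eps / (2 * M))) (fun b => b = x)).
- exists (mkposreal _ Hd1). intros e He He0. split; [exact He0|].
  apply Rabs_def2 in He. simpl in He. unfold minus, plus, opp in He; simpl in He. lra.
- reflexivity.
- intros e b He ->. cbn [fst snd].
  assert (M1 := Rmin_l (Rmin d x) (eps / (2 * M))). assert (M2 := Rmin_r (Rmin d x) (eps / (2 * M))).
  assert (M3 := Rmin_l d x). assert (M4 := Rmin_r d x).
  eexists. split; [apply Hpart; lra|]. apply HP.
  assert (X1 : ex_CInt g 0 e) by (apply ex_CInt_continuous; [lra|intros; apply Hg; lra]).
  assert (X2 : ex_CInt g e x) by (apply ex_CInt_continuous; [lra|intros; apply Hg; lra]).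
  assert (EC := CInt_Chasles g 0 e x X1 X2).
  match goal with |- Cmod ?v < _ => replace v with (CInt g 0 e + - (RtoC (U e) * h e - RtoC 0 * h 0))%C end.
  + eapply Rle_lt_trans; [apply Cmod_triangle|]. rewrite Cmod_opp.
    assert (Q1 : Cmod (RtoC (U e) * h e - RtoC 0 * h 0) < eps / 2).
    { apply Hd. apply Rabs_def1; simpl; unfold minus, plus, opp; simpl; lra. }
    assert (Q2 := CInt_bound g 0 e M ltac:(lra) X1 ltac:(intros; apply HM'; lra)).
    assert (Q3 : e * M < eps / 2).
    { replace (eps / 2) with (eps / (2 * M) * M) by (field; lra). apply Rmult_lt_compat_r; lra. }
    lra.
  + unfold L. rewrite <- EC. eq_in C. ring.
Qed.

Lemma kap_lambda (x y : R) (z : C) : x + y < 1 -> z <> RtoC 0 -> (z + RtoC 1)%C <> RtoC 0 ->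
  let l := ((z - RtoC 1) / (z + RtoC 1))%C in
  (kap x y z - RtoC x)%C <> RtoC 0 /\
  (l * l = (kap x y z - RtoC (1 - y)) / (kap x y z - RtoC x))%C /\ ((kap x y z - RtoC x) * l = Sk x y z)%C.
Proof.
intros Hxy Hz Hz1 l. unfold l, kap, Sk.
assert (Hr : RtoC (1 - x - y) <> RtoC 0) by (apply RtoC_neq; lra).
assert (H4 : RtoC 4 <> RtoC 0) by (apply RtoC_neq; lra).
assert (Ey : RtoC (1 - y) = (RtoC (1 - x - y) + RtoC x)%C) by (rewrite <- RtoC_plus; f_equal; ring).
rewrite Ey. set (r := RtoC (1 - x - y)) in *. 
assert (E1 : (RtoC x + r * ((z + RtoC 1) * (z + RtoC 1)) / (RtoC 4 * z) - RtoC x = r * ((z + RtoC 1) * (z + RtoC 1)) / (RtoC 4 * z))%C) by ring.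
rewrite E1. split; [|split].
- intros E. apply (Cmult_neq_0 (r * ((z + RtoC 1) * (z + RtoC 1)))%C (RtoC 1)); [|apply RtoC_neq; lra|].
  + repeat apply Cmult_neq_0; assumption.
  + transitivity (r * ((z + RtoC 1) * (z + RtoC 1)) / (RtoC 4 * z) * (RtoC 4 * z))%C; [field; repeat split; assumption|]. rewrite E. ring.
- replace (RtoC 4) with (RtoC 2 * RtoC 2)%C in * by (rewrite <- RtoC_mult; f_equal; ring).
  replace (RtoC 2) with (RtoC 1 + RtoC 1)%C in * by (rewrite <- RtoC_plus; f_equal; ring).
  field. repeat split; try assumption.
- field. repeat split; assumption.
Qed.

(** The lambda-coordinate of the preimage, from z = (1 + lambda) / (1 - lambda). *)
Definition point_lambda (z : C) : C := ((z - RtoC 1) / (z + RtoC 1))%C.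

Lemma kap_off_m1 (x y : R) (z : C) : 0 <= x <= 1 -> off_seg 0 1 (kap x y z) -> (z + RtoC 1)%C <> RtoC 0.
Proof.
intros Hx Hoff E. apply (Hoff x Hx). unfold kap. rewrite E. unfold Cdiv. ring.
Qed.

Lemma lambda_alpha_beta (x y t : R) (z : C) : 0 <= t <= x -> 0 <= y -> x + y < 1 -> z <> RtoC 0 ->
  off_seg 0 1 (kap x y z) ->
  lambda t 0 (if Rlt_dec 0 (Re (point_lambda z)) then Upper else Lower) (kap x y z) = (alpha x y t z + beta x y t z)%C.
Proof.
intros Ht Hy Hxy Hz Hoff. assert (Hz1 := kap_off_m1 x y z ltac:(lra) Hoff).
destruct (kap_lambda x y z Hxy Hz Hz1) as [_ [E1 E2]]. fold (point_lambda z) in E1, E2.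
rewrite (lambda_sheet x y t) by assumption. rewrite E2, alpha_plus_beta by assumption. reflexivity.
Qed.

Lemma off_seg_Dc (x y : R) (z : C) (k : R) : x + y < 1 -> z <> RtoC 0 -> 0 <= k <= 1 -> off_seg 0 1 (kap x y z) ->
  Dc x y k z <> RtoC 0.
Proof.
intros Hxy Hz Hk Hoff X. apply (Cminus_neq_0 _ _ (Hoff k Hk)).
assert (E := Dc_kap x y k z Hxy Hz).
assert (Hr : RtoC (1 - x - y) <> RtoC 0) by (apply RtoC_neq; lra).
assert (H4 : RtoC 4 <> RtoC 0) by (apply RtoC_neq; lra).
transitivity (Dc x y k z * RtoC (1 - x - y) / (RtoC 4 * z))%C; [rewrite E; field; repeat split; assumption|].
rewrite X. unfold Cdiv; ring.
Qed.

Definition sheet_of (l : C) : sheet := if Rlt_dec 0 (Re l) then Upper else Lower.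

(* Used with U = V (max 0 .), so that no one-sided limits at 0 are needed. *)
Definition extends_data (U V : R -> R) : Prop :=
  (forall t, t < 1 -> continuous U t) /\ U 0 = 0 /\
  (forall t, 0 < t < 1 -> is_derive U t (Derive V t) /\ continuous (Derive V) t).

(** The factor f is left free so that the statement also serves [Phi1], where f is 1 / lambda(0,t,.)
    and takes the required form only through the mirror map. *)
Lemma integral_from_0_lambda (x y : R) (V0 U : R -> R) (z : C) (f : R -> C) : 0 <= x -> 0 <= y -> x + y < 1 ->
  extends_data U V0 -> z <> RtoC 0 -> off_seg 0 1 (kap x y z) ->
  (forall t, 0 < t <= x -> f t = lambda t 0 (sheet_of (point_lambda z)) (kap x y z)) ->
  integral_from_0 (fun t => f t * RtoC (Derive V0 t))%C x = (Af x y U z + Bf x y U z)%C.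
Proof.
intros Hx Hy Hxy [HU [HU0 Hd]] Hz Hoff Hf. unfold integral_from_0.
destruct (Req_dec_T x 0) as [E|N].
(* For x = 0 the improper integral is 0 by convention; the right side vanishes too, as U 0 = 0. *)
- rewrite E. unfold Af, Bf. rewrite !RInt_point, HU0. change (@zero _) with (RtoC 0). ring.
- assert (Hxp : 0 < x) by lra.
  set (h := fun t => (alpha x y t z + beta x y t z)%C). set (h' := fun t => (alpha' x y t z + beta' x y t z)%C).
  assert (Hna : forall t, 0 <= t <= x -> nonvanishing (ca x y) t z).
  { intros t Ht. apply nonvanishing_a; [exact Ht|]. intros k Hk. apply off_seg_Dc; try assumption; lra. }
  assert (Hnb : forall t, nonvanishing (cb x y) t z).
  { intros t. apply nonvanishing_b; [exact Hy|]. intros k Hk. apply off_seg_Dc; try assumption; lra. }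
  assert (Ca : forall t, 0 <= t <= x -> continuous (fun t => alpha' x y t z) t).
  { intros t Ht. apply alpha'_continuous; [exact Hy|exact Hxy|lra|apply Hna, Ht]. }
  assert (Cb : forall t, 0 <= t <= x -> continuous (fun t => beta' x y t z) t).
  { intros t Ht. apply beta'_continuous; [exact Hy|exact Hxy|lra|apply Hnb]. }
  apply (is_RInt_gen_unique (V := C_R_CompleteNormedModule)).
  replace (Af x y U z + Bf x y U z)%C with (RtoC (U x) * h x - CInt (fun t => RtoC (U t) * h' t) 0 x)%C.
  + apply (improper_parts _ h h' U (Derive V0) x Hxp).
    * intros t Ht. apply RCd_plus; [apply RCd_alpha; [exact Hy|exact Hxy|lra|apply Hna, Ht]|apply RCd_beta; [exact Hy|exact Hxy|lra|apply Hnb]].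
    * intros t Ht. apply continuous_Cplus; [apply Ca, Ht|apply Cb, Ht].
    * intros t Ht. apply HU; lra.
    * exact HU0.
    * intros t Ht. apply Hd; lra.
    * intros t Ht. rewrite Hf by lra. unfold sheet_of. rewrite (lambda_alpha_beta x y t z) by (try assumption; lra). reflexivity.
  + unfold Af, Bf.
    rewrite (CInt_ext _ (fun t => RtoC (U t) * alpha' x y t z + RtoC (U t) * beta' x y t z)%C); [|lra|intros; unfold h'; ring].
    rewrite CInt_plus; [unfold h; ring| |].
    * apply ex_CInt_continuous; [lra|]. intros t Ht. apply continuous_Cmult; [apply (continuous_RtoC U), HU; lra|apply Ca, Ht].
    * apply ex_CInt_continuous; [lra|]. intros t Ht. apply continuous_Cmult; [apply (continuous_RtoC U), HU; lra|apply Cb, Ht].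
Qed.

(** * The contour problem *)

Lemma F_point_lambda (z : C) (k : Chat) : (z + RtoC 1)%C <> RtoC 0 -> F_map (Fin (point_lambda z), k) = Fin z.
Proof.
intros Hz. unfold F_map, point_lambda; cbn [fst].
assert (H2 : RtoC 2 <> RtoC 0) by (apply RtoC_neq; lra).
assert (E2 : RtoC 2 = (RtoC 1 + RtoC 1)%C) by (rewrite <- RtoC_plus; f_equal; ring).
assert (E : (RtoC 1 - (z - RtoC 1) / (z + RtoC 1))%C = (RtoC 2 / (z + RtoC 1))%C) by (rewrite E2; field; exact Hz).
assert (N : (RtoC 1 - (z - RtoC 1) / (z + RtoC 1))%C <> RtoC 0).
{ rewrite E. intros X. apply H2. transitivity (RtoC 2 / (z + RtoC 1) * (z + RtoC 1))%C; [field; exact Hz|]. rewrite X; ring. }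
destruct (Ceq_dec _ (RtoC 1)) as [X|_].
- exfalso. apply N. rewrite X. ring.
- f_equal. rewrite E, E2. rewrite E2 in H2. field. repeat split; assumption.
Qed.

Lemma Finv_eq (x y : R) (P : point) (z : C) : x + y < 1 -> surface x y P -> F_map P = Fin z -> Finv x y z = P.
Proof.
intros Hxy HP E. destruct (Finv_spec x y z Hxy) as [H1 H2].
apply (F_injective x y); try assumption. rewrite H2, E. reflexivity.
Qed.

Lemma surface_kap (x y : R) (z : C) : x + y < 1 -> z <> RtoC 0 -> (z + RtoC 1)%C <> RtoC 0 ->
  surface x y (Fin (point_lambda z), Fin (kap x y z)).
Proof.
intros Hxy Hz Hz1. destruct (kap_lambda x y z Hxy Hz Hz1) as [N [E _]]. split; [|exact E].
intros X. apply N. rewrite X. ring.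
Qed.

Lemma Finv_kap (x y : R) (z : C) : x + y < 1 -> z <> RtoC 0 -> (z + RtoC 1)%C <> RtoC 0 ->
  Finv x y z = (Fin (point_lambda z), Fin (kap x y z)).
Proof. intros Hxy Hz Hz1. apply Finv_eq; [exact Hxy|apply surface_kap; assumption|apply F_point_lambda, Hz1]. Qed.

Lemma plus_1_eq_0 (z : C) : (z + RtoC 1)%C = RtoC 0 -> z = RtoC (-1).
Proof.
intros E. replace z with (z + RtoC 1 - RtoC 1)%C by ring. rewrite E, <- RtoC_minus. f_equal. ring.
Qed.

(** The value z = 0 belongs to a point over infinity and z = -1 to the branch point over x; at every
    other z the k-coordinate of [Finv] is [kap]. *)
Lemma off_cut_kap (x y : R) (z : C) : 0 <= x -> 0 <= y -> x + y < 1 ->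
  (off_cut (Finv x y z) <-> z <> RtoC 0 /\ off_seg 0 1 (kap x y z)).
Proof.
intros Hx Hy Hxy.
assert (R1 : forall kp, ~ (Im kp = 0 /\ 0 <= Re kp <= 1) <-> off_seg 0 1 kp).
{ intros kp. split.
  - intros H k Hk E. apply H. rewrite E. simpl. split; [reflexivity|exact Hk].
  - intros H [E Hk]. apply (H (Re kp) Hk). destruct kp; simpl in *. unfold RtoC. congruence. }
destruct (Ceq_dec z (RtoC 0)) as [->|Hz].
{ rewrite (Finv_eq x y (Fin (point_lambda (RtoC 0)), Infty) (RtoC 0)).
  - unfold off_cut; cbn [snd]. split; [intros []|intros [X _]; apply X; reflexivity].
  - exact Hxy.
  - right. unfold point_lambda. apply injective_projections; simpl; field.
  - apply F_point_lambda. rewrite <- RtoC_plus. apply RtoC_neq. lra. }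
destruct (Ceq_dec (z + RtoC 1) (RtoC 0)) as [E|Hz1].
- rewrite (Finv_eq x y (Infty, Fin (RtoC x)) z); [|exact Hxy|reflexivity|unfold F_map; simpl; f_equal; symmetry; apply plus_1_eq_0, E].
  split.
  + intros H. exfalso. apply H. simpl. split; [reflexivity|lra].
  + intros [_ H]. exfalso. exact (kap_off_m1 x y z ltac:(lra) H E).
- rewrite Finv_kap by assumption. unfold off_cut; cbn [snd]. rewrite R1. tauto.
Qed.

Lemma on_surface_kap (Phi : sheet -> C -> C) (x y : R) (z : C) : 0 <= x -> 0 <= y -> x + y < 1 ->
  z <> RtoC 0 -> off_seg 0 1 (kap x y z) ->
  on_surface Phi (Finv x y z) = Phi (sheet_of (point_lambda z)) (kap x y z).
Proof.
intros Hx Hy Hxy Hz Hoff. rewrite Finv_kap; [reflexivity|exact Hxy|exact Hz|].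
apply (kap_off_m1 x y); [lra|exact Hoff].
Qed.

(** The roots of a real quadratic with product 1 are real or conjugate of modulus 1. *)
Lemma Dc_real_zero (x y k : R) (z : C) : Dc x y k z = RtoC 0 -> Im z = 0 \/ Re z * Re z + Im z * Im z = 1.
Proof.
intros E. destruct z as [a b]. unfold Dc in E. set (c := cc x y k) in *.
assert (E1 := f_equal Re E). assert (E2 := f_equal Im E). simpl in E1, E2. simpl.
destruct (Req_dec_T b 0) as [B|B]; [left; exact B|right].
assert (X : c = - (2 * a)).
{ apply (Rmult_eq_reg_r b); [lra|exact B]. }
rewrite X in E1. lra.
Qed.

(** By [Dc_real_zero] the points over [0, 1] lie on the real line or the unit circle. A vertical
    shift by d / 2 or d / 4 away from the real line leaves it, and at most one of the two ends on
    the circle. *)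
Lemma off_cut_dense (x y : R) (z0 : C) (d : R) : 0 <= x -> 0 <= y -> x + y < 1 -> 0 < d ->
  exists z, Cmod (z - z0) < d /\ off_cut (Finv x y z).
Proof.
intros Hx Hy Hxy Hd. destruct z0 as [a b].
assert (H : exists e, Rabs e < d /\ b + e <> 0 /\ a * a + (b + e) * (b + e) <> 1).
{ destruct (Rle_dec 0 b) as [B|B].
  - destruct (Req_dec_T (a * a + (b + d / 2) * (b + d / 2)) 1) as [E|N].
    + exists (d / 4). rewrite Rabs_pos_eq by lra. repeat split; [lra|lra|]. nra.
    + exists (d / 2). rewrite Rabs_pos_eq by lra. repeat split; [lra|lra|exact N].
  - destruct (Req_dec_T (a * a + (b + - (d / 2)) * (b + - (d / 2))) 1) as [E|N].
    + exists (- (d / 4)). rewrite Rabs_Ropp, Rabs_pos_eq by lra. repeat split; [lra|lra|]. nra.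
    + exists (- (d / 2)). rewrite Rabs_Ropp, Rabs_pos_eq by lra. repeat split; [lra|lra|exact N]. }
destruct H as [e [He [N1 N2]]]. exists (a, b + e). split.
- replace ((a, (b + e)%R) - (a, b))%C with ((0, e) : C) by (apply injective_projections; simpl; ring).
  eapply Rle_lt_trans; [apply Cmod_le_abs|]. simpl. rewrite Rabs_R0. lra.
- apply off_cut_kap; try assumption.
  assert (Nz : ((a, (b + e)%R) : C) <> RtoC 0) by (intros E; apply N1; exact (f_equal Im E)).
  split; [exact Nz|]. intros k Hk E.
  destruct (Dc_real_zero x y k (a, b + e)) as [X|X]; [|exact (N1 X)|exact (N2 X)].
  rewrite Dc_kap by assumption. rewrite E. ring.
Qed.

(** Because [off_cut] is dense, the limit clause of [jump_value] determines the value; a function H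
    that agrees with Phi off the cut and is continuous at z0 supplies it. *)
Lemma jump_value_spec (Phi : sheet -> C -> C) (x y : R) (H : C -> C) (z0 w : C) : 0 <= x -> 0 <= y -> x + y < 1 ->
  (forall z, z <> RtoC 0 -> off_seg 0 1 (kap x y z) -> Phi (sheet_of (point_lambda z)) (kap x y z) = H z) ->
  continuous H z0 -> (jump_value Phi x y z0 w <-> w = H z0).
Proof.
intros Hx Hy Hxy HH Hc.
assert (HS : forall z, off_cut (Finv x y z) -> on_surface Phi (Finv x y z) = H z).
{ intros z Hz. apply off_cut_kap in Hz; try assumption. destruct Hz as [Hz Hoff].
  rewrite on_surface_kap by assumption. apply HH; assumption. }
assert (HL : filterlim (fun w : C => on_surface Phi (Finv x y w))
    (within (fun w : C => off_cut (Finv x y w)) (locally z0)) (locally (H z0))).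
{ apply (filterlim_within_near (fun w : C => off_cut (Finv x y w)) (fun w : C => off_cut (Finv x y w)) z0 (H z0) H (fun w : C => on_surface Phi (Finv x y w)) 1); [lra| |].
  - intros u _ Hu. split; [exact Hu|apply HS, Hu].
  - apply continuous_within, Hc. }
split.
- intros [_ HJ]. apply (filterlim_within_unique _ z0 w (H z0) _ (fun d Hd => off_cut_dense x y z0 d Hx Hy Hxy Hd) HJ HL).
- intros ->. split; [intros Hz; symmetry; apply HS, Hz|exact HL].
Qed.

Lemma Dc_zero_point (x y k : R) (z : C) : x + y < 1 -> Dc x y k z = RtoC 0 ->
  exists P, surface x y P /\ snd P = Fin (RtoC k) /\ F_map P = Fin z.
Proof.
intros Hxy E. assert (Hr : RtoC (1 - x - y) <> RtoC 0) by (apply RtoC_neq; lra).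
assert (H4 : RtoC 4 <> RtoC 0) by (apply RtoC_neq; lra).
assert (Hz : z <> RtoC 0).
{ intros X. rewrite X in E. unfold Dc in E. apply (RtoC_neq 1 0); [lra|]. rewrite <- E. ring. }
assert (Ek : kap x y z = RtoC k).
{ assert (E' := Dc_kap x y k z Hxy Hz). rewrite E in E'.
  replace (kap x y z) with (RtoC 4 * z / RtoC (1 - x - y) * (kap x y z - RtoC k) * RtoC (1 - x - y) / (RtoC 4 * z) + RtoC k)%C by (field; repeat split; assumption).
  rewrite <- E'. unfold Cdiv. ring. }
destruct (Ceq_dec (z + RtoC 1) (RtoC 0)) as [E1|Hz1].
- exists (Infty, Fin (RtoC k)). repeat split.
  + simpl. rewrite <- Ek. unfold kap. rewrite E1. unfold Cdiv. ring.
  + unfold F_map; simpl. f_equal. symmetry. apply plus_1_eq_0, E1.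
- exists (Fin (point_lambda z), Fin (kap x y z)). split; [apply surface_kap; assumption|]. split; [cbn [snd]; rewrite Ek; reflexivity|].
  apply F_point_lambda, Hz1.
Qed.

(** A zero of [Dc] for k in [0, x] is a point of F(Sigma_0), and g0 encircles all of these. *)
Lemma contour_Dc0 (x y k : R) (g0 g1 : R -> C) (z : C) : x + y < 1 -> contour x y g0 g1 -> 0 <= k <= x ->
  ~ encircles g0 z -> Dc x y k z <> RtoC 0.
Proof.
intros Hxy [_ [_ [_ [_ [_ [H _]]]]]] Hk Hz E. destruct (Dc_zero_point x y k z Hxy E) as [P [P1 [P2 P3]]].
apply Hz, (H P z); [|exact P3]. split; [exact P1|]. exists k. split; [exact Hk|exact P2].
Qed.
Lemma contour_Dc1 (x y k : R) (g0 g1 : R -> C) (z : C) : x + y < 1 -> contour x y g0 g1 -> 1 - y <= k <= 1 ->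
  ~ encircles g1 z -> Dc x y k z <> RtoC 0.
Proof.
intros Hxy [_ [_ [_ [_ [_ [_ [H _]]]]]]] Hk Hz E. destruct (Dc_zero_point x y k z Hxy E) as [P [P1 [P2 P3]]].
apply Hz, (H P z); [|exact P3]. split; [exact P1|]. exists k. split; [exact Hk|exact P2].
Qed.

(* Exchanging x and y corresponds to k -> 1 - k, lambda -> 1 / lambda, z -> -z. *)
Lemma Dc_mirror (x y k : R) (z : C) : x + y < 1 -> Dc y x k (- z)%C = Dc x y (1 - k) z.
Proof.
intros Hxy. unfold Dc. replace (cc y x k) with (- cc x y (1 - k)) by (unfold cc; field; lra).
rewrite RtoC_opp. ring.
Qed.

Lemma kap_mirror (x y : R) (z : C) : x + y < 1 -> z <> RtoC 0 -> kap y x (- z)%C = (RtoC 1 - kap x y z)%C.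
Proof.
intros Hxy Hz. unfold kap. replace (1 - y - x) with (1 - x - y) by ring.
assert (H4 : RtoC 4 <> RtoC 0) by (apply RtoC_neq; lra).
replace (RtoC y) with (RtoC 1 - RtoC x - RtoC (1 - x - y))%C by (rewrite <- !RtoC_minus; f_equal; ring).
set (r := RtoC (1 - x - y)).
replace (RtoC 4) with (RtoC 1 + RtoC 1 + RtoC 1 + RtoC 1)%C in * by (rewrite <- !RtoC_plus; f_equal; ring).
field. repeat split; try assumption.
Qed.

Lemma sheet_of_inv (l : C) : l <> RtoC 0 -> sheet_of (/ l) = sheet_of l.
Proof.
intros Hl. unfold sheet_of. assert (H := Cnorm2_neq_0 l Hl). destruct l as [a b]. simpl in H. simpl.
assert (Hp : 0 < a * (a * 1) + b * (b * 1)) by (assert (X := pow2_ge_0 a); assert (Y := pow2_ge_0 b); simpl in *; lra).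
assert (Hq := Rinv_0_lt_compat _ Hp). unfold Rdiv.
set (q := / (a * (a * 1) + b * (b * 1))) in *.
destruct (Rlt_dec 0 (a * q)), (Rlt_dec 0 a); try reflexivity; exfalso; nra.
Qed.

Lemma lambda_mirror (y' : R) (s : sheet) (kp : C) : 0 <= y' <= 1 -> off_seg 0 1 kp ->
  (/ lambda 0 y' s kp = lambda y' 0 s (RtoC 1 - kp))%C.
Proof.
intros Hy Hoff.
assert (N : forall k, 0 <= k <= 1 -> (kp - RtoC k)%C <> RtoC 0) by (intros k Hk; apply Cminus_neq_0, Hoff, Hk).
assert (S1 := slit_ratio 0 (1 - y') kp ltac:(lra) (off_seg_sub 0 1 0 (1 - y') kp Hoff ltac:(lra) ltac:(lra))).
assert (Hoff' : off_seg 0 1 (RtoC 1 - kp)%C).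
{ intros k Hk E. apply (Hoff (1 - k) ltac:(lra)). rewrite RtoC_minus, <- E. ring. }
assert (S2 := slit_ratio y' 1 (RtoC 1 - kp)%C ltac:(lra) (off_seg_sub 0 1 y' 1 _ Hoff' ltac:(lra) ltac:(lra))).
(* The two radicands are reciprocal, and inversion preserves the sign of the real part. *)
assert (E : (/ csqrt ((kp - RtoC (1 - y')) / (kp - RtoC 0)) = csqrt ((RtoC 1 - kp - RtoC 1) / (RtoC 1 - kp - RtoC y')))%C).
{ set (u := csqrt ((kp - RtoC (1 - y')) / (kp - RtoC 0))).
  assert (Hu : (u * u = (kp - RtoC (1 - y')) / (kp - RtoC 0))%C) by apply csqrt_sqr.
  assert (Hup : 0 < Re u) by (apply csqrt_Re_pos, S1).
  assert (Hun : u <> RtoC 0) by (intros X; rewrite X in Hup; simpl in Hup; lra).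
  apply sqrt_unique_C; [|..].
  { rewrite csqrt_sqr. transitivity (/ (u * u))%C; [field; exact Hun|]. rewrite Hu.
    rewrite RtoC_minus. field. assert (N0 := N 0 ltac:(lra)). assert (N1 := N (1 - y') ltac:(lra)). rewrite RtoC_minus in N1.
    repeat split; try assumption.
    all: intros X; first [apply N0; rewrite X; ring | apply N1; replace (kp - (RtoC 1 - RtoC y'))%C with (- (RtoC 1 - kp - RtoC y'))%C by ring; rewrite X; ring]. }
  - unfold sheet_of. assert (H := sheet_of_inv u Hun). unfold sheet_of in H. destruct (Rlt_dec 0 (Re u)); [|tauto].
    destruct (Rlt_dec 0 (Re (/ u))); [assumption|discriminate].
  - apply csqrt_Re_pos, S2. }
unfold lambda. rewrite Rminus_0_r. destruct s; [exact E|].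
rewrite <- E. field. intros X. assert (Hup := csqrt_Re_pos _ S1). rewrite X in Hup. simpl in Hup. lra.
Qed.

Lemma point_lambda_mirror (z : C) : (z + RtoC 1)%C <> RtoC 0 -> (z - RtoC 1)%C <> RtoC 0 -> (point_lambda (- z) = / point_lambda z)%C.
Proof.
intros H1 H2. unfold point_lambda. field. repeat split; try assumption.
intros X. apply H2. replace (z - RtoC 1)%C with (- (- z + RtoC 1))%C by ring. rewrite X. ring.
Qed.

Lemma Phi1_value (x y : R) (V1 U : R -> R) (z : C) : 0 <= x -> 0 <= y -> x + y < 1 ->
  extends_data U V1 -> z <> RtoC 0 -> off_seg 0 1 (kap x y z) ->
  Phi1 V1 y (sheet_of (point_lambda z)) (kap x y z) = (Af y x U (- z) + Bf y x U (- z))%C.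
Proof.
intros Hx Hy Hxy HU Hz Hoff.
assert (Hz' : (- z)%C <> RtoC 0) by (intros X; apply Hz; replace z with (- - z)%C by ring; rewrite X; ring).
assert (Hoff' : off_seg 0 1 (kap y x (- z)%C)).
{ rewrite kap_mirror by assumption. intros k Hk E. apply (Hoff (1 - k) ltac:(lra)). rewrite RtoC_minus, <- E. ring. }
assert (H1 := kap_off_m1 x y z ltac:(lra) Hoff).
assert (H2 := kap_off_m1 y x (- z)%C ltac:(lra) Hoff').
assert (H3 : (z - RtoC 1)%C <> RtoC 0).
{ intros X. apply H2. replace (- z + RtoC 1)%C with (- (z - RtoC 1))%C by ring. rewrite X. ring. }
apply integral_from_0_lambda; try assumption; [lra|].
assert (Hl : point_lambda z <> RtoC 0).
{ unfold point_lambda. intros X. apply H3. transitivity ((z - RtoC 1) / (z + RtoC 1) * (z + RtoC 1))%C; [field; exact H1|]. rewrite X; ring. }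
intros t Ht. rewrite kap_mirror, point_lambda_mirror, sheet_of_inv by assumption.
apply lambda_mirror; [lra|exact Hoff].
Qed.

Lemma Cderiv_mirror (f : C -> C) (z l : C) : Cderiv f (- z) l -> Cderiv (fun w => f (- w)%C) z (- l)%C.
Proof.
intros H e He. destruct (H e He) as [d [Hd H']]. exists d. split; [exact Hd|]. intros w Hw.
assert (E : Cmod (- w - - z)%C = Cmod (w - z)%C) by (rewrite <- Cmod_opp; f_equal; ring).
specialize (H' (- w)%C). rewrite E in H'. specialize (H' Hw).
replace (f (- w) - f (- z) - - l * (w - z))%C with (f (- w) - f (- z) - l * (- w - - z))%C by ring. exact H'.
Qed.

Theorem explicit_RH (x y : R) (V0 V1 U0 U1 : R -> R) (g0 g1 : R -> C) : inD x y ->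
  extends_data U0 V0 -> extends_data U1 V1 -> contour x y g0 g1 ->
  exists m, unique_RH_solution g0 g1 (jump_value (Phi0 V0 x) x y) (jump_value (Phi1 V1 y) x y) m /\
    m (RtoC 0) = RtoC (- 2 * (goursat_half U0 x y + goursat_half U1 y x)).
Proof.
intros [Hx [Hy Hxy]] HU0 HU1 Hg.
assert (Hyx : y + x < 1) by lra.
assert (Hp : loop_pair g0 g1) by (unfold loop_pair; unfold contour in Hg; tauto).
assert (Hdisj : forall z, ~ (on_or_inside g0 z /\ on_or_inside g1 z)) by apply Hp.
assert (A0d : analytic_off g0 (Af x y U0)).
{ intros z Hz. apply Af_derivable; try assumption; [apply HU0|]. intros k Hk. apply (contour_Dc0 x y k g0 g1); assumption. }
assert (B0d : analytic_off g1 (Bf x y U0)).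
{ intros z Hz. apply Bf_derivable; try assumption; [apply HU0|]. intros k Hk. apply (contour_Dc1 x y k g0 g1); assumption. }
assert (A1d : analytic_off g1 (fun z => Af y x U1 (- z)%C)).
{ intros z Hz. destruct (Af_derivable y x U1 (- z)%C) as [l Hl]; try assumption; [apply HU1| |eexists; apply Cderiv_mirror, Hl].
  intros k Hk. rewrite Dc_mirror by exact Hxy. apply (contour_Dc1 x y (1 - k) g0 g1); try assumption. lra. }
assert (B1d : analytic_off g0 (fun z => Bf y x U1 (- z)%C)).
{ intros z Hz. destruct (Bf_derivable y x U1 (- z)%C) as [l Hl]; try assumption; [apply HU1| |eexists; apply Cderiv_mirror, Hl].
  intros k Hk. rewrite Dc_mirror by exact Hxy. apply (contour_Dc0 x y (1 - k) g0 g1); try assumption. lra. }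
destruct (scalar_RH g0 g1 (jump_value (Phi0 V0 x) x y) (jump_value (Phi1 V1 y) x y) (Af x y U0) (Bf x y U0)
  (fun z => Af y x U1 (- z)%C) (fun z => Bf y x U1 (- z)%C)) as [m [Hm E]]; try assumption.
- unfold contour in Hg; tauto.
- unfold contour in Hg; tauto.
- destruct (Af_decay x y U0 Hx Hy Hxy (proj1 HU0)) as [M0 [r0 [Hr0 H0]]].
  destruct (Af_decay y x U1 Hy Hx Hyx (proj1 HU1)) as [M1 [r1 [Hr1 H1]]].
  exists (Rmax M0 M1), (r0 + r1). split; [lra|]. intros z Hz.
  assert (Hzp : 0 < / Cmod z) by (apply Rinv_0_lt_compat; lra).
  split.
  + eapply Rle_trans; [apply H0; lra|]. apply Rmult_le_compat_r; [lra|apply Rmax_l].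
  + eapply Rle_trans; [apply H1; rewrite Cmod_opp; lra|]. rewrite Cmod_opp. apply Rmult_le_compat_r; [lra|apply Rmax_r].
- intros z w Hz. apply (jump_value_spec (Phi0 V0 x) x y (fun z => Af x y U0 z + Bf x y U0 z)%C); try assumption.
  + intros u Hu Hoff. apply integral_from_0_lambda; try assumption. reflexivity.
  + destruct (A0d z) as [l Hl]; [intros [X _]; exact (X Hz)|].
    destruct (B0d z) as [l' Hl']; [intros X; apply (Hdisj z); split; [left; exact Hz|right; exact X]|].
    apply continuous_Cplus; [exact (Cderiv_continuous _ _ _ Hl)|exact (Cderiv_continuous _ _ _ Hl')].
- intros z w Hz. apply (jump_value_spec (Phi1 V1 y) x y (fun z => Af y x U1 (- z) + Bf y x U1 (- z))%C); try assumption.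
  + intros u Hu Hoff. apply Phi1_value; assumption.
  + destruct (A1d z) as [l Hl]; [intros [X _]; exact (X Hz)|].
    destruct (B1d z) as [l' Hl']; [intros X; apply (Hdisj z); split; [right; exact X|left; exact Hz]|].
    apply continuous_Cplus; [exact (Cderiv_continuous _ _ _ Hl)|exact (Cderiv_continuous _ _ _ Hl')].
- exists m. split; [exact Hm|]. rewrite E.
  replace (- RtoC 0)%C with (RtoC 0) by ring.
  rewrite !Af_at_0; try assumption; [|apply HU1|apply HU0]. rewrite <- RtoC_plus. f_equal. ring.
Qed.

(** * The Euler-Darboux equation *)

Definition cont2 (D : R -> R -> Prop) (f : R -> R -> R) : Prop :=
  forall x y, D x y -> continuous (fun p : R * R => f (fst p) (snd p)) (x, y).
(* An open neighbourhood of D on which all integrands make sense. *)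
Definition domE (x y : R) : Prop := x < 1 /\ y < 1 /\ x + y < 1.
(** The weight c collects the factors [sg] and 1 - [sg] that come from differentiating [ka] in x and
    in t. The normalisation 1 / PI is kept outside. *)
Definition kernel_avg (c : R -> R) (psi : R -> R -> R) (x y t : R) : R :=
  RInt (fun th => c th * psi y (ka x (sg th) t)) 0 PI.
Definition kernel_int (U c : R -> R) (psi : R -> R -> R) (x y : R) : R := RInt (fun t => U t * kernel_avg c psi x y t) 0 x.

Lemma cont2_comp {T : UniformSpace} (D : R -> R -> Prop) (f : R -> R -> R) (u v : T -> R) (p : T) :
  cont2 D f -> D (u p) (v p) -> continuous u p -> continuous v p -> continuous (fun q => f (u q) (v q)) p.
Proof. intros H HD Hu Hv. apply (continuous_comp_2 u v f p Hu Hv). apply H, HD. Qed.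

Lemma locally_lt_comp {T : UniformSpace} (f : T -> R) (p : T) (b : R) : continuous f p -> f p < b ->
  locally p (fun q => f q < b).
Proof. intros Hf Hp. apply (Hf (fun u => u < b)). exact (open_lt b (f p) Hp). Qed.

Lemma domK_locally {T : UniformSpace} (u v : T -> R) (p : T) : continuous u p -> continuous v p -> domK (u p) (v p) ->
  locally p (fun q => domK (u q) (v q)).
Proof.
intros Hu Hv [H1 H2]. apply filter_and; [apply locally_lt_comp; assumption|].
apply (locally_lt_comp (fun q => u q + v q)); [apply (continuous_Rplus u v); assumption|exact H2].
Qed.

Lemma domK_ka (x y s t : R) : domK y x -> domK y t -> 0 <= s <= 1 -> domK y (ka x s t).
Proof.
unfold domK, ka. intros [A B] [A' B'] Hs.
assert (t + (x - t) * s <= Rmax x t); [|unfold Rmax in *; destruct Rle_dec; lra].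
unfold Rmax; destruct Rle_dec; nra.
Qed.

Lemma continuous_kernel_avg {T : UniformSpace} (c : R -> R) (psi : R -> R -> R) (u v w : T -> R) (p : T) :
  (forall s, continuous c s) -> cont2 domK psi ->
  continuous u p -> continuous v p -> continuous w p -> domK (v p) (u p) -> domK (v p) (w p) ->
  continuous (fun q => kernel_avg c psi (u q) (v q) (w q)) p.
Proof.
intros Hc Hpsi Hu Hv Hw H1 H2. unfold kernel_avg.
apply (continuous_RInt_parameter (V := R_CompleteNormedModule) (fun th q => c th * psi (v q) (ka (u q) (sg th) (w q)))).
- apply PI_ge_0.
- intros s _.
  assert (Cu : continuous (fun q : R * T => u (snd q)) (s, p)) by (apply (continuous_comp (fun q : R * T => snd q) u); [apply continuous_snd_at|exact Hu]).
  assert (Cv : continuous (fun q : R * T => v (snd q)) (s, p)) by (apply (continuous_comp (fun q : R * T => snd q) v); [apply continuous_snd_at|exact Hv]).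
  assert (Cw : continuous (fun q : R * T => w (snd q)) (s, p)) by (apply (continuous_comp (fun q : R * T => snd q) w); [apply continuous_snd_at|exact Hw]).
  apply (continuous_Rmult (fun q : R * T => c (fst q))).
  + apply (continuous_comp (fun q : R * T => fst q) c); [apply continuous_fst_at|apply Hc].
  + apply (cont2_comp domK psi (fun q : R * T => v (snd q)) (fun q : R * T => ka (u (snd q)) (sg (fst q)) (w (snd q)))); [exact Hpsi| |exact Cv|].
    * cbn [fst snd]. apply domK_ka; [exact H1|exact H2|apply sg_bounds].
    * unfold ka. apply (continuous_Rplus (fun q : R * T => w (snd q))); [exact Cw|].
      apply (continuous_Rmult (fun q : R * T => u (snd q) - w (snd q)) (fun q => sg (fst q))).
      -- apply (continuous_Rminus (fun q : R * T => u (snd q))); assumption.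
      -- apply (continuous_sg_comp (fun q : R * T => fst q)), continuous_fst_at.
- generalize (filter_and _ _ (domK_locally v u p Hv Hu H1) (domK_locally v w p Hv Hw H2)). apply filter_imp. intros q [Q1 Q2].
  apply (ex_RInt_continuous (V := R_CompleteNormedModule)). intros s _.
  apply (continuous_Rmult c); [apply Hc|].
  apply (cont2_comp domK psi (fun _ => v q) (fun s => ka (u q) (sg s) (w q))); [exact Hpsi|apply domK_ka; [exact Q1|exact Q2|apply sg_bounds]|apply continuous_const|].
  unfold ka. cont.
Qed.

Lemma kernel_avg_diag (c : R -> R) (psi : R -> R -> R) (x y : R) : (forall s, continuous c s) ->
  kernel_avg c psi x y x = RInt c 0 PI * psi y x.
Proof.
intros Hc. unfold kernel_avg. transitivity (RInt (fun th => scal (psi y x) (c th)) 0 PI).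
- apply RInt_ext. intros s _. unfold ka, scal; simpl; unfold mult; simpl. replace (x + (x - x) * sg s) with x by ring. ring.
- rewrite (RInt_scal (V := R_CompleteNormedModule)).
  + unfold scal; simpl; unfold mult; simpl. ring.
  + apply (ex_RInt_continuous (V := R_CompleteNormedModule)). intros; apply Hc.
Qed.

Lemma continuous_kernel_avg_theta (c : R -> R) (psi : R -> R -> R) (x y t s : R) :
  (forall s, continuous c s) -> cont2 domK psi -> domK y x -> domK y t ->
  continuous (fun th => c th * psi y (ka x (sg th) t)) s.
Proof.
intros Hc Hpsi H1 H2. apply (continuous_Rmult c); [apply Hc|].
apply (cont2_comp domK psi (fun _ => y) (fun s => ka x (sg s) t)); [exact Hpsi|apply domK_ka; [exact H1|exact H2|apply sg_bounds]|apply continuous_const|].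
unfold ka. cont.
Qed.

Lemma is_derive_kernel_avg_x (c : R -> R) (psi psik : R -> R -> R) (x y t : R) :
  (forall s, continuous c s) -> cont2 domK psi -> cont2 domK psik ->
  (forall y k, domK y k -> is_derive (psi y) k (psik y k)) -> domK y x -> domK y t ->
  is_derive (fun x => kernel_avg c psi x y t) x (kernel_avg (fun th => c th * sg th) psik x y t).
Proof.
intros Hc Hpsi Hpsik Hd H1 H2. unfold kernel_avg.
assert (L := domK_locally (fun _ : R => y) (fun u : R => u) x (continuous_const _ _) (continuous_id _) H1).
apply (is_derive_RInt_parameter (fun s x => c s * psi y (ka x (sg s) t)) (fun s x => c s * sg s * psik y (ka x (sg s) t)) 0 PI (PI + 1)); [apply PI_ge_0|lra| | |].
- revert L. apply filter_imp. intros u Hu s _. evar_last.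
  + apply (is_derive_scal (fun u => psi y (ka u (sg s) t)) u (c s)).
    apply (is_derive_comp (psi y) (fun u => ka u (sg s) t)).
    * apply Hd. apply domK_ka; [exact Hu|exact H2|apply sg_bounds].
    * unfold ka. instantiate (1 := sg s). auto_derive; [exact I|ring].
  + unfold scal; simpl; unfold mult; simpl. ring.
- revert L. apply filter_imp. intros u Hu s _. apply continuous_kernel_avg_theta; assumption.
- intros s _. apply (continuous_Rmult (fun q : R * R => c (fst q) * sg (fst q))).
  + apply (continuous_Rmult (fun q : R * R => c (fst q))).
    * apply (continuous_comp (fun q : R * R => fst q) c); [apply continuous_fst_at|apply Hc].
    * apply (continuous_sg_comp (fun q : R * R => fst q)), continuous_fst_at.
  + apply (cont2_comp domK psik (fun _ : R * R => y) (fun q : R * R => ka (snd q) (sg (fst q)) t)); [exact Hpsik|apply domK_ka; [exact H1|exact H2|apply sg_bounds]|apply continuous_const|].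
    unfold ka. cont; first [apply continuous_fst_at|apply continuous_snd_at].
Qed.

Lemma is_derive_kernel_avg_y (c : R -> R) (psi psiy : R -> R -> R) (x y t : R) :
  (forall s, continuous c s) -> cont2 domK psi -> cont2 domK psiy ->
  (forall y k, domK y k -> is_derive (fun y => psi y k) y (psiy y k)) -> domK y x -> domK y t ->
  is_derive (fun y => kernel_avg c psi x y t) y (kernel_avg c psiy x y t).
Proof.
intros Hc Hpsi Hpsiy Hd H1 H2. unfold kernel_avg.
assert (L := filter_and _ _ (domK_locally (fun u : R => u) (fun _ : R => x) y (continuous_id _) (continuous_const _ _) H1)
  (domK_locally (fun u : R => u) (fun _ : R => t) y (continuous_id _) (continuous_const _ _) H2)).
apply (is_derive_RInt_parameter (fun s y => c s * psi y (ka x (sg s) t)) (fun s y => c s * psiy y (ka x (sg s) t)) 0 PI (PI + 1)); [apply PI_ge_0|lra| | |].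
- revert L. apply filter_imp. intros u [Hu Hu'] s _. 
  apply (is_derive_scal (fun u => psi u (ka x (sg s) t)) u (c s)).
  apply Hd. apply domK_ka; [exact Hu|exact Hu'|apply sg_bounds].
- revert L. apply filter_imp. intros u [Hu Hu'] s _. apply continuous_kernel_avg_theta; assumption.
- intros s _. apply (continuous_Rmult (fun q : R * R => c (fst q))).
  + apply (continuous_comp (fun q : R * R => fst q) c); [apply continuous_fst_at|apply Hc].
  + apply (cont2_comp domK psiy (fun q : R * R => snd q) (fun q : R * R => ka x (sg (fst q)) t)); [exact Hpsiy|apply domK_ka; [exact H1|exact H2|apply sg_bounds]|apply continuous_snd_at|].
    unfold ka. cont; first [apply continuous_fst_at|apply continuous_snd_at].
Qed.

Lemma kernel_int_integrand_continuous (U c : R -> R) (psi : R -> R -> R) (x y t : R) :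
  (forall t, t < 1 -> continuous U t) -> (forall s, continuous c s) -> cont2 domK psi -> domK y x -> domK y t ->
  continuous (fun t => U t * kernel_avg c psi x y t) t.
Proof.
intros HU Hc Hpsi H1 H2. apply (continuous_Rmult U); [apply HU, H2|].
apply (continuous_kernel_avg c psi (fun _ : R => x) (fun _ => y) (fun t => t)); try assumption; first [apply continuous_const|apply continuous_id].
Qed.

Lemma ex_kernel_int (U c : R -> R) (psi : R -> R -> R) (x y : R) :
  (forall t, t < 1 -> continuous U t) -> (forall s, continuous c s) -> cont2 domK psi -> domE x y ->
  ex_RInt (fun t => U t * kernel_avg c psi x y t) 0 x.
Proof.
intros HU Hc Hpsi [H1 [H2 H3]]. apply (ex_RInt_continuous (V := R_CompleteNormedModule)). intros t Ht.
assert (Ht' : t <= Rmax 0 x) by lra.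
apply kernel_int_integrand_continuous; try assumption; unfold domK; [lra|]. revert Ht'. unfold Rmax. destruct Rle_dec; lra.
Qed.

(** The substitution t = x tau makes the range independent of x, so that joint continuity, also
    across x = 0, becomes that of a parameter integral. *)
Lemma kernel_int_rescale (U c : R -> R) (psi : R -> R -> R) (x y : R) :
  (forall t, t < 1 -> continuous U t) -> (forall s, continuous c s) -> cont2 domK psi -> domE x y ->
  kernel_int U c psi x y = x * RInt (fun tau => U (x * tau) * kernel_avg c psi x y (x * tau)) 0 1.
Proof.
intros HU Hc Hpsi HE. unfold kernel_int.
assert (X := ex_kernel_int U c psi x y HU Hc Hpsi HE).
set (f := fun t => U t * kernel_avg c psi x y t) in *.
assert (Y := RInt_comp_lin (V := R_CompleteNormedModule) f x 0 0 1).
replace (x * 0 + 0) with 0 in Y by ring. replace (x * 1 + 0) with x in Y by ring.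
rewrite <- (Y X).
transitivity (RInt (fun tau => scal x (f (x * tau))) 0 1).
- apply RInt_ext. intros t _. rewrite Rplus_0_r. reflexivity.
- destruct (Req_dec_T x 0) as [->|N].
  + rewrite Rmult_0_l. rewrite (RInt_ext _ (fun _ => 0)); [rewrite RInt_const; unfold scal; simpl; unfold mult; simpl; ring|].
    intros t _. unfold scal; simpl; unfold mult; simpl. ring.
  + apply (RInt_scal (V := R_CompleteNormedModule)). 
    assert (Z := ex_RInt_comp_lin (V := R_NormedModule) f x 0 0 1).
    replace (x * 0 + 0) with 0 in Z by ring. replace (x * 1 + 0) with x in Z by ring.
    apply (ex_RInt_ext (V := R_NormedModule) (fun t => scal (/ x) (scal x (f (x * t + 0))))).
    * intros t _. rewrite Rplus_0_r. unfold scal; simpl; unfold mult; simpl. unfold f. field. exact N.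
    * apply (ex_RInt_scal (V := R_NormedModule)), Z, X.
Qed.

Lemma domE_scaled (x y tau : R) : domE x y -> 0 <= tau <= 1 -> domK y (x * tau).
Proof.
unfold domE, domK. intros [A [B D]] Ht.
assert (x * tau <= Rmax 0 x); [|unfold Rmax in *; destruct Rle_dec; lra].
unfold Rmax; destruct Rle_dec; nra.
Qed.

Lemma continuous_kernel_int (U c : R -> R) (psi : R -> R -> R) :
  (forall t, t < 1 -> continuous U t) -> (forall s, continuous c s) -> cont2 domK psi -> cont2 domE (kernel_int U c psi).
Proof.
intros HU Hc Hpsi x y HE.
assert (L : locally (x, y) (fun q : R * R => domE (fst q) (snd q))).
{ destruct HE as [A [B D]]. unfold domE. apply filter_and; [|apply filter_and].
  - apply (locally_lt_comp (fun q : R * R => fst q)); [apply continuous_fst_at|exact A].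
  - apply (locally_lt_comp (fun q : R * R => snd q)); [apply continuous_snd_at|exact B].
  - apply (locally_lt_comp (fun q : R * R => fst q + snd q)); [cont; first [apply continuous_fst_at|apply continuous_snd_at]|exact D]. }
apply (continuous_ext_loc _ (fun q : R * R => fst q * RInt (fun tau => U (fst q * tau) * kernel_avg c psi (fst q) (snd q) (fst q * tau)) 0 1)).
{ revert L. apply filter_imp. intros q Hq. symmetry. apply kernel_int_rescale; assumption. }
apply (continuous_Rmult (fun q : R * R => fst q)); [apply continuous_fst_at|].
apply (continuous_RInt_everywhere (V := R_CompleteNormedModule) (T := prod_UniformSpace R_UniformSpace R_UniformSpace)
  (fun tau q => U (fst q * tau) * kernel_avg c psi (fst q) (snd q) (fst q * tau))); [lra|].
revert L. apply filter_imp. intros q Hq s Hs.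
assert (C1 : continuous (fun v : R * (R * R) => fst (snd v)) (s, q)) by apply (continuous_fst_snd (T := R_UniformSpace) (U := R_UniformSpace) (V := R_UniformSpace)).
assert (C2 : continuous (fun v : R * (R * R) => snd (snd v)) (s, q)) by apply (continuous_snd_snd (T := R_UniformSpace) (U := R_UniformSpace) (V := R_UniformSpace)).
assert (C3 : continuous (fun v : R * (R * R) => fst (snd v) * fst v) (s, q)).
{ apply (continuous_Rmult (fun v : R * (R * R) => fst (snd v))); [exact C1|apply continuous_fst_at]. }
assert (O1 := domE_scaled (fst q) (snd q) s Hq Hs).
apply (continuous_Rmult (fun v : R * (R * R) => U (fst (snd v) * fst v))).
- apply (continuous_comp (fun v : R * (R * R) => fst (snd v) * fst v) U); [exact C3|]. apply HU, O1.
- apply (continuous_kernel_avg c psi (fun v : R * (R * R) => fst (snd v)) (fun v => snd (snd v)) (fun v => fst (snd v) * fst v)); try assumption.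
  cbn [fst snd]. destruct Hq as [A [B D]]. split; [exact A|]. rewrite Rplus_comm. exact D.
Qed.

Lemma is_derive_kernel_int_y (U c : R -> R) (psi psiy : R -> R -> R) (x y : R) :
  (forall t, t < 1 -> continuous U t) -> (forall s, continuous c s) -> cont2 domK psi -> cont2 domK psiy ->
  (forall y k, domK y k -> is_derive (fun y => psi y k) y (psiy y k)) -> domE x y -> 0 <= x ->
  is_derive (fun y => kernel_int U c psi x y) y (kernel_int U c psiy x y).
Proof.
intros HU Hc Hpsi Hpsiy Hd [H1 [H2 H3]] Hx. unfold kernel_int.
(* The midpoint of x and the nearest singularity: for t < b and second coordinate below 1 - b all
   arguments remain in [domK]. *)
set (b := (x + Rmin 1 (1 - y)) / 2).
assert (M1 := Rmin_l 1 (1 - y)). assert (M2 := Rmin_r 1 (1 - y)).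
assert (M3 : x < Rmin 1 (1 - y)) by (apply Rmin_glb_lt; lra).
assert (L : locally y (fun v => v < 1 - b)) by (apply (locally_lt_comp (fun v => v)); [apply continuous_id|unfold b; lra]).
assert (HO : forall v t, v < 1 - b -> t < b -> domK v x /\ domK v t) by (unfold domK, b; intros; lra).
apply (is_derive_RInt_parameter (fun t y => U t * kernel_avg c psi x y t) (fun t y => U t * kernel_avg c psiy x y t) 0 x b); [exact Hx|unfold b; lra| | |].
- revert L. apply filter_imp. intros v Hv t Ht. destruct (HO v t Hv Ht) as [O1 O2].
  apply (is_derive_scal (fun v => kernel_avg c psi x v t) v (U t)). apply is_derive_kernel_avg_y; assumption.
- revert L. apply filter_imp. intros v Hv t Ht. destruct (HO v t Hv Ht) as [O1 O2]. apply kernel_int_integrand_continuous; assumption.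
- intros t Ht. destruct (HO y t ltac:(unfold b; lra) Ht) as [O1 O2].
  apply (continuous_Rmult (fun q : R * R => U (fst q))).
  + apply (continuous_comp (fun q : R * R => fst q) U); [apply continuous_fst_at|apply HU, O2].
  + apply (continuous_kernel_avg c psiy (fun q : R * R => x) (fun q => snd q) (fun q => fst q)); try assumption;
    first [apply continuous_const|apply continuous_fst_at|apply continuous_snd_at].
Qed.

Lemma is_derive_RInt_diagonal (G G' : R -> R -> R) (b x : R) : 0 <= x < b ->
  (forall u t, u < b -> t < b -> is_derive (fun u => G u t) u (G' u t)) ->
  cont2 (fun u t => u < b /\ t < b) G -> cont2 (fun u t => u < b /\ t < b) G' ->
  is_derive (fun x => RInt (fun t => G x t) 0 x) x (RInt (fun t => G' x t) 0 x + G x x).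
Proof.
intros Hx Hd HG HG'.
set (e := (b - x) / 2). assert (He : 0 < e) by (unfold e; lra). set (pe := mkposreal e He).
assert (Hc : forall u t, u < b -> t < b -> continuous (fun t => G u t) t).
{ intros u t Hu Ht. apply (cont2_comp _ G (fun _ => u) (fun t => t) t HG (conj Hu Ht)); [apply continuous_const|apply continuous_id]. }
assert (HD : forall u v, u < b -> v < b -> continuity_2d_pt (fun u v => Derive (fun z => G z v) u) u v).
{ intros u v Hu Hv. apply continuity_2d_pt_ext_loc with G'.
  - assert (He' : 0 < Rmin (b - u) (b - v)) by (apply Rmin_pos; lra). exists (mkposreal _ He'). simpl. intros u' v' Hu' Hv'.
    assert (M1 := Rmin_l (b - u) (b - v)). assert (M2 := Rmin_r (b - u) (b - v)).
    apply Rabs_def2 in Hu', Hv'. symmetry. apply is_derive_unique, Hd; lra.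
  - apply continuity_2d_pt_filterlim. exact (HG' u v (conj Hu Hv)). }
assert (HL : locally x (fun u => u < b)) by (apply (locally_lt_comp (fun u => u)); [apply continuous_id|lra]).
assert (Hex : forall a c, a < b -> c < b -> locally x (fun u => ex_RInt (fun t => G u t) a c)).
{ intros a c Ha Hc'. revert HL. apply filter_imp. intros u Hu. apply (ex_RInt_continuous (V := R_CompleteNormedModule)).
  intros t Ht. apply Hc; [exact Hu|]. unfold Rmax in Ht. destruct (Rle_dec a c); lra. }
evar_last.
- apply (is_derive_RInt_param_bound_comp G (fun _ => 0) (fun x => x) x 0 1).
  + apply Hex; lra.
  + exists pe. apply Hex; simpl; unfold e; lra.
  + exists pe. apply Hex; simpl; unfold e; lra.
  + apply (is_derive_const (K := R_AbsRing) (V := R_NormedModule)).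
  + apply (is_derive_id (K := R_AbsRing)).
  + exists pe. revert HL. apply filter_imp. intros u Hu t Ht. exists (G' u t). apply Hd; [exact Hu|].
    simpl in Ht. assert (X : t <= Rmax (0 + e) (x + e)) by lra. revert X. unfold Rmax, e. destruct Rle_dec; lra.
  + intros t. rewrite Rmin_left, Rmax_right by lra. intros Ht. apply HD; lra.
  + exists pe. intros u v Hu Hv. simpl in Hu, Hv. apply Rabs_def2 in Hu, Hv. apply HD; unfold e in *; lra.
  + exists pe. intros u v Hu Hv. simpl in Hu, Hv. apply Rabs_def2 in Hu, Hv. apply HD; unfold e in *; lra.
  + apply continuity_pt_filterlim. apply Hc; lra.
  + apply continuity_pt_filterlim. apply Hc; lra.
- rewrite (RInt_ext (fun t => Derive (fun u => G u t) x) (fun t => G' x t)).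
  + ring.
  + rewrite Rmin_left, Rmax_right by lra. intros t Ht. apply is_derive_unique, Hd; lra.
Qed.

Lemma is_derive_kernel_int_x (U c : R -> R) (psi psik : R -> R -> R) (x y : R) :
  (forall t, t < 1 -> continuous U t) -> (forall s, continuous c s) -> cont2 domK psi -> cont2 domK psik ->
  (forall y k, domK y k -> is_derive (psi y) k (psik y k)) -> domE x y -> 0 <= x ->
  is_derive (fun x => kernel_int U c psi x y) x (U x * (RInt c 0 PI * psi y x) + kernel_int U (fun th => c th * sg th) psik x y).
Proof.
intros HU Hc Hpsi Hpsik Hd [H1 [H2 H3]] Hx. unfold kernel_int.
assert (Hc' : forall s, continuous (fun th => c th * sg th) s) by (intros s; cont; apply Hc).
assert (M1 := Rmin_l 1 (1 - y)). assert (M2 := Rmin_r 1 (1 - y)).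
assert (M3 : x < Rmin 1 (1 - y)) by (apply Rmin_glb_lt; lra).
assert (HO : forall t, t < Rmin 1 (1 - y) -> domK y t) by (unfold domK; intros; lra).
assert (HC : forall cc pp, (forall s, continuous cc s) -> cont2 domK pp ->
  cont2 (fun u t => u < Rmin 1 (1 - y) /\ t < Rmin 1 (1 - y)) (fun u t => U t * kernel_avg cc pp u y t)).
{ intros cc pp Hcc Hpp u t [Hu Ht]. apply (continuous_Rmult (fun q : R * R => U (snd q))).
  - apply (continuous_comp (fun q : R * R => snd q) U); [apply continuous_snd_at|apply HU]. simpl. lra.
  - apply (continuous_kernel_avg cc pp (fun q : R * R => fst q) (fun q => y) (fun q => snd q)); try assumption;
    first [apply continuous_const|apply continuous_fst_at|apply continuous_snd_at|apply HO; assumption]. }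
evar_last.
- apply (is_derive_RInt_diagonal (fun x t => U t * kernel_avg c psi x y t) (fun x t => U t * kernel_avg (fun th => c th * sg th) psik x y t) (Rmin 1 (1 - y))).
  + lra.
  + intros u t Hu Ht. apply (is_derive_scal (fun u => kernel_avg c psi u y t) u (U t)). apply is_derive_kernel_avg_x; try assumption; apply HO; assumption.
  + apply HC; assumption.
  + apply HC; assumption.
- cbv beta. rewrite kernel_avg_diag by exact Hc. ring.
Qed.

(** * Functions of class C^n in two variables *)

(** The partial derivatives are given as functions, not through [Derive], which keeps the closure
    properties direct inductions; on open sets [ex_diff_n] follows. *)
Fixpoint smooth (D : R -> R -> Prop) (n : nat) (f : R -> R -> R) : Prop :=
  cont2 D f /\
  match n with
  | O => True
  | S m => exists fx fy, (forall x y, D x y -> is_derive (fun u => f u y) x (fx x y) /\ is_derive (f x) y (fy x y)) /\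
      smooth D m fx /\ smooth D m fy
  end.

Lemma smooth_cont2 (D : R -> R -> Prop) (n : nat) (f : R -> R -> R) : smooth D n f -> cont2 D f.
Proof. destruct n; intros [H _]; exact H. Qed.

Lemma smooth_pred (D : R -> R -> Prop) (n : nat) (f : R -> R -> R) : smooth D (S n) f -> smooth D n f.
Proof.
revert f. induction n as [|n IH]; intros f [Hc [fx [fy [Hd [Hx Hy]]]]]; split; try exact Hc; [exact I|].
exists fx, fy. split; [exact Hd|]. split; apply IH; assumption.
Qed.

Lemma smooth_const (D : R -> R -> Prop) (n : nat) (c : R) : smooth D n (fun _ _ => c).
Proof.
revert c. induction n as [|n IH]; intros c; (split; [intros x y _; apply continuous_const|]); [exact I|].
exists (fun _ _ => 0), (fun _ _ => 0). split; [|split; apply IH].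
intros x y _. split; apply (is_derive_const (K := R_AbsRing) (V := R_NormedModule)).
Qed.

Lemma smooth_plus (D : R -> R -> Prop) (n : nat) (f g : R -> R -> R) :
  smooth D n f -> smooth D n g -> smooth D n (fun x y => f x y + g x y).
Proof.
revert f g. induction n as [|n IH]; intros f g Hf Hg; (split; [intros x y H;
  apply (continuous_Rplus (fun p : R * R => f (fst p) (snd p))); eapply smooth_cont2; eassumption|]); [exact I|].
destruct Hf as [_ [fx [fy [Hd [Hx Hy]]]]], Hg as [_ [gx [gy [Hd' [Hx' Hy']]]]].
exists (fun x y => fx x y + gx x y), (fun x y => fy x y + gy x y). split; [|split; apply IH; assumption].
intros x y H. destruct (Hd x y H), (Hd' x y H).
split; apply (is_derive_plus (K := R_AbsRing) (V := R_NormedModule)); assumption.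
Qed.

Lemma smooth_minus (D : R -> R -> Prop) (n : nat) (f g : R -> R -> R) :
  smooth D n f -> smooth D n g -> smooth D n (fun x y => f x y - g x y).
Proof.
revert f g. induction n as [|n IH]; intros f g Hf Hg; (split; [intros x y H;
  apply (continuous_Rminus (fun p : R * R => f (fst p) (snd p))); eapply smooth_cont2; eassumption|]); [exact I|].
destruct Hf as [_ [fx [fy [Hd [Hx Hy]]]]], Hg as [_ [gx [gy [Hd' [Hx' Hy']]]]].
exists (fun x y => fx x y - gx x y), (fun x y => fy x y - gy x y). split; [|split; apply IH; assumption].
intros x y H. destruct (Hd x y H), (Hd' x y H).
split; apply (is_derive_minus (K := R_AbsRing) (V := R_NormedModule)); assumption.
Qed.

Lemma is_derive_Rmult (f g : R -> R) (x df dg : R) : is_derive f x df -> is_derive g x dg ->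
  is_derive (fun t => f t * g t) x (df * g x + f x * dg).
Proof. intros Hf Hg. apply (is_derive_mult (K := R_AbsRing) f g x df dg Hf Hg). exact Rmult_comm. Qed.

Lemma smooth_mult (D : R -> R -> Prop) (n : nat) (f g : R -> R -> R) :
  smooth D n f -> smooth D n g -> smooth D n (fun x y => f x y * g x y).
Proof.
revert f g. induction n as [|n IH]; intros f g Hf Hg; (split; [intros x y H;
  apply (continuous_Rmult (fun p : R * R => f (fst p) (snd p))); eapply smooth_cont2; eassumption|]); [exact I|].
assert (Hf1 := smooth_pred _ _ _ Hf). assert (Hg1 := smooth_pred _ _ _ Hg).
destruct Hf as [_ [fx [fy [Hd [Hx Hy]]]]], Hg as [_ [gx [gy [Hd' [Hx' Hy']]]]].
exists (fun x y => fx x y * g x y + f x y * gx x y), (fun x y => fy x y * g x y + f x y * gy x y).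
split; [|split; apply smooth_plus; apply IH; assumption].
intros x y H. destruct (Hd x y H), (Hd' x y H).
split; [apply (is_derive_Rmult (fun u => f u y) (fun u => g u y))|apply (is_derive_Rmult (f x) (g x))]; assumption.
Qed.

Lemma smooth_swap (D D' : R -> R -> Prop) (n : nat) (f : R -> R -> R) :
  (forall x y, D' x y -> D y x) -> smooth D n f -> smooth D' n (fun x y => f y x).
Proof.
intros HD. revert f. induction n as [|n IH]; intros f Hf; (split; [intros x y H;
  apply (cont2_comp D f (fun p : R * R => snd p) (fun p => fst p)); [eapply smooth_cont2; eassumption|apply HD, H|apply continuous_snd_at|apply continuous_fst_at]|]); [exact I|].
destruct Hf as [_ [fx [fy [Hd [Hx Hy]]]]].
exists (fun x y => fy y x), (fun x y => fx y x). split; [|split; apply IH; assumption].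
intros x y H. destruct (Hd y x (HD x y H)). split; assumption.
Qed.

Definition open2 (D : R -> R -> Prop) : Prop :=
  forall x y, D x y -> locally (x, y) (fun q : R * R => D (fst q) (snd q)).

Lemma open2_x (D : R -> R -> Prop) (x y : R) : open2 D -> D x y -> locally x (fun u => D u y).
Proof.
intros HD H. destruct (HD x y H) as [d Hd]. exists d. intros u Hu. apply (Hd (u, y)). split; [exact Hu|apply ball_center].
Qed.
Lemma open2_y (D : R -> R -> Prop) (x y : R) : open2 D -> D x y -> locally y (fun v => D x v).
Proof.
intros HD H. destruct (HD x y H) as [d Hd]. exists d. intros v Hv. apply (Hd (x, v)). split; [apply ball_center|exact Hv].
Qed.

Lemma smooth_ext (D : R -> R -> Prop) (n : nat) (f g : R -> R -> R) : open2 D ->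
  (forall x y, D x y -> f x y = g x y) -> smooth D n f -> smooth D n g.
Proof.
intros HD E Hf. 
assert (Hc : cont2 D g).
{ intros x y H. apply (continuous_ext_loc _ (fun p : R * R => f (fst p) (snd p))); [|apply (smooth_cont2 D n f Hf x y H)].
  generalize (HD x y H). apply filter_imp. intros q Hq. apply E, Hq. }
destruct n as [|n]; (split; [exact Hc|]); [exact I|].
destruct Hf as [_ [fx [fy [Hd [Hx Hy]]]]]. exists fx, fy. split; [|split; assumption].
intros x y H. destruct (Hd x y H) as [H1 H2]. split.
- apply (is_derive_ext_loc (fun u => f u y)); [|exact H1]. generalize (open2_x D x y HD H). apply filter_imp. intros u Hu; apply E, Hu.
- apply (is_derive_ext_loc (f x)); [|exact H2]. generalize (open2_y D x y HD H). apply filter_imp. intros u Hu; apply E, Hu.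
Qed.

Lemma smooth_ex_diff_n (D : R -> R -> Prop) (n : nat) (f : R -> R -> R) (x y : R) : open2 D -> smooth D n f -> D x y ->
  ex_diff_n f n x y.
Proof.
intros HD. revert f x y. induction n as [|n IH]; intros f x y Hf H;
  (split; [apply continuity_2d_pt_filterlim, (smooth_cont2 _ _ _ Hf x y H)|]); [exact I|].
destruct Hf as [_ [fx [fy [Hd [Hx Hy]]]]].
split; [exists (fx x y); apply Hd, H|]. split; [exists (fy x y); apply Hd, H|].
destruct (HD x y H) as [d Hd'].
split; [apply (ex_diff_n_ext_loc fx)|apply (ex_diff_n_ext_loc fy)]; try (apply IH; assumption);
  exists d; intros u v Hu Hv; symmetry; apply is_derive_unique, Hd, (Hd' (u, v)); split; assumption.
Qed.

Lemma open2_intD : open2 intD.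
Proof.
intros x y [A [B D]]. unfold intD.
assert (X : forall (f : R * R -> R), continuous f (x, y) -> 0 < f (x, y) -> locally ((x, y) : R * R) (fun q => 0 < f q)).
{ intros f Hf Hp. apply (Hf (fun u => 0 < u)). exact (open_gt 0 _ Hp). }
apply filter_and; [|apply filter_and].
- apply (X (fun q => fst q)); [apply continuous_fst_at|exact A].
- apply (X (fun q => snd q)); [apply continuous_snd_at|exact B].
- apply (locally_lt_comp (fun q : R * R => fst q + snd q)); [cont; first [apply continuous_fst_at|apply continuous_snd_at]|exact D].
Qed.

Lemma smooth_ia (n : nat) : smooth domK n ia.
Proof.
induction n as [|n IH]; (split; [intros y k [H1 H2]; unfold ia; cont; first [apply continuous_snd_at|apply continuous_fst_at|simpl; lra]|]); [exact I|].
exists (fun _ _ => 0), (fun y k => ia y k * ia y k). split; [|split; [apply smooth_const|apply smooth_mult; exact IH]].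
intros y k [H1 H2]. split; unfold ia; auto_derive; try exact I; try lra. field. lra.
Qed.

Lemma smooth_ib (n : nat) : smooth domK n ib.
Proof.
induction n as [|n IH]; (split; [intros y k [H1 H2]; unfold ib; cont; first [apply continuous_snd_at|apply continuous_fst_at|simpl; lra]|]); [exact I|].
exists (fun y k => ib y k * ib y k), (fun y k => ib y k * ib y k). split; [|split; apply smooth_mult; exact IH].
intros y k [H1 H2]. split; unfold ib; auto_derive; try lra; field; lra.
Qed.

Definition fy (y k : R) : R := ff y k * (/ 2 * ib y k).

Lemma is_derive_ff_y (y k : R) : domK y k -> is_derive (fun y => ff y k) y (fy y k).
Proof.
intros [Hk Hy]. unfold ff. evar_last.
- apply (is_derive_scal (fun y => Rpower (1 - y - k) (- / 2)) y (Rpower (1 - k) (/ 2))).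
  apply (is_derive_Rpower_comp (fun y => 1 - y - k) y (-1)); [|lra]. auto_derive; [exact I|ring].
- unfold fy, ff, ib. rewrite !Rpower_pred by lra. ring.
Qed.

Lemma smooth_ff (n : nat) : smooth domK n ff.
Proof.
induction n as [|n IH]; (split; [intros y k [H1 H2]; unfold ff; cont; first [apply continuous_snd_at|apply continuous_fst_at|simpl; lra]|]); [exact I|].
exists fy, dff. split; [|split].
- intros y k H. split; [apply is_derive_ff_y, H|apply is_derive_ff, H].
- unfold fy. apply smooth_mult; [exact IH|]. apply smooth_mult; [apply smooth_const|apply smooth_ib].
- unfold dff. apply smooth_mult; [exact IH|]. apply smooth_mult; [apply smooth_const|]. apply smooth_minus; [apply smooth_ib|apply smooth_ia].
Qed.

(** Derivatives of [ff], the letters after f naming the variables of differentiation; [dff] and [fy]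
    are the first ones. *)
Definition fky (y k : R) : R := ff y k * (/ 4 * ((ib y k - ia y k) * ib y k) + / 2 * (ib y k * ib y k)).
Definition fkk (y k : R) : R :=
  ff y k * (/ 4 * ((ib y k - ia y k) * (ib y k - ia y k)) + / 2 * (ib y k * ib y k - ia y k * ia y k)).
Definition fkky (y k : R) : R :=
  ff y k * (/ 2 * ib y k * (/ 4 * ((ib y k - ia y k) * (ib y k - ia y k)) + / 2 * (ib y k * ib y k - ia y k * ia y k)) +
    / 2 * ((ib y k - ia y k) * (ib y k * ib y k)) + ib y k * (ib y k * ib y k)).
(* chi = d/dk of (1-k)^(1/2) (1-y-k)^(-3/2). *)
Definition chi (y k : R) : R := ff y k * (/ 2 * ((ib y k - ia y k) * ib y k) + ib y k * ib y k).
Definition dchi (y k : R) : R :=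
  ff y k * (/ 2 * (ib y k - ia y k) * (/ 2 * ((ib y k - ia y k) * ib y k) + ib y k * ib y k) +
    / 2 * ((ib y k * ib y k - ia y k * ia y k) * ib y k + (ib y k - ia y k) * (ib y k * ib y k)) + 2 * (ib y k * (ib y k * ib y k))).

Lemma smooth_combination (n : nat) (f : R -> R -> R) : f = dff \/ f = fy \/ f = fky \/ f = fkk \/ f = fkky \/ f = chi \/ f = dchi -> smooth domK n f.
Proof.
intros [->|[->|[->|[->|[->|[->| ->]]]]]]; unfold dff, fy, fky, fkk, fkky, chi, dchi;
repeat first [exact (smooth_ff n)|exact (smooth_ia n)|exact (smooth_ib n)|apply smooth_const|apply smooth_mult|apply smooth_minus|apply smooth_plus].
Qed.

Lemma is_derive_ff_mult (q : R -> R) (y k dq : R) : domK y k -> is_derive q k dq ->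
  is_derive (fun k => ff y k * q k) k (dff y k * q k + ff y k * dq).
Proof. intros H Hq. apply (is_derive_Rmult (ff y) q); [apply is_derive_ff, H|exact Hq]. Qed.
Lemma is_derive_ff_mult_y (q : R -> R) (y k dq : R) : domK y k -> is_derive q y dq ->
  is_derive (fun y => ff y k * q y) y (fy y k * q y + ff y k * dq).
Proof. intros H Hq. apply (is_derive_Rmult (fun y => ff y k) q); [apply is_derive_ff_y, H|exact Hq]. Qed.

Lemma is_derive_dff (y k : R) : domK y k -> is_derive (dff y) k (fkk y k).
Proof.
intros H. unfold dff at 1. evar_last; [apply (is_derive_ff_mult (fun k => / 2 * (ib y k - ia y k))); [exact H|]|].
- instantiate (1 := / 2 * (ib y k * ib y k - ia y k * ia y k)). destruct H. unfold ia, ib. auto_derive; [repeat split; lra|]. field. lra.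
- unfold fkk, dff. field.
Qed.
Lemma is_derive_dff_y (y k : R) : domK y k -> is_derive (fun y => dff y k) y (fky y k).
Proof.
intros H. unfold dff. evar_last; [apply (is_derive_ff_mult_y (fun y => / 2 * (ib y k - ia y k))); [exact H|]|].
- instantiate (1 := / 2 * (ib y k * ib y k)). destruct H. unfold ia, ib. auto_derive; [repeat split; lra|]. field. lra.
- unfold fky, fy. field.
Qed.
Lemma is_derive_fkk_y (y k : R) : domK y k -> is_derive (fun y => fkk y k) y (fkky y k).
Proof.
intros H. unfold fkk. evar_last; [apply (is_derive_ff_mult_y (fun y => / 4 * ((ib y k - ia y k) * (ib y k - ia y k)) + / 2 * (ib y k * ib y k - ia y k * ia y k))); [exact H|]|].
- instantiate (1 := / 2 * ((ib y k - ia y k) * (ib y k * ib y k)) + ib y k * (ib y k * ib y k)). destruct H. unfold ia, ib. auto_derive; [repeat split; lra|]. field. lra.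
- unfold fkky, fy. field.
Qed.
Lemma is_derive_chi (y k : R) : domK y k -> is_derive (chi y) k (dchi y k).
Proof.
intros H. unfold chi. evar_last; [apply (is_derive_ff_mult (fun k => / 2 * ((ib y k - ia y k) * ib y k) + ib y k * ib y k)); [exact H|]|].
- instantiate (1 := / 2 * ((ib y k * ib y k - ia y k * ia y k) * ib y k + (ib y k - ia y k) * (ib y k * ib y k)) + 2 * (ib y k * (ib y k * ib y k))).
  destruct H. unfold ia, ib. auto_derive; [repeat split; lra|]. field. lra.
- unfold dchi, dff. field.
Qed.

(** The left side is the Euler-Darboux operator applied to (1 - s) [dff y (ka x s t)]. The right
    side is the derivative in th of - sin th * (1 - s) [chi y (ka x s t)] / (4 (1 - x - y)) at s =
    [sg th], written with cos th = 1 - 2 s and sin^2 th = 4 s (1 - s). *)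
Lemma kernel_identity (y x t s : R) : domK y x -> domK y t -> 0 <= s <= 1 -> let k := ka x s t in
  (1 - s) * s * fkky y k - / (2 * (1 - x - y)) * ((1 - s) * s * fkk y k + (1 - s) * fky y k) =
  - / (4 * (1 - x - y)) * ((1 - 2 * s) * (1 - s) * chi y k - 2 * s * (1 - s) * chi y k + 2 * (x - t) * s * ((1 - s) * (1 - s)) * dchi y k).
Proof.
intros H1 H2 Hs k. assert (Hk : domK y k) by (apply domK_ka; assumption).
unfold fkky, fkk, fky, chi, dchi. set (f := ff y k). unfold ia, ib.
destruct H1, H2, Hk as [K1 K2].
(* From x - k = (x - t) (1 - s), the one relation between k and x, t, s on which the identity
   rests. *)
replace (1 - x - y) with ((1 - y - k) - (x - t) * (1 - s)) by (unfold k, ka; ring).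
field. repeat split; try lra. unfold k, ka. intros E. lra.
Qed.

Definition cm (th : R) : R := 1 - sg th.
Definition cms (th : R) : R := cm th * sg th.

Lemma continuous_cm (s : R) : continuous cm s.
Proof. unfold cm. cont. Qed.
Lemma continuous_cms (s : R) : continuous cms s.
Proof. unfold cms, cm. cont. Qed.

Lemma RInt_cm : RInt cm 0 PI = PI / 2.
Proof.
apply is_RInt_unique. evar_last.
- apply (is_RInt_derive (V := R_CompleteNormedModule) (fun th => (th + sin th) / 2) cm).
  + intros s _. unfold cm, sg. auto_derive; [exact I|field].
  + intros s _. apply continuous_cm.
- unfold minus, plus, opp; simpl. rewrite sin_PI, sin_0. field.
Qed.

Lemma cont2_combination (f : R -> R -> R) : f = ff \/ f = dff \/ f = fy \/ f = fky \/ f = fkk \/ f = fkky \/ f = chi \/ f = dchi -> cont2 domK f.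
Proof. intros [->|H]; apply (smooth_cont2 domK 0); [apply smooth_ff|apply smooth_combination, H]. Qed.
Ltac csolve := apply cont2_combination; tauto.

Lemma RInt_comb (h1 h2 h3 : R -> R) (a b e : R) : ex_RInt h1 a b -> ex_RInt h2 a b -> ex_RInt h3 a b ->
  RInt (fun t => h1 t - e * (h2 t + h3 t)) a b = RInt h1 a b - e * (RInt h2 a b + RInt h3 a b).
Proof.
intros H1 H2 H3. apply is_RInt_unique.
apply (is_RInt_minus (V := R_NormedModule) h1 (fun t => e * (h2 t + h3 t))); [apply (RInt_correct (V := R_CompleteNormedModule)), H1|].
apply (is_RInt_scal (V := R_NormedModule) (fun t => h2 t + h3 t)).
apply (is_RInt_plus (V := R_NormedModule)); apply (RInt_correct (V := R_CompleteNormedModule)); assumption.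
Qed.

Lemma kernel_avg_identity (x y t : R) : domK y x -> domK y t ->
  kernel_avg cms fkky x y t - / (2 * (1 - x - y)) * (kernel_avg cms fkk x y t + kernel_avg cm fky x y t) = 0.
Proof.
intros H1 H2.
assert (Hex : forall c psi, (forall s, continuous c s) -> cont2 domK psi -> ex_RInt (fun th => c th * psi y (ka x (sg th) t)) 0 PI).
{ intros c psi Hc Hp. apply (ex_RInt_continuous (V := R_CompleteNormedModule)). intros s _. apply continuous_kernel_avg_theta; assumption. }
unfold kernel_avg. rewrite <- RInt_comb; [|apply Hex; [exact continuous_cms|csolve]|apply Hex; [exact continuous_cms|csolve]|apply Hex; [exact continuous_cm|csolve]].
set (h := fun th => _).
set (r4 := - / (4 * (1 - x - y))).
set (G := fun th => r4 * (sin th * (cm th * chi y (ka x (sg th) t)))).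
assert (Hh : forall s, continuous h s).
{ intros s. unfold h. apply (continuous_Rminus (fun th => cms th * fkky y (ka x (sg th) t))).
  - apply continuous_kernel_avg_theta; try assumption; [exact continuous_cms|csolve].
  - apply (continuous_Rmult (fun _ => / (2 * (1 - x - y)))); [apply continuous_const|].
    apply (continuous_Rplus (fun th => cms th * fkk y (ka x (sg th) t))); apply continuous_kernel_avg_theta; try assumption; try csolve; [exact continuous_cms|exact continuous_cm]. }
apply is_RInt_unique. evar_last.
- apply (is_RInt_derive (V := R_CompleteNormedModule) G h); [|intros; apply Hh].
  intros th _. assert (Hk := domK_ka x y (sg th) t H1 H2 (sg_bounds th)).
  assert (Dk : is_derive (fun th => ka x (sg th) t) th ((x - t) * (sin th / 2))).
  { unfold ka, sg. auto_derive; [exact I|field]. }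
  assert (Dchi : is_derive (fun th => chi y (ka x (sg th) t)) th ((x - t) * (sin th / 2) * dchi y (ka x (sg th) t))).
  { apply (is_derive_comp (chi y) (fun th => ka x (sg th) t)); [apply is_derive_chi, Hk|exact Dk]. }
  assert (Dcm : is_derive cm th (- (sin th / 2))) by (unfold cm, sg; auto_derive; [exact I|field]).
  evar_last.
  + apply (is_derive_scal (fun th => sin th * (cm th * chi y (ka x (sg th) t))) th r4).
    apply (is_derive_Rmult sin (fun th => cm th * chi y (ka x (sg th) t))); [apply is_derive_sin|].
    apply (is_derive_Rmult cm (fun th => chi y (ka x (sg th) t))); [exact Dcm|exact Dchi].
  + unfold h, cms, cm. rewrite (kernel_identity y x t (sg th) H1 H2 (sg_bounds th)). fold r4.
    set (c0 := chi y (ka x (sg th) t)). set (d0 := dchi y (ka x (sg th) t)).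
    assert (Ecos : cos th = 1 - 2 * sg th) by (unfold sg; field).
    assert (Esin : sin th * sin th = 4 * sg th * (1 - sg th)).
    { assert (X := sin2_cos2 th). unfold Rsqr in X. unfold sg. lra. }
    eq_in R. transitivity (r4 * (cos th * ((1 - sg th) * c0) - (sin th * sin th) / 2 * c0 + (sin th * sin th) / 2 * ((1 - sg th) * ((x - t) * d0)))).
    * apply (f_equal (fun u => r4 * u)). field.
    * rewrite Ecos, Esin. apply (f_equal (fun u => r4 * u)). field.
- unfold G. rewrite sin_PI, sin_0. unfold minus, plus, opp; simpl. ring.
Qed.

Lemma kernel_int_identity (U : R -> R) (x y : R) : (forall t, t < 1 -> continuous U t) -> domE x y ->
  kernel_int U cms fkky x y - / (2 * (1 - x - y)) * (kernel_int U cms fkk x y + kernel_int U cm fky x y) = 0.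
Proof.
intros HU HE. unfold kernel_int.
rewrite <- RInt_comb; [|apply ex_kernel_int; try assumption; [exact continuous_cms|csolve]|apply ex_kernel_int; try assumption; [exact continuous_cms|csolve]|apply ex_kernel_int; try assumption; [exact continuous_cm|csolve]].
rewrite (RInt_ext _ (fun _ => 0)).
- rewrite RInt_const. unfold scal; simpl; unfold mult; simpl. ring.
- intros t Ht. eq_in R. transitivity (U t * (kernel_avg cms fkky x y t - / (2 * (1 - x - y)) * (kernel_avg cms fkk x y t + kernel_avg cm fky x y t))); [ring|].
  destruct HE as [A [B D]]. rewrite kernel_avg_identity; [ring|unfold domK; lra|]. unfold domK. destruct Ht as [_ Ht]. revert Ht. unfold Rmax. destruct Rle_dec; lra.
Qed.

(** [Rx] is the part of the x-derivative of [goursat_half] without U', [Py] its y-derivative, and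
    [Rxy] the part of the mixed derivative without U'. The factor 1/2 is 1 - (1 / PI) times the
    integral of [cm]: the moving end point of the integral cancels half of U [dff]. *)
Definition Rx (U : R -> R) (x y : R) : R := / 2 * (U x * dff y x) - / PI * kernel_int U cms fkk x y.
Definition Py (U : R -> R) (x y : R) : R := U x * fy y x - / PI * kernel_int U cm fky x y.
Definition Rxy (U : R -> R) (x y : R) : R := / 2 * (U x * fky y x) - / PI * kernel_int U cms fkky x y.

Lemma goursat_half_kernel_int (U : R -> R) (x y : R) : (forall t, t < 1 -> continuous U t) -> domE x y ->
  goursat_half U x y = U x * ff y x - / PI * kernel_int U cm dff x y.
Proof.
intros HU HE. unfold goursat_half. apply (f_equal (fun u => U x * ff y x - u)). unfold kernel_int.
transitivity (RInt (fun t => scal (/ PI) (U t * kernel_avg cm dff x y t)) 0 x).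
- apply RInt_ext. intros t _. unfold scal; simpl; unfold mult; simpl. unfold Kt, Ravg, kernel_avg, pa', cm. ring.
- apply (RInt_scal (V := R_CompleteNormedModule)). apply ex_kernel_int; try assumption; [exact continuous_cm|csolve].
Qed.

Lemma domE_open : open2 domE.
Proof.
intros x y [A [B D]]. unfold domE. apply filter_and; [|apply filter_and].
- apply (locally_lt_comp (fun q : R * R => fst q)); [apply continuous_fst_at|exact A].
- apply (locally_lt_comp (fun q : R * R => snd q)); [apply continuous_snd_at|exact B].
- apply (locally_lt_comp (fun q : R * R => fst q + snd q)); [cont; first [apply continuous_fst_at|apply continuous_snd_at]|exact D].
Qed.

Lemma domE_domK_x (x y : R) : domE x y -> domK y x.
Proof. unfold domE, domK. lra. Qed.

Lemma is_derive_goursat_half_x (U : R -> R) (x y dU : R) : (forall t, t < 1 -> continuous U t) -> domE x y -> 0 <= x -> is_derive U x dU ->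
  is_derive (fun x => goursat_half U x y) x (dU * ff y x + Rx U x y).
Proof.
intros HU HE Hx HdU.
apply (is_derive_ext_loc (fun x => U x * ff y x - / PI * kernel_int U cm dff x y)).
{ generalize (open2_x domE x y domE_open HE). apply filter_imp. intros u Hu. symmetry. apply goursat_half_kernel_int; assumption. }
evar_last.
- apply (is_derive_minus (V := R_NormedModule) (fun x => U x * ff y x)).
  + apply (is_derive_Rmult U (ff y)); [exact HdU|apply is_derive_ff, domE_domK_x, HE].
  + apply (is_derive_scal (fun x => kernel_int U cm dff x y) x (/ PI)).
    apply (is_derive_kernel_int_x U cm dff fkk); try assumption; [exact continuous_cm|csolve|csolve|apply is_derive_dff].
- unfold minus, plus, opp; simpl. rewrite RInt_cm. unfold Rx. change (fun th => cm th * sg th) with cms. field. apply PI_neq0.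
Qed.

Lemma is_derive_goursat_half_y (U : R -> R) (x y : R) : (forall t, t < 1 -> continuous U t) -> domE x y -> 0 <= x ->
  is_derive (goursat_half U x) y (Py U x y).
Proof.
intros HU HE Hx.
apply (is_derive_ext_loc (fun y => U x * ff y x - / PI * kernel_int U cm dff x y)).
{ generalize (open2_y domE x y domE_open HE). apply filter_imp. intros u Hu. symmetry. apply goursat_half_kernel_int; assumption. }
apply (is_derive_minus (V := R_NormedModule) (fun y => U x * ff y x)).
- apply (is_derive_scal (fun y => ff y x) y (U x)). apply is_derive_ff_y, domE_domK_x, HE.
- apply (is_derive_scal (fun y => kernel_int U cm dff x y) y (/ PI)).
  apply is_derive_kernel_int_y; try assumption; [exact continuous_cm|csolve|csolve|apply is_derive_dff_y].
Qed.

Lemma is_derive_Px_y (U : R -> R) (x y dU : R) : (forall t, t < 1 -> continuous U t) -> domE x y -> 0 <= x ->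
  is_derive (fun y => dU * ff y x + Rx U x y) y (dU * fy y x + Rxy U x y).
Proof.
intros HU HE Hx. assert (HO := domE_domK_x x y HE).
apply (is_derive_plus (V := R_NormedModule) (fun y => dU * ff y x)).
- apply (is_derive_scal (fun y => ff y x) y dU). apply is_derive_ff_y, HO.
- apply (is_derive_minus (V := R_NormedModule) (fun y => / 2 * (U x * dff y x))).
  + apply (is_derive_scal (fun y => U x * dff y x) y (/ 2)). apply (is_derive_scal (fun y => dff y x) y (U x)). apply is_derive_dff_y, HO.
  + apply (is_derive_scal (fun y => kernel_int U cms fkk x y) y (/ PI)).
    apply is_derive_kernel_int_y; try assumption; [exact continuous_cms|csolve|csolve|apply is_derive_fkk_y].
Qed.

(** At k = x one has [ib y x] = 1 / (1 - x - y), so [fy] = [ff] / (2 (1 - x - y)) and the terms with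
    dU cancel. The terms with U x cancel likewise, and the integrals by [kernel_int_identity]. *)
Lemma goursat_half_equation (U : R -> R) (x y dU : R) : (forall t, t < 1 -> continuous U t) -> domE x y ->
  dU * fy y x + Rxy U x y - (dU * ff y x + Rx U x y + Py U x y) / (2 * (1 - x - y)) = 0.
Proof.
intros HU HE. assert (H := kernel_int_identity U x y HU HE). destruct HE as [A [B D]]. unfold Rxy, Rx, Py.
assert (E : kernel_int U cms fkky x y = / (2 * (1 - x - y)) * (kernel_int U cms fkk x y + kernel_int U cm fky x y)) by lra.
rewrite E. unfold fky, dff, fy. replace (ib y x) with (/ (1 - x - y)) by (unfold ib; f_equal; ring).
generalize (ia y x). intros a. field. repeat split; first [apply PI_neq0|lra].
Qed.

Lemma continuous_U_fst (U : R -> R) (x y : R) : (forall t, t < 1 -> continuous U t) -> x < 1 -> continuous (fun p : R * R => U (fst p)) (x, y).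
Proof. intros HU Hx. apply (continuous_comp (fun p : R * R => fst p) U); [apply continuous_fst_at|apply HU, Hx]. Qed.

Lemma cont2_domE_domK (f : R -> R -> R) : cont2 domK f -> cont2 domE (fun x y => f y x).
Proof.
intros Hf x y HE. apply (cont2_comp domK f (fun p : R * R => snd p) (fun p => fst p)); [exact Hf|apply domE_domK_x, HE|apply continuous_snd_at|apply continuous_fst_at].
Qed.

Lemma cont2_goursat_half (U : R -> R) : (forall t, t < 1 -> continuous U t) -> cont2 domE (goursat_half U) /\ cont2 domE (Rx U) /\ cont2 domE (Py U).
Proof.
intros HU.
assert (HI : forall c psi, (forall s, continuous c s) -> cont2 domK psi -> cont2 domE (fun x y => / PI * kernel_int U c psi x y)).
{ intros c psi Hc Hp x y HE. apply (continuous_Rmult (fun _ => / PI)); [apply continuous_const|]. apply (continuous_kernel_int U c psi HU Hc Hp x y HE). }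
assert (HUf : forall f, cont2 domK f -> cont2 domE (fun x y => U x * f y x)).
{ intros f Hf x y HE. apply (continuous_Rmult (fun p : R * R => U (fst p))); [apply continuous_U_fst; [exact HU|apply HE]|apply (cont2_domE_domK f Hf x y HE)]. }
split; [|split]; intros x y HE.
- apply (continuous_ext_loc _ (fun p : R * R => U (fst p) * ff (snd p) (fst p) - / PI * kernel_int U cm dff (fst p) (snd p))).
  { generalize (domE_open x y HE). apply filter_imp. intros q Hq. symmetry. apply goursat_half_kernel_int; assumption. }
  apply (continuous_Rminus (fun p : R * R => U (fst p) * ff (snd p) (fst p))); [apply HUf; [csolve|exact HE]|apply HI; [exact continuous_cm|csolve|exact HE]].
- apply (continuous_Rminus (fun p : R * R => / 2 * (U (fst p) * dff (snd p) (fst p)))); [|apply HI; [exact continuous_cms|csolve|exact HE]].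
  apply (continuous_Rmult (fun _ => / 2)); [apply continuous_const|apply HUf; [csolve|exact HE]].
- apply (continuous_Rminus (fun p : R * R => U (fst p) * fy (snd p) (fst p))); [apply HUf; [csolve|exact HE]|apply HI; [exact continuous_cm|csolve|exact HE]].
Qed.

Lemma intD_domE (x y : R) : intD x y -> domE x y /\ 0 <= x /\ domK y x.
Proof. unfold intD, domE, domK. lra. Qed.

(** Each derivative is again such an integral, with weight c or c [sg]; in x there is also the
    end-point term U psi, through which the smoothness of U enters. *)
Lemma smooth_kernel_int (n : nat) (U c : R -> R) (psi : R -> R -> R) : (forall t, t < 1 -> continuous U t) ->
  smooth intD n (fun x _ => U x) -> (forall s, continuous c s) -> smooth domK n psi -> smooth intD n (kernel_int U c psi).
Proof.
intros HU. revert c psi. induction n as [|n IH]; intros c psi HsU Hc Hpsi;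
  (split; [intros x y H; apply continuous_kernel_int; [exact HU|exact Hc|exact (smooth_cont2 _ _ _ Hpsi)|apply intD_domE, H]|]); [exact I|].
assert (Hp1 := smooth_pred _ _ _ Hpsi). assert (HU1 := smooth_pred _ _ _ HsU).
assert (Hcp := smooth_cont2 _ _ _ Hpsi).
destruct Hpsi as [_ [py [pk [Hd [Hy Hk]]]]].
assert (Hc' : forall s, continuous (fun th => c th * sg th) s) by (intros s; cont; apply Hc).
exists (fun x y => U x * (RInt c 0 PI * psi y x) + kernel_int U (fun th => c th * sg th) pk x y), (kernel_int U c py).
split; [|split].
- intros x y H. destruct (intD_domE x y H) as [HE [Hx HO]]. split.
  + apply is_derive_kernel_int_x; try assumption; [exact (smooth_cont2 _ _ _ Hk)|intros; apply Hd; assumption].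
  + apply is_derive_kernel_int_y; try assumption; [exact (smooth_cont2 _ _ _ Hy)|intros; apply Hd; assumption].
- apply smooth_plus; [|apply IH; assumption].
  apply smooth_mult; [exact HU1|]. apply smooth_mult; [apply smooth_const|].
  apply (smooth_swap domK intD n psi); [intros; apply intD_domE; assumption|exact Hp1].
- apply IH; assumption.
Qed.

Lemma smooth_goursat_half (n : nat) (U : R -> R) : (forall t, t < 1 -> continuous U t) -> smooth intD n (fun x _ => U x) ->
  smooth intD n (goursat_half U).
Proof.
intros HU HsU. apply (smooth_ext intD n (fun x y => U x * ff y x - / PI * kernel_int U cm dff x y) (goursat_half U) open2_intD).
- intros x y H. symmetry. apply goursat_half_kernel_int; [exact HU|apply intD_domE, H].
- apply smooth_minus.
  + apply smooth_mult; [exact HsU|]. apply (smooth_swap domK intD n ff); [intros; apply intD_domE; assumption|apply smooth_ff].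
  + apply smooth_mult; [apply smooth_const|]. apply smooth_kernel_int; try assumption; [exact continuous_cm|apply smooth_combination; tauto].
Qed.

Lemma smooth_Derive_n (n j : nat) (f : R -> R) :
  (forall x, 0 < x < 1 -> (forall k, (k <= j + n)%nat -> ex_derive_n f k x) /\ continuous (Derive_n f (j + n)) x) ->
  smooth intD n (fun x _ => Derive_n f j x).
Proof.
revert j. induction n as [|n IH]; intros j H.
- split; [|exact I]. intros x y Hxy. apply (continuous_comp (fun p : R * R => fst p) (Derive_n f j)); [apply continuous_fst_at|].
  replace j with (j + 0)%nat by lia. apply H. simpl. unfold intD in Hxy. lra.
- assert (Hd : forall x, 0 < x < 1 -> is_derive (Derive_n f j) x (Derive_n f (S j) x)).
  { intros x Hx. apply Derive_correct. apply (proj1 (H x Hx) (S j)). lia. }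
  split.
  + intros x y Hxy. apply (continuous_comp (fun p : R * R => fst p) (Derive_n f j)); [apply continuous_fst_at|].
    apply (ex_derive_continuous (V := R_NormedModule)). eexists. apply Hd. simpl. unfold intD in Hxy. lra.
  + exists (fun x _ => Derive_n f (S j) x), (fun _ _ => 0). split; [|split; [|apply smooth_const]].
    * intros x y Hxy. split; [apply Hd; unfold intD in Hxy; lra|apply (is_derive_const (K := R_AbsRing) (V := R_NormedModule))].
    * apply IH. replace (S j + n)%nat with (j + S n)%nat by lia. exact H.
Qed.

Lemma is_derive_fy_k (y k : R) : domK y k -> is_derive (fy y) k (fky y k).
Proof.
intros H. unfold fy at 1. evar_last; [apply (is_derive_ff_mult (fun k => / 2 * ib y k)); [exact H|]|].
- instantiate (1 := / 2 * (ib y k * ib y k)). destruct H. unfold ib. auto_derive; [repeat split; lra|]. field. lra.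
- unfold fky, dff. field.
Qed.
Lemma is_derive_fky_k (y k : R) : domK y k -> is_derive (fky y) k (fkky y k).
Proof.
intros H. unfold fky at 1. evar_last; [apply (is_derive_ff_mult (fun k => / 4 * ((ib y k - ia y k) * ib y k) + / 2 * (ib y k * ib y k))); [exact H|]|].
- instantiate (1 := / 4 * ((ib y k * ib y k - ia y k * ia y k) * ib y k + (ib y k - ia y k) * (ib y k * ib y k)) + ib y k * (ib y k * ib y k)).
  destruct H. unfold ia, ib. auto_derive; [repeat split; lra|]. field. lra.
- unfold fkky, dff. field.
Qed.

(** The mixed derivative in the other order. In the half with x and y exchanged the x-derivative is
    [Py U1 y x], which the equation then differentiates in y, its first argument. *)
Lemma is_derive_Py_x (U : R -> R) (x y dU : R) : (forall t, t < 1 -> continuous U t) -> domE x y -> 0 <= x -> is_derive U x dU ->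
  is_derive (fun x => Py U x y) x (dU * fy y x + Rxy U x y).
Proof.
intros HU HE Hx HdU. unfold Py. evar_last.
- apply (is_derive_minus (V := R_NormedModule) (fun x => U x * fy y x)).
  + apply (is_derive_Rmult U (fy y)); [exact HdU|apply is_derive_fy_k, domE_domK_x, HE].
  + apply (is_derive_scal (fun x => kernel_int U cm fky x y) x (/ PI)).
    apply (is_derive_kernel_int_x U cm fky fkky); try assumption; [exact continuous_cm|csolve|csolve|apply is_derive_fky_k].
- unfold minus, plus, opp; simpl. rewrite RInt_cm. unfold Rxy. change (fun th => cm th * sg th) with cms. field. apply PI_neq0.
Qed.

(** * Extension of the data, and existence for the Goursat problem *)

Lemma Rmax_0_close (u t : R) : Rabs (Rmax 0 u - Rmax 0 t) <= Rabs (u - t).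
Proof. unfold Rmax, Rabs. repeat destruct Rle_dec; repeat destruct Rcase_abs; lra. Qed.

Lemma continuous_on_extend (w : R -> R) (t : R) : continuous_on I01 w -> t < 1 -> continuous (fun t => w (Rmax 0 t)) t.
Proof.
intros Hw Ht.
assert (HI : forall u, u < 1 -> I01 (Rmax 0 u)).
{ intros u Hu. unfold I01. assert (X := Rmax_l 0 u). split; [exact X|]. unfold Rmax; destruct Rle_dec; lra. }
apply (filterlim_comp _ _ _ (Rmax 0) w (locally t) (within I01 (locally (Rmax 0 t))) _); [|apply Hw, HI, Ht].
intros P [d Hd].
assert (He : 0 < Rmin d (1 - t)) by (apply Rmin_pos; [apply cond_pos|lra]).
exists (mkposreal _ He). intros u Hu. apply Rabs_def2 in Hu. simpl in Hu. unfold minus, plus, opp in Hu; simpl in Hu.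
assert (M1 := Rmin_l d (1 - t)). assert (M2 := Rmin_r d (1 - t)).
apply Hd; [|apply HI; lra]. unfold ball; simpl; unfold AbsRing_ball, abs, minus, plus, opp; simpl.
eapply Rle_lt_trans; [apply Rmax_0_close|]. apply Rabs_def1; lra.
Qed.

Lemma locally_gt_lt (t : R) : 0 < t < 1 -> locally t (fun u => 0 < u < 1).
Proof.
intros Ht. apply filter_and; [exact (open_gt 0 t (proj1 Ht))|exact (open_lt 1 t (proj2 Ht))].
Qed.

Lemma extends_data_Rmax (n : nat) (V : R -> R) : (2 <= n)%nat -> continuous_on I01 V -> Cn_open01 n V -> V 0 = 0 ->
  extends_data (fun t => V (Rmax 0 t)) V /\ smooth intD n (fun x _ => V (Rmax 0 x)).
Proof.
intros Hn HV HC H0. split; [split; [|split]|].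
- intros t Ht. apply continuous_on_extend; assumption.
- rewrite Rmax_left by lra. exact H0.
- intros t Ht. split.
  + apply (is_derive_ext_loc V).
    { generalize (locally_gt_lt t Ht). apply filter_imp. intros u Hu. rewrite Rmax_right by lra. reflexivity. }
    apply Derive_correct. apply (proj1 (HC t Ht) 1%nat). lia.
  + apply (ex_derive_continuous (V := R_NormedModule) (Derive V)). apply (proj1 (HC t Ht) 2%nat Hn).
- apply (smooth_ext intD n (fun x _ => Derive_n V 0 x) _ open2_intD).
  + intros x y [Hx _]. simpl. rewrite Rmax_right by lra. reflexivity.
  + apply smooth_Derive_n. exact HC.
Qed.

(* Rpower 0 a is exp (a * ln 0), which is 1 since ln 0 = 0 in the library. *)
Definition power0 (a t : R) : R := if Rle_dec t 0 then 0 else Rpower t a.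

Lemma power0_pos (a t : R) : 0 < t -> power0 a t = Rpower t a.
Proof. intros H. unfold power0. destruct Rle_dec; [lra|reflexivity]. Qed.

Lemma continuous_power0 (a t : R) : 0 < a -> continuous (power0 a) t.
Proof.
intros Ha. destruct (Rtotal_order t 0) as [L|[->|L]].
- apply (continuous_ext_loc _ (fun _ => 0)); [|apply continuous_const].
  generalize (open_lt 0 t L). apply filter_imp. intros u Hu. unfold power0. destruct Rle_dec; [reflexivity|lra].
- apply filterlim_locally. intros e. assert (He := cond_pos e).
  assert (Hd : 0 < Rpower e (/ a)) by apply exp_pos. exists (mkposreal _ Hd). intros u Hu.
  apply Rabs_def2 in Hu. simpl in Hu. unfold minus, plus, opp in Hu; simpl in Hu.
  unfold ball; simpl; unfold AbsRing_ball, abs, minus, plus, opp; simpl. unfold power0.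
  destruct (Rle_dec 0 0); [|lra]. rewrite Ropp_0, Rplus_0_r. destruct (Rle_dec u 0).
  + rewrite Rabs_R0. exact He.
  + rewrite Rabs_pos_eq by (apply Rlt_le, exp_pos).
    replace (pos e) with (Rpower (Rpower e (/ a)) a).
    * apply Rlt_Rpower_l; lra.
    * rewrite Rpower_mult, Rinv_l by lra. apply Rpower_1, He.
- apply (continuous_ext_loc _ (fun u => Rpower u a)).
  + generalize (open_gt 0 t L). apply filter_imp. intros u Hu. symmetry. apply power0_pos, Hu.
  + apply (continuous_Rpower_comp (fun u => u) a); [apply continuous_id|exact L].
Qed.

(** The larger exponent multiplies the given extension by t^(b - a), which tends to 0 at 0, so the
    result continues by 0 to negative arguments. *)
Lemma weighted_extension (a b : R) (V : R -> R) : weighted_derivative_continuous a V -> a < b ->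
  exists w, (forall t, t < 1 -> continuous w t) /\ forall t, 0 < t < 1 -> w t = Rpower t b * Derive V t.
Proof.
intros [g [Hg Eg]] Hab. exists (fun t => power0 (b - a) t * g (Rmax 0 t)). split.
- intros t Ht. apply (continuous_Rmult (power0 (b - a))); [apply continuous_power0; lra|apply continuous_on_extend; assumption].
- intros t Ht. rewrite power0_pos, Rmax_right, Eg by lra. rewrite <- Rmult_assoc, <- Rpower_plus. f_equal. f_equal. ring.
Qed.

Definition goursat_sol (U0 U1 : R -> R) (x y : R) : R := goursat_half U0 x y + goursat_half U1 y x.
Definition goursat_sol_x (dV0 U0 U1 : R -> R) (x y : R) : R := dV0 x * ff y x + (Rx U0 x y + Py U1 y x).

Lemma goursat_sol_swap (U0 U1 : R -> R) (x y : R) : goursat_sol U0 U1 x y = goursat_sol U1 U0 y x.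
Proof. unfold goursat_sol. ring. Qed.

Lemma domE_swap (x y : R) : domE x y -> domE y x.
Proof. unfold domE. lra. Qed.

Lemma is_derive_goursat_sol_x (V0 U0 U1 : R -> R) (x y : R) : extends_data U0 V0 -> (forall t, t < 1 -> continuous U1 t) ->
  0 < x -> 0 <= y -> x + y < 1 -> is_derive (fun x => goursat_sol U0 U1 x y) x (goursat_sol_x (Derive V0) U0 U1 x y).
Proof.
intros [HU0 [_ Hd]] HU1 Hx Hy Hxy. assert (HE : domE x y) by (unfold domE; lra).
unfold goursat_sol_x. rewrite <- Rplus_assoc. apply (is_derive_plus (V := R_NormedModule) (fun x => goursat_half U0 x y)).
- apply is_derive_goursat_half_x; [exact HU0|exact HE|lra|apply Hd; lra].
- apply (is_derive_goursat_half_y U1 y x); [exact HU1|apply domE_swap, HE|exact Hy].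
Qed.

Lemma is_derive_goursat_sol_y (V1 U0 U1 : R -> R) (x y : R) : extends_data U1 V1 -> (forall t, t < 1 -> continuous U0 t) ->
  0 <= x -> 0 < y -> x + y < 1 -> is_derive (goursat_sol U0 U1 x) y (goursat_sol_x (Derive V1) U1 U0 y x).
Proof.
intros H1 HU0 Hx Hy Hxy. apply (is_derive_ext (fun y => goursat_sol U1 U0 y x)); [intros; apply goursat_sol_swap|].
apply is_derive_goursat_sol_x; [exact H1|exact HU0|exact Hy|exact Hx|lra].
Qed.

Lemma partial_x_goursat_sol (V0 U0 U1 : R -> R) (x y : R) : extends_data U0 V0 -> (forall t, t < 1 -> continuous U1 t) ->
  0 < x -> 0 <= y -> x + y < 1 -> partial_x (goursat_sol U0 U1) x y = goursat_sol_x (Derive V0) U0 U1 x y.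
Proof. intros. apply is_derive_unique. apply is_derive_goursat_sol_x; assumption. Qed.
Lemma partial_y_goursat_sol (V1 U0 U1 : R -> R) (x y : R) : extends_data U1 V1 -> (forall t, t < 1 -> continuous U0 t) ->
  0 <= x -> 0 < y -> x + y < 1 -> partial_y (goursat_sol U0 U1) x y = goursat_sol_x (Derive V1) U1 U0 y x.
Proof. intros. apply is_derive_unique. apply (is_derive_goursat_sol_y V1 U0 U1); assumption. Qed.

Lemma goursat_sol_equation (V0 V1 U0 U1 : R -> R) (x y : R) : extends_data U0 V0 -> extends_data U1 V1 -> intD x y ->
  partial_y (partial_x (goursat_sol U0 U1)) x y - (partial_x (goursat_sol U0 U1) x y + partial_y (goursat_sol U0 U1) x y) / (2 * (1 - x - y)) = 0.
Proof.
intros H0 H1 H. assert (HD := H). destruct H as [Hx [Hy Hxy]]. assert (HE : domE x y) by (unfold domE; lra).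
assert (X : is_derive (partial_x (goursat_sol U0 U1) x) y
  (Derive V0 x * fy y x + Rxy U0 x y + (Derive V1 y * fy x y + Rxy U1 y x))).
{ apply (is_derive_ext_loc (fun y => Derive V0 x * ff y x + Rx U0 x y + Py U1 y x)).
  { generalize (open2_y intD x y open2_intD HD). apply filter_imp. intros v [_ [Hv Hv']].
    rewrite (partial_x_goursat_sol V0) by (first [exact H0|exact (proj1 H1)|lra]). unfold goursat_sol_x. eq_in R. ring. }
  apply (is_derive_plus (V := R_NormedModule) (fun y => Derive V0 x * ff y x + Rx U0 x y)).
  - apply is_derive_Px_y; [apply H0|exact HE|lra].
  - apply is_derive_Py_x; [apply H1|apply domE_swap, HE|lra|apply H1; lra]. }
change (partial_y (partial_x (goursat_sol U0 U1)) x y) with (Derive (partial_x (goursat_sol U0 U1) x) y). rewrite (is_derive_unique _ _ _ X).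
rewrite (partial_x_goursat_sol V0), (partial_y_goursat_sol V1) by (first [exact H0|exact H1|exact (proj1 H0)|exact (proj1 H1)|lra]).
assert (E0 := goursat_half_equation U0 x y (Derive V0 x) (proj1 H0) HE).
assert (E1 := goursat_half_equation U1 y x (Derive V1 y) (proj1 H1) (domE_swap _ _ HE)).
replace (1 - y - x) with (1 - x - y) in E1 by ring. unfold goursat_sol_x.
assert (Hr : 2 * (1 - x - y) <> 0) by lra. unfold Rdiv in *. lra.
Qed.

Lemma cont2_swap_domE (f : R -> R -> R) : cont2 domE f -> cont2 domE (fun x y => f y x).
Proof.
intros Hf x y HE. apply (cont2_comp domE f (fun p : R * R => snd p) (fun p => fst p)); [exact Hf|apply domE_swap, HE|apply continuous_snd_at|apply continuous_fst_at].
Qed.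

(** The weighted derivative x^b V_x with x^b V0' replaced by its extension w0, so that it is defined
    across x = 0. *)
Definition weighted_sol_x (b : R) (w0 U0 U1 : R -> R) (x y : R) : R := w0 x * ff y x + power0 b x * (Rx U0 x y + Py U1 y x).

Lemma cont2_weighted_sol_x (b : R) (w0 U0 U1 : R -> R) : 0 < b -> (forall t, t < 1 -> continuous w0 t) ->
  (forall t, t < 1 -> continuous U0 t) -> (forall t, t < 1 -> continuous U1 t) -> cont2 domE (weighted_sol_x b w0 U0 U1).
Proof.
intros Hb Hw H0 H1 x y HE.
apply (continuous_Rplus (fun p : R * R => w0 (fst p) * ff (snd p) (fst p)) (fun p => power0 b (fst p) * (Rx U0 (fst p) (snd p) + Py U1 (snd p) (fst p)))).
- apply (continuous_Rmult (fun p : R * R => w0 (fst p))); [apply continuous_U_fst; [exact Hw|apply HE]|].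
  apply (cont2_domE_domK ff); [csolve|exact HE].
- apply (continuous_Rmult (fun p : R * R => power0 b (fst p)) (fun p => Rx U0 (fst p) (snd p) + Py U1 (snd p) (fst p))).
  + apply (continuous_comp (fun p : R * R => fst p) (power0 b)); [apply continuous_fst_at|apply continuous_power0, Hb].
  + apply (continuous_Rplus (fun p : R * R => Rx U0 (fst p) (snd p)) (fun p => Py U1 (snd p) (fst p))).
    * exact (proj1 (proj2 (cont2_goursat_half U0 H0)) x y HE).
    * exact (cont2_swap_domE (Py U1) (proj2 (proj2 (cont2_goursat_half U1 H1))) x y HE).
Qed.

Lemma weighted_sol_x_eq (b : R) (w0 V0 U0 U1 : R -> R) (x y : R) : extends_data U0 V0 -> (forall t, t < 1 -> continuous U1 t) ->
  0 < x -> 0 <= y -> x + y < 1 -> w0 x = Rpower x b * Derive V0 x ->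
  weighted_sol_x b w0 U0 U1 x y = Rpower x b * partial_x (goursat_sol U0 U1) x y.
Proof.
intros H0 H1 Hx Hy Hxy E. rewrite (partial_x_goursat_sol V0) by assumption. unfold weighted_sol_x, goursat_sol_x. rewrite E, power0_pos by exact Hx. ring.
Qed.

Lemma cont2_domE_D (f : R -> R -> R) : cont2 domE f ->
  continuous_on (fun p : R * R => inD (fst p) (snd p)) (fun p : R * R => f (fst p) (snd p)).
Proof.
intros Hf [x y] H. apply (continuous_within (fun p : R * R => inD (fst p) (snd p)) (x, y) (fun p : R * R => f (fst p) (snd p))). apply Hf. simpl in H. unfold inD, domE in *. lra.
Qed.

Lemma ff_0_k (k : R) : k < 1 -> ff 0 k = 1.
Proof.
intros Hk. unfold ff. rewrite Rminus_0_r, <- Rpower_plus. replace (/ 2 + - / 2) with 0 by field. apply Rpower_O. lra.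
Qed.
Lemma goursat_half_0_y (U : R -> R) (y : R) : U 0 = 0 -> goursat_half U 0 y = 0.
Proof. intros H. unfold goursat_half. rewrite RInt_point, H. unfold zero; simpl. ring. Qed.
Lemma goursat_half_x_0 (U : R -> R) (x : R) : x < 1 -> goursat_half U x 0 = U x.
Proof.
intros Hx. unfold goursat_half. rewrite ff_0_k by exact Hx.
rewrite (RInt_ext _ (fun _ => 0)); [rewrite RInt_const; unfold scal; simpl; unfold mult; simpl; ring|].
intros t _. unfold Kt, Ravg. rewrite (RInt_ext _ (fun _ => 0)).
- rewrite RInt_const. unfold scal; simpl; unfold mult; simpl. ring.
- intros s _. unfold pa', dff, ib, ia. rewrite Rminus_0_r. eq_in R. ring.
Qed.

Theorem goursat_sol_solution (n : nat) (V0 V1 : R -> R) : (2 <= n)%nat -> goursat_data n V0 V1 ->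
  Cn_solution n V0 V1 (goursat_sol (fun t => V0 (Rmax 0 t)) (fun t => V1 (Rmax 0 t))).
Proof.
intros Hn [C0 [C1 [D0 [D1 [[a [Ha [W0 W1]]] [Z0 Z1]]]]]].
destruct (extends_data_Rmax n V0 Hn C0 D0 Z0) as [H0 S0]. destruct (extends_data_Rmax n V1 Hn C1 D1 Z1) as [H1 S1].
set (U0 := fun t => V0 (Rmax 0 t)) in *. set (U1 := fun t => V1 (Rmax 0 t)) in *.
(* The exponent is raised strictly above a, and above 0 even when a = 0, so that [power0] is
   continuous for both b and b - a. *)
set (b := (1 + a) / 2). assert (Hb : 0 < b < 1 /\ a < b) by (unfold b; lra).
destruct (weighted_extension a b V0 W0 ltac:(lra)) as [w0 [Cw0 E0]].
destruct (weighted_extension a b V1 W1 ltac:(lra)) as [w1 [Cw1 E1]].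
assert (K0 := proj1 H0). assert (K1 := proj1 H1).
assert (Gx : cont2 domE (weighted_sol_x b w0 U0 U1)) by (apply cont2_weighted_sol_x; first [assumption|lra]).
assert (Gy : cont2 domE (fun x y => weighted_sol_x b w1 U1 U0 y x)) by (apply cont2_swap_domE, cont2_weighted_sol_x; first [assumption|lra]).
assert (Ex : forall x y, intD x y -> weighted_sol_x b w0 U0 U1 x y = Rpower x b * partial_x (goursat_sol U0 U1) x y).
{ intros x y [A [B D]]. apply (weighted_sol_x_eq b w0 V0); try assumption; [lra|apply E0; lra]. }
assert (Ey : forall x y, intD x y -> weighted_sol_x b w1 U1 U0 y x = Rpower y b * partial_y (goursat_sol U0 U1) x y).
{ intros x y [A [B D]]. rewrite (weighted_sol_x_eq b w1 V1 U1 U0 y x); try assumption; [|lra|lra|apply E1; lra].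
  rewrite (partial_x_goursat_sol V1), (partial_y_goursat_sol V1) by (first [exact H1|assumption|lra]). reflexivity. }
assert (Heq : forall x y, intD x y -> partial_y (partial_x (goursat_sol U0 U1)) x y - (partial_x (goursat_sol U0 U1) x y + partial_y (goursat_sol U0 U1) x y) / (2 * (1 - x - y)) = 0).
{ intros x y. apply (goursat_sol_equation V0 V1); assumption. }
split; [|split; [|split; [exact Heq|split; [|split]]]].
- apply cont2_domE_D. intros x y HE. apply (continuous_Rplus (fun p : R * R => goursat_half U0 (fst p) (snd p)) (fun p => goursat_half U1 (snd p) (fst p))).
  + exact (proj1 (cont2_goursat_half U0 K0) x y HE).
  + exact (cont2_swap_domE (goursat_half U1) (proj1 (cont2_goursat_half U1 K1)) x y HE).
- intros x y H. apply (smooth_ex_diff_n intD); [exact open2_intD| |exact H].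
  apply smooth_plus; [apply smooth_goursat_half; assumption|].
  apply (smooth_swap intD intD n (goursat_half U1)); [unfold intD; intros; lra|apply smooth_goursat_half; assumption].
- exists b. split; [lra|]. split; [|split].
  + exists (fun p => weighted_sol_x b w0 U0 U1 (fst p) (snd p)). split; [apply cont2_domE_D, Gx|]. intros p Hp. apply Ex, Hp.
  + exists (fun p => weighted_sol_x b w1 U1 U0 (snd p) (fst p)). split; [apply (cont2_domE_D (fun x y => weighted_sol_x b w1 U1 U0 y x)), Gy|]. intros p Hp. apply Ey, Hp.
  (* The weighted mixed derivative is read off from the equation: y^b times the extension of x^b V_x
     plus x^b times that of y^b V_y, over 2 (1 - x - y). *)
  + set (g := fun x y => (power0 b y * weighted_sol_x b w0 U0 U1 x y + power0 b x * weighted_sol_x b w1 U1 U0 y x) / (2 * (1 - x - y))).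
    exists (fun p => g (fst p) (snd p)). split.
    * apply cont2_domE_D. intros x y HE. assert (HE' := HE). destruct HE' as [A [B D]]. unfold g.
      assert (Pb : forall (f : R * R -> R), continuous f (x, y) -> continuous (fun p => power0 b (f p)) (x, y)).
      { intros f Hf. apply (continuous_comp f (power0 b)); [exact Hf|apply continuous_power0; lra]. }
      apply (continuous_Rdiv (fun p : R * R => power0 b (snd p) * weighted_sol_x b w0 U0 U1 (fst p) (snd p) + power0 b (fst p) * weighted_sol_x b w1 U1 U0 (snd p) (fst p))).
      -- apply (continuous_Rplus (fun p : R * R => power0 b (snd p) * weighted_sol_x b w0 U0 U1 (fst p) (snd p))).
         ++ apply (continuous_Rmult (fun p : R * R => power0 b (snd p))); [apply Pb, continuous_snd_at|apply Gx, HE].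
         ++ apply (continuous_Rmult (fun p : R * R => power0 b (fst p))); [apply Pb, continuous_fst_at|apply Gy, HE].
      -- cont; first [apply continuous_fst_at|apply continuous_snd_at].
      -- simpl. lra.
    * intros [x y] Hp. simpl in Hp. cbn [fst snd]. unfold g. rewrite (Ex x y Hp), (Ey x y Hp).
      assert (E := Heq x y Hp). destruct Hp as [A [B D]]. rewrite !power0_pos by lra.
      replace (partial_y (partial_x (goursat_sol U0 U1)) x y) with ((partial_x (goursat_sol U0 U1) x y + partial_y (goursat_sol U0 U1) x y) / (2 * (1 - x - y))) by lra.
      eq_in R. field. lra.
- intros x [A B]. unfold goursat_sol. rewrite goursat_half_x_0, goursat_half_0_y by (first [lra|apply H1]). unfold U0. rewrite Rmax_right by lra. ring.
- intros y [A B]. unfold goursat_sol. rewrite goursat_half_x_0, goursat_half_0_y by (first [lra|apply H0]). unfold U1. rewrite Rmax_right by lra. ring.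
Qed.

Lemma ff_y_0 (y : R) : y < 1 -> ff y 0 = / sqrt (1 - y).
Proof.
intros Hy. unfold ff. rewrite !Rminus_0_r. rewrite Rpower_Ropp, Rpower_sqrt, Rpower_sqrt, sqrt_1 by lra. ring.
Qed.

(** As x tends to 0, [Rx] and [Py] have finite limits and are killed by x^a; the remaining term is
    x^a V0' [ff y x], and [ff y 0] = 1 / sqrt (1 - y). *)
Lemma limit_x (a m y : R) (V0 U0 U1 : R -> R) : 0 < a -> extends_data U0 V0 -> (forall t, t < 1 -> continuous U1 t) ->
  filterlim (fun x => Rpower x a * Derive V0 x) (at_right 0) (locally m) -> 0 <= y < 1 ->
  filterlim (fun x => Rpower x a * partial_x (goursat_sol U0 U1) x y) (at_right 0) (locally (m / sqrt (1 - y))).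
Proof.
intros Ha H0 H1 Hm Hy. assert (HE : domE 0 y) by (unfold domE; lra).
assert (Cx : forall f, cont2 domE f -> continuous (fun x => f x y) 0).
{ intros f Hf. apply (cont2_comp domE f (fun x => x) (fun _ => y)); [exact Hf|exact HE|apply continuous_id|apply continuous_const]. }
set (R0 := fun x => Rx U0 x y + Py U1 y x).
assert (CR : continuous (fun x => power0 a x * R0 x) 0).
{ apply (continuous_Rmult (power0 a)); [apply continuous_power0, Ha|]. apply (continuous_Rplus (fun x => Rx U0 x y) (fun x => Py U1 y x)).
  - exact (Cx (Rx U0) (proj1 (proj2 (cont2_goursat_half U0 (proj1 H0))))).
  - exact (Cx (fun x y => Py U1 y x) (cont2_swap_domE (Py U1) (proj2 (proj2 (cont2_goursat_half U1 H1))))). }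
assert (CF : continuous (fun x => ff y x) 0) by (apply (Cx (fun x y => ff y x)), cont2_domE_domK; csolve).
assert (E : m / sqrt (1 - y) = m * ff y 0 + power0 a 0 * R0 0).
{ rewrite ff_y_0 by lra. unfold power0. destruct (Rle_dec 0 0); [|lra]. unfold Rdiv. ring. }
rewrite E.
assert (LR : forall f : R -> R, continuous f 0 -> filterlim f (at_right 0) (locally (f 0))).
{ intros f Hf. apply (continuous_within _ 0 f Hf). }
apply (filterlim_ext_loc (fun x => Rpower x a * Derive V0 x * ff y x + power0 a x * R0 x)).
- assert (Hp : 0 < 1 - y) by lra. exists (mkposreal _ Hp). intros x Hx Hx0.
  apply Rabs_def2 in Hx. simpl in Hx. unfold minus, plus, opp in Hx; simpl in Hx.
  rewrite (partial_x_goursat_sol V0) by (first [exact H0|assumption|lra]). unfold goursat_sol_x, R0. rewrite power0_pos by exact Hx0. eq_in R. ring.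
- refine (filterlim_comp_2 (fun x => Rpower x a * Derive V0 x * ff y x) (fun x => power0 a x * R0 x) Rplus _ _ (filterlim_plus (K := R_AbsRing) (V := R_NormedModule) (m * ff y 0) (power0 a 0 * R0 0))).
  + exact (filterlim_comp_2 (fun x => Rpower x a * Derive V0 x) (fun x => ff y x) Rmult Hm (LR _ CF) (filterlim_mult (K := R_AbsRing) m (ff y 0))).
  + apply LR, CR.
Qed.

(** * Uniqueness for the Goursat problem *)

Definition cont_D (g : R -> R -> R) : Prop :=
  continuous_on (fun p : R * R => inD (fst p) (snd p)) (fun p : R * R => g (fst p) (snd p)).

Lemma cont_D_eps (g : R -> R -> R) : cont_D g <-> forall x y e, inD x y -> 0 < e ->
  exists d, 0 < d /\ forall u v, inD u v -> Rabs (u - x) < d -> Rabs (v - y) < d -> Rabs (g u v - g x y) < e.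
Proof.
split.
- intros Hg x y e H He.
  destruct (proj1 (filterlim_locally _ _) (Hg (x, y) H) (mkposreal e He)) as [d Hd].
  exists d. split; [apply cond_pos|]. intros u v Huv Hu Hv. apply (Hd (u, v)); [split; assumption|exact Huv].
- intros Hg [x y] H. apply filterlim_locally. intros e.
  destruct (Hg x y e H (cond_pos e)) as [d [Hd H']]. exists (mkposreal d Hd). intros [u v] [Hu Hv] Huv.
  exact (H' u v Huv Hu Hv).
Qed.

Lemma cont_D_bounded (g : R -> R -> R) (T : R) : cont_D g -> T < 1 ->
  exists M, 0 <= M /\ forall x y, inD x y -> x + y <= T -> Rabs (g x y) <= M.
Proof.
intros Hg HT.
set (P := fun a b h => exists M, forall x y, inD x y -> x + y <= T -> a <= x <= a + h -> b <= y <= b + h -> Rabs (g x y) <= M).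
assert (HP : P 0 0 1).
{ apply (square_bisection P); [|lra|].
  - intros a b h Hh [M1 H1] [M2 H2] [M3 H3] [M4 H4]. exists (Rmax (Rmax M1 M2) (Rmax M3 M4)). intros x y HD Hxy Hx Hy.
    assert (X1 := Rmax_l M1 M2). assert (X2 := Rmax_r M1 M2). assert (X3 := Rmax_l M3 M4). assert (X4 := Rmax_r M3 M4).
    assert (Y1 := Rmax_l (Rmax M1 M2) (Rmax M3 M4)). assert (Y2 := Rmax_r (Rmax M1 M2) (Rmax M3 M4)).
    destruct (Rle_dec x (a + h / 2)), (Rle_dec y (b + h / 2)).
    + specialize (H1 x y HD Hxy). lra.
    + specialize (H3 x y HD Hxy). lra.
    + specialize (H2 x y HD Hxy). lra.
    + specialize (H4 x y HD Hxy). lra.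
  - intros x y Hx Hy. destruct (Rle_dec (x + y) T) as [L|L].
    + assert (HD : inD x y) by (unfold inD; lra).
      destruct (proj1 (cont_D_eps g) Hg x y 1 HD Rlt_0_1) as [d [Hd H]]. exists d. split; [exact Hd|].
      intros a b h Hh Ha Hb. exists (Rabs (g x y) + 1). intros u v HD' _ Hu Hv.
      assert (X : Rabs (g u v - g x y) < 1) by (apply H; [exact HD'|apply Rabs_def1; lra|apply Rabs_def1; lra]).
      assert (Y := Rabs_triang (g u v - g x y) (g x y)). replace (g u v - g x y + g x y) with (g u v) in Y by ring. lra.
    + exists ((x + y - T) / 2). split; [lra|]. intros a b h Hh Ha Hb. exists 0. intros u v _ Huv Hu Hv. lra. }
destruct HP as [M HM]. exists (Rmax M 0). split; [apply Rmax_r|]. intros x y HD Hxy.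
eapply Rle_trans; [|apply Rmax_l]. unfold inD in HD. apply HM; [exact HD|exact Hxy|lra|lra].
Qed.

(* One of the two symmetric halves of the first-order system satisfied by p = U_x, q = U_y. *)
Definition half (a : R) (U p q : R -> R -> R) : Prop :=
  cont_D U /\
  (forall x y, intD x y -> is_derive (fun u => U u y) x (p x y)) /\
  (forall x y, intD x y -> is_derive (p x) y ((p x y + q x y) / (2 * (1 - x - y)))) /\
  exists G, cont_D G /\ forall x y, intD x y -> G x y = Rpower x a * p x y.

Lemma Rpower_le_1 (x a : R) : 0 < x < 1 -> 0 <= a -> Rpower x a <= 1.
Proof.
intros Hx Ha. unfold Rpower. rewrite <- exp_0. assert (ln x < 0) by (rewrite <- ln_1; apply ln_increasing; lra).
destruct (Req_dec_T a 0) as [->|N]; [rewrite Rmult_0_l; lra|]. apply Rlt_le, exp_increasing. nra.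
Qed.

(** The trace of p on y = 0 is read off from the extension G of x^a p. Were l = |G x 0| positive,
    |p| would exceed l / 2 on a short horizontal segment close to the axis, and U would vary along
    it by a fixed amount, whereas U tends to 0 with y. *)
Lemma half_vanish (a x : R) (U p q : R -> R -> R) : 0 <= a -> half a U p q -> (forall x, I01 x -> U x 0 = 0) -> 0 < x < 1 ->
  forall e, 0 < e -> exists d, 0 < d /\ forall y, 0 < y < d -> x + y < 1 -> Rabs (p x y) < e.
Proof.
intros Ha [HU [Hp [_ [G [HG EG]]]]] H0 Hx.
assert (HD : inD x 0) by (unfold inD; lra).
assert (L : G x 0 = 0).
{ apply NNPP. intros N. assert (Hl := Rabs_pos_lt _ N). set (l := Rabs (G x 0)) in *.
  destruct (proj1 (cont_D_eps G) HG x 0 (l / 2) HD ltac:(lra)) as [d [Hd H]].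
  assert (Hm : 0 < Rmin d (1 - x)) by (apply Rmin_pos; lra).
  assert (M1 := Rmin_l d (1 - x)). assert (M2 := Rmin_r d (1 - x)).
  set (m := Rmin d (1 - x)) in *. set (x2 := x + m / 2).
  assert (HD2 : inD x2 0) by (unfold inD, x2; lra).
  (* Two errors of this size amount to half of l / 2 * (x2 - x), the variation of U that |p| > l / 2
     would enforce. *)
  assert (Hs : 0 < l / 2 * (x2 - x) / 4) by (unfold x2; nra).
  destruct (proj1 (cont_D_eps U) HU x 0 _ HD Hs) as [d1 [Hd1 H1]].
  destruct (proj1 (cont_D_eps U) HU x2 0 _ HD2 Hs) as [d2 [Hd2 H2]].
  assert (Hy : exists y, 0 < y /\ y < d1 /\ y < d2 /\ y < m / 2).
  { exists (Rmin (Rmin d1 d2) (m / 2) / 2). assert (X := Rmin_pos _ _ (Rmin_pos _ _ Hd1 Hd2) (Rdiv_lt_0_compat m 2 Hm ltac:(lra))).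
    assert (X1 := Rmin_l (Rmin d1 d2) (m / 2)). assert (X2 := Rmin_r (Rmin d1 d2) (m / 2)).
    assert (X3 := Rmin_l d1 d2). assert (X4 := Rmin_r d1 d2). lra. }
  destruct Hy as [y [Y0 [Y1 [Y2 Y3]]]].
  assert (Hint : forall xi, x <= xi <= x2 -> intD xi y) by (unfold intD, x2; intros; lra).
  destruct (MVT_gen (fun u => U u y) x x2 (fun u => p u y)) as [xi [Hxi E]].
  { intros u Hu. apply Hp, Hint. revert Hu. rewrite Rmin_left, Rmax_right by (unfold x2; lra). lra. }
  { intros u Hu. apply continuity_pt_filterlim. apply (ex_derive_continuous (V := R_NormedModule) (fun u => U u y)). eexists. apply Hp, Hint.
    revert Hu. rewrite Rmin_left, Rmax_right by (unfold x2; lra). lra. }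
  rewrite Rmin_left, Rmax_right in Hxi by (unfold x2; lra).
  assert (HI := Hint xi Hxi). assert (HDi : inD xi y) by (unfold intD, inD in *; lra).
  assert (Z1 : Rabs (U x y - U x 0) < l / 2 * (x2 - x) / 4).
  { apply H1; [unfold inD, intD, x2 in *; lra|rewrite Rminus_diag, Rabs_R0; exact Hd1|rewrite Rminus_0_r, Rabs_pos_eq; lra]. }
  assert (Z2 : Rabs (U x2 y - U x2 0) < l / 2 * (x2 - x) / 4).
  { apply H2; [unfold inD, intD, x2 in *; lra|rewrite Rminus_diag, Rabs_R0; exact Hd2|rewrite Rminus_0_r, Rabs_pos_eq; lra]. }
  rewrite (H0 x) in Z1 by (unfold I01; lra). rewrite (H0 x2) in Z2 by (unfold I01, inD in *; lra).
  rewrite Rminus_0_r in Z1, Z2.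
  assert (Z3 : Rabs (G xi y - G x 0) < l / 2).
  { apply H; [exact HDi|unfold x2 in Hxi; rewrite Rabs_pos_eq; lra|rewrite Rminus_0_r, Rabs_pos_eq; lra]. }
  assert (Z4 : l / 2 < Rabs (p xi y)).
  { assert (X := EG xi y HI). assert (X2 : Rabs (G xi y) <= Rabs (p xi y)).
    { rewrite X, Rabs_mult, (Rabs_pos_eq (Rpower xi a)) by (apply Rlt_le, exp_pos).
      assert (R1 := Rpower_le_1 xi a ltac:(unfold intD in HI; lra) Ha). assert (R2 := Rabs_pos (p xi y)). nra. }
    assert (X3 := Rabs_triang_inv (G x 0) (G xi y)). rewrite (Rabs_minus_sym (G x 0)) in X3. unfold l in *. lra. }
  assert (Z5 : Rabs (p xi y * (x2 - x)) < l / 2 * (x2 - x) / 2).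
  { rewrite <- E. unfold Rminus at 1. eapply Rle_lt_trans; [apply Rabs_triang|]. rewrite Rabs_Ropp. lra. }
  rewrite Rabs_mult, (Rabs_pos_eq (x2 - x)) in Z5 by (unfold x2; lra).
  assert (0 < x2 - x) by (unfold x2; lra). nra. }
intros e He.
assert (Hpx : 0 < Rpower x a) by apply exp_pos.
destruct (proj1 (cont_D_eps G) HG x 0 (e * Rpower x a) HD ltac:(nra)) as [d [Hd H]].
exists d. split; [exact Hd|]. intros y Hy Hxy.
assert (HI : intD x y) by (unfold intD; lra).
assert (X : Rabs (G x y - G x 0) < e * Rpower x a).
{ apply H; [unfold inD; lra|rewrite Rminus_diag, Rabs_R0; exact Hd|rewrite Rminus_0_r, Rabs_pos_eq; lra]. }
rewrite L, Rminus_0_r, (EG x y HI), Rabs_mult, (Rabs_pos_eq (Rpower x a)) in X by lra. nra.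
Qed.

Lemma half_bound (a T : R) (U p q : R -> R -> R) : half a U p q -> T < 1 ->
  exists M, 0 <= M /\ forall x y, intD x y -> x + y <= T -> Rabs (p x y) <= M * Rpower x (- a).
Proof.
intros [_ [_ [_ [G [HG EG]]]]] HT. destruct (cont_D_bounded G T HG HT) as [M [HM H]]. exists M. split; [exact HM|].
intros x y HI Hxy. assert (X := H x y ltac:(unfold intD, inD in *; lra) Hxy). rewrite (EG x y HI), Rabs_mult, (Rabs_pos_eq (Rpower x a)) in X by (apply Rlt_le, exp_pos).
assert (Hp := exp_pos (a * ln x)). change (exp (a * ln x)) with (Rpower x a) in Hp.
rewrite Rpower_Ropp. apply (Rmult_le_reg_r (Rpower x a)); [exact Hp|]. rewrite Rmult_assoc, Rinv_l by lra. lra.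
Qed.

(* The weight turns the Volterra operator of the system into a contraction. *)
Definition weight (b l x y : R) : R := exp (l * (Rpower x b + Rpower y b)).

(** By [half_vanish], p is recovered from p_y by integration from y = 0. On (0, 1) both x^(-a) and
    t^(-a) are at least 1, so |p_y| is at most B x^(-a) t^(-a) E t / (1 - T). The constant l
    satisfies l (1 - a) = 2 / (1 - T), which makes this bound exactly c E' t with c = B / 2 *
    x^(-a); integration yields the factor 1/2. *)
Lemma half_step (a T B : R) (U p q : R -> R -> R) : 0 <= a < 1 -> T < 1 -> half a U p q -> (forall x, I01 x -> U x 0 = 0) ->
  let l := 2 / ((1 - T) * (1 - a)) in 0 <= B ->
  (forall x y, intD x y -> x + y <= T ->
    Rabs (p x y) <= B * (Rpower x (- a) * weight (1 - a) l x y) /\ Rabs (q x y) <= B * (Rpower y (- a) * weight (1 - a) l x y)) ->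
  forall x y, intD x y -> x + y <= T -> Rabs (p x y) <= B / 2 * (Rpower x (- a) * weight (1 - a) l x y).
Proof.
intros Ha HT Hh H0 l HB Hpq x y HI Hxy. assert (HI' := HI). destruct HI' as [Hx [Hy Hxy1]].
assert (Hv := half_vanish a x U p q (proj1 Ha) Hh H0 ltac:(lra)).
destruct Hh as [_ [_ [Hp _]]].
set (c := B / 2 * Rpower x (- a)).
set (E := weight (1 - a) l x).
assert (Hint : forall t, 0 < t <= y -> intD x t /\ x + t <= T) by (unfold intD; intros; lra).
assert (HEp : forall t, 0 < E t) by (intros t; apply exp_pos).
assert (HE : forall t, 0 < t -> is_derive E t (l * ((1 - a) * Rpower t (- a)) * E t)).
{ intros t Ht. unfold E, weight. evar_last.
  - apply (is_derive_comp exp (fun t => l * (Rpower x (1 - a) + Rpower t (1 - a)))); [apply is_derive_exp|].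
    apply (is_derive_scal (fun t => Rpower x (1 - a) + Rpower t (1 - a)) t l).
    apply (is_derive_plus (V := R_NormedModule) (fun _ => Rpower x (1 - a))); [apply (is_derive_const (K := R_AbsRing) (V := R_NormedModule))|].
    apply (is_derive_Rpower_comp (fun t => t) t 1); [apply (is_derive_id (K := R_AbsRing))|exact Ht].
  - unfold plus, zero, scal; simpl; unfold mult; simpl. replace (1 - a - 1) with (- a) by ring. ring. }
assert (Hpm : forall t, 0 < t <= y -> Rabs ((p x t + q x t) / (2 * (1 - x - t))) <= c * (l * ((1 - a) * Rpower t (- a)) * E t)).
{ intros t Ht. destruct (Hint t Ht) as [HI1 HT1]. destruct (Hpq x t HI1 HT1) as [P1 P2]. fold E in P1, P2.
  change (weight (1 - a) l x t) with (E t) in P1, P2.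
  assert (Pow : forall u, 0 < u < 1 -> 1 <= Rpower u (- a)).
  { intros u Hu. rewrite Rpower_Ropp. assert (X := Rpower_le_1 u a Hu (proj1 Ha)). assert (X' : 0 < Rpower u a) by apply exp_pos.
    rewrite <- Rinv_1. apply Rinv_le_contravar; lra. }
  assert (Px := Pow x ltac:(lra)). assert (Pv := Pow t ltac:(lra)). assert (Et := HEp t).
  set (u := Rpower x (- a)) in *. set (v := Rpower t (- a)) in *. set (w := E t) in *.
  assert (Q1 : Rabs (p x t + q x t) <= 2 * B * (u * v * w)).
  { eapply Rle_trans; [apply Rabs_triang|].
    assert (u * w <= u * v * w) by (apply Rmult_le_compat_r; nra).
    assert (v * w <= u * v * w) by (apply Rmult_le_compat_r; nra). nra. }
  unfold Rdiv. rewrite Rabs_mult, (Rabs_pos_eq (/ _)) by (apply Rlt_le, Rinv_0_lt_compat; unfold intD in HI1; lra).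
  replace (c * (l * ((1 - a) * v) * w)) with (2 * B * (u * v * w) * / (2 * (1 - T))) by (unfold c, l, u; field; lra).
  apply Rmult_le_compat; [apply Rabs_pos|apply Rlt_le, Rinv_0_lt_compat; unfold intD in HI1; lra|exact Q1|].
  apply Rinv_le_contravar; [lra|unfold intD in HI1; lra]. }
(* The sign s treats p and -p together: s p - c E does not increase on [t0, y], and at t0 it is
   below e. *)
assert (Hcmp : forall s, s = 1 \/ s = -1 -> s * p x y <= c * E y).
{ intros s Hs. apply le_epsilon. intros e He. destruct (Hv e He) as [d [Hd Hd']].
  set (t0 := Rmin d y / 2). assert (X := Rmin_pos d y Hd Hy). assert (X1 := Rmin_l d y). assert (X2 := Rmin_r d y).
  assert (Ht0 : 0 < t0 < d /\ t0 < y) by (unfold t0; lra).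
  assert (Hd0 := Hd' t0 ltac:(lra) ltac:(lra)).
  assert (HF : forall t, 0 < t <= y -> is_derive (fun t => s * p x t - c * E t) t (s * ((p x t + q x t) / (2 * (1 - x - t))) - c * (l * ((1 - a) * Rpower t (- a)) * E t))).
  { intros t Ht. apply (is_derive_minus (V := R_NormedModule) (fun t => s * p x t)).
    - apply (is_derive_scal (p x) t s). apply Hp, Hint, Ht.
    - apply (is_derive_scal E t c). apply HE; lra. }
  destruct (MVT_gen (fun t => s * p x t - c * E t) t0 y (fun t => s * ((p x t + q x t) / (2 * (1 - x - t))) - c * (l * ((1 - a) * Rpower t (- a)) * E t))) as [xi [Hxi Exi]].
  { rewrite Rmin_left, Rmax_right by lra. intros t Ht. apply HF; lra. }
  { rewrite Rmin_left, Rmax_right by lra. intros t Ht. apply continuity_pt_filterlim.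
    apply (ex_derive_continuous (V := R_NormedModule) (fun t => s * p x t - c * E t)). eexists. apply HF; lra. }
  rewrite Rmin_left, Rmax_right in Hxi by lra.
  assert (Q := Hpm xi ltac:(lra)). assert (Q1 := HEp t0).
  set (z := (p x xi + q x xi) / (2 * (1 - x - xi))) in *. set (zz := c * (l * ((1 - a) * Rpower xi (- a)) * E xi)) in *.
  assert (Q2 : s * z <= zz) by (assert (Y := Rle_abs z); assert (Y' := Rle_abs (- z)); rewrite Rabs_Ropp in Y'; destruct Hs as [-> | ->]; lra).
  assert (Q3 : s * p x t0 < e) by (apply Rabs_def2 in Hd0; destruct Hs as [-> | ->]; lra).
  assert (Q4 : 0 <= c * E t0).
  { apply Rmult_le_pos; [|lra]. unfold c. apply Rmult_le_pos; [lra|apply Rlt_le, exp_pos]. }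
  assert (Q5 : (s * z - zz) * (y - t0) <= 0) by (assert (0 < y - t0) by lra; nra). lra. }
assert (C1 := Hcmp 1 ltac:(left; reflexivity)). assert (C2 := Hcmp (-1) ltac:(right; reflexivity)).
assert (Ec : B / 2 * (Rpower x (- a) * E y) = c * E y) by (unfold c; ring).
change (weight (1 - a) l x y) with (E y). rewrite Ec.
apply Rabs_le. split; lra.
Qed.

Lemma weight_sym (b l x y : R) : weight b l x y = weight b l y x.
Proof. unfold weight. f_equal. ring. Qed.

Lemma zero_of_halving (x c : R) : 0 <= x -> (forall n, x <= c / 2 ^ n) -> x = 0.
Proof.
intros Hx H. destruct (Req_dec_T x 0) as [E|N]; [exact E|exfalso].
assert (Hc : 0 < c) by (assert (X := H 0%nat); simpl in X; lra).
destruct (pow_lt_1_zero (/ 2) ltac:(rewrite Rabs_pos_eq; lra) (x / c)) as [n Hn]; [apply Rdiv_lt_0_compat; lra|].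
specialize (Hn n (Nat.le_refl _)). rewrite Rabs_pos_eq, pow_inv in Hn by (apply pow_le; lra).
assert (X := H n). apply (Rmult_lt_compat_l c) in Hn; [|exact Hc]. replace (c * (x / c)) with x in Hn by (field; lra). unfold Rdiv in X. lra.
Qed.

(** The constant l depends on the level T = x + y of the point considered. On the part of D below
    this level [half_step] applies to p and, after exchanging x and y, to q; iteration gives the
    bound M / 2^n. *)
Lemma halves_vanish (a : R) (U p q : R -> R -> R) : 0 <= a < 1 -> half a U p q ->
  half a (fun x y => U y x) (fun x y => q y x) (fun x y => p y x) ->
  (forall x, I01 x -> U x 0 = 0) -> (forall y, I01 y -> U 0 y = 0) ->
  forall x y, intD x y -> p x y = 0.
Proof.
intros Ha H1 H2 Z1 Z2 x y HI. set (T := x + y). assert (HT : T < 1) by (unfold intD, T in *; lra).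
destruct (half_bound a T _ _ _ H1 HT) as [M1 [HM1 B1]]. destruct (half_bound a T _ _ _ H2 HT) as [M2 [HM2 B2]].
set (l := 2 / ((1 - T) * (1 - a))).
assert (Hl : 0 < l) by (unfold l; apply Rdiv_lt_0_compat; [lra|apply Rmult_lt_0_compat; lra]).
set (M := M1 + M2).
assert (HE : forall x y, 1 <= weight (1 - a) l x y).
{ intros u v. unfold weight. rewrite <- exp_0 at 1. assert (X : 0 < Rpower u (1 - a)) by apply exp_pos. assert (Y : 0 < Rpower v (1 - a)) by apply exp_pos.
  apply Rlt_le, exp_increasing. nra. }
assert (HB : forall n x y, intD x y -> x + y <= T ->
  Rabs (p x y) <= M / 2 ^ n * (Rpower x (- a) * weight (1 - a) l x y) /\ Rabs (q x y) <= M / 2 ^ n * (Rpower y (- a) * weight (1 - a) l x y)).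
{ induction n as [|n IH].
  - intros u v Huv HTuv. simpl. rewrite Rdiv_1_r. assert (X1 := B1 u v Huv HTuv). assert (X2 := B2 v u ltac:(unfold intD in *; lra) ltac:(lra)).
    assert (X3 := HE u v). assert (X4 : 0 < Rpower u (- a)) by apply exp_pos. assert (X5 : 0 < Rpower v (- a)) by apply exp_pos.
    split; [eapply Rle_trans; [exact X1|]|eapply Rle_trans; [exact X2|]]; unfold M; apply Rmult_le_compat; nra.
  - assert (Hpos : 0 <= M / 2 ^ n) by (apply Rmult_le_pos; [unfold M; lra|apply Rlt_le, Rinv_0_lt_compat, pow_lt; lra]).
    replace (M / 2 ^ S n) with (M / 2 ^ n / 2) by (simpl; field; apply pow_nonzero; lra).
    intros u v Huv HTuv. split.
    + apply (half_step a T (M / 2 ^ n) U p q); assumption.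
    + rewrite weight_sym. apply (half_step a T (M / 2 ^ n) (fun x y => U y x) (fun x y => q y x) (fun x y => p y x)); try assumption.
      * intros s t Hst HTst. destruct (IH t s ltac:(unfold intD in *; lra) ltac:(lra)) as [I1 I2]. rewrite (weight_sym _ _ t s) in I1, I2. split; assumption.
      * unfold intD in *; lra.
      * lra. }
apply Rabs_eq_0. apply (zero_of_halving _ (M * (Rpower x (- a) * weight (1 - a) l x y))); [apply Rabs_pos|].
intros n. destruct (HB n x y HI ltac:(unfold T; lra)) as [X _].
replace (M * (Rpower x (- a) * weight (1 - a) l x y) / 2 ^ n) with (M / 2 ^ n * (Rpower x (- a) * weight (1 - a) l x y)) by (unfold Rdiv; ring).
exact X.
Qed.

(** With p = 0 the function U is constant on horizontal segments, and its values there tend to that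
    on the axis x = 0. *)
Lemma zero_of_half (a : R) (U p q : R -> R -> R) (x y : R) : half a U p q -> (forall x y, intD x y -> p x y = 0) ->
  (forall x, I01 x -> U x 0 = 0) -> (forall y, I01 y -> U 0 y = 0) -> inD x y -> U x y = 0.
Proof.
intros [HU [Hp _]] Hz Z1 Z2 [Hx [Hy Hxy]].
destruct (Req_dec_T x 0) as [->|Nx]; [apply Z2; unfold I01; lra|].
destruct (Req_dec_T y 0) as [->|Ny]; [apply Z1; unfold I01; lra|].
apply NNPP. intros N. assert (Hl := Rabs_pos_lt _ N).
destruct (proj1 (cont_D_eps U) HU 0 y _ ltac:(unfold inD; lra) Hl) as [d [Hd H]].
assert (X := Rmin_pos d x Hd ltac:(lra)). assert (X1 := Rmin_l d x). assert (X2 := Rmin_r d x).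
set (t := Rmin d x / 2). assert (Ht : 0 < t < d /\ t < x) by (unfold t; lra).
assert (Hint : forall xi, t <= xi <= x -> intD xi y) by (unfold intD; intros; lra).
destruct (MVT_gen (fun u => U u y) t x (fun u => p u y)) as [xi [Hxi E]].
{ intros u Hu. apply Hp, Hint. revert Hu. rewrite Rmin_left, Rmax_right by lra. lra. }
{ intros u Hu. apply continuity_pt_filterlim. apply (ex_derive_continuous (V := R_NormedModule) (fun u => U u y)). eexists. apply Hp, Hint.
  revert Hu. rewrite Rmin_left, Rmax_right by lra. lra. }
rewrite Rmin_left, Rmax_right in Hxi by lra. rewrite Hz in E by (apply Hint; exact Hxi).
assert (Y := H t y ltac:(unfold inD; lra) ltac:(rewrite Rminus_0_r, Rabs_pos_eq; lra) ltac:(rewrite Rminus_diag, Rabs_R0; exact Hd)).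
rewrite (Z2 y) in Y by (unfold I01; lra). replace (U t y - 0) with (U x y) in Y by lra. lra.
Qed.

Lemma cont_D_minus (f g : R -> R -> R) : cont_D f -> cont_D g -> cont_D (fun x y => f x y - g x y).
Proof.
rewrite !cont_D_eps. intros Hf Hg x y e HD He.
destruct (Hf x y (e / 2) HD ltac:(lra)) as [d1 [Hd1 H1]]. destruct (Hg x y (e / 2) HD ltac:(lra)) as [d2 [Hd2 H2]].
exists (Rmin d1 d2). split; [apply Rmin_pos; lra|]. intros u v Huv Hu Hv.
assert (M1 := Rmin_l d1 d2). assert (M2 := Rmin_r d1 d2).
specialize (H1 u v Huv ltac:(lra) ltac:(lra)). specialize (H2 u v Huv ltac:(lra) ltac:(lra)).
replace (f u v - g u v - (f x y - g x y)) with ((f u v - f x y) + - (g u v - g x y)) by ring.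
eapply Rle_lt_trans; [apply Rabs_triang|]. rewrite Rabs_Ropp. lra.
Qed.

Lemma cont_D_swap (f : R -> R -> R) : cont_D f -> cont_D (fun x y => f y x).
Proof.
rewrite !cont_D_eps. intros Hf x y e HD He. destruct (Hf y x e ltac:(unfold inD in *; lra) He) as [d [Hd H]].
exists d. split; [exact Hd|]. intros u v Huv Hu Hv. apply H; [unfold inD in *; lra|exact Hv|exact Hu].
Qed.

Lemma cont_D_mult_x (h : R -> R) (f : R -> R -> R) : (forall x, continuous h x) -> cont_D f -> cont_D (fun x y => h x * f x y).
Proof.
intros Hh Hf [x y] HD.
apply (filterlim_comp_2 (fun p : R * R => h (fst p)) (fun p : R * R => f (fst p) (snd p)) Rmult (G := locally (h x)) (H := locally (f x y))).
- apply (continuous_within (fun p : R * R => inD (fst p) (snd p)) (x, y) (fun p : R * R => h (fst p))).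
  apply (continuous_comp (fun p : R * R => fst p) h); [apply continuous_fst_at|apply Hh].
- exact (Hf (x, y) HD).
- exact (filterlim_mult (K := R_AbsRing) (h x) (f x y)).
Qed.

Lemma cont_D_pair (g : R * R -> R) : continuous_on (fun p : R * R => inD (fst p) (snd p)) g -> cont_D (fun x y => g (x, y)).
Proof. intros Hg [x y] H. apply (filterlim_ext g); [intros [u v]; reflexivity|exact (Hg (x, y) H)]. Qed.

Lemma half_minus (a : R) (U p q U' p' q' : R -> R -> R) : half a U p q -> half a U' p' q' ->
  half a (fun x y => U x y - U' x y) (fun x y => p x y - p' x y) (fun x y => q x y - q' x y).
Proof.
intros [A1 [A2 [A3 [G [A4 A5]]]]] [B1 [B2 [B3 [G' [B4 B5]]]]]. split; [|split; [|split]].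
- apply cont_D_minus; assumption.
- intros x y H. apply (is_derive_minus (V := R_NormedModule) (fun u => U u y)); [apply A2, H|apply B2, H].
- intros x y H. evar_last; [apply (is_derive_minus (V := R_NormedModule) (p x)); [apply A3, H|apply B3, H]|].
  unfold minus, plus, opp; simpl. unfold Rdiv. eq_in R. ring.
- exists (fun x y => G x y - G' x y). split; [apply cont_D_minus; assumption|].
  intros x y H. rewrite A5, B5 by exact H. ring.
Qed.

Lemma half_mono (a b : R) (U p q : R -> R -> R) : a < b -> half a U p q -> half b U p q.
Proof.
intros Hab [A1 [A2 [A3 [G [A4 A5]]]]]. split; [exact A1|]. split; [exact A2|]. split; [exact A3|].
exists (fun x y => power0 (b - a) x * G x y). split.
- apply cont_D_mult_x; [intros x; apply continuous_power0; lra|exact A4].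
- intros x y H. rewrite A5 by exact H. rewrite power0_pos by apply H. rewrite <- Rmult_assoc, <- Rpower_plus. f_equal. f_equal. ring.
Qed.

(** The equation gives p_y. The derivative q_x equals it by Schwarz's theorem, whose continuity
    hypotheses come from [ex_diff_n] with n >= 2. *)
Lemma solution_halves (n : nat) (V0 V1 : R -> R) (W : R -> R -> R) : (2 <= n)%nat -> Cn_solution n V0 V1 W ->
  exists a, 0 <= a < 1 /\ half a W (partial_x W) (partial_y W) /\
    half a (fun x y => W y x) (fun x y => partial_y W y x) (fun x y => partial_x W y x).
Proof.
intros Hn [HC [HD [HE [[a [Ha [[gx [Gx Ex]] [[gy [Gy Ey]] _]]]] _]]]].
exists a. split; [exact Ha|].
assert (Hd : forall x y, intD x y -> ex_derive (fun u => W u y) x /\ ex_derive (W x) y /\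
  ex_derive (partial_x W x) y /\ ex_derive (fun u => partial_y W u y) x /\
  continuity_2d_pt (fun u v => Derive (partial_x W u) v) x y /\ continuity_2d_pt (fun u v => Derive (fun z => partial_y W z v) u) x y).
{ intros x y H. specialize (HD x y H). destruct n as [|[|n]]; [lia|lia|].
  destruct HD as [_ [D1 [D2 [D3 D4]]]]. destruct D3 as [_ [_ [D5 [_ D6]]]]. destruct D4 as [_ [D7 [_ [D8 _]]]].
  assert (Z : forall f m, ex_diff_n f m x y -> continuity_2d_pt f x y) by (intros f [|m] [Q _]; exact Q).
  repeat split; try assumption; eapply Z; eassumption. }
assert (Hpy : forall x y, intD x y -> Derive (partial_x W x) y = (partial_x W x y + partial_y W x y) / (2 * (1 - x - y))).
{ intros x y H. assert (E := HE x y H). unfold partial_y at 1 in E. change (fun t => partial_x W x t) with (partial_x W x) in E. lra. }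
assert (Hqx : forall x y, intD x y -> Derive (fun u => partial_y W u y) x = Derive (partial_x W x) y).
{ intros x y H. apply (Schwarz W x y).
  - destruct (open2_intD x y H) as [d Hd']. exists d. intros u v Hu Hv. specialize (Hd' (u, v) (conj Hu Hv)). simpl in Hd'.
    destruct (Hd u v Hd') as [D1 [D2 [D3 [D4 _]]]]. repeat split; assumption.
  - apply (Hd x y H).
  - apply (Hd x y H). }
split.
- split; [exact HC|]. split; [|split].
  + intros x y H. apply Derive_correct, (Hd x y H).
  + intros x y H. rewrite <- Hpy by exact H. apply Derive_correct, (Hd x y H).
  + exists (fun x y => gx (x, y)). split.
    * apply cont_D_pair, Gx.
    * intros x y H. apply (Ex (x, y) H).
- split; [apply (cont_D_swap W), HC|]. split; [|split].
  + intros x y H. apply Derive_correct, (Hd y x ltac:(unfold intD in *; lra)).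
  + intros x y H. assert (H' : intD y x) by (unfold intD in *; lra).
    replace ((partial_y W y x + partial_x W y x) / (2 * (1 - x - y))) with (Derive (fun u => partial_y W u x) y).
    * apply Derive_correct, (Hd y x H').
    * rewrite Hqx, Hpy by exact H'. replace (1 - y - x) with (1 - x - y) by ring. f_equal. ring.
  + exists (fun x y => gy (y, x)). split.
    * apply (cont_D_swap (fun x y => gy (x, y))), cont_D_pair, Gy.
    * intros x y H. apply (Ey (y, x)). simpl. unfold intD in *; lra.
Qed.

Theorem solution_unique (n : nat) (V0 V1 : R -> R) (W W' : R -> R -> R) (x y : R) : (2 <= n)%nat ->
  Cn_solution n V0 V1 W -> Cn_solution n V0 V1 W' -> inD x y -> W x y = W' x y.
Proof.
intros Hn H H' HD.
destruct (solution_halves n V0 V1 W Hn H) as [a [Ha [A1 A2]]]. destruct (solution_halves n V0 V1 W' Hn H') as [a' [Ha' [A1' A2']]].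
(* The two solutions may come with different exponents; their difference is weighted with a larger
   common one. *)
set (b := (1 + Rmax a a') / 2). assert (M1 := Rmax_l a a'). assert (M2 := Rmax_r a a').
assert (M3 : Rmax a a' < 1) by (apply Rmax_lub_lt; lra).
assert (Hb : 0 <= b < 1 /\ a < b /\ a' < b) by (unfold b; lra).
assert (B1 := half_minus b _ _ _ _ _ _ (half_mono a b _ _ _ ltac:(lra) A1) (half_mono a' b _ _ _ ltac:(lra) A1')).
assert (B2 := half_minus b _ _ _ _ _ _ (half_mono a b _ _ _ ltac:(lra) A2) (half_mono a' b _ _ _ ltac:(lra) A2')).
destruct H as [_ [_ [_ [_ [Z1 Z2]]]]], H' as [_ [_ [_ [_ [Z1' Z2']]]]].
assert (Q1 : forall x, I01 x -> W x 0 - W' x 0 = 0) by (intros u Hu; rewrite Z1, Z1' by exact Hu; ring).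
assert (Q2 : forall y, I01 y -> W 0 y - W' 0 y = 0) by (intros u Hu; rewrite Z2, Z2' by exact Hu; ring).
assert (Hp := halves_vanish b _ _ _ ltac:(lra) B1 B2 Q1 Q2).
assert (X := zero_of_half b _ _ _ x y B1 Hp Q1 Q2 HD). cbv beta in X. lra.
Qed.

Theorem theorem5 (n : nat) (hn : (2 <= n)%nat) (V0 V1 : R -> R)
    (hdata : goursat_data n V0 V1) :
  exists V : R -> R -> R,
    Cn_solution n V0 V1 V /\
    (forall W, Cn_solution n V0 V1 W -> forall x y, inD x y -> W x y = V x y) /\
    (forall x y, inD x y -> forall g0 g1, contour x y g0 g1 ->
       exists m : C -> C,
         unique_RH_solution g0 g1
           (jump_value (Phi0 V0 x) x y) (jump_value (Phi1 V1 y) x y) m /\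
         RtoC (V x y) = (- / 2 * m (RtoC 0))%C) /\
    (forall alpha m1 m2 : R, 0 < alpha < 1 ->
       weighted_derivative_continuous alpha V0 ->
       weighted_derivative_continuous alpha V1 ->
       filterlim (fun x => Rpower x alpha * Derive V0 x) (at_right 0) (locally m1) ->
       filterlim (fun y => Rpower y alpha * Derive V1 y) (at_right 0) (locally m2) ->
       (forall y, 0 <= y < 1 ->
          filterlim (fun x => Rpower x alpha * partial_x V x y) (at_right 0)
            (locally (m1 / sqrt (1 - y)))) /\
       (forall x, 0 <= x < 1 ->
          filterlim (fun y => Rpower y alpha * partial_y V x y) (at_right 0)
            (locally (m2 / sqrt (1 - x))))).
Proof.
assert (HV := goursat_sol_solution n V0 V1 hn hdata).
destruct hdata as [C0 [C1 [D0 [D1 [_ [Z0 Z1]]]]]].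
destruct (extends_data_Rmax n V0 hn C0 D0 Z0) as [H0 _]. destruct (extends_data_Rmax n V1 hn C1 D1 Z1) as [H1 _].
set (U0 := fun t => V0 (Rmax 0 t)) in *. set (U1 := fun t => V1 (Rmax 0 t)) in *.
exists (goursat_sol U0 U1). split; [exact HV|]. split; [|split].
- intros W HW x y HD. apply (solution_unique n V0 V1); assumption.
- intros x y HD g0 g1 Hg. destruct (explicit_RH x y V0 V1 U0 U1 g0 g1 HD H0 H1 Hg) as [m [Hm E]].
  exists m. split; [exact Hm|]. rewrite E. unfold goursat_sol.
  replace (- / 2)%C with (RtoC (- / 2)) by (rewrite RtoC_opp, RtoC_inv by lra; reflexivity).
  rewrite <- RtoC_mult. f_equal. field.
- intros alpha m1 m2 Ha _ _ L1 L2. split.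
  + intros y Hy. apply (limit_x alpha m1 y V0 U0 U1); [apply Ha|exact H0|apply H1|exact L1|exact Hy].
  (* Exchanging the data together with x and y turns the limit in y into the limit in x. *)
  + intros x Hx. apply (filterlim_ext_loc (fun y => Rpower y alpha * partial_x (goursat_sol U1 U0) y x)).
    * apply filter_forall. intros y. unfold partial_x, partial_y. apply (f_equal (fun u => Rpower y alpha * u)).
      apply Derive_ext. intros t. apply goursat_sol_swap.
    * apply (limit_x alpha m2 x V1 U1 U0); [apply Ha|exact H1|apply H0|exact L2|exact Hx].
Qed.
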